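(* Assume that $\mathfrak g$ is of finite type, and let $\mathfrak X$, $\xi$, $R$, $R_X$, $\tau$, $\tau_0$ be as in the context. Set $$R^{(\tau,X)}=(\mathrm{Ad}(\xi)\,T_{w_0}^{-1}T_{w_X}^{-1}\tau\tau_0\otimes1)(R\,\overline{R_X})\in\mathcal U^{(2)}_0,\qquad \mathfrak X_{K2}=\sum_{\mu\in Q^+}K_\mu\otimes\mathfrak X_\mu\in\mathcal U^{(2)}_0 .$$ Then the quasi K-matrix $\mathfrak X$ satisfies the relation $$\Delta(\mathfrak X)=(\mathfrak X\otimes1)\cdot R^{(\tau,X)}\cdot\mathfrak X_{K2}$$ in $\mathcal U^{(2)}_0$.
   Context: \textbf{Quantized enveloping algebra (finite type).} $A=(a_{ij})_{i,j\in I}$ is a Cartan matrix of finite type, $\epsilon_i$ coprime positive integers with $(\epsilon_ia_{ij})$ symmetric, $\mathfrak g$ the corresponding semisimple Lie algebra with simple roots $\alpha_i$, simple coroots $h_i$, fundamental coweights $\varpi_i^\vee$ ($\alpha_j(\varpi_i^\vee)=\delta_{ij}$), Weyl group $W$ generated by simple reflections $\sigma_i$ with longest element $w_0$, root lattice $Q$, $Q^+=\sum\mathbb N_0\alpha_i$, weight lattice $P$, form $(\alpha_i,\alpha_j)=\epsilon_ia_{ij}$. $d$ is the smallest positive integer with $d/\det(A)\in\mathbb Z$, $\mathbb K$ a field of characteristic zero, $k=\mathbb K(q^{1/d})$, $q_i=q^{\epsilon_i}$. $U_q(\mathfrak g)$ is the $k$-algebra generated by $E_i,F_i,K_h$ ($i\in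 I$, $h\in\sum\mathbb Zh_i$) with $K_0=1$, $K_hK_{h'}=K_{h+h'}$, $K_hE_i=q^{\alpha_i(h)}E_iK_h$, $K_hF_i=q^{-\alpha_i(h)}F_iK_h$, $E_iF_j-F_jE_i=\delta_{ij}\frac{K_i-K_i^{-1}}{q_i-q_i^{-1}}$, $K_i=K_{\epsilon_ih_i}$, and the quantum Serre relations $\sum_{n=0}^{1-a_{ij}}(-1)^n\left[{1-a_{ij}\atop n}\right]_{q_i}x_i^{1-a_{ij}-n}x_jx_i^n=0$ ($i\ne j$, $x=E$ or $F$). Coproduct: $\Delta(E_i)=E_i\otimes1+K_i\otimes E_i$, $\Delta(F_i)=F_i\otimes K_i^{-1}+1\otimes F_i$, $\Delta(K_h)=K_h\otimes K_h$. $K_\mu=\prod K_i^{n_i}$ for $\mu=\sum n_i\alpha_i\in Q$. $U^\pm$ are generated by the $E_i$, resp. $F_i$, with weight components $U^+_\mu$, $U^-_{-\mu}$, $\mu\in Q^+$. The bar involution is the $\mathbb K$-algebra automorphism $x\mapsto\overline x$ with $q^{1/d}\mapsto q^{-1/d}$, $E_i\mapsto E_i$, $F_i\mapsto F_i$, $K_h\mapsto K_{-h}$; on $U_q(\mathfrak g)\otimes U_q(\mathfrak g)$ it is $\overline{u\otimes v}=\overline u\otimes\overline v$. \textbf{Completions.} $\mathcal O_{int}$ is the category of finite dimensional type 1 modules $M=\bigoplus_{\lambda\in P}M_\lambda$, $M_\lambda=\{m:K_hm=q^{\lambda(h)}m\ \forall h\}$. $\mathcal U$ is the algebra of natural endomorphisms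 of the forgetful functor $\mathcal O_{int}\to k$-vector spaces; $\mathcal U^{(2)}_0$ is the algebra of natural endomorphisms $(\varphi_{M,N})$ of the functor $(M,N)\mapsto M\otimes N$ (as vector spaces) on $\mathcal O_{int}\times\mathcal O_{int}$. $\mathcal U\otimes\mathcal U\subseteq\mathcal U^{(2)}_0$, and $\Delta:\mathcal U\to\mathcal U^{(2)}_0$ is $(\varphi_M)_M\mapsto(\varphi_{M\otimes N})_{M,N}$, extending the coproduct of $U_q(\mathfrak g)\subseteq\mathcal U$. Elements of $\widehat{U^+}=\prod_{\mu\in Q^+}U^+_\mu$ define elements of $\mathcal U$; likewise infinite sums whose $\mu$-term has second tensor factor in $U_\mu^+$ define elements of $\mathcal U_0^{(2)}$. A map $\xi:P\to k^\times$ defines $\xi\in\mathcal U$ acting by $\xi(\lambda)$ on $M_\lambda$. $T_i\in\mathcal U$ acts on $m\in M_\lambda$ by $T_i(m)=\sum_{a,b,c\ge0,\,-a+b-c=\lambda(h_i)}(-1)^bq_i^{b-ac}E_i^{(a)}F_i^{(b)}E_i^{(c)}m$; it is invertible, and $T_w=T_{i_1}\cdots T_{i_l}$ for a reduced expression $w=\sigma_{i_1}\cdots\sigma_{i_l}$. Conjugation by $T_w$ preserves $U_q(\mathfrak g)$; the resulting automorphism is also denoted $T_w$. \textbf{Quantum symmetric pair.} For $X\subseteq I$ let $w_X$ be the longest element of $\langle\sigma_i:i\in X\rangle$ and $\rho_X,\rho_X^\vee$ the half sums of positive roots and coroots of the corresponding subalgebra $\mathfrak g_X$. $\mathrm{Aut}(A,X)$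 is the set of permutations $\tau$ of $I$ with $a_{\tau(i)\tau(j)}=a_{ij}$, $\tau(X)=X$ (with $\epsilon_{\tau(i)}=\epsilon_i$). $(X,\tau)$ is an admissible pair: $\tau\in\mathrm{Aut}(A,X)$, $\tau^2=\mathrm{id}$, $w_X(\alpha_j)=-\alpha_{\tau(j)}$ for $j\in X$, and $\alpha_j(\rho_X^\vee)\in\mathbb Z$ if $j\in I\setminus X$, $\tau(j)=j$. $\Theta=-w_X\circ\tau$ on $P$, where $\tau(\alpha_i)=\alpha_{\tau(i)}$; $Q^\Theta$ is the fixed sublattice in $Q$. $s:I\to\mathbb K^\times$ satisfies $s(i)=1$ if $i\in X$ or $\tau(i)=i$, and $s(i)/s(\tau(i))=(-1)^{\alpha_i(2\rho_X^\vee)}$ if $i\notin X$, $\tau(i)\ne i$. $X_i=-s(\tau(i))T_{w_X}(E_{\tau(i)})$ for $i\in I\setminus X$. $I_{ns}=\{i\in I\setminus X:\tau(i)=i,\ a_{ij}=0\ \forall j\in X\}$. Parameters $\mathbf c=(c_i)\in(k^\times)^{I\setminus X}$, $\mathbf s=(s_i)\in k^{I\setminus X}$ satisfy: $c_i=c_{\tau(i)}$ if $\tau(i)\ne i$ and $(\alpha_i,\Theta(\alpha_i))=0$; $s_j\ne0$ implies $j\in I_{ns}$ and $a_{ij}\in-2\mathbb N_0$ for all $i\in I_{ns}\setminus\{j\}$; $c_{\tau(i)}=q^{(\alpha_i,\Theta(\alpha_i)-2\rho_X)}\overline{c_i}$; $\overline{s_i}=s_i$. $\tau_0\in\mathrm{Aut}(A,X)$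 is determined by $w_0(\alpha_i)=-\alpha_{\tau_0(i)}$, and further $\tau\tau_0=\tau_0\tau$, $c_{\tau_0\tau(i)}=c_i$, $s_{\tau_0(i)}=s_i$ ($i\in I\setminus X$), $s(\tau(i))=s(\tau_0(i))$ ($i\in I$). $\tau,\tau_0$ act on $U_q(\mathfrak g)$ by permuting indices of generators. $B_{\mathbf c,\mathbf s}$ is the subalgebra of $U_q(\mathfrak g)$ generated by $\mathcal M_X=U_q(\mathfrak g_X)=\langle E_i,F_i,K_i^{\pm1}:i\in X\rangle$, $U^{0\prime}_\Theta=\langle K_\mu:\mu\in Q^\Theta\rangle$ and $B_i=F_i+c_iX_iK_i^{-1}+s_iK_i^{-1}$ ($i\in I\setminus X$). \textbf{Quasi K-matrix.} There is a $\mathbb K$-algebra automorphism $x\mapsto\overline x^B$ of $B_{\mathbf c,\mathbf s}$ with $q^{1/d}\mapsto q^{-1/d}$, $\overline x^B=\overline x$ on $\mathcal M_XU^{0\prime}_\Theta$, $\overline{B_i}^B=B_i$. $\mathfrak X=\sum_{\mu\in Q^+}\mathfrak X_\mu\in\widehat{U^+}$ is the unique element with $\mathfrak X_\mu\in U^+_\mu$, $\mathfrak X_0=1$ and $\overline x^B\mathfrak X=\mathfrak X\overline x$ in $\mathcal U$ for all $x\in B_{\mathbf c,\mathbf s}$ (it exists). \textbf{The function $\xi$.} $\gamma(\alpha_i)=1$ for $i\in X$, $\gamma(\alpha_i)=c_is(\tau(i))$ for $i\in I\setminus X$; this is extended to a fixed group homomorphism $\gamma:P\to k^\times$ (if necessary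 after replacing $k$ by a finite extension). With $\lambda^+=\frac12(\lambda+\Theta(\lambda))$, $\tilde\lambda=\frac12(\lambda-\Theta(\lambda))$, $\xi(\lambda)=\gamma(\lambda)\,q^{-(\lambda^+,\lambda^+)+\sum_{j\in I}(\tilde\alpha_j,\tilde\alpha_j)\lambda(\varpi_j^\vee)}$ for $\lambda\in P$. $\mathrm{Ad}(\xi)(u)=\xi u\xi^{-1}$; it preserves $U_q(\mathfrak g)$. \textbf{Quasi R-matrices.} $R=\sum_{\mu\in Q^+}R_\mu$, $R_\mu\in U^-_{-\mu}\otimes U^+_\mu$, $R_0=1\otimes1$, is the unique such element with $\Delta(\overline u)R=R\,\overline{\Delta(u)}$ for all $u\in U_q(\mathfrak g)$. $R_X$ is the analogous element (quasi R-matrix) for the subalgebra $U_q(\mathfrak g_X)=\mathcal M_X$; one has $\overline{R_X}=R_X^{-1}$, with the bar involution applied termwise. In the definition of $R^{(\tau,X)}$ the composite automorphism $\mathrm{Ad}(\xi)\circ T_{w_0}^{-1}\circ T_{w_X}^{-1}\circ\tau\tau_0$ of $U_q(\mathfrak g)$ is applied termwise to the first tensor factor. *)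

(* Defs.v *)
From HB Require Import structures.
From mathcomp Require Import all_boot all_order all_fingroup all_algebra fieldext.
From mathcomp Require Import generic_quotient.
From mathcomp Require Import boolp classical_sets functions cardinality fsbigop.
From mathcomp Require Import mxtens.

Set Implicit Arguments.
Unset Strict Implicit.
Unset Printing Implicit Defensive.

Import Order.TTheory GRing.Theory Num.Theory.
Local Open Scope classical_set_scope.
Local Open Scope quotient_scope.
Local Open Scope ring_scope.

(* Algebras given by generators and relations.                                *)
(* [presAlg P] is the k-algebra generated by G subject to the relations P.    *)
(* Two formal expressions are identified when they agree in every k-algebra   *)
(* whose chosen elements [v : G -> A] satisfy P; a k-algebra is a ring A with *)
(* a ring morphism k -> A whose image commutes with the chosen elements.      *)
(* This is the initial such algebra: see [plift_alg_morph] and [plift_gen].   *)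

Inductive pterm (k G : Type) : Type :=
| TGen of G | TCst of k | TAdd of pterm k G & pterm k G | TMul of pterm k G & pterm k G.
Arguments TGen {k G}.
Arguments TCst {k G}.
HB.instance Definition _ (k G : Type) := gen_eqMixin (pterm k G).
HB.instance Definition _ (k G : Type) := gen_choiceMixin (pterm k G).

Fixpoint teval (k G : Type) (A : pzRingType) (iota : k -> A) (v : G -> A)
    (t : pterm k G) : A :=
  match t with
  | TGen g => v g
  | TCst c => iota c
  | TAdd t1 t2 => teval iota v t1 + teval iota v t2
  | TMul t1 t2 => teval iota v t1 * teval iota v t2
  end.

Section PresentedAlgebra.
Variables (k : fieldType) (G : Type).
Variable P : forall A : pzRingType, (k -> A) -> (G -> A) -> Prop.
Arguments P {A}.

Definition model (A : pzRingType) (iota : {rmorphism k -> A}) (v : G -> A) : Prop :=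
  (forall c g, iota c * v g = v g * iota c) /\ P iota v.

Definition teq (t t' : pterm k G) : bool :=
  `[< forall (A : pzRingType) (iota : {rmorphism k -> A}) (v : G -> A),
        model iota v -> teval iota v t = teval iota v t' >].

Lemma teq_refl : reflexive teq. Proof. by move=> t; apply/asboolP. Qed.
Lemma teq_sym : symmetric teq.
Proof.
by move=> t t'; apply/asboolP/asboolP => h A iota v m; rewrite (h _ _ _ m).
Qed.
Lemma teq_trans : transitive teq.
Proof.
move=> t t' t'' /asboolP h /asboolP h'; apply/asboolP => A iota v m.
by rewrite (h _ _ _ m) (h' _ _ _ m).
Qed.
Canonical teq_equiv := EquivRel teq teq_refl teq_sym teq_trans.

Definition presAlg := {eq_quot teq}.
HB.instance Definition _ := Choice.on presAlg.
HB.instance Definition _ : EqQuotient _ teq presAlg := EqQuotient.on presAlg.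

Definition pgen (g : G) : presAlg := \pi_presAlg (TGen g).
Definition pcst (c : k) : presAlg := \pi_presAlg (TCst c).
Definition padd (x y : presAlg) : presAlg := \pi_presAlg (TAdd (repr x) (repr y)).
Definition pmul (x y : presAlg) : presAlg := \pi_presAlg (TMul (repr x) (repr y)).

(* The algebra morphism to A extending iota on k and v on generators; it is   *)
(* only meaningful if [model iota v].                                         *)
Definition plift (A : pzRingType) (iota : k -> A) (v : G -> A) (x : presAlg) : A :=
  teval iota v (repr x).

Lemma plift_inj (x y : presAlg) :
  (forall (A : pzRingType) (iota : {rmorphism k -> A}) (v : G -> A),
     model iota v -> plift iota v x = plift iota v y) -> x = y.
Proof.
by move=> h; rewrite -[x]reprK -[y]reprK; apply/eqmodP/asboolP => A iota v /h.
Qed.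

Section Lift.
Variables (A : pzRingType) (iota : {rmorphism k -> A}) (v : G -> A).
Hypothesis m : model iota v.

Lemma plift_pi t : plift iota v (\pi_presAlg t) = teval iota v t.
Proof.
have h : repr (\pi_presAlg t) = t %[mod presAlg] by rewrite reprK.
by move/eqmodP/asboolP: h => h; exact: h.
Qed.
Lemma plift_gen g : plift iota v (pgen g) = v g.
Proof. by rewrite plift_pi. Qed.
Lemma plift_cst c : plift iota v (pcst c) = iota c.
Proof. by rewrite plift_pi. Qed.
Lemma plift_add x y : plift iota v (padd x y) = plift iota v x + plift iota v y.
Proof. by rewrite plift_pi. Qed.
Lemma plift_mul x y : plift iota v (pmul x y) = plift iota v x * plift iota v y.
Proof. by rewrite plift_pi. Qed.
Definition pliftE := (plift_gen, plift_cst, plift_add, plift_mul).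
Lemma plift_central c x : iota c * plift iota v x = plift iota v x * iota c.
Proof.
rewrite /plift; elim: (repr x) => [g|c'|t1 h1 t2 h2|t1 h1 t2 h2] /=.
- by case: m.
- by rewrite -!rmorphM mulrC.
- by rewrite mulrDr mulrDl h1 h2.
- by rewrite mulrA h1 -!mulrA h2.
Qed.
End Lift.

Lemma paddA : associative padd.
Proof. by move=> x y z; apply: plift_inj => A i v m; rewrite !(pliftE m) addrA. Qed.
Lemma paddC : commutative padd.
Proof. by move=> x y; apply: plift_inj => A i v m; rewrite !(pliftE m) addrC. Qed.
Lemma padd0 : left_id (pcst 0) padd.
Proof.
by move=> x; apply: plift_inj => A i v m; rewrite !(pliftE m) rmorph0 add0r.
Qed.
Lemma paddN : left_inverse (pcst 0) (pmul (pcst (-1))) padd.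
Proof.
move=> x; apply: plift_inj => A i v m.
by rewrite !(pliftE m) rmorphN1 rmorph0 mulN1r addNr.
Qed.
HB.instance Definition _ := GRing.isZmodule.Build presAlg paddA paddC padd0 paddN.

Lemma pmulA : associative pmul.
Proof. by move=> x y z; apply: plift_inj => A i v m; rewrite !(pliftE m) mulrA. Qed.
Lemma pmul1l : left_id (pcst 1) pmul.
Proof.
by move=> x; apply: plift_inj => A i v m; rewrite !(pliftE m) rmorph1 mul1r.
Qed.
Lemma pmul1r : right_id (pcst 1) pmul.
Proof.
by move=> x; apply: plift_inj => A i v m; rewrite !(pliftE m) rmorph1 mulr1.
Qed.
Lemma pmulDl : left_distributive pmul padd.
Proof. by move=> x y z; apply: plift_inj => A i v m; rewrite !(pliftE m) mulrDl. Qed.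
Lemma pmulDr : right_distributive pmul padd.
Proof. by move=> x y z; apply: plift_inj => A i v m; rewrite !(pliftE m) mulrDr. Qed.
HB.instance Definition _ :=
  GRing.Zmodule_isPzRing.Build presAlg pmulA pmul1l pmul1r pmulDl pmulDr.

Definition pscale (c : k) (x : presAlg) : presAlg := pcst c * x.
Lemma pscaleA a b x : pscale a (pscale b x) = pscale (a * b) x.
Proof.
by apply: plift_inj => A i v m; rewrite !(pliftE m) rmorphM mulrA.
Qed.
Lemma pscale1 : left_id 1 pscale.
Proof. by move=> x; exact: pmul1l. Qed.
Lemma pscaleDr : right_distributive pscale +%R.
Proof. by move=> a x y; exact: pmulDr. Qed.
Lemma pscaleDl x : {morph pscale^~ x : a b / a + b}.
Proof.
by move=> a b; apply: plift_inj => A i v m; rewrite !(pliftE m) rmorphD mulrDl.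
Qed.
HB.instance Definition _ :=
  GRing.Zmodule_isLmodule.Build k presAlg pscaleA pscale1 pscaleDr pscaleDl.

Lemma pcst_is_zmod_morphism : zmod_morphism pcst.
Proof.
move=> a b; apply: plift_inj => A i v m.
by rewrite !(pliftE m) rmorphB rmorphN1 mulN1r.
Qed.
HB.instance Definition _ :=
  GRing.isZmodMorphism.Build k presAlg pcst pcst_is_zmod_morphism.
Lemma pcst_is_monoid_morphism : monoid_morphism pcst.
Proof.
split=> // a b; apply: plift_inj => A i v m.
by rewrite !(pliftE m) rmorphM.
Qed.
HB.instance Definition _ :=
  GRing.isMonoidMorphism.Build k presAlg pcst pcst_is_monoid_morphism.

End PresentedAlgebra.

Arguments presAlg {k G} P.
Arguments pgen {k G P} g.
Arguments pcst {k G P} c.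

Section AlgebraMorphism.
Variables (k : fieldType) (G : Type).
Variable P : forall A : pzRingType, (k -> A) -> (G -> A) -> Prop.
Local Notation U := (presAlg P).

(* With iota the structure map of A this is a k-algebra morphism; composing   *)
(* iota with an automorphism of k gives semilinear ring morphisms.            *)
Definition alg_morph (A : pzRingType) (iota : k -> A) (f : U -> A) : Prop :=
  [/\ {morph f : x y / x + y}, {morph f : x y / x * y}
    & forall c, f (pcst c) = iota c].

Lemma plift_alg_morph (A : pzRingType) (iota : {rmorphism k -> A}) (v : G -> A) :
  model P iota v -> alg_morph iota (plift iota v).
Proof.
move=> m; split=> [x y|x y|c]; [exact: plift_add|exact: plift_mul|exact: plift_cst].
Qed.

Definition is_subalg (B : set U) : Prop :=
  [/\ B 1, (forall (a : k) u v, B u -> B v -> B (a *: u + v))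
    & forall u v, B u -> B v -> B (u * v)].

Definition gen_subalg (S : set U) : set U := smallest is_subalg S.

(* The tensor product of U with itself: two commuting copies of U over k.     *)
Definition tens_rel (A : pzRingType) (iota : k -> A) (v : U + U -> A) : Prop :=
  [/\ alg_morph iota (fun x => v (inl x)), alg_morph iota (fun x => v (inr x))
    & forall x y, v (inl x) * v (inr y) = v (inr y) * v (inl x)].
Definition tensAlg := presAlg tens_rel.
Definition tens (x y : U) : tensAlg := pgen (inl x) * pgen (inr y).

Definition tens_lift (A : pzRingType) (iota : k -> A) (f g : U -> A) : tensAlg -> A :=
  plift iota (fun z => match z with inl x => f x | inr y => g y end).

Definition tens_set (S T : set U) : set tensAlg :=
  [set z | exists2 s : seq (U * U),
     (forall p, p \in s -> S p.1 /\ T p.2) & z = \sum_(p <- s) tens p.1 p.2].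

End AlgebraMorphism.

Section FractionExtension.
Variables (R : idomainType) (F : fieldType) (ev : {rmorphism R -> F}).
Hypothesis ev_inj : forall x, ev x = 0 -> x = 0.
Local Notation tofrac := (@FracField.tofrac R).

Definition frac_ext of forall x, ev x = 0 -> x = 0 := fun x : {fraction R} =>
  ev \n_(repr x) / ev \d_(repr x).
Local Notation ext := (frac_ext ev_inj).

Lemma ev_neq0 x : x != 0 -> ev x != 0.
Proof. by apply: contraNneq => /ev_inj ->. Qed.

Lemma fracE (p r : R) : r != 0 ->
  tofrac p / tofrac r = \pi_(FracField.type R) (Ratio p r).
Proof.
move=> r0; unlock FracField.tofrac; rewrite /GRing.inv /GRing.mul /= !piE.
rewrite /FracField.mulf /FracField.invf !numden_Ratio ?oner_neq0 //.
by rewrite mulr1 mul1r.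
Qed.

Lemma fracP (x : {fraction R}) : exists p r : R, r != 0 /\ x = tofrac p / tofrac r.
Proof.
exists \n_(repr x), \d_(repr x); split; first exact: denom_ratioP.
by rewrite fracE ?denom_ratioP // Ratio_numden reprK.
Qed.

Lemma frac_extE (p r : R) : r != 0 -> ext (tofrac p / tofrac r) = ev p / ev r.
Proof.
move=> r0; rewrite fracE // /frac_ext; set x := repr _.
have dx : \d_x != 0 by exact: denom_ratioP.
have h : \n_x * r = \d_x * p.
  by have := FracField.equivf_l (Ratio p r); rewrite !numden_Ratio.
move/(congr1 ev): h; rewrite !rmorphM /= => h.
by apply/eqP; rewrite eqr_div ?ev_neq0 // h mulrC.
Qed.

Lemma frac_ext_tofrac (p : R) : ext (tofrac p) = ev p.
Proof.
have := frac_extE p (oner_neq0 R).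
by rewrite !rmorph1 !divr1.
Qed.

Lemma frac_ext_is_zmod_morphism : zmod_morphism ext.
Proof.
move=> x y; have [p [r [r0 ->]]] := fracP x; have [p' [r' [r0' ->]]] := fracP y.
rewrite -mulNr addf_div ?tofrac_eq0 // mulNr -!rmorphM -rmorphB.
rewrite !frac_extE ?mulf_neq0 //.
by rewrite rmorphB !rmorphM -[in RHS]mulNr addf_div ?ev_neq0 // mulNr.
Qed.
HB.instance Definition _ :=
  GRing.isZmodMorphism.Build {fraction R} F ext frac_ext_is_zmod_morphism.

Lemma frac_ext_is_monoid_morphism : monoid_morphism ext.
Proof.
split=> [|x y]; first by rewrite -tofrac1 frac_ext_tofrac rmorph1.
have [p [r [r0 ->]]] := fracP x; have [p' [r' [r0' ->]]] := fracP y.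
by rewrite mulf_div -!rmorphM !frac_extE ?mulf_neq0 // !rmorphM mulf_div.
Qed.
HB.instance Definition _ :=
  GRing.isMonoidMorphism.Build {fraction R} F ext frac_ext_is_monoid_morphism.
End FractionExtension.

(* The field k = K(t), where t stands for q^{1/d}, and its involution over K  *)
(* inverting t.                                                               *)

Section BaseField.
Variable K : fieldType.

Definition kfield : fieldType := GRing.Field.clone {fraction {poly K}} _.
Definition kemb : {rmorphism {poly K} -> kfield} := @FracField.tofrac {poly K}.
Definition kcst (c : K) : kfield := kemb c%:P.
Definition kt : kfield := kemb 'X.

Lemma kemb_inj (p : {poly K}) : kemb p = 0 -> p = 0.
Proof. by move=> /eqP; rewrite tofrac_eq0 => /eqP. Qed.

Lemma kt_neq0 : kt != 0.
Proof. by apply/eqP => /kemb_inj/eqP; rewrite polyX_eq0. Qed.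

Definition evalV : {rmorphism {poly K} -> kfield} :=
  horner_eval kt^-1 \o map_poly (kemb \o polyC).

Lemma evalV_inj p : evalV p = 0 -> p = 0.
Proof.
move=> p0; apply/eqP; rewrite -size_poly_eq0; case sp : (size p) => [|m] //=.
pose r : {poly K} := \poly_(i < m.+1) p`_(m - i).
have h : evalV p * kt ^+ m = kemb r.
  rewrite /= /horner_eval horner_coef size_map_inj_poly ?rmorph0 //; last first.
    by move=> a b /= /eqP; rewrite -subr_eq0 -!rmorphB => /eqP/kemb_inj/eqP;
      rewrite polyC_eq0 subr_eq0 => /eqP.
  rewrite sp mulr_suml /r poly_def rmorph_sum /=.
  rewrite (reindex_inj rev_ord_inj) /=; apply: eq_bigr => i _.
  have le : (i <= m)%N by rewrite -ltnS ltn_ord.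
  rewrite coef_map /= subSS -mul_polyC rmorphM rmorphXn /= -mulrA; congr (_ * _).
  have -> : kt ^+ m = kt ^+ (m - i) * kt ^+ i by rewrite -exprD subnK.
  by rewrite mulrA -exprMn mulVf ?kt_neq0 // expr1n mul1r.
have {}h : r = 0 by apply: kemb_inj; rewrite -h p0 mul0r.
have : r`_0 = 0 by rewrite h coef0.
rewrite coef_poly /= subn0 => pm.
have /eqP : lead_coef p = 0 by rewrite /lead_coef sp.
by rewrite lead_coef_eq0 => /eqP p00; rewrite p00 size_poly0 in sp.
Qed.

Definition kbar : {rmorphism kfield -> kfield} := frac_ext evalV_inj.

Lemma kbar_t : kbar kt = kt^-1.
Proof.
by rewrite /kbar /= frac_ext_tofrac /= /horner_eval map_polyX hornerX.
Qed.
Lemma kbar_cst c : kbar (kcst c) = kcst c.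
Proof.
by rewrite /kbar /= frac_ext_tofrac /= /horner_eval map_polyC hornerC.
Qed.

End BaseField.

(* Root data. The space h^* is 'cV[rat] in the basis of simple roots, and the *)
(* coroot lattice is 'cV[int] in the basis of simple coroots h_i.             *)

Definition finite_cartan (n : nat) (a : 'M[int]_n) (eps : 'I_n -> nat) : Prop :=
  [/\ forall i, a i i = 2,
      forall i j, i != j -> a i j <= 0 /\ (a i j = 0 -> a j i = 0),
      (forall i, (0 < eps i)%N) /\ \big[gcdn/0%N]_i eps i = 1%N,
      forall i j, (eps i)%:Z * a i j = (eps j)%:Z * a j i
    & forall v : 'cV[int]_n, v != 0 ->
        0 < \sum_i \sum_j v i 0 * ((eps i)%:Z * a i j) * v j 0].

Record cartanDatum := CartanDatum {
  rk : nat;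
  car : 'M[int]_rk;
  eps : 'I_rk -> nat;
  cartanP : finite_cartan car eps }.
Arguments car : clear implicits.
Arguments eps : clear implicits.

Section RootData.
Variable D : cartanDatum.
Local Notation I := 'I_(rk D).
Local Notation hdual := 'cV[rat]_(rk D).
Local Notation Qplus := 'cV[nat]_(rk D).
Implicit Types (l m b : hdual) (X : {set I}) (t : {perm I}).

(* This is the smallest positive integer d with d / det(A) an integer. *)
Definition ddet : nat := `|\det (car D)|%N.

Definition alpha (i : I) : hdual := delta_mx i 0.

(* lambda(h_i) and lambda(h); recall alpha_j(h_i) = a_ij. *)
Definition pairing l (i : I) : rat := \sum_j (car D i j)%:~R * l j 0.
Definition weight_at l (h : 'cV[int]_(rk D)) : rat :=
  \sum_i (h i 0)%:~R * pairing l i.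

(* lambda(varpi_j^vee) *)
Definition coweight l (j : I) : rat := l j 0.

Definition form l m : rat :=
  \sum_i \sum_j l i 0 * ((eps D i)%:R * (car D i j)%:~R) * m j 0.

Definition Plat : set hdual := [set l | forall i, pairing l i \is a Num.int].
Definition Qint (mu : 'cV[int]_(rk D)) : hdual := map_mx intr mu.
Definition Qnat (mu : Qplus) : hdual := \col_i (mu i 0)%:R.

Definition refl (i : I) : 'M[rat]_(rk D) :=
  1%:M - alpha i *m \row_j (car D i j)%:~R.
Definition wprod (s : seq I) : 'M[rat]_(rk D) :=
  foldr (fun i w => refl i *m w) 1%:M s.
Definition weyl X : set 'M[rat]_(rk D) :=
  [set w | exists2 s : seq I, {subset s <= X} & w = wprod s].

Definition reduced (s : seq I) : Prop :=
  forall s', wprod s' = wprod s -> (size s <= size s')%N.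
Definition redword (w : 'M[rat]_(rk D)) : seq I :=
  xget [::] [set s | reduced s /\ wprod s = w].
Definition longest X : 'M[rat]_(rk D) :=
  xget 1%:M [set w | weyl X w /\
    forall w', weyl X w' -> (size (redword w') <= size (redword w))%N].

(* Positive roots of g_X; in finite type every root is W-conjugate to a       *)
(* simple root. The pairing with the coroot of b is 2 (-, b) / (b, b).        *)
Definition posroot X : set hdual :=
  [set b | (exists w i, [/\ weyl X w, i \in X & b = w *m alpha i]) /\
           forall j, 0 <= b j 0].
Definition rho X : hdual := 2^-1 *: \sum_(b \in posroot X) b.
Definition at_rhoV X l : rat :=
  2^-1 * \sum_(b \in posroot X) (2 * form l b / form b b).

Definition autAX X t : Prop :=
  [/\ forall i j, car D (t i) (t j) = car D i j,
      t @: X = X & forall i, eps D (t i) = eps D i].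

Definition diagram t l : hdual := \col_i l ((t^-1)%g i) 0.
Definition Theta X t l : hdual := - (longest X *m diagram t l).

Definition admissible X t : Prop :=
  [/\ autAX X t, forall i, t (t i) = i,
      forall j, j \in X -> longest X *m alpha j = - alpha (t j)
    & forall j, j \notin X -> t j = j -> at_rhoV X (alpha j) \is a Num.int].

End RootData.

Definition qint (k : fieldType) (q : k) (m : nat) : k := (q ^+ m - q ^- m) / (q - q^-1).
Definition qfact (k : fieldType) (q : k) (m : nat) : k :=
  \prod_(1 <= i < m.+1) qint q i.
Definition qbinom (k : fieldType) (q : k) (m n : nat) : k :=
  qfact q m / (qfact q n * qfact q (m - n)).

Inductive ugen (D : cartanDatum) : Type :=
| GE of 'I_(rk D) | GF of 'I_(rk D) | GK of 'cV[int]_(rk D).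

Section QuantumGroup.
Variables (K : fieldType) (D : cartanDatum).
Local Notation k := (kfield K).
Local Notation I := 'I_(rk D).
Local Notation hdual := 'cV[rat]_(rk D).
Local Notation coroots := 'cV[int]_(rk D).
Local Notation Qplus := 'cV[nat]_(rk D).
Implicit Types (X : {set I}) (t : {perm I}) (mu : Qplus).

(* q^r for r in (1/d) Z; for other r the value is irrelevant. *)
Definition qpow (r : rat) : k := kt K ^ numq (r * (ddet D)%:R).
Definition qi (i : I) : k := qpow (eps D i)%:R.

(* sum_i m_i alpha_i |-> sum_i m_i eps_i h_i, so that K_mu = K_(coroot_of mu) *)
Definition coroot_of (mu : coroots) : coroots := \col_i (mu i 0 * (eps D i)%:Z).

Definition serre (A : pzRingType) (iota : k -> A) (x : I -> A) : Prop :=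
  forall i j, i != j -> let N := `|1 - car D i j|%N in
  \sum_(n < N.+1) iota ((-1) ^+ n * qbinom (qi i) N n)
                  * x i ^+ (N - n) * x j * x i ^+ n = 0.

Definition uq_rel (A : pzRingType) (iota : k -> A) (v : ugen D -> A) : Prop :=
  let E i := v (GE i) in let F i := v (GF i) in let KK h := v (GK h) in
  let Ki i := KK (coroot_of (delta_mx i 0)) in
  let Kinv i := KK (- coroot_of (delta_mx i 0)) in
  [/\ KK 0 = 1 /\ forall h h', KK (h + h') = KK h * KK h',
      forall h i, KK h * E i = iota (qpow (weight_at (alpha i) h)) * E i * KK h,
      forall h i, KK h * F i = iota (qpow (- weight_at (alpha i) h)) * F i * KK h,
      forall i j, E i * F j - F j * E i =
        if i == j then iota (qi i - (qi i)^-1)^-1 * (Ki i - Kinv i) else 0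
    & serre iota E /\ serre iota F].

Definition Uq := presAlg uq_rel.
Definition UU := tensAlg uq_rel.

Definition uE (i : I) : Uq := pgen (GE i).
Definition uF (i : I) : Uq := pgen (GF i).
Definition uK (h : coroots) : Uq := pgen (GK h).
Definition uKmu (mu : coroots) : Uq := uK (coroot_of mu).
Definition uKi (i : I) : Uq := uKmu (delta_mx i 0).
Definition uKV (i : I) : Uq := uKmu (- delta_mx i 0).
Definition ucst : {rmorphism k -> Uq} := pcst.
Definition uucst : {rmorphism k -> UU} := pcst.

Definition ubar : Uq -> Uq :=
  plift (ucst \o kbar K) (fun g : ugen D =>
    match g with GE i => uE i | GF i => uF i | GK h => uK (- h) end).
Definition uubar : UU -> UU :=
  tens_lift (uucst \o kbar K) (fun u => tens (ubar u) 1) (fun u => tens 1 (ubar u)).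

(* The automorphism permuting the indices of the generators; h_i |-> h_(t i). *)
Definition udiag t : Uq -> Uq :=
  plift ucst (fun g : ugen D =>
    match g with
    | GE i => uE (t i) | GF i => uF (t i)
    | GK h => uK (\col_i h ((t^-1)%g i) 0)
    end).

Definition coprod : Uq -> UU :=
  plift uucst (fun g : ugen D =>
    match g with
    | GE i => tens (uE i) 1 + tens (uKi i) (uE i)
    | GF i => tens (uF i) (uKV i) + tens 1 (uF i)
    | GK h => tens (uK h) (uK h)
    end).

Definition Uplus X mu : set Uq :=
  [set u | gen_subalg [set uE i | i in [set` X]] u /\
   forall h, uK h * u = qpow (weight_at (Qnat mu) h) *: (u * uK h)].
(* U^-_{-mu} *)
Definition Uminus X mu : set Uq :=
  [set u | gen_subalg [set uF i | i in [set` X]] u /\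
   forall h, uK h * u = qpow (- weight_at (Qnat mu) h) *: (u * uK h)].

(* M_X = U_q(g_X) *)
Definition leviX X : set Uq :=
  gen_subalg [set u | exists2 i, i \in X &
    [\/ u = uE i, u = uF i, u = uKi i | u = uKV i]].

Definition divE (i : I) (a : nat) : Uq := (qfact (qi i) a)^-1 *: uE i ^+ a.
Definition divF (i : I) (a : nat) : Uq := (qfact (qi i) a)^-1 *: uF i ^+ a.

End QuantumGroup.

(* Modules and completions. Finite dimensional modules are realised on column *)
(* vectors over a finite extension L of k (the field of values of xi), and    *)
(* tensor products by Kronecker products of matrices. Elements of the         *)
(* completions U and U_0^(2) are represented by families of endomorphisms     *)
(* indexed by modules or pairs of modules; two elements are equal when their  *)
(* components at all objects of O_int agree. Naturality holds for all the     *)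
(* families below and plays no role in comparing them.                        *)

Section Completion.
Variables (K : fieldType) (D : cartanDatum) (L : fieldExtType (kfield K)).
Local Notation k := (kfield K).
Local Notation I := 'I_(rk D).
Local Notation hdual := 'cV[rat]_(rk D).
Local Notation coroots := 'cV[int]_(rk D).
Local Notation Qplus := 'cV[nat]_(rk D).
Local Notation Uq := (Uq K D).
Local Notation UU := (UU K D).
Implicit Types (X : {set I}) (mu : Qplus).

Definition mxcst (n : nat) (c : k) : 'M[L]_n := (c%:A)%:M.

(* To be a module, [uact] must satisfy [Oint]. *)
Record umod := UMod { udim : nat; uact : Uq -> 'M[L]_udim }.

Definition weight_vec (M : umod) (l : hdual) (v : 'cV[L]_(udim M)) : Prop :=
  forall h : coroots, uact M (uK K h) *m v = (qpow K D (weight_at l h))%:A *: v.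

Definition Oint (M : umod) : Prop :=
  alg_morph (@mxcst (udim M)) (uact M) /\
  forall v : 'cV[L]_(udim M), exists2 s : seq 'cV[L]_(udim M),
    (forall w, w \in s -> exists2 l, Plat l & weight_vec l w) & v = \sum_(w <- s) w.

Definition act2 (M N : umod) : UU -> 'M[L]_(udim M * udim N) :=
  tens_lift (@mxcst _) (fun u => tensmx (uact M u) 1%:M)
                       (fun u => tensmx 1%:M (uact N u)).

Definition tensmod (M N : umod) : umod :=
  UMod (fun u => act2 M N (coprod u)).

Definition fam1 := forall M : umod, 'M[L]_(udim M).
Definition fam2 := forall M N : umod, 'M[L]_(udim M * udim N).

Definition eq1 (f g : fam1) : Prop := forall M, Oint M -> f M = g M.
Definition eq2 (f g : fam2) : Prop :=
  forall M N, Oint M -> Oint N -> f M N = g M N.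

Definition mul1 (f g : fam1) : fam1 := fun M => f M *m g M.
Definition mul2 (f g : fam2) : fam2 := fun M N => f M N *m g M N.
Definition inv1 (f : fam1) : fam1 := fun M => invmx (f M).
Definition tensr1 (f : fam1) : fam2 := fun M N => tensmx (f M) 1%:M.
Definition Delta (f : fam1) : fam2 := fun M N => f (tensmod M N).

Definition emb1 (u : Uq) : fam1 := fun M => uact M u.
Definition emb2 (z : UU) : fam2 := fun M N => act2 M N z.

(* sum_mu x_mu; on each module all but finitely many terms must act by zero. *)
Definition sum1 (x : Qplus -> Uq) : fam1 := fun M => \sum_(mu \in setT) uact M (x mu).
Definition sum2 (x : Qplus -> UU) : fam2 :=
  fun M N => \sum_(mu \in setT) act2 M N (x mu).

(* The element acting on the weight space of weight l by f l. *)
Definition by_weight (f : hdual -> fam1) : fam1 := fun M =>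
  xget 0 [set T | forall l v, Plat l -> weight_vec l v -> T *m v = f l M *m v].

Definition scalar_fam (xi : hdual -> L) : fam1 := by_weight (fun l M => (xi l)%:M).

Definition Tfam (i : I) : fam1 := by_weight (fun l M =>
  \sum_(p \in [set p : nat * nat * nat |
                 - p.1.1%:R + p.1.2%:R - p.2%:R = pairing l i])
    let: (a, b, c) := p in
    uact M (((-1) ^+ b * qi K i ^ (b%:Z - (a * c)%:Z)) *:
            (divE K i a * divF K i b * divE K i c))).

Definition Tw (w : 'M[rat]_(rk D)) : fam1 := fun M =>
  foldr (fun i T => Tfam i M *m T) 1%:M (redword w).

(* The automorphism u |-> f u f^-1 of U_q(g), for f such that conjugation by  *)
(* f preserves the image of U_q(g) in the completion.                         *)
Definition Ad (f : fam1) (u : Uq) : Uq :=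
  xget 0 [set u' | eq1 (emb1 u') (mul1 (mul1 f (emb1 u)) (inv1 f))].

(* Quasi R-matrix of g_X, where S = U_q(g_X). *)
Definition quasiR X (S : set Uq) (R : Qplus -> UU) : Prop :=
  [/\ forall mu, tens_set (Uminus X mu) (Uplus X mu) (R mu),
      R 0 = tens 1 1
    & forall u, S u -> eq2 (mul2 (emb2 (coprod (ubar u))) (sum2 R))
                           (mul2 (sum2 R) (emb2 (uubar (coprod u))))].

Definition mul_series (x y : Qplus -> UU) (mu : Qplus) : UU :=
  \sum_(p \in [set p : Qplus * Qplus | p.1 + p.2 = mu]) x p.1 * y p.2.

End Completion.

Arguments emb1 {K D} L u M.
Arguments emb2 {K D} L z M N.
Arguments sum1 {K D} L x M.
Arguments sum2 {K D} L x M N.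
Arguments Tfam {K D} L i M.
Arguments Tw {K D} L w M.
Arguments Ad {K D} L f u.

Section QuantumSymmetricPair.
Variables (K : fieldType) (D : cartanDatum) (L : fieldExtType (kfield K)).
Local Notation k := (kfield K).
Local Notation I := 'I_(rk D).
Local Notation hdual := 'cV[rat]_(rk D).
Local Notation Qplus := 'cV[nat]_(rk D).
Local Notation Uq := (Uq K D).
Local Notation UU := (UU K D).
Variables (X : {set I}) (tau : {perm I}).

Definition sign_fun (s : I -> K) : Prop :=
  [/\ forall i, s i != 0,
      forall i, (i \in X) || (tau i == i) -> s i = 1
    & forall i, i \notin X -> tau i != i ->
        s i / s (tau i) = (-1) ^ numq (2 * at_rhoV X (alpha i))].

Definition Ins : set I :=
  [set i | [/\ i \notin X, tau i = i & forall j, j \in X -> car D i j = 0]].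

(* c_i and s_i are only used for i outside X. *)
Definition parameters (c sp : I -> k) : Prop :=
  [/\ forall i, i \notin X -> c i != 0,
      forall i, i \notin X -> tau i != i ->
        form (alpha i) (Theta X tau (alpha i)) = 0 -> c i = c (tau i),
      forall j, j \notin X -> sp j != 0 -> Ins j /\
        forall i, Ins i -> i != j -> exists m : nat, car D i j = - (2 * m)%:Z,
      forall i, i \notin X -> c (tau i) =
        qpow K D (form (alpha i) (Theta X tau (alpha i) - 2 *: rho X)) * kbar K (c i)
    & forall i, i \notin X -> kbar K (sp i) = sp i].

Definition compatible_tau0 (tau0 : {perm I}) (s : I -> K) (c sp : I -> k) : Prop :=
  [/\ autAX X tau0 /\ (forall i, longest [set: I]%SET *m alpha i = - alpha (tau0 i)),
      forall i, tau (tau0 i) = tau0 (tau i),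
      forall i, i \notin X -> c (tau0 (tau i)) = c i,
      forall i, i \notin X -> sp (tau0 i) = sp i
    & forall i, s (tau i) = s (tau0 i)].

Variables (s : I -> K) (c sp : I -> k).

Definition Xelt (i : I) : Uq :=
  - (kcst (s (tau i)) *: Ad L (Tw L (longest X)) (uE K (tau i))).

Definition Bgen (i : I) : Uq :=
  uF K i + c i *: (Xelt i * uKV K i) + sp i *: uKV K i.

(* U^0'_Theta is generated by this set *)
Definition KTheta : set Uq :=
  [set u | exists2 mu : 'cV[int]_(rk D),
     Theta X tau (Qint mu) = Qint mu & u = uKmu K mu].

(* M_X U^0'_Theta *)
Definition leviTheta : set Uq := gen_subalg (leviX X `|` KTheta).

Definition Bcs : set Uq :=
  gen_subalg (leviX X `|` KTheta `|` [set Bgen i | i in [set i | i \notin X]]).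

(* barB is the bar involution of B_{c,s}; only its values on B_{c,s} matter. *)
Definition is_barB (barB : Uq -> Uq) : Prop :=
  [/\ set_bij Bcs Bcs barB,
      barB 1 = 1 /\ (forall u v, Bcs u -> Bcs v -> barB (u * v) = barB u * barB v),
      (forall u v, Bcs u -> Bcs v -> barB (u + v) = barB u + barB v) /\
      (forall (a : k) u, Bcs u -> barB (a *: u) = kbar K a *: barB u),
      forall u, leviTheta u -> barB u = ubar u
    & forall i, i \notin X -> barB (Bgen i) = Bgen i].

Definition quasiK (barB : Uq -> Uq) (XX : Qplus -> Uq) : Prop :=
  [/\ forall mu, Uplus [set: I]%SET mu (XX mu), XX 0 = 1
    & forall u, Bcs u -> eq1 (mul1 (emb1 L (barB u)) (sum1 L XX))
                             (mul1 (sum1 L XX) (emb1 L (ubar u)))].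

Definition is_gamma (gamma : hdual -> L) : Prop :=
  [/\ forall l, Plat l -> gamma l != 0,
      forall l m, Plat l -> Plat m -> gamma (l + m) = gamma l * gamma m,
      forall i, i \in X -> gamma (alpha i) = 1
    & forall i, i \notin X -> gamma (alpha i) = (c i * kcst (s (tau i)))%:A].

Definition xi (gamma : hdual -> L) (l : hdual) : L :=
  let lplus := 2^-1 *: (l + Theta X tau l) in
  let atilde j := 2^-1 *: (alpha j - Theta X tau (alpha j)) in
  gamma l * (qpow K D (- form lplus lplus +
                   \sum_j form (atilde j) (atilde j) * coweight l j))%:A.

(* Ad(xi) T_(w_0)^-1 T_(w_X)^-1 tau tau_0 *)
Definition twist (tau0 : {perm I}) (gamma : hdual -> L) (u : Uq) : Uq :=
  Ad L (scalar_fam (xi gamma))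
    (Ad L (inv1 (Tw L (longest [set: I]%SET)))
      (Ad L (inv1 (Tw L (longest X))) (udiag tau (udiag tau0 u)))).

Definition RtauX (tau0 : {perm I}) (gamma : hdual -> L) (R RX : Qplus -> UU) :
    fam2 D L :=
  sum2 L (fun mu =>
    tens_lift (uucst K D) (fun u => tens (twist tau0 gamma u) 1) (fun u => tens 1 u)
      (mul_series R (fun nu => uubar (RX nu)) mu)).

Definition XK2 (XX : Qplus -> Uq) : fam2 D L :=
  sum2 L (fun mu => tens (uKmu K (map_mx Posz mu)) (XX mu)).

End QuantumSymmetricPair.

(* Main.v *)
(* Both sides are compared on a pair of modules M, N. The composite automorphism
   Ad(xi) T_(w_0)^-1 T_(w_X)^-1 tau tau_0 turns M into another module M' of O_int,
   and it exchanges F_i with a multiple of bar(X_i) K_i, and c_i X_i K_i^-1 with F_i,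
   so that R^(tau,X) is just R bar(R_X) acting on M' (x) N. Likewise X_K2 is the
   quasi K-matrix of the module obtained from M (x) N by letting E_i act as
   K_i (x) E_i and F_i as K_i^-1 (x) F_i. The intertwining properties of the quasi
   K- and R-matrices, applied to these modules, then show that the right-hand side Y
   satisfies Delta(B_i) Y = Y Delta(bar(B_i)) for i outside X and
   Delta(F_j) Y = Y Delta(F_j) for j in X. So does Delta(X), by the definition of X.
   Both differ from X (x) 1 by terms of positive weight in the second factor. If they
   were different, a component of least height of the difference would commute with
   all 1 (x) F_i while having a weight which pairs positively with some h_i; this is
   impossible by sl2-theory. The remaining work is to compute T_w on generators,
   which on finite dimensional modules reduces to sl2 and to rank two. *)

From HB Require Import structures.
From mathcomp Require Import all_boot all_order all_fingroup all_algebra fieldext.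
From mathcomp Require Import boolp classical_sets functions cardinality fsbigop mxtens.
From mathcomp Require Import ring lra zify.
Require Import Defs.

Set Implicit Arguments.
Unset Strict Implicit.
Unset Printing Implicit Defensive.
Import Order.TTheory GRing.Theory Num.Theory.
Local Open Scope ring_scope.

(** * Quantum integers *)

(** Faithfulness of U_q(g) on its finite dimensional modules is not established; identities between
    elements are replaced by identities of their actions on all modules of O_int. This shapes the
    proof in three ways. [Ad] picks one element of U_q(g) that has to work on every module at once,
    so preimages of the generators under T_i must be exhibited explicitly. An equality of actions
    does not pass through the bar involution by itself, because bar is only semilinear; restriction
    of scalars from L to k turns bar-conjugation into another module. And [redword] chooses reduced
    words arbitrarily, so the braid relations of the T_i have to be proved. The scalars match for a
    reason visible only at the level of roots: bar(T_(w_X) E) and T_(w_X)^-1 E differ by one factor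
    (-1)^m q_j^m per positive root of X, and the product of these factors is what the conditions on
    c and s, with their rho_X and rho_X^vee, compensate. The exponent in xi must moreover lie in
    (1/d)Z, which is a parity question about det A. *)

Section QNumbers.
Variables (F : fieldType) (q : F).
Hypothesis qX : forall n, q ^+ n.+1 != 1.
Hypothesis q0 : q != 0.

Definition qz (m : int) : F := (q ^ m - q ^ (- m)) / (q - q^-1).

Lemma qintE n : qint q n = qz n.
Proof. by rewrite /qint /qz exprnN. Qed.

Lemma qD (a b : int) : q ^ (a + b) = q ^ a * q ^ b.
Proof. exact: expfzDr. Qed.

Lemma qN (a : int) : q ^ (- a) = (q ^ a)^-1.
Proof. by rewrite invr_expz. Qed.

Lemma qVz (a : int) : q ^ a != 0.
Proof. exact: expfz_neq0. Qed.

Lemma q_subV : q - q^-1 != 0.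
Proof.
apply: contraNneq (qX 1) => h.
by rewrite exprS expr1 -{1}[q](subrK q^-1) h add0r mulVf.
Qed.

Lemma qz0 : qz 0 = 0.
Proof. by rewrite /qz oppr0 subrr mul0r. Qed.

Lemma qz1 : qz 1 = 1.
Proof. by rewrite /qz exprN1 expr1z divff // q_subV. Qed.

Lemma qzN m : qz (- m) = - qz m.
Proof. by rewrite /qz opprK -mulNr opprB. Qed.

Lemma qzS_neq0 (n : nat) : qz n.+1 != 0.
Proof.
rewrite /qz mulf_neq0 ?invr_neq0 ?q_subV //.
rewrite qN subr_eq0; apply: contraNneq (qX (n + n.+1)%N) => h.
by rewrite -addSn exprD -[q ^+ n.+1]/(q ^ n.+1) {1}h mulVf // qVz.
Qed.

Lemma qfactS n : qfact q n.+1 = qfact q n * qz n.+1.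
Proof. by rewrite /qfact big_nat_recr //= qintE. Qed.

Lemma qfact0 : qfact q 0 = 1.
Proof. by rewrite /qfact big_geq. Qed.

Lemma qfact_neq0 n : qfact q n != 0.
Proof.
by elim: n => [|n h]; rewrite ?qfact0 ?oner_neq0 // qfactS mulf_neq0 // qzS_neq0.
Qed.

(** Set to 0 for m > n, where the truncated subtraction in [qbinom] would leave a nonzero quotient;
    Pascal's rule needs these zeros. *)
Definition bq n m : F := if (m <= n)%N then qbinom q n m else 0.

Lemma bq_small n m : (n < m)%N -> bq n m = 0.
Proof. by rewrite /bq ltnNge => /negbTE ->. Qed.

Lemma bqE n m : bq (n + m) m = qfact q (n + m) / (qfact q m * qfact q n).
Proof. by rewrite /bq leq_addl /qbinom addnK. Qed.

Lemma bq0 n : bq n 0 = 1.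
Proof. by rewrite -[n in LHS]addn0 bqE addn0 qfact0 mul1r divff // qfact_neq0. Qed.

Lemma bqnn n : bq n n = 1.
Proof. by rewrite -[n in bq n]add0n bqE add0n qfact0 mulr1 divff // qfact_neq0. Qed.

(** After cancelling common factorials this is [a + b] = q^(-b) [a] + q^a [b] with a = n - m and b =
    m + 1. *)
Lemma bqS' n m :
  bq n.+1 m.+1 = q ^ (- m.+1%:Z) * bq n m.+1 + q ^ (n%:Z - m%:Z) * bq n m.
Proof.
case: (ltngtP m n) => [lt|gt|<-]; last first.
- by rewrite !bqnn bq_small // mulr0 subrr expr0z mul1r add0r.
- by rewrite !bq_small ?mulr0 ?addr0 //; lia.
have [p ->] : exists p, n = (p + m.+1)%N by exists (n - m.+1)%N; lia.
have E1 := bqE p.+1 m.+1; have E2 := bqE p m.+1; have E3 := bqE p.+1 m.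
rewrite addSn in E1; rewrite addSnnS in E3; rewrite E1 E2 E3 !qfactS.
have -> : (p + m.+1)%N%:Z - m%:Z = p.+1%:Z by lia.
set z := qfact q (p + m.+1); have zn : z != 0 by apply: qfact_neq0.
have := qfact_neq0 m; have := qfact_neq0 p; set x := qfact q m; set y := qfact q p.
move=> yn xn; have := qzS_neq0 m; have := qzS_neq0 p => pn mn.
have -> : qz (p + m.+1).+1 = q ^ (- m.+1%:Z) * qz p.+1 + q ^ p.+1%:Z * qz m.+1.
  rewrite /qz; have -> : (p + m.+1).+1%:Z = p.+1%:Z + m.+1%:Z by lia.
  rewrite opprD !qD !qN; have := qVz p.+1; have := qVz m.+1; have := q_subV.
  by move: (q ^ p.+1) (q ^ m.+1) (q - q^-1) => a b c c0 b0 a0; field; rewrite c0 a0 b0.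
by field; rewrite xn yn pn mn.
Qed.

(* The sum is a finite q-difference of the Laurent polynomial a |-> [h+a, j-c] in q^a;
   the chosen exponent makes the two Pascal rules telescope. *)
Definition qdiff (j h n : nat) (e : int) : F :=
  \sum_(a < j.+1) (-1) ^+ a * q ^ (a%:Z * e) * bq j a * bq (h + a) n.

Lemma qdiffS j h n e :
  qdiff j.+1 h n e = qdiff j h n (e - 1) - q ^ (e + j%:Z) * qdiff j h.+1 n (e - 1).
Proof.
rewrite /qdiff big_ord_recl /=.
have -> : \sum_(i < j.+1) (-1) ^+ bump 0 i * q ^ ((bump 0 i)%:Z * e) *
      bq j.+1 (bump 0 i) * bq (h + bump 0 i) n =
   \sum_(i < j.+1) ((-1) ^+ i.+1 * q ^ (i.+1%:Z * (e - 1)) * bq j i.+1 * bq (h + i.+1) n)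
   - q ^ (e + j%:Z) * \sum_(i < j.+1) ((-1) ^+ i * q ^ (i%:Z * (e - 1)) * bq j i
       * bq (h.+1 + i) n).
  rewrite mulr_sumr -sumrB; apply: eq_bigr => i _.
  rewrite /bump /= add1n bqS' addSnnS exprS.
  have -> : i.+1%:Z * e = i%:Z * (e - 1) + i%:Z + e by lia.
  have -> : i.+1%:Z * (e - 1) = i%:Z * (e - 1) + e - 1 by lia.
  have -> : i.+1%:Z = i%:Z + 1 by lia.
  rewrite !(qD, qN) expr1z.
  have := qVz i; have := qVz j; have := qVz (i%:Z * (e - 1)); have := qVz e.
  move: (bq j i.+1) (bq j i) (bq _ n) ((-1) ^+ i) q0 => u v w s.
  move: (q ^ (i%:Z * (e - 1))) (q ^ i) (q ^ j) (q ^ e) => x1 x2 x3 x4.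
  by move=> ? ? ? ? ?; field; do ?[apply/andP; split].
rewrite addrA; congr (_ - _).
rewrite [in RHS]big_ord_recl /= /bump /=.
rewrite [in LHS]big_ord_recr /= (bq_small (ltnSn j)) mulr0 mul0r addr0.
by rewrite !mul0r !bq0.
Qed.

(** In [qdiffS] expand the binomial with h + 1 by Pascal's rule: for the exponent 1 - c the
    binomials with unchanged lower index cancel, and only those with lower index j - c remain. *)
Lemma qdiff_rec j h c : (c <= j)%N ->
  qdiff j.+1 h (j.+1 - c) (1 - c%:Z) = - q ^ h.+1%:Z * qdiff j h (j - c) (1 - c%:Z).
Proof.
move=> cj; rewrite qdiffS /qdiff !mulr_sumr -sumrB; apply: eq_bigr => a _.
rewrite subSn // addSn bqS'; set s := (-1) ^+ a; set b := bq j a.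
have -> : (h + a)%N%:Z - (j - c)%N%:Z = h%:Z + a%:Z - j%:Z + c%:Z by lia.
have -> : (j - c).+1%:Z = j%:Z - c%:Z + 1 by lia.
have -> : a%:Z * (1 - c%:Z - 1) = - (a%:Z * c%:Z) by lia.
have -> : a%:Z * (1 - c%:Z) = a%:Z - (a%:Z * c%:Z) by lia.
have -> : h.+1%:Z = h%:Z + 1 by lia.
move: (a%:Z) (j%:Z) (c%:Z) (h%:Z) => a' j' c' h'.
rewrite !(qD, qN) expr1z.
have := qVz (a' * c'); have := qVz a'; have := qVz j'; have := qVz c'; have := qVz h'.
move: (bq (h + a) _) (bq (h + a) _) q0 => u v.
move: (q ^ (a' * c')) (q ^ a') (q ^ j') (q ^ c') (q ^ h') => x1 x2 x3 x4 x5.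
by move=> ? ? ? ? ? ?; field; do ?[apply/andP; split].
Qed.

Lemma qdiff0 j h : qdiff j h j 1 = (-1) ^+ j * q ^ (j%:Z * h.+1%:Z).
Proof.
elim: j => [|j IH].
  by rewrite /qdiff big_ord1 /= !bq0 mul0r !mulr1.
have := @qdiff_rec j h 0 (leq0n _); rewrite subr0 !subn0 => ->.
rewrite IH exprS mulN1r !mulNr; congr (- _); rewrite mulrCA -qD; congr (_ * _).
Qed.

(** A q-difference of order j kills an expression of degree j - c < j. The recursion ends at lower
    index 0, where all binomials are 1 and the two halves of [qdiffS] cancel. *)
Lemma qdiff_vanish j h c : (0 < c)%N -> (c <= j)%N ->
  qdiff j h (j - c) (1 - c%:Z) = 0.
Proof.
move=> c0 cj; rewrite -(subnK cj); move: (j - c)%N => p; elim: p => [|p IH].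
  rewrite add0n subnn; case: c c0 cj => // c _ _.
  rewrite qdiffS /qdiff.
  have -> : 1 - c.+1%:Z + c = 0 by lia.
  rewrite expr0z mul1r -sumrB big1 // => a _; rewrite !bq0 subrr //.
by rewrite addSn qdiff_rec ?leq_addl // IH mulr0.
Qed.

End QNumbers.

(** Divided power g^n / [n]! of an operator, locked so that simplification keeps it folded. *)
HB.lock Definition dpw (F : fieldType) (q : F) (V : lmodType F) (g : V -> V)
  (n : nat) (v : V) : V := (qfact q n)^-1 *: iter n g v.

(** * Integrable representations of quantum sl2 *)

Section DividedPowers.
Variables (F : fieldType) (q : F) (V : lmodType F).
Hypothesis qX : forall n, q ^+ n.+1 != 1.
Hypothesis q0 : q != 0.

Local Notation dpow := (dpw q).

Lemma dpow0 (g : V -> V) v : dpow g 0 v = v.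
Proof. by rewrite !dpw.unlock qfact0 invr1 scale1r. Qed.

Lemma dpow_iter (g : V -> V) n v : iter n g v = qfact q n *: dpow g n v.
Proof. by rewrite dpw.unlock scalerA divff ?scale1r // qfact_neq0. Qed.

Variable g : {linear V -> V}.

Lemma iter0 n : iter n g 0 = 0.
Proof. by elim: n => //= n ->; rewrite linear0. Qed.

Lemma iter_lin n a u v : iter n g (a *: u + v) = a *: iter n g u + iter n g v.
Proof. by elim: n => //= n ->; rewrite linearP. Qed.

Lemma iterZ n a u : iter n g (a *: u) = a *: iter n g u.
Proof. by rewrite -[a *: u]addr0 iter_lin iter0 addr0. Qed.

Lemma iterDr n u v : iter n g (u + v) = iter n g u + iter n g v.
Proof. by rewrite -[u]scale1r iter_lin !scale1r. Qed.

Lemma iterN n u : iter n g (- u) = - iter n g u.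
Proof. by rewrite -scaleN1r iterZ scaleN1r. Qed.

Lemma dpow_lin n a u v : dpow g n (a *: u + v) = a *: dpow g n u + dpow g n v.
Proof. by rewrite !dpw.unlock iter_lin scalerDr !scalerA mulrC. Qed.

Lemma dpow_0 n : dpow g n 0 = 0.
Proof. by rewrite !dpw.unlock iter0 scaler0. Qed.

Lemma dpowZ n a u : dpow g n (a *: u) = a *: dpow g n u.
Proof. by rewrite -[a *: u]addr0 dpow_lin dpow_0 addr0. Qed.

Lemma dpowDr n u v : dpow g n (u + v) = dpow g n u + dpow g n v.
Proof. by rewrite -[u]scale1r dpow_lin !scale1r. Qed.

Lemma dpow_sum n I (r : seq I) (P : pred I) (E : I -> V) :
  dpow g n (\sum_(i <- r | P i) E i) = \sum_(i <- r | P i) dpow g n (E i).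
Proof. by apply: (big_morph (dpow g n)) => [u v|]; rewrite ?dpowDr ?dpow_0. Qed.

Lemma dpowS n v : qz q n.+1 *: dpow g n.+1 v = g (dpow g n v).
Proof.
transitivity ((qfact q n)^-1 *: g (iter n g v)); last by rewrite dpw.unlock linearZ.
rewrite dpw.unlock scalerA qfactS //=.
by congr (_ *: _); field; rewrite qfact_neq0 ?qzS_neq0.
Qed.

Lemma dpowSr n v : qz q n.+1 *: dpow g n.+1 v = dpow g n (g v).
Proof.
rewrite !dpw.unlock iterSr scalerA qfactS // //.
by congr (_ *: _); field; rewrite qfact_neq0 ?qzS_neq0.
Qed.

Lemma dpow_dpow a b v : dpow g a (dpow g b v) = bq q (a + b) a *: dpow g (a + b) v.
Proof.
rewrite !dpw.unlock iterZ !scalerA -iterD [(a + b)%N]addnC bqE //.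
by congr (_ *: _); field; rewrite !qfact_neq0.
Qed.

Lemma dpow_nil n N v : iter N g v = 0 -> (N <= n)%N -> dpow g n v = 0.
Proof. by move=> h le; rewrite !dpw.unlock -(subnK le) iterD h iter0 scaler0. Qed.

Lemma bq_absorb c a :
  bq q (c + a.+1) a.+1 * qz q a.+1 = qz q c.+1 * bq q (c + a.+1) a.
Proof.
have := bqE q c.+1 a; rewrite addSnnS => ->; rewrite bqE // !qfactS //.
by field; rewrite !qfact_neq0 // !qzS_neq0.
Qed.

Lemma bqC a b : bq q (a + b) a = bq q (a + b) b.
Proof. by rewrite bqE addnC bqE addnC [X in _ / X]mulrC. Qed.

Lemma bq_neq0 n m : (m <= n)%N -> bq q n m != 0.
Proof.
by move=> le; rewrite -(subnK le) bqE // !(mulf_neq0, invr_neq0) ?qfact_neq0.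
Qed.

End DividedPowers.

Lemma sum_ord_stable (V : zmodType) (g : nat -> V) n n' :
  (forall a, (n <= a)%N -> g a = 0) -> (forall a, (n' <= a)%N -> g a = 0) ->
  \sum_(a < n) g a = \sum_(a < n') g a.
Proof.
wlog le : n n' / (n <= n')%N => [hw h h'|h _].
  by case: (leqP n n') => [|/ltnW] /hw; [apply|move=> hh; rewrite hh].
rewrite (big_ord_widen _ _ le) big_mkcond; apply: eq_bigr => a _.
by case: ltnP => // /h.
Qed.

Section Sl2.
Variables (F : fieldType) (q : F) (V : lmodType F).
Hypothesis qX : forall n, q ^+ n.+1 != 1.
Hypothesis q0 : q != 0.
Local Notation qz := (qz q).
Local Notation bq := (bq q).
Local Notation dpow := (dpw q).

(** The space is arbitrary because two cases are needed: column vectors, and matrices under the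
    adjoint action. Uniform nilpotency of e and f stands in for finite dimension, and W gives weight
    spaces that are not asked to span. *)
Record sl2rep (e f : {linear V -> V}) (W : int -> V -> Prop) : Prop := Sl2Rep {
  sl2_lin : forall m a u v, W m u -> W m v -> W m (a *: u + v);
  sl2_W0 : forall m, W m 0;
  sl2_e : forall m v, W m v -> W (m + 2) (e v);
  sl2_f : forall m v, W m v -> W (m - 2) (f v);
  sl2_ef : forall m v, W m v -> e (f v) - f (e v) = qz m *: v;
  sl2_nile : exists N, forall v, iter N e v = 0;
  sl2_nilf : exists N, forall v, iter N f v = 0 }.

(** The Chevalley involution: every statement on highest weight vectors yields one on lowest weight
    vectors. *)
Lemma sl2_swap e f W : sl2rep e f W -> sl2rep f e (fun m => W (- m)).
Proof.
case=> h1 h2 h3 h4 h5 h6 h7; split=> // [m a u v|m v h|m v h|m v h].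
- exact: h1.
- by have := h4 _ _ h; congr (W _ _); lia.
- by have := h3 _ _ h; congr (W _ _); lia.
- have := h5 _ _ h; rewrite qzN scaleNr => /(congr1 -%R); rewrite opprK opprB; exact.
Qed.

Section Rep.
Variables (e f : {linear V -> V}) (W : int -> V -> Prop).
Hypothesis H : sl2rep e f W.

Lemma W_Z m a u : W m u -> W m (a *: u).
Proof. by move=> h; rewrite -[_ *: _]addr0; apply: sl2_lin H _ _ _ _ h (sl2_W0 H m). Qed.

Lemma W_iter_e m v n : W m v -> W (m + 2 * n%:Z) (iter n e v).
Proof.
move=> h; elim: n => [|n IH] /=; first by rewrite mulr0 addr0.
by move/(sl2_e H): IH; congr (W _ _); lia.
Qed.

Lemma W_iter_f m v n : W m v -> W (m - 2 * n%:Z) (iter n f v).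
Proof.
move=> h; elim: n => [|n IH] /=; first by rewrite mulr0 subr0.
by move/(sl2_f H): IH; congr (W _ _); lia.
Qed.

Lemma W_eD m v n : W m v -> W (m + 2 * n%:Z) (dpow e n v).
Proof. by move=> h; rewrite dpw.unlock; apply: W_Z; apply: W_iter_e. Qed.

Lemma W_fD m v n : W m v -> W (m - 2 * n%:Z) (dpow f n v).
Proof. by move=> h; rewrite dpw.unlock; apply: W_Z; apply: W_iter_f. Qed.

Lemma f_iter_e m v n : W m v -> f (iter n.+1 e v) =
  iter n.+1 e (f v) - (qz n.+1 * qz (m + n%:Z)) *: iter n e v.
Proof.
move=> h; elim: n => [|n IH].
  by rewrite /= qz1 // mul1r addr0 -(sl2_ef H h) opprB addrC subrK.
have := sl2_ef H (W_iter_e n.+1 h); rewrite iterS => /eqP.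
rewrite subr_eq addrC -subr_eq => /eqP <-; rewrite IH linearB linearZ /= -addrA.
rewrite -opprD -scalerDl; congr (_ - _ *: _).
rewrite /qz.
have -> : m + n.+1%:Z = (m + n%:Z) + 1 by lia.
have -> : m + 2 * n.+1%:Z = (m + n%:Z) + n%:Z + 1 + 1 by lia.
move: (m + n%:Z) => M.
have -> : n.+2%:Z = n%:Z + 1 + 1 by lia.
have -> : n.+1%:Z = n%:Z + 1 by lia.
rewrite !(qD q0, qN) expr1z !invfM.
have := q_subV qX q0; have := qVz q0 n; have := qVz q0 M.
have qq : q * q - 1 != 0 by rewrite subr_eq0 -expr2; exact: (qX 1).
move: (q ^ n%:Z) (q ^ M) => x y y0 x0 z0; field; rewrite ?x0 ?y0 ?q0 ?qq //.
Qed.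

Lemma f_eD m v n : W m v -> f (dpow e n.+1 v) =
  dpow e n.+1 (f v) - qz (m + n%:Z) *: dpow e n v.
Proof.
move=> h; rewrite !dpw.unlock linearZ /= -iterS (f_iter_e _ h) scalerBr; congr (_ - _).
by rewrite !scalerA qfactS //; congr (_ *: _); field; rewrite qfact_neq0 ?qzS_neq0.
Qed.

(** If e^(N+1) v = 0 and f v = 0, applying f to the former gives [N + 1][m + 1 + N] e^N v = 0, and
    both quantum integers are nonzero. So nilpotency of e descends to v = 0. *)
Lemma low_pos (m : nat) v : W m.+1 v -> f v = 0 -> v = 0.
Proof.
move=> h f0; have [N /(_ v)] := sl2_nile H; elim: N => [//|N IH] h0.
apply: IH; have := f_iter_e N h; rewrite h0 f0 linear0 iter0 sub0r => /esym/eqP.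
rewrite oppr_eq0 scaler_eq0 mulf_eq0 (negPf (qzS_neq0 qX q0 _)).
have -> : m.+1%:Z + N%:Z = (m + N).+1%:Z by lia.
by rewrite (negPf (qzS_neq0 qX q0 _)) => /eqP.
Qed.

Definition primv (p : nat) (u : V) : Prop := W p u /\ e u = 0.

End Rep.

Section Rep2.
Variables (e f : {linear V -> V}) (W : int -> V -> Prop).
Hypothesis H : sl2rep e f W.
Local Notation prim := (primv e W).

Lemma high_neg (m : nat) v : W (- m.+1%:Z) v -> e v = 0 -> v = 0.
Proof. by move=> h1 h2; apply: (low_pos (sl2_swap H) (m := m)). Qed.

Lemma e_fD m v n : W m v -> e (dpow f n.+1 v) =
  dpow f n.+1 (e v) + qz (m - n%:Z) *: dpow f n v.
Proof.
move=> h; have := f_eD (sl2_swap H) (m := - m) n; rewrite opprK => /(_ _ h) ->.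
by rewrite -scaleNr -qzN; congr (_ + qz _ *: _); lia.
Qed.

(** The vector f^(p+1) u is killed by e, because [p - p] = 0, and has weight -p - 2; such a vector
    vanishes. *)
Lemma prim_bound p u b : prim p u -> (p < b)%N -> dpow f b u = 0.
Proof.
case=> h e0 lt.
suff h0 : dpow f p.+1 u = 0.
  move/eqP: h0; rewrite dpw.unlock scaler_eq0 invr_eq0 (negPf (qfact_neq0 qX q0 _)).
  by rewrite orFb => /eqP h0; rewrite -(subnK lt) iterD h0 iter0 scaler0.
apply: (@high_neg p.+1).
  by have := W_fD H p.+1 h; congr (W _ _); lia.
by rewrite (e_fD _ h) e0 (@dpow_0 F q V f) add0r subrr qz0 scale0r.
Qed.

Lemma e_prim p u b : prim p u -> e (dpow f b.+1 u) = qz (p%:Z - b%:Z) *: dpow f b u.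
Proof. by case=> h e0; rewrite (e_fD _ h) e0 dpow_0 add0r. Qed.

Lemma eD_fD p u a b : prim p u -> (b + a <= p)%N ->
  dpow e a (dpow f (b + a) u) = bq (p - b) a *: dpow f b u.
Proof.
move=> h; elim: a => [|a IH] le.
  by rewrite addn0 dpow0 bq0 ?scale1r.
apply: (@scalerI _ _ (qz a.+1)); first exact: qzS_neq0.
rewrite dpowSr // addnS (e_prim _ h) dpowZ IH; last by lia.
rewrite !scalerA; congr (_ *: _).
have [c ->] : exists c, p = (b + (c + a.+1))%N by exists (p - b - a.+1)%N; lia.
by rewrite addKn [RHS]mulrC bq_absorb //; congr (qz _ * _); lia.
Qed.

Lemma eD_fD_gt p u a b : prim p u -> (b < a)%N -> dpow e a (dpow f b u) = 0.
Proof.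
move=> h lt; case: (leqP b p) => bp; last first.
  by rewrite (prim_bound h bp) dpow_0.
have := @eD_fD p u b 0 h; rewrite add0n subn0 dpow0 => /(_ bp) hb.
move/(congr1 (dpow e (a - b))): hb; rewrite dpow_dpow // subnK ?(ltnW lt) //.
have -> : dpow e (a - b) (bq p b *: u) = 0.
  case: h => _ h; rewrite dpowZ; have -> : (a - b = (a - b).-1.+1)%N by lia.
  by rewrite !dpw.unlock iterSr h iter0 !scaler0.
move/eqP; rewrite scaler_eq0 (negPf (bq_neq0 qX q0 _)); last by rewrite leq_subr.
by move/eqP.
Qed.

(** Induction on the order to which e annihilates z: the last e^n z is primitive, and subtracting a
    multiple of f^(n) e^n z lowers the order. The multiple exists because the binomial [w + 2n, n]
    is nonzero for w >= 0. *)
Lemma decomp_pos (w n : nat) z : W w z -> iter n e z = 0 ->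
  exists u : nat -> V, (forall k, prim (w + 2 * k) (u k)) /\
    z = \sum_(k < n) dpow f k (u k).
Proof.
elim: n z => [|n IH] z hz h0.
  exists (fun _ => 0); split; last by rewrite big_ord0.
  by move=> k; split; [exact: (sl2_W0 H)|rewrite linear0].
set u := iter n e z.
have pu : prim (w + 2 * n) u.
  by split=> //; have := W_iter_e H n hz; congr (W _ _); lia.
set c := qfact q n * bq (w + 2 * n) n.
have c0 : c != 0 by rewrite mulf_neq0 ?qfact_neq0 ?bq_neq0 //; lia.
have cu : iter n e (dpow f n u) = c *: u.
  rewrite (dpow_iter qX q0) -[n in dpow f n u]add0n (eD_fD pu) ?add0n; last by lia.
  by rewrite subn0 dpow0 scalerA.
have hz' : W w (z - c^-1 *: dpow f n u).
  rewrite addrC -scaleNr; apply: (sl2_lin H) => //.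
  by have := W_fD H n pu.1; congr (W _ _); lia.
have [|v [hv ez]] := IH _ hz'.
  by rewrite iterDr iterN iterZ cu scalerA mulVf // scale1r subrr.
exists (fun k => if k == n then c^-1 *: u else v k); split=> [k|].
  case: eqP => [->|_]; last exact: hv.
  by split; [apply: (W_Z H); case: pu|rewrite linearZ /= pu.2 scaler0].
rewrite big_ord_recr /= eqxx dpowZ -[LHS](subrK (c^-1 *: dpow f n u)) ez.
congr (_ + _); apply: eq_bigr => k _; case: eqP => // kn.
by have := ltn_ord k; rewrite kn ltnn.
Qed.

End Rep2.

Section Rep3.
Variables (e f : {linear V -> V}) (W : int -> V -> Prop).
Hypothesis H : sl2rep e f W.
Local Notation prim := (primv e W).

(* u generates a string whose k-th vector has weight w *)
Definition strand (w : int) (k : nat) (u : V) : Prop :=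
  u = 0 \/ exists l : nat, [/\ prim l u, (k <= l)%N & l%:Z - 2 * k%:Z = w].

Lemma low_to_high l k y : W (- l%:Z) y -> f y = 0 -> (k <= l)%N ->
  prim l (dpow e l y) /\ dpow e k y = dpow f (l - k) (dpow e l y).
Proof.
move=> hy fy kl; have py : primv f (fun m => W (- m)) l y by [].
split; first split.
- by have := W_eD H l hy; congr (W _ _); lia.
- by rewrite -dpowS // (prim_bound (sl2_swap H) py) ?scaler0.
have := @eD_fD _ _ _ (sl2_swap H) l y (l - k) k py; rewrite subnKC // => ->//.
by rewrite bqnn // scale1r.
Qed.

Lemma decomp w z : W w z -> exists n (u : nat -> V),
  (forall k, strand w k (u k)) /\ z = \sum_(k < n) dpow f k (u k).
Proof.
move=> hz; case: w hz => w hz.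
  have [N /(_ z) h0] := sl2_nile H; have [u [hu ->]] := decomp_pos H hz h0.
  exists N, u; split=> // k; right; exists (w + 2 * k)%N; split=> //; lia.
rewrite NegzE in hz *.
have [N /(_ z) h0] := sl2_nilf H.
have [y [hy ez]] := decomp_pos (sl2_swap H) hz h0.
(* The strings found in the swapped representation start at lowest vectors y_k of weight -(w + 1 +
   2k). Counted from their highest vectors they have index w + 1 + k; the smaller indices are filled
   with 0. *)
exists (w.+1 + N)%N.
exists (fun k => if (k < w.+1)%N then 0
                 else dpow e (w.+1 + 2 * (k - w.+1)) (y (k - w.+1)%N)).
split=> [k|].
  case: ltnP => kw; first by left.
  right; exists (w.+1 + 2 * (k - w.+1))%N.
  have [h1 h2] := hy (k - w.+1)%N.
  have [h3 _] := low_to_high h1 h2 (leq0n _).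
  split=> //; lia.
rewrite big_split_ord /= big1 ?add0r => [|k _]; last first.
  by rewrite ltn_ord dpow_0.
rewrite {}ez; apply: eq_bigr => k _.
rewrite ltnNge leq_addr /= addKn; have [h1 h2] := hy k.
have [_ ->] := low_to_high (k := k) h1 h2 ltac:(lia).
congr (dpow f _ _); lia.
Qed.

(** Reduces a statement on a weight space to the vectors f^(j) u with u primitive of weight h + j.
    In this notation Lusztig's operator exchanges j and h up to a scalar. *)
Lemma strand_ind (P : V -> Prop) w :
  P 0 -> (forall u v, P u -> P v -> P (u + v)) ->
  (forall h j u, prim (h + j) u -> h%:Z - j%:Z = w -> P (dpow f j u)) ->
  forall z, W w z -> P z.
Proof.
move=> P0 PD Ps z /decomp [n [u [hu ->]]].
elim/big_ind: _ => // k _; case: (hu k) => [->|[l [h1 h2 h3]]].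
  by rewrite dpow_0.
by apply: (Ps (l - k)%N); [rewrite subnK|lia].
Qed.

Lemma decomp_bounded w z M : W w z -> iter M.+1 e z = 0 ->
  exists (u : nat -> V),
  (forall k, strand w k (u k)) /\ z = \sum_(k < M.+1) dpow f k (u k).
Proof.
move=> /decomp [n [u [hu ->]]]; elim: n => [|n IH].
  by exists (fun _ => 0); split=> [k|]; [left|rewrite big_ord0 big1 // => k; rewrite dpow_0].
case: (ltnP n M.+1) => nM h0.
  exists (fun k => if (k < n.+1)%N then u k else 0); split=> [k|].
    by case: ifP => // _; left.
  rewrite (big_ord_widen M.+1 (fun k => dpow f k (u k))) // big_mkcond /=.
  by apply: eq_bigr => k _; case: ifP => //; rewrite dpow_0.
suff u0 : u n = 0.
  by rewrite big_ord_recr /= u0 dpow_0 addr0 in h0 *; apply: IH.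
case: (hu n) => // -[l [h1 h2 h3]].
(* Applying e^(n) kills the strings of smaller index and returns the generator [u n] up to a nonzero
   binomial. *)
have : dpow e n (\sum_(k < n.+1) dpow f k (u k)) = 0 by exact: dpow_nil nM.
rewrite dpow_sum big_ord_recr big1 /= ?add0r; last first.
  move=> k _; case: (hu k) => [->|[l' [h1' _ _]]]; first by rewrite !dpow_0.
  by rewrite (eD_fD_gt H h1').
have := @eD_fD _ _ _ H l (u n) n 0 h1; rewrite add0n => -> //.
rewrite dpow0 subn0 => /eqP; rewrite scaler_eq0 (negPf (bq_neq0 qX q0 _)) //.
by move/eqP.
Qed.

(* Lusztig's operator with the divided powers cut off at N; the exponent b is determined by a and c *)
Definition Tsl N (m : int) (v : V) : V :=
  \sum_(a < N) \sum_(c < N) if 0 <= m + a%:Z + c%:Z then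
    let b := absz (m + a%:Z + c%:Z) in
    ((-1) ^+ b * q ^ (b%:Z - (a * c)%:Z)) *: dpow e a (dpow f b (dpow e c v)) else 0.

(** For fixed c the sum over a is the q-difference of order j of a binomial of degree j - c. It
    vanishes for c > 0, and c = 0 gives the stated power of q. Terms beyond the string are zero, so
    the cutoff N may be replaced by j + 1. *)
Lemma Tsl_strand N h j u : prim (h + j) u -> (forall v, iter N e v = 0) ->
  Tsl N (h%:Z - j%:Z) (dpow f j u) =
  ((-1) ^+ h * q ^ (h%:Z * j.+1%:Z)) *: dpow f h u.
Proof.
move=> pu hN.
pose t a c : V := ((-1) ^+ (h + j + a + c) * q ^ (h%:Z - j%:Z + a%:Z + c%:Z - (a * c)%:Z) *
   bq (h + c) c * bq (h + a) (j - c) * bq j a) *: dpow f h u.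
pose g a c := (if 0 <= h%:Z - j%:Z + a%:Z + c%:Z then
    let b := absz (h%:Z - j%:Z + a%:Z + c%:Z) in
    ((-1) ^+ b * q ^ (b%:Z - (a * c)%:Z)) *:
       dpow e a (dpow f b (dpow e c (dpow f j u))) else 0).
have gN a c : (N <= a)%N || (N <= c)%N -> g a c = 0.
  rewrite /g; case: ifP => //= _ /orP[] le.
    by rewrite (@dpow_nil _ _ _ e _ N) ?scaler0.
  by rewrite (@dpow_nil _ _ _ e c N) // !dpow_0 scaler0.
have gj a c : (j < c)%N -> g a c = 0.
  rewrite /g; case: ifP => //= _ lt.
  by rewrite (eD_fD_gt H pu lt) !dpow_0 scaler0.
have gt a c : (c <= j)%N -> g a c = t a c.
  move=> cj; rewrite /g /t.
  have -> : dpow e c (dpow f j u) = bq (h + c) c *: dpow f (j - c) u.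
    have := @eD_fD _ _ _ H _ u c (j - c) pu; rewrite subnK // => -> //; last by lia.
    by congr (bq _ _ *: _); lia.
  (* Where b would be negative a binomial in [t] vanishes as well, so the case distinction
     disappears. *)
  case: ifP => [|/negbT]; last first.
    rewrite -ltNge => lt; rewrite (@bq_small _ _ (h + a)); last by lia.
    by rewrite mulr0 mul0r scale0r.
  move=> ge; set b := absz _; have hb : b%:Z = h%:Z - j%:Z + a%:Z + c%:Z by rewrite /b; lia.
  rewrite dpowZ dpow_dpow // dpowZ.
  have -> : (b + (j - c) = h + a)%N by lia.
  have -> : bq (h + a) b = bq (h + a) (j - c).
    have -> : (h + a = b + (j - c))%N by lia.
    exact: bqC.
  rewrite dpowZ; case: (leqP a j) => aj.
    rewrite (eD_fD H pu) ?leq_add2l // addKn !scalerA; congr (_ *: _).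
    rewrite -hb; have -> : (-1) ^+ (h + j + a + c) = (-1) ^+ b :> F.
      have -> : (h + j + a + c = b + 2 * j)%N by lia.
      by rewrite exprD exprM sqrrN expr1n expr1n mulr1.
    by rewrite -!mulrA; congr (_ * (_ * _)); rewrite mulrCA.
  rewrite (prim_bound H pu) ?ltn_add2l // dpow_0 !scaler0.
  by rewrite (bq_small q aj) mulr0 scale0r.
have -> : Tsl N (h%:Z - j%:Z) (dpow f j u) = \sum_(a < j.+1) \sum_(c < j.+1) t a c.
  transitivity (\sum_(a < N) \sum_(c < j.+1) g a c).
    apply: eq_bigr => a _; apply: sum_ord_stable => c le; last exact: gj.
    by apply: gN; rewrite le orbT.
  rewrite (@sum_ord_stable _ (fun a => \sum_(c < j.+1) g a c) N j.+1).
  - by apply: eq_bigr => a _; apply: eq_bigr => c _; apply: gt; rewrite -ltnS.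
  - by move=> a le; rewrite big1 // => c _; apply: gN; rewrite le.
  move=> a le; rewrite big1 // => c _; rewrite gt ?leq_ord // /t.
  by rewrite (@bq_small _ _ j a) // mulr0 scale0r.
rewrite exchange_big /= big_ord_recl /=.
have inner c : (c <= j)%N -> \sum_(a < j.+1) t a c =
   ((-1) ^+ (h + j + c) * q ^ (h%:Z - j%:Z + c%:Z) * bq (h + c) c *
   qdiff q j h (j - c) (1 - c%:Z)) *: dpow f h u.
  move=> cj; rewrite /t -scaler_suml; congr (_ *: _).
  rewrite /qdiff mulr_sumr; apply: eq_bigr => a _.
  have -> : h%:Z - j%:Z + a%:Z + c%:Z - (a * c)%:Z = (h%:Z - j%:Z + c%:Z) + a%:Z * (1 - c%:Z) by lia.
  have -> : (h + j + a + c = (h + j + c) + a)%N by lia.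
  rewrite exprD qD //; ring.
rewrite inner // big1 ?addr0 => [|c _]; last first.
  rewrite inner; last by rewrite /bump /= add1n; have := ltn_ord c.
  by rewrite qdiff_vanish // ?mulr0 ?scale0r //; have := ltn_ord c; rewrite /bump /=; lia.
rewrite /= subn0 addn0 addn0 bq0 // mulr1 (qdiff0 qX q0); congr (_ *: _).
have -> : (-1) ^+ (h + j) * q ^ (h%:Z - j%:Z) * ((-1) ^+ j * q ^ (j%:Z * h.+1%:Z)) =
   (-1) ^+ (h + j + j) * (q ^ (h%:Z - j%:Z) * q ^ (j%:Z * h.+1%:Z)) by rewrite !exprD; ring.
rewrite -qD // -addnA addnn exprD -mul2n exprM sqrrN !expr1n mulr1.
by congr (_ * q ^ _); lia.
Qed.

Section T.
Variables (T : {linear V -> V}) (N : nat).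
Hypothesis hN : forall v, iter N e v = 0.
Hypothesis hT : forall m v, W m v -> T v = Tsl N m v.

Lemma T_strand h j u : prim (h + j) u ->
  T (dpow f j u) = ((-1) ^+ h * q ^ (h%:Z * j.+1%:Z)) *: dpow f h u.
Proof.
move=> pu; rewrite -(Tsl_strand pu hN); apply: hT.
by have := W_fD H j pu.1; congr (W _ _); lia.
Qed.

Lemma T_e m v : W m v -> T (e v) = - q ^ (- m) *: f (T v).
Proof.
apply: (@strand_ind (fun v => T (e v) = - q ^ (- m) *: f (T v)) m) => [|u w hu hw|h j u pu hm].
- by rewrite !linear0 ?scaler0.
- by rewrite !linearD /= hu hw.
rewrite (T_strand pu) linearZ /= -dpowS // !scalerA.
case: j => [|j] in pu hm *.
  rewrite dpow0 pu.2 linear0 (prim_bound H pu) ?scaler0 //.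
  by rewrite addn0.
rewrite (e_prim H _ pu) linearZ /=.
have pu' : prim (h.+1 + j) u by rewrite addSnnS.
rewrite (T_strand pu') scalerA; congr (_ *: _).
have -> : (h + j.+1)%:Z - j%:Z = h.+1%:Z by lia.
have -> : q ^ (h.+1%:Z * j.+1%:Z) = q ^ (- m) * q ^ (h%:Z * j.+2%:Z).
  by rewrite -qD //; congr (_ ^ _); lia.
by move: (qz h.+1) (q ^ (- m)) (q ^ (_ * _)) => x y z; rewrite exprS; ring.
Qed.

Lemma T_f m v : W m v -> T (f v) = - q ^ (m - 2) *: e (T v).
Proof.
apply: (@strand_ind (fun v => T (f v) = - q ^ (m - 2) *: e (T v)) m) => [|u w hu hw|h j u pu hm].
- by rewrite !linear0 ?scaler0.
- by rewrite !linearD /= hu hw.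
rewrite (T_strand pu) linearZ /= -dpowS // !scalerA.
case: h => [|h] in pu hm *.
  rewrite dpow0 pu.2 (prim_bound H pu) //.
  by rewrite !scaler0 linear0.
have pu' : prim (h + j.+1) u by rewrite addnS -addSn.
rewrite linearZ /= (T_strand pu') (e_prim H _ pu) !scalerA; congr (_ *: _).
have -> : (h.+1 + j)%:Z - h%:Z = j.+1%:Z by lia.
have -> : q ^ (h%:Z * j.+2%:Z) = q ^ (m - 2) * q ^ (h.+1%:Z * j.+1%:Z).
  by rewrite -qD //; congr (_ ^ _); lia.
by move: (qz j.+1) (q ^ (m - 2)) (q ^ (_ * _)) => x y z; rewrite exprS; ring.
Qed.

Lemma T_surj m z : W m z -> exists v, T v = z.
Proof.
apply: (@strand_ind (fun v => exists u, T u = v) m) => [|u w [u' <-] [w' <-]|h j u pu hm].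
- by exists 0; rewrite linear0.
- by exists (u' + w'); rewrite linearD.
rewrite addnC in pu.
exists (((-1) ^+ j * q ^ (j%:Z * h.+1%:Z))^-1 *: dpow f h u).
rewrite linearZ /= (T_strand pu) scalerA mulVf ?scale1r //.
by rewrite mulf_neq0 ?qVz // expf_neq0 // oppr_eq0 oner_neq0.
Qed.

Variables (x : {linear V -> V}) (M : nat).
(** For x commuting with f and lowering weights by M, this is the value on u of the top of the
    string generated by x under the adjoint action, written in divided powers. *)
Definition xtop (u : V) : V :=
  \sum_(r < M.+1) ((-1) ^+ r * q ^ (- r%:Z)) *: dpow e (M - r) (x (dpow e r u)).
Hypothesis xf : forall v, x (f v) = f (x v).
Hypothesis xW : forall m v, W m v -> W (m - M%:Z) (x v).
Hypothesis xe : forall m u, W m u -> e (xtop u) = q ^ M%:Z *: xtop (e u).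
Hypothesis x1 : forall p u, prim p u -> iter M.+1 e (x u) = 0.

Lemma xtop_lin a u v : xtop (a *: u + v) = a *: xtop u + xtop v.
Proof.
rewrite /xtop scaler_sumr -big_split /=; apply: eq_bigr => r _.
by rewrite dpow_lin linearP dpow_lin scalerDr !scalerA mulrC.
Qed.

Lemma xtop0 : xtop 0 = 0.
Proof. by have := xtop_lin (-1) 0 0; rewrite scaler0 addr0 scaleN1r addNr. Qed.

Lemma xtopZ a u : xtop (a *: u) = a *: xtop u.
Proof. by rewrite -[a *: u]addr0 xtop_lin xtop0 addr0. Qed.

(** Both sides are compared string by string in the decomposition of x u, which by [x1] needs at
    most M applications of f. *)
Lemma T_xtop_prim p u : prim p u -> T (x u) = xtop (T u).
Proof.
move=> pu; have xu := xW pu.1.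
have [v [hv ez]] := decomp_bounded xu (x1 pu).
have pu0 : prim (p + 0) u by rewrite addn0.
have := T_strand pu0; rewrite dpow0 => ->; rewrite xtopZ.
have xfD n w : x (dpow f n w) = dpow f n (x w).
  rewrite !dpw.unlock linearZ /=; congr (_ *: _).
  by elim: n => //= n IH; rewrite xf IH.
have step r : x (dpow e r (dpow f p u)) = if (r <= p)%N then dpow f (p - r) (x u) else 0.
  case: leqP => rp; last by rewrite (eD_fD_gt H pu rp) linear0.
  have := @eD_fD _ _ _ H _ u r (p - r) pu; rewrite subnK // => ->//.
  by have -> : (p - (p - r) = r)%N; [lia|rewrite bqnn // scale1r xfD].
rewrite /xtop.
under eq_bigr => r _ do rewrite step.
rewrite ez linear_sum /=.
have -> : \sum_(r < M.+1) ((-1) ^+ r * q ^ (- r%:Z)) *: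
    dpow e (M - r) (if (r <= p)%N then dpow f (p - r) (\sum_(k < M.+1) dpow f k (v k)) else 0)
  = \sum_(k < M.+1) \sum_(r < M.+1) ((-1) ^+ r * q ^ (- r%:Z)) *:
    (if (r <= p)%N then dpow e (M - r) (dpow f (p - r) (dpow f k (v k))) else 0).
  rewrite exchange_big /=; apply: eq_bigr => r _; rewrite -scaler_sumr; congr (_ *: _).
  case: leqP => rp; last by rewrite dpow_0 big1.
  by rewrite !dpow_sum.
rewrite scaler_sumr; apply: eq_bigr => -[k /= kM] _.
case: (hv k) => [->|[l [hl kl wl]]].
  rewrite dpow_0 linear0 big1 ?scaler0 // => r _; rewrite !dpow_0.
  by case: ifP; rewrite scaler0.
have [N' lE] : exists N', l = (N' + k)%N by exists (l - k)%N; lia.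
subst l; rewrite (T_strand hl).
(* rewriting r = M - i turns the sum into a finite q-difference *)
pose c (i : nat) : F := (-1) ^+ (M + i) * q ^ (i%:Z - M%:Z) * bq (N' + i) k * bq k i.
have term (r : nat) : (r <= M)%N -> ((-1) ^+ r * q ^ (- r%:Z)) *:
    (if (r <= p)%N then dpow e (M - r) (dpow f (p - r) (dpow f k (v k))) else 0)
   = c (M - r)%N *: dpow f N' (v k).
  move=> rM; rewrite /c; case: leqP => rp; last first.
    by rewrite (@bq_small _ _ (N' + (M - r))) ?mulr0 ?mul0r ?scale0r ?scaler0 //; lia.
  rewrite dpow_dpow // dpowZ.
  have -> : (p - r + k = N' + (M - r))%N by lia.
  case: (leqP (M - r) k) => le.
    rewrite (eD_fD H hl) ?leq_add2l // addKn !scalerA; congr (_ *: _).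
    have -> : (-1) ^+ (M + (M - r)) = (-1) ^+ r :> F.
      by rewrite -[LHS]signr_odd -[RHS]signr_odd; congr (_ ^+ nat_of_bool _); lia.
    have -> : (M - r)%N%:Z - M%:Z = - r%:Z by lia.
    rewrite -!mulrA; do 3 congr (_ * _).
    have h1 := bqE q (p - r) k; have h2 := bqE q k (p - r).
    have e1 : (N' + (M - r) = p - r + k)%N by lia.
    rewrite e1 h1 addnC h2; rewrite [(k + (p - r))%N]addnC; congr (_ / _).
    by rewrite mulrC.
  by rewrite (prim_bound H hl) ?ltn_add2l // dpow_0 !scaler0 (bq_small q le) mulr0 scale0r.
have -> : \sum_(r < M.+1) ((-1) ^+ r * q ^ (- r%:Z)) *:
    (if (r <= p)%N then dpow e (M - r) (dpow f (p - r) (dpow f k (v k))) else 0) =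
    \sum_(r < M.+1) c (M - r)%N *: dpow f N' (v k).
  by apply: eq_bigr => r _; rewrite term ?leq_ord.
rewrite -scaler_suml scalerA; congr (_ *: _).
rewrite (reindex_inj rev_ord_inj) /=.
under eq_bigr => r _ do rewrite subSS subKn ?leq_ord //.
have -> : \sum_(i < M.+1) c i = \sum_(i < k.+1) c i.
  rewrite (big_ord_widen M.+1 c kM) [RHS]big_mkcond; apply: eq_bigr => i _.
  by case: ltnP => // lt; rewrite /c (@bq_small _ _ k) ?mulr0.
have -> : \sum_(i < k.+1) c i = (-1) ^+ M * q ^ (- M%:Z) * qdiff q k N' k 1.
  rewrite /qdiff mulr_sumr; apply: eq_bigr => i _; rewrite /c.
  by rewrite exprD qD // mulr1; ring.
rewrite qdiff0 //.
have -> : (-1) ^+ p * q ^ (p%:Z * 1) * ((-1) ^+ M * q ^ (- M%:Z) *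
    ((-1) ^+ k * q ^ (k%:Z * N'.+1%:Z))) =
   (-1) ^+ (p + M + k) * (q ^ (p%:Z * 1) * q ^ (- M%:Z) * q ^ (k%:Z * N'.+1%:Z)).
  by rewrite !exprD; ring.
rewrite -!qD //; congr (_ * _ ^ _); last by lia.
have -> : (p + M + k = N' + 2 * M)%N by lia.
by rewrite exprD exprM sqrrN !expr1n mulr1.
Qed.

(** Induction along a string: x commutes with f, T turns f into a multiple of e, and [xe] moves e
    past [xtop]. The powers of q agree because x shifts weights by -M. *)
Lemma T_xtop m v : W m v -> T (x v) = xtop (T v).
Proof.
apply: (@strand_ind (fun v => T (x v) = xtop (T v)) m) => [|u w hu hw|h j u pu hm].
- by rewrite !linear0 xtop0.
- by rewrite !linearD /= hu hw -[in RHS](scale1r (T u)) xtop_lin scale1r.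
elim: j h m pu hm => [|j IH] h m pu hm.
  by rewrite dpow0; apply: (T_xtop_prim (p := h)); rewrite addn0 in pu.
have pu' : prim (h.+1 + j) u by rewrite addSnnS.
have IH' := IH h.+1 (m + 2) pu' ltac:(lia).
apply: (@scalerI _ _ (qz j.+1)); first exact: qzS_neq0.
rewrite -xtopZ -!linearZ /= dpowS // xf.
have Wd : W (m + 2) (dpow f j u) by have := W_fD H j pu'.1; congr (W _ _); lia.
rewrite (T_f (xW Wd)) (T_f Wd) IH' xtopZ.
have WT : W (- (m + 2)) (T (dpow f j u)).
  rewrite (T_strand pu'); apply: (W_Z H).
  by have := W_fD H h.+1 pu'.1; congr (W _ _); lia.
rewrite (xe WT) scalerA; congr (_ *: _).
by rewrite mulNr -qD //; congr (- _ ^ _); lia.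
Qed.

End T.
End Rep3.
End Sl2.

(** Applying A_h minus its eigenvalue on the first vector removes that vector; the inductive
    hypothesis then applies to the others, rescaled by differences of eigenvalues. *)
Lemma eig_indep (F : fieldType) (V : lmodType F) (H : Type) (A : H -> {linear V -> V})
    (T : eqType) (chi : T -> H -> F) (s : seq T) (u : T -> V) :
  uniq s -> (forall l, l \in s -> forall h, A h (u l) = chi l h *: u l) ->
  (forall l l', l \in s -> l' \in s -> l != l' -> exists h, chi l h != chi l' h) ->
  \sum_(l <- s) u l = 0 -> forall l, l \in s -> u l = 0.
Proof.
elim: s u => [|l0 s IH] u //= /andP[l0s us] hA hd.
rewrite big_cons => h0.
have hs l : l \in s -> u l = 0.
  move=> ls; have ls' : l \in l0 :: s by rewrite inE ls orbT.
  have ne : l != l0 by apply: contraNneq l0s => <-.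
  have [h hne] := hd l l0 ls' (mem_head _ _) ne.
  have {IH} := IH (fun l' => (chi l' h - chi l0 h) *: u l') us.
  have hh1 l' : l' \in s -> forall h', A h' ((chi l' h - chi l0 h) *: u l') =
      chi l' h' *: ((chi l' h - chi l0 h) *: u l').
    by move=> l's h'; rewrite linearZ /= hA ?inE ?l's ?orbT // !scalerA mulrC.
  move=> /(_ hh1) {hh1}.
  have hh2 l1 l2 : l1 \in s -> l2 \in s -> l1 != l2 -> exists h', chi l1 h' != chi l2 h'.
    by move=> h1 h2; apply: hd; rewrite inE ?h1 ?h2 orbT.
  move=> /(_ hh2) {hh2}.
  have hh3 : \sum_(l' <- s) (chi l' h - chi l0 h) *: u l' = 0.
    have e1 : A h (u l0 + \sum_(l' <- s) u l') - chi l0 h *: (u l0 + \sum_(l' <- s) u l') = 0.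
      by rewrite h0 linear0 scaler0 subrr.
    rewrite -[RHS]e1 linearD /= hA ?mem_head // scalerDr opprD addrACA subrr add0r.
    rewrite linear_sum scaler_sumr -sumrB !big_seq; apply: eq_bigr => l' l's.
    by rewrite scalerBl hA // inE l's orbT.
  move=> /(_ hh3 l ls) /eqP; rewrite scaler_eq0 subr_eq0 (negPf hne) => /eqP //.
move=> l; rewrite inE => /orP[/eqP ->|/hs //].
by move: h0; rewrite big_seq big1 ?addr0 // => l' /hs.
Qed.

Lemma scMl (R : fieldType) n (a : R) (x y : 'M[R]_n) : (a *: x) * y = a *: (x * y).
Proof. exact/esym/scalemxAl. Qed.
Lemma scMr (R : fieldType) n (a : R) (x y : 'M[R]_n) : x * (a *: y) = a *: (x * y).
Proof. exact/esym/scalemxAr. Qed.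

(** * Weight representations *)

Section MatrixVectors.
Variables (L : fieldType) (n : nat).
Lemma mulMV (A B : 'M[L]_n) (v : 'cV[L]_n) : (A * B) *m v = A *m (B *m v).
Proof. by rewrite mulmxA. Qed.

Lemma mx_vec_eq (A B : 'M[L]_n) : (forall v : 'cV[L]_n, A *m v = B *m v) -> A = B.
Proof.
move=> h; apply/matrixP => a b; have := h (delta_mx b 0).
by rewrite -!colE => /matrixP/(_ a 0); rewrite !mxE.
Qed.

End MatrixVectors.

Section QPow.
Variables (K : fieldType) (D : cartanDatum).
Local Notation k := (kfield K).
Local Notation I := 'I_(rk D).
Local Notation hdual := 'cV[rat]_(rk D).
Local Notation coroots := 'cV[int]_(rk D).

Lemma kt_pow_neq1 n : kt K ^+ n.+1 != 1.
Proof.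
have e : kt K ^+ n.+1 - 1 = kemb K ('X^(n.+1) - 1) by rewrite rmorphB rmorph1 rmorphXn.
rewrite -subr_eq0 e; apply/eqP => /kemb_inj/eqP.
by rewrite -size_poly_eq0 size_XnsubC.
Qed.

Lemma ktz_eq1 (m : int) : kt K ^ m = 1 -> m = 0.
Proof.
case: m => [[|n]|n] //.
  by move=> h; have := kt_pow_neq1 n; rewrite -[kt K ^+ _]/(kt K ^ n.+1) h eqxx.
rewrite NegzE => h; have := kt_pow_neq1 n; rewrite -[kt K ^+ _]/(kt K ^ n.+1).
by move: h; rewrite -invr_expz => /(congr1 GRing.inv); rewrite invrK invr1 => ->; rewrite eqxx.
Qed.

(** Positivity of the form is given on integral vectors; clearing denominators extends it to
    rational ones. *)
Lemma clear_denom (l : hdual) : exists2 N : nat, (0 < N)%N &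
  exists z : coroots, N%:R *: l = Qint z.
Proof.
pose N := (\prod_(i : I) absz (denq (l i ord0)))%N.
have N0 : (0 < N)%N by apply: prodn_gt0 => i; rewrite absz_gt0 denq_neq0.
exists N => //.
exists (\col_i (numq (l i 0) * (\prod_(j | j != i) absz (denq (l j ord0)))%N%:Z)).
apply/matrixP => i j; rewrite !mxE ord1 rmorphM /= /N (bigD1 i) //= natrM numqE.
have -> : (absz (denq (l i ord0)))%:R = (denq (l i ord0))%:~R :> rat.
  by rewrite -[in RHS](gez0_abs (ltW (denq_gt0 _))).
by rewrite -[(\prod_(_ | _) _)%N%:~R]/(_%:R); ring.
Qed.

Lemma form_pos (l : hdual) : l != 0 -> 0 < form l l.
Proof.
move=> l0; have [N N0 [z ez]] := clear_denom l.
have Nr : (N%:R : rat) != 0 by rewrite pnatr_eq0 -lt0n.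
have z0 : z != 0.
  apply: contraNneq l0 => z0; have : N%:R *: l = 0 by rewrite ez z0 /Qint map_mx0.
  by move/eqP; rewrite scaler_eq0 (negPf Nr).
have [_ _ _ _ /(_ z z0) hp] := cartanP D.
have e : form (Qint z) (Qint z) =
   (\sum_i \sum_j z i 0 * ((eps D i)%:Z * car D i j) * z j 0)%:~R.
  rewrite rmorph_sum; apply: eq_bigr => i _; rewrite rmorph_sum; apply: eq_bigr => j _.
  by rewrite !mxE !rmorphM.
have e2 : form (N%:R *: l) (N%:R *: l) = N%:R ^+ 2 * form l l.
  rewrite /form mulr_sumr; apply: eq_bigr => i _; rewrite mulr_sumr; apply: eq_bigr => j _.
  by rewrite !mxE; ring.
have : 0 < form (N%:R *: l) (N%:R *: l) by rewrite ez e ltr0z.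
by rewrite e2 pmulr_rgt0 // exprn_gt0 // ltr0n.
Qed.

Lemma formE (l m : hdual) : form l m = \sum_i l i 0 * (eps D i)%:R * pairing m i.
Proof.
apply: eq_bigr => i _; rewrite /pairing mulr_sumr; apply: eq_bigr => j _.
by rewrite !mulrA.
Qed.

(** A vector in the kernel of the Cartan matrix would be isotropic for a positive definite form. *)
Lemma ddet_gt0 : (0 < ddet D)%N.
Proof.
rewrite /ddet absz_gt0; apply/negP => /eqP d0.
pose A : 'M[rat]_(rk D) := map_mx intr (car D).
have : \det A^T == 0 by rewrite det_tr /A det_map_mx d0 rmorph0.
move/det0P => [v v0 hv].
have l0 : v^T != 0 by rewrite -[0]trmx0 (inj_eq (can_inj (@trmxK _ _ _))).
have := form_pos l0; rewrite formE big1 ?ltxx // => i _.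
have -> : pairing v^T i = (v *m A^T) 0 i.
  by rewrite mxE; apply: eq_bigr => j _; rewrite !mxE mulrC.
by rewrite hv [X in _ * X]mxE mulr0.
Qed.

Lemma ddet_neq0 : ((ddet D)%:R : rat) != 0.
Proof. by rewrite pnatr_eq0 -lt0n ddet_gt0. Qed.

(** Exponents in (1/d)Z. [qpow] takes the numerator of r d, so it turns sums into products only when
    r d is an integer. *)
Definition qok (r : rat) := (r * (ddet D)%:R) \is a Num.int.

Lemma qok_int (m : int) : qok m%:~R.
Proof. by rewrite /qok rpredM ?intr_int ?natr_int. Qed.

Lemma qok_Num r : r \is a Num.int -> qok r.
Proof. by move=> /intrP[m ->]; apply: qok_int. Qed.

Lemma qokD r s : qok r -> qok s -> qok (r + s).
Proof. by rewrite /qok mulrDl; apply: rpredD. Qed.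

Lemma qokN r : qok r -> qok (- r).
Proof. by rewrite /qok mulNr rpredN. Qed.

Lemma qpowD r s : qok r -> qok s -> qpow K D (r + s) = qpow K D r * qpow K D s.
Proof.
rewrite /qok /qpow mulrDl => /intrP[a ->] /intrP[b ->].
by rewrite -rmorphD /= !numq_int expfzDr // kt_neq0.
Qed.

Lemma qpow0 : qpow K D 0 = 1.
Proof. by rewrite /qpow mul0r (numq_int 0). Qed.

Lemma qpow_neq0 r : qpow K D r != 0.
Proof. by rewrite /qpow expfz_neq0 // kt_neq0. Qed.

Lemma qpowN r : qok r -> qpow K D (- r) = (qpow K D r)^-1.
Proof.
move=> h; apply: (mulfI (qpow_neq0 r)); rewrite -qpowD ?qokN //.
by rewrite subrr qpow0 divff // qpow_neq0.
Qed.

Lemma qpow_inj r s : qok r -> qok s -> qpow K D r = qpow K D s -> r = s.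
Proof.
rewrite /qok /qpow => hr hs; move: (hr) (hs) => /intrP[a ea] /intrP[b eb].
rewrite ea eb !numq_int => h; have h1 : kt K ^ (a - b) = 1.
  by rewrite expfzDr ?kt_neq0 // h -expfzDr ?kt_neq0 // subrr expr0z.
apply: (mulIf ddet_neq0); rewrite ea eb; congr (_%:~R).
by move/ktz_eq1/eqP: h1; rewrite subr_eq0 => /eqP.
Qed.

Lemma qpowX (r : rat) (m : int) : qok r -> qpow K D r ^ m = qpow K D (m%:~R * r).
Proof.
rewrite /qok /qpow -mulrA => /intrP[a ->].
by rewrite -rmorphM /= !numq_int exprz_exp mulrC.
Qed.

Lemma kbar_qpow r : kbar K (qpow K D r) = (qpow K D r)^-1.
Proof.
have h n : kbar K (kt K ^+ n) = (kt K ^+ n)^-1 by rewrite rmorphXn /= kbar_t exprVn.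
rewrite /qpow; case: (numq _) => n; first exact: h.
by rewrite NegzE -exprnN fmorphV /= h.
Qed.

Lemma eps_gt0 (i : I) : (0 < eps D i)%N.
Proof. by have [_ _ [h _] _ _] := cartanP D. Qed.

Lemma car_ii (i : I) : car D i i = 2.
Proof. by have [h _ _ _ _] := cartanP D. Qed.

Lemma car_sym (i j : I) : (eps D i)%:Z * car D i j = (eps D j)%:Z * car D j i.
Proof. by have [_ _ _ h _] := cartanP D. Qed.

Lemma car_le0 (i j : I) : i != j -> car D i j <= 0.
Proof. by have [_ h _ _ _] := cartanP D => /h[]. Qed.

Lemma qi_neq0 (i : I) : qi K i != 0.
Proof. exact: qpow_neq0. Qed.

Lemma qiX (i : I) (m : int) : qi K i ^ m = qpow K D ((eps D i)%:R * m%:~R).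
Proof. by rewrite /qi qpowX; [rewrite mulrC|apply/qok_Num/natr_int]. Qed.

Lemma qi_pow (i : I) n : qi K i ^+ n.+1 != 1.
Proof.
rewrite -[_ ^+ _]/(qi K i ^ n.+1) qiX; apply/eqP; rewrite -qpow0.
move/qpow_inj; rewrite -[(eps D i)%:R]/((eps D i)%:~R) -rmorphM qok_int.
rewrite -[0]/(0%:~R) qok_int => /(_ isT isT) /eqP.
by rewrite /= intr_eq0 mulf_eq0 => /orP[] /eqP; have := eps_gt0 i; lia.
Qed.

Lemma alphaE (i j : I) : alpha i j 0 = (j == i)%:R.
Proof. by rewrite mxE eqxx andbT. Qed.

Lemma pairing_alpha (i j : I) : pairing (alpha j) i = (car D i j)%:~R.
Proof.
rewrite /pairing (bigD1 j) //= alphaE eqxx mulr1 big1 ?addr0 // => l lj.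
by rewrite alphaE (negPf lj) mulr0.
Qed.

Lemma pairing_lin i a (l m : hdual) : pairing (a *: l + m) i = a * pairing l i + pairing m i.
Proof.
rewrite /pairing mulr_sumr -big_split /=; apply: eq_bigr => j _.
by rewrite !mxE; ring.
Qed.

Lemma pairingD i (l m : hdual) : pairing (l + m) i = pairing l i + pairing m i.
Proof. by rewrite -[l in LHS]scale1r pairing_lin mul1r. Qed.

Lemma pairing0 i : pairing (0 : hdual) i = 0.
Proof. by rewrite /pairing big1 // => j _; rewrite mxE mulr0. Qed.

Lemma pairingZ i a (l : hdual) : pairing (a *: l) i = a * pairing l i.
Proof. by rewrite -[a *: l]addr0 pairing_lin pairing0 addr0. Qed.

Lemma pairingN i (l : hdual) : pairing (- l) i = - pairing l i.
Proof. by rewrite -scaleN1r pairingZ mulN1r. Qed.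

Lemma pairing_inj (l m : hdual) : (forall i, pairing l i = pairing m i) -> l = m.
Proof.
move=> h; apply/eqP; rewrite -subr_eq0; apply: contraT => /form_pos.
by rewrite formE big1 ?ltxx // => i _; rewrite pairingD pairingN h subrr mulr0.
Qed.

Lemma weight_atD (l m : hdual) h : weight_at (l + m) h = weight_at l h + weight_at m h.
Proof.
by rewrite /weight_at -big_split /=; apply: eq_bigr => i _; rewrite pairingD mulrDr.
Qed.

Lemma weight_atZ a (l : hdual) h : weight_at (a *: l) h = a * weight_at l h.
Proof. by rewrite /weight_at mulr_sumr; apply: eq_bigr => i _; rewrite pairingZ mulrCA. Qed.

Lemma weight_atN (l : hdual) h : weight_at (- l) h = - weight_at l h.
Proof. by rewrite -scaleN1r weight_atZ mulN1r. Qed.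

Lemma weight_at0 h : weight_at (0 : hdual) h = 0.
Proof. by rewrite -(scale0r (0 : hdual)) weight_atZ mul0r. Qed.

Lemma weight_atDr (l : hdual) h h' : weight_at l (h + h') = weight_at l h + weight_at l h'.
Proof.
by rewrite /weight_at -big_split /=; apply: eq_bigr => i _; rewrite mxE rmorphD mulrDl.
Qed.

Lemma weight_atNr (l : hdual) h : weight_at l (- h) = - weight_at l h.
Proof.
by rewrite /weight_at -sumrN; apply: eq_bigr => i _; rewrite mxE rmorphN mulNr.
Qed.

Lemma weight_at_coroot (l m : hdual) (mu : coroots) :
  m = Qint mu -> weight_at l (coroot_of mu) = form m l.
Proof.
by move=> ->; rewrite formE; apply: eq_bigr => i _; rewrite !mxE rmorphM.
Qed.

Lemma Qint_delta i : Qint (delta_mx i 0) = alpha i :> hdual.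
Proof. by apply/matrixP => a b; rewrite !mxE; case: (_ && _). Qed.

Lemma form_alpha i (l : hdual) : form (alpha i) l = (eps D i)%:R * pairing l i.
Proof.
rewrite formE (bigD1 i) //= alphaE eqxx mul1r big1 ?addr0 // => j ji.
by rewrite alphaE (negPf ji) !mul0r.
Qed.

Lemma weight_at_Ki (l : hdual) i :
  weight_at l (coroot_of (delta_mx i 0)) = (eps D i)%:R * pairing l i.
Proof. by rewrite (weight_at_coroot l (esym (Qint_delta i))) form_alpha. Qed.

Lemma Plat_wt (l : hdual) h : Plat l -> weight_at l h \is a Num.int.
Proof. by move=> hl; apply: rpred_sum => i _; rewrite rpredM ?intr_int //; apply: hl. Qed.

Lemma Plat_ok (l : hdual) h : Plat l -> qok (weight_at l h).
Proof. by move=> hl; apply/qok_Num/Plat_wt. Qed.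

Lemma PlatD (l m : hdual) : Plat l -> Plat m -> Plat (l + m).
Proof. by move=> hl hm i; rewrite pairingD rpredD // ?hl ?hm. Qed.

Lemma PlatN (l : hdual) : Plat l -> Plat (- l).
Proof. by move=> hl i; rewrite pairingN rpredN hl. Qed.

Lemma Plat_alpha i : Plat (alpha i : hdual).
Proof. by move=> j; rewrite pairing_alpha intr_int. Qed.

Lemma Plat0 : Plat (0 : hdual).
Proof. by move=> j; rewrite pairing0 rpred0. Qed.

Lemma PlatMn (l : hdual) n : Plat l -> Plat (l *+ n).
Proof.
by move=> hl; elim: n => [|n IH]; rewrite ?mulr0n; [apply: Plat0|rewrite mulrS; apply: PlatD].
Qed.

Lemma Plat_Qint mu : Plat (Qint mu : hdual).
Proof. by move=> i; apply: rpred_sum => j _; rewrite mxE rpredM ?intr_int. Qed.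

Lemma Plat_Qnat mu : Plat (Qnat mu : hdual).
Proof. by move=> i; apply: rpred_sum => j _; rewrite mxE rpredM ?intr_int ?natr_int. Qed.

(** Since q is not a root of unity, the K_i already separate weights. *)
Lemma Plat_sep (l m : hdual) : Plat l -> Plat m -> l != m ->
  exists h, qpow K D (weight_at l h) != qpow K D (weight_at m h).
Proof.
move=> hl hm ne; apply: contrapT => hn; case/eqP: ne; apply: pairing_inj => i.
have := @qpow_inj _ _ (Plat_ok (coroot_of (delta_mx i 0)) hl) (Plat_ok (coroot_of (delta_mx i 0)) hm).
rewrite !weight_at_Ki => h; apply: (@mulfI _ (eps D i)%:R).
  by rewrite pnatr_eq0 -lt0n eps_gt0.
apply: h; apply/eqP; apply: contraT => ne.
by case: hn; exists (coroot_of (delta_mx i 0)); rewrite !weight_at_Ki.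
Qed.

End QPow.

Section WeightRep.
Variables (K : fieldType) (D : cartanDatum) (L : fieldExtType (kfield K)).
Local Notation k := (kfield K).
Local Notation I := 'I_(rk D).
Local Notation hdual := 'cV[rat]_(rk D).
Local Notation coroots := 'cV[int]_(rk D).
Local Notation Qplus := 'cV[nat]_(rk D).

Definition qL (i : I) : L := (qi K i)%:A.

Lemma algM (a b : k) : (a * b)%:A = a%:A * b%:A :> L.
Proof. by rewrite -in_algE rmorphM. Qed.

Lemma algX (a : k) (m : int) : (a ^ m)%:A = a%:A ^ m :> L.
Proof.
case: m => n; first by rewrite -in_algE rmorphXn.
by rewrite NegzE -!exprnN -in_algE fmorphV rmorphXn.
Qed.

Lemma algV (a : k) : (a^-1)%:A = (a%:A)^-1 :> L.
Proof. by rewrite -in_algE fmorphV. Qed.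

Lemma alg_inj : injective (fun a : k => a%:A : L).
Proof. exact: (fmorph_inj (in_alg L)). Qed.

Lemma alg_neq0 (a : k) : a != 0 -> a%:A != 0 :> L.
Proof. by move=> a0; rewrite -in_algE fmorph_eq0. Qed.

Lemma qL_neq0 i : qL i != 0.
Proof. by apply: alg_neq0; apply: qi_neq0. Qed.

Lemma qL_pow i n : qL i ^+ n.+1 != 1.
Proof.
rewrite -[_ ^+ _]/(qL i ^ n.+1) -algX; apply: contra (qi_pow K i n) => /eqP h.
by apply/eqP; apply: alg_inj; rewrite /= scale1r.
Qed.

Lemma qLX i (m : int) : qL i ^ m = (qpow K D ((eps D i)%:R * m%:~R))%:A.
Proof. by rewrite -qiX algX. Qed.

Definition wt (n : nat) (Kh : coroots -> 'M[L]_n) (l : hdual) (v : 'cV[L]_n) : Prop :=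
  forall h, Kh h *m v = (qpow K D (weight_at l h))%:A *: v.

(* Weight representations; the Serre relations are omitted because they hold automatically. *)
Record wrep (n : nat) (E F : I -> 'M[L]_n) (Kh : coroots -> 'M[L]_n) : Prop := WRep {
  wr0 : Kh 0 = 1;
  wrD : forall h h', Kh (h + h') = Kh h * Kh h';
  wrE : forall h i, Kh h * E i = (qpow K D (weight_at (alpha i) h))%:A *: (E i * Kh h);
  wrF : forall h i, Kh h * F i = (qpow K D (- weight_at (alpha i) h))%:A *: (F i * Kh h);
  wrEF : forall i j, E i * F j - F j * E i = if i == j then
     (qi K i - (qi K i)^-1)^-1%:A *: (Kh (coroot_of (delta_mx i 0)) - Kh (- coroot_of (delta_mx i 0))) else 0;
  wr_dec : forall v : 'cV[L]_n, exists2 s : seq 'cV[L]_n,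
    (forall w, w \in s -> exists2 l, Plat l & wt Kh l w) & v = \sum_(w <- s) w }.

Section Torus.
Variables (n : nat) (Kh : coroots -> 'M[L]_n).

Lemma wt0 l : wt Kh l 0.
Proof. by move=> h; rewrite mulmx0 scaler0. Qed.

Lemma wt_lin l a u v : wt Kh l u -> wt Kh l v -> wt Kh l (a *: u + v).
Proof.
move=> hu hv h; rewrite mulmxDr -scalemxAr hu hv scalerDr !scalerA.
by congr (_ + _); rewrite mulrC.
Qed.

Lemma wtD l u v : wt Kh l u -> wt Kh l v -> wt Kh l (u + v).
Proof. by rewrite -{2}[u]scale1r; apply: wt_lin. Qed.

Lemma wtZ l a u : wt Kh l u -> wt Kh l (a *: u).
Proof. by move=> h; rewrite -[_ *: _]addr0; apply: wt_lin => //; apply: wt0. Qed.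

Lemma wt_sum l (J : Type) (r : seq J) (P : pred J) (g : J -> 'cV[L]_n) :
  (forall j, P j -> wt Kh l (g j)) -> wt Kh l (\sum_(j <- r | P j) g j).
Proof. by move=> h; apply: (big_ind (wt Kh l)) => //; [apply: wt0|apply: wtD]. Qed.

Hypothesis dec : forall v : 'cV[L]_n, exists2 s : seq 'cV[L]_n,
    (forall w, w \in s -> exists2 l, Plat l & wt Kh l w) & v = \sum_(w <- s) w.

Lemma wt_indep (s : seq hdual) (u : hdual -> 'cV[L]_n) :
  uniq s -> (forall l, l \in s -> Plat l) -> (forall l, l \in s -> wt Kh l (u l)) ->
  \sum_(l <- s) u l = 0 -> forall l, l \in s -> u l = 0.
Proof.
move=> us hs hu; apply: (eig_indep (A := fun h => mulmx (Kh h))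
  (chi := fun l h => (qpow K D (weight_at l h))%:A)) => //.
move=> l l' ls ls' ne; have [h hne] := Plat_sep K (hs _ ls) (hs _ ls') ne.
by exists h; apply: contra hne => /eqP/alg_inj/eqP.
Qed.

Lemma dec_pairs (v : 'cV[L]_n) : exists r : seq (hdual * 'cV[L]_n),
  (forall p, p \in r -> Plat p.1 /\ wt Kh p.1 p.2) /\ v = \sum_(p <- r) p.2.
Proof.
have [s hs ->] := dec v; elim: s hs => [|w s IH] hs.
  by exists [::]; split=> //; rewrite !big_nil.
have [l hl hw] := hs w (mem_head _ _).
have [|r [hr er]] := IH; first by move=> w' h; apply: hs; rewrite inE h orbT.
exists ((l, w) :: r); split; last by rewrite !big_cons er.
by move=> p; rewrite inE => /orP[/eqP ->//|]; apply: hr.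
Qed.

(** A decomposition into weight vectors is chosen for each basis vector; its pieces of weight l
    become the columns of the projector [P l]. *)
Lemma wproj_ex : exists s : seq hdual, exists P : hdual -> 'M[L]_n,
  [/\ uniq s, forall l, l \in s -> Plat l, forall l v, wt Kh l (P l *m v),
      \sum_(l <- s) P l = 1 & forall l, l \notin s -> P l = 0].
Proof.
have [r hr] := choice (fun j : 'I_n => dec_pairs (delta_mx j 0)).
pose s := undup (flatten [seq [seq p.1 | p <- r j] | j <- enum 'I_n]).
have hs j p : p \in r j -> p.1 \in s.
  move=> pr; rewrite mem_undup; apply/flattenP; exists [seq p.1 | p <- r j].
    by apply/mapP; exists j => //; rewrite mem_enum.
  by apply/mapP; exists p.
pose c l j : 'cV[L]_n := \sum_(p <- r j | p.1 == l) p.2.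
pose P l : 'M[L]_n := \sum_j c l j *m delta_mx 0 j.
have cw l j : wt Kh l (c l j).
  rewrite /c big_seq_cond; apply: wt_sum => p /andP[pr /eqP <-].
  exact: ((hr j).1 p pr).2.
have Pv l v : P l *m v = \sum_j v j 0 *: c l j.
  rewrite mulmx_suml; apply: eq_bigr => j _; rewrite -mulmxA -rowE.
  apply/matrixP => a b; rewrite !mxE big_ord1 !mxE mulrC ord1 //.
exists s, P; split.
- exact: undup_uniq.
- move=> l; rewrite mem_undup => /flattenP[t /mapP[j _ ->] /mapP[p pr ->]].
  exact: ((hr j).1 p pr).1.
- by move=> l v; rewrite Pv; apply: wt_sum => j _; apply: wtZ.
- apply/matrixP => a b.
  have -> : (\sum_(l <- s) P l) a b = (\sum_(l <- s) P l *m (delta_mx b 0 : 'cV_n)) a 0.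
    by rewrite -mulmx_suml -colE mxE.
  suff -> : \sum_(l <- s) P l *m (delta_mx b 0 : 'cV_n) = delta_mx b 0 by rewrite !mxE eqxx andbT.
  have Pb l : P l *m (delta_mx b 0 : 'cV_n) = c l b.
    rewrite Pv (bigD1 b) //= mxE !eqxx scale1r big1 ?addr0 // => j jb.
    by rewrite mxE (negPf jb) scale0r.
  under eq_bigr => l _ do rewrite Pb /c big_mkcond /=.
  rewrite exchange_big /= [RHS](hr b).2 big_seq [RHS]big_seq; apply: eq_bigr => p pr.
  rewrite -big_mkcond /=; under eq_bigl => l do rewrite eq_sym.
  by rewrite -big_filter filter_pred1_uniq ?undup_uniq ?big_seq1 //; apply: hs pr.
move=> l ls; rewrite /P big1 // => j _; rewrite /c big_seq_cond big1 ?mul0mx // => p.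
by case/andP=> /hs ps /eqP e; rewrite e (negPf ls) in ps.
Qed.

Lemma wproj_wt s P : uniq s -> (forall l, l \in s -> Plat l) ->
  (forall l v, wt Kh l (P l *m v)) -> \sum_(l <- s) P l = 1 ->
  (forall l, l \notin s -> P l = 0) ->
  forall l l' v, Plat l' -> wt Kh l' v -> P l *m v = if l == l' then v else 0.
Proof.
move=> us hs hP h1 h0 l l' v hl' hv.
(* The difference between two weight decompositions of v: the one given by the projectors, and v
   placed in degree l'. *)
pose u m := (if m == l' then P m *m v - v else P m *m v).
have sv : \sum_(m <- s) P m *m v = v by rewrite -mulmx_suml h1 mul1mx.
have hu m : wt Kh m (u m).
  rewrite /u; case: eqP => [->|_]; last exact: hP.
  by rewrite addrC -scaleN1r; apply: wt_lin.
have key : forall m, m \in undup (l' :: s) -> u m = 0.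
  apply: wt_indep => //; first exact: undup_uniq.
    by move=> m; rewrite mem_undup inE => /orP[/eqP ->|/hs].
  have hs' : \sum_(m <- s | m != l') P m *m v + P l' *m v = v.
    case: (boolP (l' \in s)) => l's; first by rewrite -[RHS]sv (bigD1_seq l') //= addrC.
    rewrite (h0 _ l's) mul0mx addr0 -[RHS]sv big_seq_cond [RHS]big_seq; apply: eq_bigl => m.
    by case: (boolP (m \in s)) => // ms; apply: contraNneq l's => <-.
  have -> : \sum_(m <- undup (l' :: s)) u m = u l' + \sum_(m <- s | m != l') u m.
    rewrite /=; case: (boolP (l' \in s)) => l's; rewrite ?undup_id //.
      by rewrite (bigD1_seq l').
    rewrite big_cons; congr (_ + _); rewrite big_seq [RHS]big_seq_cond; apply: eq_bigl => m.
    by case: (boolP (m \in s)) => // ms; apply/esym; apply: contraNneq l's => <-.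
  rewrite /u eqxx addrAC addrC.
  have -> : \sum_(i <- s | i != l') (if i == l' then P i *m v - v else P i *m v) =
      \sum_(m <- s | m != l') P m *m v.
    by apply: eq_bigr => m /negPf ->.
  by rewrite [X in - v + X]addrC hs' addNr.
case: (boolP (l \in undup (l' :: s))) => ls; last first.
  move: ls; rewrite mem_undup inE negb_or => /andP[/negPf -> ls].
  by rewrite h0 // mul0mx.
have := key l ls; rewrite /u; case: eqP => // _ /eqP; rewrite subr_eq0 => /eqP //.
Qed.

End Torus.

Section OpWeights.
Variables (n : nat) (Kh : coroots -> 'M[L]_n).

Definition opwt (th : hdual) (x : 'M[L]_n) : Prop :=
  forall h, Kh h * x = (qpow K D (weight_at th h))%:A *: (x * Kh h).

Lemma opwt_lin th a x y : opwt th x -> opwt th y -> opwt th (a *: x + y).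
Proof.
move=> hx hy h; rewrite mulrDr mulrDl scalerDr scMr scMl hx hy !scalerA.
by rewrite mulrC.
Qed.

Lemma opwt0 th : opwt th 0.
Proof. by move=> h; rewrite mulr0 mul0r scaler0. Qed.

Lemma opwtD th x y : opwt th x -> opwt th y -> opwt th (x + y).
Proof. by rewrite -{2}[x]scale1r; apply: opwt_lin. Qed.

Lemma opwtZ th a x : opwt th x -> opwt th (a *: x).
Proof. by move=> h; rewrite -[_ *: _]addr0; apply: opwt_lin => //; apply: opwt0. Qed.

Lemma opwtN th x : opwt th x -> opwt th (- x).
Proof. by rewrite -scaleN1r; apply: opwtZ. Qed.

Lemma opwtM th th' x y : Plat th -> Plat th' -> opwt th x -> opwt th' y ->
  opwt (th + th') (x * y).
Proof.
move=> pt pt' hx hy h; rewrite mulrA hx scMl -[x * Kh h * y]mulrA hy scMr scalerA.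
by rewrite -algM weight_atD qpowD ?Plat_ok // mulrA.
Qed.

Lemma opwt1 : opwt 0 1.
Proof. by move=> h; rewrite mulr1 mul1r weight_at0 qpow0 !scale1r. Qed.

Lemma opwtX th x m : Plat th -> opwt th x -> opwt (th *+ m) (x ^+ m).
Proof.
move=> pt hx; elim: m => [|m IH]; first exact: opwt1.
by rewrite mulrS exprS; apply: opwtM => //; apply: PlatMn.
Qed.

Lemma opwt_wt th l x v : Plat th -> Plat l -> opwt th x -> wt Kh l v -> wt Kh (l + th) (x *m v).
Proof.
move=> pt pl hx hv h; rewrite -mulMV hx -scalemxAl mulMV hv -scalemxAr scalerA.
by rewrite -algM addrC weight_atD qpowD ?Plat_ok.
Qed.

Hypothesis dec : forall v : 'cV[L]_n, exists2 s : seq 'cV[L]_n,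
    (forall w, w \in s -> exists2 l, Plat l & wt Kh l w) & v = \sum_(w <- s) w.

Lemma mx_wt_eq (A B : 'M[L]_n) :
  (forall l v, Plat l -> wt Kh l v -> A *m v = B *m v) -> A = B.
Proof.
move=> h; apply: mx_vec_eq => v; have [s hs ->] := dec v.
rewrite !mulmx_sumr !big_seq; apply: eq_bigr => w ws.
by have [l pl wl] := hs w ws; apply: h wl.
Qed.

(** Such an operator shifts weights by th, and only finitely many weights occur; it is zero once a
    coordinate of th exceeds all their differences. Nilpotency of E_i and F_i and finiteness of the
    graded sums rest on this. *)
Lemma opwt_big : exists N : nat, forall th x, Plat th -> opwt th x ->
  forall i, N%:R <= `|th i 0| -> x = 0.
Proof.
have [s [P [us hs hP h1 h0]]] := wproj_ex dec.
have [B hB] : exists B : nat, forall l i, l \in s -> `|(l : hdual) i 0| < B%:R.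
  elim: (s) => [|l s' [B hB]]; first by exists 0%N.
  pose B' := \max_(i : I) (Num.bound (l i ord0 : rat)).
  exists (maxn B' B) => l' i; rewrite inE => /orP[/eqP ->|l's].
    apply: lt_le_trans (archi_boundP (normr_ge0 _)) _; rewrite ler_nat leq_max.
    apply/orP; left; rewrite /B'.
    have -> : Num.bound `|l i 0| = Num.bound (l i 0) by rewrite /Num.bound normr_id.
    exact: leq_bigmax.
  by apply: lt_le_trans (hB _ _ l's) _; rewrite ler_nat leq_maxr.
exists (B + B)%N => th x pt hx i hi; apply: mx_vec_eq => v; rewrite mul0mx.
have h1' : 1%:M = \sum_(l <- s) P l :> 'M[L]_n by rewrite h1.
rewrite -[v]mul1mx h1' mulmx_suml mulmx_sumr big_seq big1 // => l ls.
have pl := hs l ls; have hw := opwt_wt pt pl hx (hP l v).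
rewrite -[LHS]mul1mx h1' mulmx_suml big_seq big1 // => l' l's.
rewrite (wproj_wt us hs hP h1 h0 l' (PlatD pl pt) hw).
case: eqP => // e; have := hB l' i l's; have := hB l i ls.
rewrite e mxE => b1 b2.
have : `|th i 0| < (B + B)%:R.
  rewrite -[th i 0](addKr (l i 0)) natrD; apply: le_lt_trans (ler_normD _ _) _.
  by rewrite normrN ltrD.
by rewrite ltNge hi.
Qed.

End OpWeights.

End WeightRep.

Ltac mxring := apply/matrixP => ? ?; rewrite !mxE; ring.

(** * The adjoint action *)

(** The adjoint action x |-> sum u_(1) x S(u_(2)) for u = E and, in the next definition, for u = F,
    with the coproduct of U_q(g). *)
Definition adl (R : fieldType) (n : nat) (E K Kv : 'M[R]_n) (x : 'M[R]_n) : 'M[R]_n :=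
  E * x - K * x * Kv * E.
Definition adr (R : fieldType) (n : nat) (F K : 'M[R]_n) (x : 'M[R]_n) : 'M[R]_n :=
  (F * x - x * F) * K.

Section AdLinear.
Variables (R : fieldType) (n : nat) (E F K Kv : 'M[R]_n).
Lemma adl_linear : linear (adl E K Kv).
Proof.
move=> a x y; rewrite /adl !mulrDr !mulrDl scMr scMr !scMl scalerBr opprD addrACA //.
Qed.
HB.instance Definition _ := GRing.isLinear.Build R 'M[R]_n 'M[R]_n *:%R (adl E K Kv) adl_linear.
Lemma adr_linear : linear (adr F K).
Proof.
move=> a x y; rewrite /adr !mulrBl !mulrDr !mulrDl !scMr !scMl scalerBr opprD addrACA //.
Qed.
HB.instance Definition _ := GRing.isLinear.Build R 'M[R]_n 'M[R]_n *:%R (adr F K) adr_linear.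
End AdLinear.

Section AdSl2.
Variables (R : fieldType) (q : R) (n : nat) (E F K Kv : 'M[R]_n).
Hypothesis qX : forall m, q ^+ m.+1 != 1.
Hypothesis q0 : q != 0.
Hypothesis KKv : K * Kv = 1.
Hypothesis KvK : Kv * K = 1.
Hypothesis KE : K * E = q ^ 2 *: (E * K).
Hypothesis KF : K * F = q ^ (-2) *: (F * K).
Hypothesis EF : E * F - F * E = (q - q^-1)^-1 *: (K - Kv).
Variable N : nat.
Hypothesis EN : E ^+ N = 0.
Hypothesis FN : F ^+ N = 0.

Definition Wad (m : int) (x : 'M[R]_n) : Prop := K * x = q ^ m *: (x * K).
Definition Wvec (m : int) (v : 'cV[R]_n) : Prop := K *m v = q ^ m *: v.

Lemma iter_mul (A : 'M[R]_n) m (v : 'cV[R]_n) : iter m (mulmx A) v = A ^+ m *m v.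
Proof. by elim: m => [|m IH]; rewrite ?expr0 ?mul1mx // iterS IH exprS mulMV. Qed.

Lemma Wvec_Kv m v : Wvec m v -> Kv *m v = q ^ (- m) *: v.
Proof.
move=> h; have : Kv *m (K *m v) = v by rewrite -mulMV KvK mul1mx.
rewrite h -scalemxAr => h'; rewrite -[in RHS]h' scalerA -qD // addNr expr0z scale1r //.
Qed.

Lemma sl2_vec : sl2rep q (mulmx E : {linear 'cV[R]_n -> 'cV[R]_n}) (mulmx F) Wvec.
Proof.
split.
- move=> m a u v hu hv; rewrite /Wvec mulmxDr -scalemxAr hu hv scalerDr !scalerA.
  by rewrite mulrC.
- by move=> m; rewrite /Wvec mulmx0 scaler0.
- move=> m v hv; rewrite /Wvec -mulMV KE -scalemxAl mulMV hv -scalemxAr scalerA.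
  by rewrite -qD // addrC.
- move=> m v hv; rewrite /Wvec -mulMV KF -scalemxAl mulMV hv -scalemxAr scalerA.
  by rewrite -qD // addrC.
- move=> m v hv; have -> : E *m (F *m v) - F *m (E *m v) = (E * F - F * E) *m v by rewrite mulmxBl !mulMV.
  rewrite EF -scalemxAl mulmxBl hv (Wvec_Kv hv).
  by rewrite -scalerBl scalerA mulrC.
- by exists N => v; rewrite iter_mul EN mul0mx.
- by exists N => v; rewrite iter_mul FN mul0mx.
Qed.

Lemma adl_W m x : Wad m x -> adl E K Kv x = E * x - q ^ m *: (x * E).
Proof. by move=> h; rewrite /adl h scMl -[x * K * Kv]mulrA KKv mulr1 scMl. Qed.

Lemma Wad_Kv m x : Wad m x -> Kv * x = q ^ (- m) *: (x * Kv).
Proof.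
move=> h; have : Kv * (K * x) * Kv = x * Kv by rewrite mulrA KvK mul1r.
rewrite h scMr scMl => <-; rewrite scalerA -qD // addNr expr0z scale1r.
by rewrite -!mulrA KKv mulr1.
Qed.

Lemma WadM m m' x y : Wad m x -> Wad m' y -> Wad (m + m') (x * y).
Proof. by move=> hx hy; rewrite /Wad mulrA hx scMl -mulrA hy scMr scalerA -qD // mulrA. Qed.

Lemma Wad_lin m a x y : Wad m x -> Wad m y -> Wad m (a *: x + y).
Proof.
move=> hx hy; rewrite /Wad mulrDr mulrDl scMr scMl scalerDr hx hy !scalerA.
by rewrite mulrC.
Qed.

Lemma Wad0 m : Wad m 0. Proof. by rewrite /Wad mulr0 mul0r scaler0. Qed.

Lemma WadZ m a x : Wad m x -> Wad m (a *: x).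
Proof. by move=> h; rewrite -[_ *: _]addr0; apply: Wad_lin => //; apply: Wad0. Qed.

Lemma WadB m x y : Wad m x -> Wad m y -> Wad m (x - y).
Proof. by move=> hx hy; rewrite addrC -scaleN1r; apply: Wad_lin. Qed.

Lemma WadE : Wad 2 E. Proof. exact: KE. Qed.
Lemma WadF : Wad (-2) F. Proof. exact: KF. Qed.
Lemma WadK : Wad 0 K. Proof. by rewrite /Wad expr0z scale1r. Qed.
Lemma Wad_adl m x : Wad m x -> Wad (m + 2) (adl E K Kv x).
Proof.
move=> h; rewrite (adl_W h); apply: WadB.
  by rewrite addrC; apply: WadM => //; apply: WadE.
by apply: WadZ; apply: WadM => //; apply: WadE.
Qed.

Lemma Wad_adr m x : Wad m x -> Wad (m - 2) (adr F K x).
Proof.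
move=> h; rewrite /adr -[m - 2]addr0; apply: WadM; last exact: WadK.
apply: WadB; first by rewrite addrC; apply: WadM => //; apply: WadF.
by apply: WadM => //; apply: WadF.
Qed.

Lemma adl_adr m x : Wad m x ->
  adl E K Kv (adr F K x) - adr F K (adl E K Kv x) = qz q m *: x.
Proof.
move=> h; rewrite (adl_W (Wad_adr h)) (adl_W h) /adr.
have KE' : K * E = q ^ 2 *: (E * K) by exact: KE.
have -> : (F * x - x * F) * K * E = q ^ 2 *: ((F * x - x * F) * E * K).
  by rewrite -mulrA KE' scMr !mulrA.
rewrite scalerA -qD //; have -> : m - 2 + 2 = m by lia.
have -> : E * ((F * x - x * F) * K) - q ^ m *: ((F * x - x * F) * E * K) -
    (F * (E * x - q ^ m *: (x * E)) - (E * x - q ^ m *: (x * E)) * F) * K =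
    (E * F - F * E) * x * K - q ^ m *: (x * (E * F - F * E) * K).
  rewrite !(mulrBl, mulrBr, scMl, scMr) !mulrA.
  move: (E * F * x * K) (E * x * F * K) (F * x * E * K) (x * F * E * K) => b1 b2 b3 b4.
  by move: (F * E * x * K) (x * E * F * K) => b5 b6; mxring.
rewrite EF !(scMl, scMr) scalerA mulrC -scalerA -scalerBr.
have e1 : Kv * x * K = q ^ (- m) *: x by rewrite (Wad_Kv h) scMl -mulrA KvK mulr1.
rewrite !(mulrBl, mulrBr) h e1 scMl -[x * Kv * K]mulrA KvK mulr1 /qz.
rewrite [_ * (q - q^-1)^-1]mulrC -scalerA; congr (_ *: _).
by move: (x * K * K) => y; mxring.
Qed.

(** One application of g raises the total exponent of A on the two sides of x; once it reaches 2N,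
    one side carries A^N = 0. *)
Lemma sl2_ad_nil (g : 'M[R]_n -> 'M[R]_n) (A : 'M[R]_n) : A ^+ N = 0 ->
  (forall a b x, (forall a' b', (a + b < a' + b')%N -> A ^+ a' * x * A ^+ b' = 0) ->
      A ^+ a * g x * A ^+ b = 0) ->
  forall x, iter (N + N) g x = 0.
Proof.
move=> AN hg x.
suff h m a b : (N + N <= a + b + m)%N -> A ^+ a * iter m g x * A ^+ b = 0.
  by have := h (N + N)%N 0%N 0%N (leqnn _); rewrite mulr1 mul1r.
elim: m a b => [|m IH] a b le.
  rewrite addn0 in le; have : (N <= a)%N || (N <= b)%N by lia.
  by case/orP => /subnK <-; rewrite exprD AN !(mulr0, mul0r).
by rewrite iterS; apply: hg => a' b' lt; apply: IH; lia.
Qed.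

Lemma WadX w x m : Wad w x -> Wad (w * m%:Z) (x ^+ m).
Proof.
move=> h; elim: m => [|m IH].
  by rewrite mulr0 /Wad mulr1 mul1r expr0z scale1r.
by have := WadM h IH; rewrite -exprS; congr (Wad _ _); lia.
Qed.

Lemma Wad_r w x : Wad w x -> x * K = q ^ (- w) *: (K * x).
Proof. by move=> ->; rewrite scalerA -qD // addNr expr0z scale1r. Qed.

Lemma sl2_ad : sl2rep q (adl E K Kv : {linear 'M[R]_n -> 'M[R]_n}) (adr F K) Wad.
Proof.
split; [exact: Wad_lin|exact: Wad0|exact: Wad_adl|exact: Wad_adr|exact: adl_adr| |].
  exists (N + N)%N; apply: (sl2_ad_nil EN) => a b x hx.
  rewrite /= /adl mulrBr mulrBl !mulrA -exprSr hx ?sub0r; last by lia.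
  rewrite (Wad_r (WadX a WadE)) !scMl.
  have -> : K * E ^+ a * x * Kv * E * E ^+ b = K * (E ^+ a * x * (Kv * E ^+ b.+1)).
    by rewrite exprS !mulrA.
  rewrite (Wad_Kv (WadX b.+1 WadE)) scMr mulrA hx ?mul0r; last by lia.
  by rewrite scaler0 mulr0 scaler0 oppr0.
exists (N + N)%N; apply: (sl2_ad_nil FN) => a b x hx.
rewrite /= /adr -[F ^+ a * _ * _]mulrA -[_ * K * F ^+ b]mulrA (WadX b WadF) scMr scMr.
rewrite mulrBl mulrBr !mulrA -exprSr hx; last by lia.
have -> : F ^+ a * x * F * F ^+ b = F ^+ a * x * F ^+ b.+1 by rewrite exprS !mulrA.
by rewrite hx ?mul0r ?subrr ?scaler0 //; lia.
Qed.

(** The q-binomial expansion of an iterated q-commutator: each step multiplies the twist by q^2, and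
    the coefficients obey Pascal's rule. *)
Lemma iter_adl m x w : Wad w x -> iter m (adl E K Kv) x =
  \sum_(r < m.+1) ((-1) ^+ r * bq q m r * q ^ (r%:Z * (w + m%:Z - 1))) *:
     (E ^+ (m - r) * x * E ^+ r).
Proof.
move=> h; elim: m => [|m IH].
  by rewrite big_ord1 /= expr0 bq0 // mul0r expr0z !mulr1 scale1r mul1r.
rewrite iterS (adl_W (W_iter_e q0 sl2_ad m h)) IH mulr_sumr mulr_suml scaler_sumr.
have -> : \sum_(i < m.+1) E * (((-1) ^+ i * bq q m i * q ^ (i%:Z * (w + m%:Z - 1))) *:
     (E ^+ (m - i) * x * E ^+ i)) = \sum_(i < m.+2)
     (((-1) ^+ i * bq q m i * q ^ (i%:Z * (w + m%:Z - 1))) *: (E ^+ (m.+1 - i) * x * E ^+ i)).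
  rewrite [RHS]big_ord_recr /= bq_small // mulr0 mul0r scale0r addr0.
  apply: eq_bigr => i _; rewrite scMr !mulrA -exprS subSn // -ltnS //.
have -> : \sum_(i < m.+1) q ^ (w + 2 * m%:Z) *: ((((-1) ^+ i * bq q m i *
     q ^ (i%:Z * (w + m%:Z - 1))) *: (E ^+ (m - i) * x * E ^+ i)) * E) = \sum_(i < m.+2)
   (if (i : nat) is i'.+1 then (q ^ (w + 2 * m%:Z) * ((-1) ^+ i' * bq q m i' *
     q ^ (i'%:Z * (w + m%:Z - 1)))) *: (E ^+ (m.+1 - i) * x * E ^+ i) else 0).
  rewrite [RHS]big_ord_recl /= add0r; apply: eq_bigr => i _.
  by rewrite scMl scalerA -[_ * x * _ * E]mulrA -exprSr /bump add1n subSS add0n.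
rewrite -sumrB; apply: eq_bigr => -[[|i] /= im] _.
  by rewrite subr0 !bq0 // !mul0r.
rewrite -scalerBl; congr (_ *: _); rewrite bqS' //.
have -> : i.+1%:Z * (w + m%:Z - 1) = i%:Z * (w + m%:Z) - i%:Z + (w + m%:Z) - 1 by lia.
have -> : i.+1%:Z * (w + m.+1%:Z - 1) = i%:Z * (w + m%:Z) + (w + m%:Z) by lia.
have -> : i%:Z * (w + m%:Z - 1) = i%:Z * (w + m%:Z) - i%:Z by lia.
have -> : w + 2 * m%:Z = (w + m%:Z) + m%:Z by lia.
have -> : i.+1%:Z = i%:Z + 1 by lia.
rewrite !(qD q0, qN) exprS expr1z.
have := qVz q0 (i%:Z * (w + m%:Z)); have := qVz q0 i; have := qVz q0 m.
have := qVz q0 w.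
move: (bq q m i.+1) (bq q m i) ((-1) ^+ i) => u v s.
move: (q ^ (i%:Z * (w + m%:Z))) (q ^ i) (q ^ m) (q ^ w) => y1 y2 y3 y4 ? ? ? ?.
by field; do ?[apply/andP; split].
Qed.

(* For x commuting with F, of weight -M, this is the top of the string of x under the adjoint
   action; Lusztig's operator T then satisfies T x = (adtop M x) T. *)
Definition adtop (M : nat) (x : 'M[R]_n) : 'M[R]_n := dpw q (adl E K Kv) M x.

Lemma adtopE M x : Wad (- M%:Z) x -> adtop M x =
  \sum_(r < M.+1) ((-1) ^+ r * q ^ (- r%:Z)) *:
    (((qfact q (M - r))^-1 *: E ^+ (M - r)) * x * ((qfact q r)^-1 *: E ^+ r)).
Proof.
move=> h; rewrite /adtop dpw.unlock (iter_adl _ h) scaler_sumr; apply: eq_bigr => r _.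
rewrite !(scMl, scMr) !scalerA; congr (_ *: _).
have -> : r%:Z * (- M%:Z + M%:Z - 1) = - r%:Z by lia.
have rM : (r <= M)%N by rewrite -ltnS.
have := bqE q (M - r) r; rewrite subnK // => ->.
by field; rewrite !qfact_neq0.
Qed.

Lemma adr_comm x : F * x = x * F -> adr F K x = 0.
Proof. by rewrite /adr => ->; rewrite subrr mul0r. Qed.

(** Commuting with F makes x a lowest weight vector of weight -M for the adjoint action, so its
    string has length M + 1. For x = E_j this is a quantum Serre relation. *)
Lemma adtop_nil M x : Wad (- M%:Z) x -> F * x = x * F -> iter M.+1 (adl E K Kv) x = 0.
Proof.
move=> h hF; have p : primv (adr F K) (fun m => Wad (- m)) M x.
  by split=> //; apply: adr_comm.
have := prim_bound qX q0 (sl2_swap q0 sl2_ad) p (ltnSn M) => /eqP.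
by rewrite dpw.unlock scaler_eq0 invr_eq0 (negPf (qfact_neq0 qX q0 _)) => /eqP.
Qed.

Lemma Wad_adtop M x : Wad (- M%:Z) x -> Wad M%:Z (adtop M x).
Proof. by move=> h; have := W_eD q0 sl2_ad M h; congr (Wad _ _); lia. Qed.

Lemma adtop_top M x : Wad (- M%:Z) x -> F * x = x * F ->
  E * adtop M x = q ^ M%:Z *: (adtop M x * E).
Proof.
move=> h hF; have := adtop_nil h hF; rewrite iterS => h0.
have : adl E K Kv (adtop M x) = 0 by rewrite /adtop dpw.unlock linearZ /= h0 scaler0.
by rewrite (adl_W (Wad_adtop h)) => /eqP; rewrite subr_eq0 => /eqP.
Qed.

Lemma adtop_down M r x : Wad (- M%:Z) x -> F * x = x * F -> (r <= M)%N ->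
  dpw q (adr F K) r (adtop M x) = dpw q (adl E K Kv) (M - r) x.
Proof.
move=> h hF rM; have p : primv (adr F K) (fun m => Wad (- m)) M x.
  by split=> //; apply: adr_comm.
have := @eD_fD _ _ _ qX q0 _ _ _ (sl2_swap q0 sl2_ad) M x r (M - r) p.
by rewrite subnK // subKn // bqnn // scale1r => ->.
Qed.
Lemma adr_low (m : nat) y : Wad m y -> adl E K Kv y = 0 ->
  let w := dpw q (adr F K) m y in [/\ Wad (- m%:Z) w, F * w = w * F & adtop m w = y].
Proof.
move=> hy h0 w; have p : primv (adl E K Kv) Wad m y by split.
split.
- by have := W_fD q0 sl2_ad m hy; congr (Wad _ _); lia.
- have := prim_bound qX q0 sl2_ad p (ltnSn m) => /eqP.
  rewrite dpw.unlock scaler_eq0 invr_eq0 (negPf (qfact_neq0 qX q0 _)) /= => /eqP h1.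
  have : adr F K w = 0 by rewrite /w dpw.unlock linearZ /= h1 scaler0.
  rewrite /adr => /(congr1 (fun z => z * Kv)); rewrite mul0r -mulrA KKv mulr1 => /eqP.
  by rewrite subr_eq0 => /eqP.
have := @eD_fD _ _ _ qX q0 _ _ _ sl2_ad m y m 0 p.
by rewrite add0n subn0 bqnn // scale1r dpow0 leqnn => /(_ isT).
Qed.

(** This is [low_pos] for the adjoint action, and the reason why solutions of the intertwining
    relations are unique. *)
Lemma comm_F_pos m x : Wad m.+1%:Z x -> F * x = x * F -> x = 0.
Proof. by move=> h hF; apply: (low_pos qX q0 sl2_ad h); apply: adr_comm. Qed.

Section T.
Variables (T : 'M[R]_n).
Hypothesis hT : forall m v, Wvec m v -> T *m v = Tsl q (mulmx E) (mulmx F) N m v.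
Hypothesis span : forall v : 'cV[R]_n, exists2 s : seq 'cV[R]_n,
   (forall w, w \in s -> exists m, Wvec m w) & v = \sum_(w <- s) w.

Lemma Wvec_eq (A B : 'M[R]_n) :
  (forall m v, Wvec m v -> A *m v = B *m v) -> A = B.
Proof.
move=> h; apply: mx_vec_eq => v; have [s hs ->] := span v.
by rewrite !mulmx_sumr !big_seq; apply: eq_bigr => w /hs [m]; apply: h.
Qed.

Let hN (v : 'cV[R]_n) : iter N (mulmx E) v = 0.
Proof. by rewrite iter_mul EN mul0mx. Qed.
Let S := sl2_vec.
Let hTl : forall m v, Wvec m v -> (mulmx T : {linear 'cV[R]_n -> 'cV[R]_n}) v =
  Tsl q (mulmx E) (mulmx F) N m v.
Proof. exact: hT. Qed.

Lemma T_W m v : Wvec m v -> Wvec (- m) (T *m v).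
Proof.
apply: (@strand_ind _ _ _ qX q0 _ _ _ S (fun v => Wvec (- m) (T *m v))).
- by rewrite mulmx0; apply: (sl2_W0 S).
- by move=> u w hu hw; rewrite mulmxDr -[T *m u]scale1r; apply: (sl2_lin S).
move=> a j u pu ha; have -> := T_strand qX q0 S hN hTl pu; apply: (W_Z S).
by have := W_fD q0 S a pu.1; congr (Wvec _ _); lia.
Qed.

Lemma TE : T * E = - (F * K * T).
Proof.
apply: Wvec_eq => m v h; rewrite mulNmx !mulMV.
have -> : T *m (E *m v) = - q ^ (- m) *: (F *m (T *m v)) := T_e qX q0 S hN hTl h.
by rewrite (T_W h) -scalemxAr scaleNr.
Qed.

Lemma TF : T * F = - (Kv * E * T).
Proof.
apply: Wvec_eq => m v h; rewrite mulNmx !mulMV.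
have -> : T *m (F *m v) = - q ^ (m - 2) *: (E *m (T *m v)) := T_f qX q0 S hN hTl h.
have := Wvec_Kv (sl2_e S (T_W h)) => /= ->.
by rewrite scaleNr; congr (- (_ ^ _ *: _)); lia.
Qed.

Lemma TK : T * K = Kv * T.
Proof.
apply: Wvec_eq => m v h; rewrite !mulMV h (Wvec_Kv (T_W h)) -scalemxAr.
by rewrite opprK.
Qed.

Lemma T_unit : T \in unitmx.
Proof.
have hs v : exists u : 'cV[R]_n, T *m u = v.
  have [s hs ->] := span v; elim: s hs => [|w s IH] hs.
    by exists 0; rewrite big_nil mulmx0.
  have [|u hu] := IH; first by move=> w' h; apply: hs; rewrite inE h orbT.
  have [m hw] := hs w (mem_head _ _).
  have [u' hu'] := T_surj qX q0 S hN hTl hw.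
  by exists (u' + u); rewrite mulmxDr big_cons hu -hu'.
have [U hU] := choice (fun j : 'I_n => hs (delta_mx j 0)).
suff h : T *m (\sum_j U j *m delta_mx 0 j) = 1%:M by case/mulmx1_unit: h.
rewrite mulmx_sumr; apply/matrixP => a b; rewrite summxE (bigD1 b) //= mulmxA hU.
rewrite big1 ?addr0 => [|j jb].
  by rewrite mul_delta_mx !mxE eqxx andbT.
by rewrite mulmxA hU mul_delta_mx !mxE [b == j]eq_sym (negPf jb) andbF.
Qed.

Lemma T_adtop M x : Wad (- M%:Z) x -> F * x = x * F -> T * x = adtop M x * T.
Proof.
move=> hx hF; apply: Wvec_eq => m v h; rewrite !mulMV.
have xt (u : 'cV[R]_n) : xtop q (mulmx E) (mulmx x) M u = adtop M x *m u.
  rewrite (adtopE hx) mulmx_suml; apply: eq_bigr => r _.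
  rewrite -scalemxAl; congr (_ *: _).
  by rewrite !dpw.unlock !iter_mul !mulMV -!scalemxAl.
have -> : T *m (x *m v) = xtop q (mulmx E) (mulmx x) M (T *m v); last by rewrite xt.
apply: (T_xtop qX q0 S hN hTl _ _ _ _ h) => /=.
- by move=> u; rewrite -!mulMV hF.
- move=> m' u hu; rewrite /Wvec -mulMV hx -scalemxAl mulMV hu -scalemxAr scalerA -qD //.
  by rewrite addrC.
- by move=> m' u hu; rewrite !xt -!mulMV adtop_top // -scalemxAl.
(* On a vector killed by E only the term r = 0 in the expansion of ad(E)^(M+1) x survives, namely
   E^(M+1) x u. *)
move=> p u [_ /= Eu].
have := congr1 (mulmx^~ u) (adtop_nil hx hF); rewrite mul0mx (iter_adl _ hx) mulmx_suml.
rewrite big_ord_recl big1 ?addr0 => [|r _].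
  by rewrite /= expr0 bq0 // mul0r expr0z !mulr1 scale1r mulMV -iter_mul.
by rewrite lift0 [E ^+ r.+1]exprSr -scalemxAl !mulMV Eu !mulmx0 scaler0.
Qed.

End T.
End AdSl2.

Section AdRight.
Variables (R : fieldType) (q : R) (n : nat) (E F K Kv : 'M[R]_n).
Hypothesis qX : forall m, q ^+ m.+1 != 1.
Hypothesis q0 : q != 0.
Hypothesis KKv : K * Kv = 1.
Hypothesis KvK : Kv * K = 1.
Hypothesis KE : K * E = q ^ 2 *: (E * K).
Hypothesis KF : K * F = q ^ (-2) *: (F * K).
Hypothesis EF : E * F - F * E = (q - q^-1)^-1 *: (K - Kv).
Variable N : nat.
Hypothesis EN : E ^+ N = 0.
Hypothesis FN : F ^+ N = 0.

Definition adtopr (M : nat) (x : 'M[R]_n) : 'M[R]_n :=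
  \sum_(r < M.+1) ((-1) ^+ r * q ^ (- r%:Z)) *:
    (((qfact q r)^-1 *: E ^+ r) * x * ((qfact q (M - r))^-1 *: E ^+ (M - r))).

Definition adR (x : 'M[R]_n) := x * E - E * K * x * Kv.

Lemma trM (A B : 'M[R]_n) : (A * B)^T = B^T * A^T.
Proof. exact: trmx_mul. Qed.

Lemma tr1 : (1 : 'M[R]_n)^T = 1.
Proof. exact: trmx1. Qed.

Lemma trX (A : 'M[R]_n) m : (A ^+ m)^T = A^T ^+ m.
Proof. by elim: m => [|m IH]; rewrite ?tr1 // exprS exprSr trM IH. Qed.

(** Transposition reverses products, so the right-handed adjoint action becomes the left-handed one
    with K and its inverse exchanged; the formulas above then serve both. *)
Lemma adR_tr x : (adR x)^T = adl E^T Kv^T K^T x^T.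
Proof. by rewrite /adR /adl linearB /= !trM !mulrA. Qed.

Let tKKv : Kv^T * K^T = 1. Proof. by rewrite -trM KKv tr1. Qed.
Let tKvK : K^T * Kv^T = 1. Proof. by rewrite -trM KvK tr1. Qed.
Let tKE : Kv^T * E^T = q ^ 2 *: (E^T * Kv^T).
Proof.
rewrite -!trM -linearZ /=; congr (_^T).
have := Wad_Kv q0 KKv KvK KE => ->; rewrite scalerA -qD // subrr expr0z scale1r //.
Qed.
Let tKF : Kv^T * F^T = q ^ (-2) *: (F^T * Kv^T).
Proof.
rewrite -!trM -linearZ /=; congr (_^T).
have := Wad_Kv q0 KKv KvK KF => ->; rewrite scalerA -qD // subrr expr0z scale1r //.
Qed.
Let tEF : E^T * F^T - F^T * E^T = (q - q^-1)^-1 *: (Kv^T - K^T).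
Proof.
rewrite -!trM -!linearB /= -linearZ /=; congr (_^T).
by rewrite -opprB EF -scalerN opprB.
Qed.
Let tEN : E^T ^+ N = 0. Proof. by rewrite -trX EN trmx0. Qed.
Let tFN : F^T ^+ N = 0. Proof. by rewrite -trX FN trmx0. Qed.

Lemma Wad_tr m x : Wad q K m x -> Wad q Kv^T m x^T.
Proof.
move=> h; rewrite /Wad -!trM -linearZ /=; congr (_^T).
by rewrite (Wad_Kv q0 KKv KvK h) scalerA -qD // subrr expr0z scale1r.
Qed.

Lemma adtoprE M x : Wad q K (- M%:Z) x -> adtopr M x = (qfact q M)^-1 *: iter M adR x.
Proof.
move=> h.
have e : (iter M adR x)^T = iter M (adl E^T Kv^T K^T) x^T.
  by elim: (M) => //= m IH; rewrite adR_tr IH.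
apply: trmx_inj; rewrite linearZ /= e.
have := adtopE qX q0 tKKv tKvK tKE tKF tEF tEN tFN (Wad_tr h).
rewrite /adtop dpw.unlock => ->.
rewrite /adtopr linear_sum; apply: eq_bigr => r _ /=.
by rewrite linearZ /= !trM !linearZ /= !trX mulrA.
Qed.

Variables (T : 'M[R]_n).
Hypothesis hT : forall m v, Wvec q K m v -> T *m v = Tsl q (mulmx E) (mulmx F) N m v.
Hypothesis span : forall v : 'cV[R]_n, exists2 s : seq 'cV[R]_n,
   (forall w, w \in s -> exists m, Wvec q K m w) & v = \sum_(w <- s) w.

(** T carries E, F, K to -F K, -K^-1 E, K^-1, so it turns the right-handed adjoint action of E into
    the left-handed adjoint action of F. The right string going up from x is sent to the left string
    going down from its top. *)
Lemma T_adR M r x : Wad q K (- M%:Z) x -> F * x = x * F -> (r <= M)%N ->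
  T * dpw q adR r x = dpw q (adl E K Kv) (M - r) x * T.
Proof.
move=> hx hF rM.
have hTE : T * E = - (F * K * T) by eapply TE; eauto.
have hTF : T * F = - (Kv * E * T) by eapply TF; eauto.
have hTK : T * K = Kv * T by eapply TK; eauto.
have hTX := T_adtop qX q0 KKv KvK KE KF EF EN FN hT span hx hF.
have hb := adtop_down qX q0 KKv KvK KE KF EF EN FN hx hF rM.
have hTK' : T * Kv = K * T.
  by rewrite -[LHS]mul1r -KKv -!mulrA [Kv * (T * _)]mulrA -hTK -mulrA KKv mulr1.
have step z z' : T * z = z' * T -> T * adR z = adr F K z' * T.
  move=> h; have e1 : T * (z * E) = - (z' * F * K * T).
    by rewrite mulrA h -mulrA hTE mulrN !mulrA.
  have e2 : T * (E * K * z * Kv) = - (F * z' * K * T).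
    rewrite !mulrA hTE !mulNr -![F * K * T * _]mulrA hTK; congr (- _).
    rewrite !mulrA -[F * K * Kv]mulrA KKv mulr1 -[F * T * z]mulrA h !mulrA.
    by rewrite -[F * z' * T * Kv]mulrA hTK' !mulrA.
  rewrite /adR /adr mulrBr e1 e2 opprK mulrBl mulrBl addrC //.
have it m : T * iter m adR x = iter m (adr F K) (adtop q E K Kv M x) * T.
  by elim: m => //= m IH; apply: step.
rewrite -hb !dpw.unlock scMr it -scMl //.
Qed.

Lemma T_adtopr M x : Wad q K (- M%:Z) x -> F * x = x * F -> T * adtopr M x = x * T.
Proof.
move=> hx hF; have := T_adR hx hF (leqnn M).
by rewrite subnn dpow0 (adtoprE hx) dpw.unlock.
Qed.

End AdRight.

Section QRmorph.
Variables (F F' : fieldType) (f : {rmorphism F -> F'}) (q : F).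

Lemma qint_rmorph n : f (qint q n) = qint (f q) n.
Proof. by rewrite /qint fmorph_div !rmorphB /= !fmorphV !rmorphXn. Qed.

Lemma qfact_rmorph n : f (qfact q n) = qfact (f q) n.
Proof. by rewrite /qfact rmorph_prod; apply: eq_bigr => i _; apply: qint_rmorph. Qed.

Lemma qbinom_rmorph n m : f (qbinom q n m) = qbinom (f q) n m.
Proof. by rewrite /qbinom fmorph_div rmorphM /= !qfact_rmorph. Qed.

Lemma qintV n : qint q^-1 n = qint q n.
Proof.
by rewrite /qint !exprVn invrK -opprB -[X in _ / X]opprB invrK invrN mulrNN.
Qed.

Lemma qfactV n : qfact q^-1 n = qfact q n.
Proof. by rewrite /qfact; apply: eq_bigr => i _; apply: qintV. Qed.

Lemma qbinomV n m : qbinom q^-1 n m = qbinom q n m.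
Proof. by rewrite /qbinom !qfactV. Qed.
End QRmorph.

(** * Algebra morphisms and modules *)

Section AlgMorphisms.
Variables (k : fieldType) (G : Type).
Variable P : forall A : pzRingType, (k -> A) -> (G -> A) -> Prop.

Lemma pres_ind (Q : presAlg P -> Prop) :
  (forall g, Q (pgen g)) -> (forall c, Q (pcst c)) ->
  (forall x y, Q x -> Q y -> Q (x + y)) -> (forall x y, Q x -> Q y -> Q (x * y)) ->
  forall x, Q x.
Proof.
move=> hg hc hD hM x; rewrite -[x]generic_quotient.reprK; elim: (generic_quotient.repr x) => [g|c|t1 h1 t2 h2|t1 h1 t2 h2].
- exact: hg.
- exact: hc.
- have -> : \pi_(presAlg P)%qT (TAdd t1 t2) = \pi_(presAlg P)%qT t1 + \pi_(presAlg P)%qT t2.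
    by apply: plift_inj => A i v m; rewrite (plift_add m) !plift_pi.
  exact: hD.
have -> : \pi_(presAlg P)%qT (TMul t1 t2) = \pi_(presAlg P)%qT t1 * \pi_(presAlg P)%qT t2.
  by apply: plift_inj => A i v m; rewrite (plift_mul m) !plift_pi.
exact: hM.
Qed.

(** Bundled so that maps of the form [plift] receive ring morphism structures. *)
Record amor (A : pzRingType) (iota : {rmorphism k -> A}) :=
  AMor { amf :> presAlg P -> A; amP : alg_morph iota amf }.

Section Inst.
Variables (A : pzRingType) (iota : {rmorphism k -> A}) (f : amor iota).

Lemma amor_zmod : zmod_morphism (amf f).
Proof.
have [fD fM fc] := amP f; move=> x y.
have f0 : f 0 = 0 by rewrite -[0 in LHS]/(pcst 0 : presAlg P) fc rmorph0.
have fN : f (- y) = - f y.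
  by apply/eqP; rewrite -addr_eq0 -fD addNr f0.
by rewrite fD fN.
Qed.
HB.instance Definition _ := GRing.isZmodMorphism.Build (presAlg P) A (amf f) amor_zmod.
Lemma amor_monoid : monoid_morphism (amf f).
Proof.
have [fD fM fc] := amP f; split; last by move=> x y; rewrite fM.
by rewrite -[1 in LHS]/(pcst 1 : presAlg P) fc rmorph1.
Qed.
HB.instance Definition _ := GRing.isMonoidMorphism.Build (presAlg P) A (amf f) amor_monoid.
Lemma amorC c : f (pcst c) = iota c.
Proof. by case: (amP f). Qed.
Lemma amorZ c x : f (c *: x) = iota c * f x.
Proof. by rewrite -[c *: x]/(pcst c * x) rmorphM /= amorC. Qed.
End Inst.

Lemma pcst_comm c (x : presAlg P) : pcst c * x = x * pcst c.
Proof.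
apply: plift_inj => A i v m; have [_ fM fc] := plift_alg_morph m.
by rewrite !fM !fc (plift_central m).
Qed.

Lemma pscaleMl c (x y : presAlg P) : (c *: x) * y = c *: (x * y).
Proof. by rewrite -[c *: x]/(pcst c * x) -mulrA. Qed.

Lemma pscaleMr c (x y : presAlg P) : x * (c *: y) = c *: (x * y).
Proof. by rewrite -[c *: y]/(pcst c * y) mulrA -pcst_comm -mulrA. Qed.

Lemma gen_subalg_ind (S : set (presAlg P)) (Q : presAlg P -> Prop) :
  (forall u, S u -> Q u) -> Q 1 -> (forall (a : k) u v, Q u -> Q v -> Q (a *: u + v)) ->
  (forall u v, Q u -> Q v -> Q (u * v)) -> forall u, gen_subalg S u -> Q u.
Proof. by move=> hS h1 hl hm u; apply; split=> //; split. Qed.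

Lemma gen_subalgS (S : set (presAlg P)) u : S u -> gen_subalg S u.
Proof. by move=> Su Q [_ ]; apply. Qed.
Lemma gen_subalg1 (S : set (presAlg P)) : gen_subalg S 1.
Proof. by move=> Q [[h _ _] _]. Qed.
Lemma gen_subalgM (S : set (presAlg P)) u v :
  gen_subalg S u -> gen_subalg S v -> gen_subalg S (u * v).
Proof. by move=> hu hv Q QP; have [[_ _ h] _] := QP; apply: h; [apply: hu|apply: hv]. Qed.
Lemma gen_subalg_lin (S : set (presAlg P)) a u v :
  gen_subalg S u -> gen_subalg S v -> gen_subalg S (a *: u + v).
Proof. by move=> hu hv Q QP; have [[_ h _] _] := QP; apply: h; [apply: hu|apply: hv]. Qed.
End AlgMorphisms.

Section Wrep.
Variables (K : fieldType) (D : cartanDatum) (L : fieldExtType (kfield K)).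
Local Notation k := (kfield K).
Local Notation I := 'I_(rk D).
Local Notation hdual := 'cV[rat]_(rk D).
Local Notation coroots := 'cV[int]_(rk D).
Local Notation qL := (@qL K D L).

Definition Kc (i : I) : coroots := coroot_of (delta_mx i 0).

Section OneRep.
Variables (n : nat) (E F : I -> 'M[L]_n) (Kh : coroots -> 'M[L]_n).
Hypothesis H : wrep E F Kh.

Lemma wr_NK h : Kh (- h) * Kh h = 1.
Proof. by rewrite -(wrD H) addNr (wr0 H). Qed.

Lemma wr_KN h : Kh h * Kh (- h) = 1.
Proof. by rewrite -(wrD H) addrN (wr0 H). Qed.

Lemma wr_KC h h' : Kh h * Kh h' = Kh h' * Kh h.
Proof. by rewrite -!(wrD H) addrC. Qed.

Lemma opwtE i : opwt Kh (alpha i) (E i).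
Proof. by move=> h; apply: (wrE H). Qed.

Lemma opwtF i : opwt Kh (- alpha i) (F i).
Proof. by move=> h; rewrite weight_atN; apply: (wrF H). Qed.

Lemma opwtK h : opwt Kh 0 (Kh h).
Proof. by move=> h'; rewrite weight_at0 qpow0 !scale1r wr_KC. Qed.

Lemma qpow_Kc (l : hdual) i m : pairing l i = m%:~R ->
  (qpow K D (weight_at l (Kc i)))%:A = qL i ^ m :> L.
Proof. by move=> h; rewrite weight_at_Ki h qLX. Qed.

Lemma opwt_Wad th x i m : pairing th i = m%:~R -> opwt Kh th x ->
  Wad (qL i) (Kh (Kc i)) m x.
Proof. by move=> hp h; rewrite /Wad h (qpow_Kc hp). Qed.

Lemma wt_Wvec l v i m : pairing l i = m%:~R -> wt Kh l v ->
  Wvec (qL i) (Kh (Kc i)) m v.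
Proof. by move=> hp h; rewrite /Wvec h (qpow_Kc hp). Qed.

Lemma wr_KE i j : Kh (Kc i) * E j = qL i ^ (car D i j) *: (E j * Kh (Kc i)).
Proof. exact: (opwt_Wad (pairing_alpha i j) (opwtE j)). Qed.

Lemma wr_KF i j : Kh (Kc i) * F j = qL i ^ (- car D i j) *: (F j * Kh (Kc i)).
Proof.
apply: (opwt_Wad _ (opwtF j)).
by rewrite pairingN pairing_alpha rmorphN.
Qed.

Lemma wr_KE2 i : Kh (Kc i) * E i = qL i ^ 2 *: (E i * Kh (Kc i)).
Proof. by rewrite wr_KE car_ii. Qed.

Lemma wr_KF2 i : Kh (Kc i) * F i = qL i ^ (-2) *: (F i * Kh (Kc i)).
Proof. by rewrite wr_KF car_ii. Qed.

Lemma wr_EF i : E i * F i - F i * E i =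
  (qL i - (qL i)^-1)^-1 *: (Kh (Kc i) - Kh (- Kc i)).
Proof.
by rewrite (wrEF H) eqxx; congr (_ *: _); rewrite algV scalerBl algV.
Qed.

Lemma wr_nil : exists N, forall i, E i ^+ N = 0 /\ F i ^+ N = 0.
Proof.
have [N hN] := opwt_big (wr_dec H); exists N => i; split.
  apply: (hN _ _ (PlatMn N (Plat_alpha i)) (opwtX N (Plat_alpha i) (opwtE i)) i).
  by rewrite mulmxnE mxE eqxx /= normr_nat.
apply: (hN _ _ (PlatMn N (PlatN (Plat_alpha i))) (opwtX N (PlatN (Plat_alpha i)) (opwtF i)) i).
by rewrite mulmxnE !mxE eqxx /= mulNrn normrN normr_nat.
Qed.

Lemma wr_span i (v : 'cV[L]_n) : exists2 s : seq 'cV[L]_n,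
  (forall w, w \in s -> exists m, Wvec (qL i) (Kh (Kc i)) m w) & v = \sum_(w <- s) w.
Proof.
have [s hs ev] := wr_dec H v; exists s => // w ws.
have [l pl hw] := hs w ws; have /intrP[m hm] := pl i.
by exists m; apply: wt_Wvec hw.
Qed.

Lemma wr_comm_pos i th x (m : nat) : pairing th i = m.+1%:~R -> opwt Kh th x ->
  F i * x = x * F i -> x = 0.
Proof.
move=> hp hx hF; have [N hN] := wr_nil.
by have := comm_F_pos (qL_pow L i) (qL_neq0 L i) (wr_KN _) (wr_NK _) (wr_KE2 i) (wr_KF2 i)
  (wr_EF i) (hN i).1 (hN i).2 (opwt_Wad hp hx) hF.
Qed.

(** E_j commutes with F_i and has weight a_ij under K_i, so it is a lowest weight vector of the
    adjoint action and [adtop_nil] applies with M = -a_ij. *)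
Lemma wr_serreE : forall i j, i != j -> let N := absz (1 - car D i j) in
  \sum_(m < N.+1) (((-1) ^+ m * qbinom (qi K i) N m)%:A : L) *:
    (E i ^+ (N - m) * E j * E i ^+ m) = 0.
Proof.
move=> i j ij N; have [B hB] := wr_nil.
have aN : car D i j = - (N.-1)%:Z by have := car_le0 ij; rewrite /N; lia.
have NP : N = N.-1.+1 by have := car_le0 ij; rewrite /N; lia.
have hw : Wad (qL i) (Kh (Kc i)) (- (N.-1)%:Z) (E j) by rewrite -aN; exact: wr_KE.
have hF : F i * E j = E j * F i.
  by have := wrEF H j i; rewrite eq_sym (negPf ij) => /eqP; rewrite subr_eq0 => /eqP ->.
have := adtop_nil (qL_pow L i) (qL_neq0 L i) (wr_KN _) (wr_NK _) (wr_KE2 i) (wr_KF2 i)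
  (wr_EF i) (hB i).1 (hB i).2 hw hF; rewrite -NP.
rewrite (iter_adl (qL_pow L i) (qL_neq0 L i) (wr_KN _) (wr_NK _) (wr_KE2 i) (wr_KF2 i)
  (wr_EF i) (hB i).1 (hB i).2 _ hw) => h0; rewrite -[RHS]h0.
apply: eq_bigr => m _; congr (_ *: _).
have -> : m%:Z * (- N.-1%:Z + N%:Z - 1) = 0 by rewrite {2}NP; lia.
rewrite expr0z mulr1 /bq -ltnS ltn_ord algM; congr (_ * _).
  by rewrite -in_algE rmorphXn rmorphN1.
by rewrite -in_algE qbinom_rmorph.
Qed.

(** The Chevalley involution on weight representations; it transfers statements on E to F, such as
    the Serre relations. *)
Lemma wrep_swap : wrep F E (fun h => Kh (- h)).
Proof.
split.
- by rewrite oppr0 (wr0 H).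
- by move=> h h'; rewrite opprD (wrD H).
- by move=> h i; rewrite (wrF H) weight_atNr opprK.
- by move=> h i; rewrite (wrE H) weight_atNr.
- move=> i j; rewrite opprK.
  have := wrEF H j i; rewrite eq_sym => h; rewrite -opprB h.
  by case: eqP => [->|_]; rewrite ?oppr0 // -scalerN opprB.
move=> v; have [s hs ->] := wr_dec H v; exists s => // w ws.
have [l pl hl] := hs w ws; exists (- l); first exact: PlatN.
by move=> h; rewrite hl weight_atNr weight_atN.
Qed.
End OneRep.

Section Models.
Variables (n : nat).
Local Notation cst := (@mxcst K L n).

Lemma mxcst_zmod : zmod_morphism cst.
Proof. by move=> a b; rewrite /mxcst scalerBl raddfB. Qed.
HB.instance Definition _ := GRing.isZmodMorphism.Build k 'M[L]_n cst mxcst_zmod.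
Lemma mxcst_monoid : monoid_morphism cst.
Proof.
split=> [|a b]; first by rewrite /mxcst scale1r.
by rewrite /mxcst algM scalar_mxM.
Qed.
HB.instance Definition _ := GRing.isMonoidMorphism.Build k 'M[L]_n cst mxcst_monoid.

Lemma mxcstM c (x : 'M[L]_n) : cst c * x = (c%:A : L) *: x.
Proof. exact: mul_scalar_mx. Qed.

Lemma mxcstC c (x : 'M[L]_n) : cst c * x = x * cst c.
Proof. by rewrite mxcstM; symmetry; exact: mul_mx_scalar. Qed.

Variables (E F : I -> 'M[L]_n) (Kh : coroots -> 'M[L]_n).
Hypothesis H : wrep E F Kh.

Definition gens (g : ugen D) : 'M[L]_n :=
  match g with GE i => E i | GF i => F i | GK h => Kh h end.

Lemma serre_of (E' F' : I -> 'M[L]_n) Kh' : wrep E' F' Kh' -> serre cst E'.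
Proof.
move=> H' i j ij; have := wr_serreE H' ij => /= h; rewrite -[RHS]h.
apply: eq_bigr => m _; rewrite -!mulrA mxcstM //.
Qed.

Lemma wrep_model : model (@uq_rel K D) cst gens.
Proof.
split; first by move=> c g; exact: mxcstC.
split=> /=.
- split; [exact: (wr0 H)|exact: (wrD H)].
- by move=> h i; rewrite (wrE H) -mulrA mxcstM.
- by move=> h i; rewrite (wrF H) -mulrA mxcstM.
- by move=> i j; rewrite (wrEF H); case: eqP => // _; rewrite mxcstM.
by split; [apply: serre_of H|apply: serre_of (wrep_swap H)].
Qed.

Definition rmod : umod D L := UMod (plift cst gens).

Lemma Oint_rmod : Oint rmod.
Proof.
split; first exact: plift_alg_morph wrep_model.
move=> v; have [s hs ->] := wr_dec H v; exists s => // w ws.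
have [l pl hl] := hs w ws; exists l => // h.
by rewrite /= /uK (plift_gen wrep_model) /=; exact: hl.
Qed.

End Models.

(** Equality in the presented algebra means equality in every model, and there the relations hold by
    definition. *)
Lemma Uq_rel : @uq_rel K D (Uq K D) pcst (@pgen k (ugen D) (@uq_rel K D)).
Proof.
have hA (A : pzRingType) (i : {rmorphism k -> A}) (v : ugen D -> A) (m : model (@uq_rel K D) i v) :
   {f : amor (@uq_rel K D) i | f =1 plift i v & forall g, f (pgen g) = v g}.
  by exists (AMor (plift_alg_morph m)) => // g; rewrite /= (plift_gen m).
split.
- split=> [|h h']; apply: plift_inj => A i v m; have [f e g] := hA A i v m; rewrite -!e.
    by rewrite g rmorph1; case: (m.2) => -[].
  by rewrite rmorphM /= !g; case: (m.2) => -[].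
- move=> h j; apply: plift_inj => A i v m; have [f e g] := hA A i v m; rewrite -!e.
  by rewrite !rmorphM /= !g amorC; case: (m.2).
- move=> h j; apply: plift_inj => A i v m; have [f e g] := hA A i v m; rewrite -!e.
  by rewrite !rmorphM /= !g amorC; case: (m.2).
- move=> j l; apply: plift_inj => A i v m; have [f e g] := hA A i v m; rewrite -!e.
  rewrite rmorphB !rmorphM /= !g; case: (m.2) => _ _ _ -> _.
  by case: eqP => _; rewrite ?rmorph0 // rmorphM rmorphB /= amorC !g.
split=> j l jl; apply: plift_inj => A i v m; have [f e g] := hA A i v m; rewrite -!e.
  rewrite rmorph_sum rmorph0 /=; case: (m.2) => _ _ _ _ [h _]; rewrite -[RHS](h j l jl).
  by apply: eq_bigr => a _; rewrite !(rmorphM f) !(rmorphXn f) /= !g amorC.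
rewrite rmorph_sum rmorph0 /=; case: (m.2) => _ _ _ _ [_ h]; rewrite -[RHS](h j l jl).
by apply: eq_bigr => a _; rewrite !(rmorphM f) !(rmorphXn f) /= !g amorC.
Qed.

Record gmod := GMod { gm :> umod D L; gmP : Oint gm }.

Definition act (M : gmod) : Uq K D -> 'M[L]_(udim M) := amf (AMor (gmP M).1).
HB.instance Definition _ (M : gmod) := GRing.RMorphism.on (act M).

Lemma actZ (M : gmod) c u : act M (c *: u) = (c%:A : L) *: act M u.
Proof. by rewrite /act amorZ mxcstM. Qed.

Lemma actC (M : gmod) c : act M (pcst c) = mxcst L _ c.
Proof. by rewrite /act amorC. Qed.

Lemma gmod_wrep (M : gmod) :
  wrep (fun i => act M (uE K i)) (fun i => act M (uF K i)) (fun h => act M (uK K h)).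
Proof.
have [[r0 rD] rE rF rEF _] := Uq_rel; split.
- by rewrite -[1]/(1 : 'M[L]_(udim M)) -(rmorph1 (act M)) -r0.
- by move=> h h'; rewrite -rmorphM -rD.
- by move=> h i; rewrite -!rmorphM -actZ -[_ *: _]/(pcst _ * _) mulrA -rE.
- by move=> h i; rewrite -!rmorphM -actZ -[_ *: _]/(pcst _ * _) mulrA -rF.
- move=> i j; rewrite -!rmorphM -!rmorphB -actZ.
  by have := rEF i j => /= ->; case: eqP => // _; rewrite rmorph0.
by case: (gmP M).
Qed.

End Wrep.

Lemma fsumE (V : zmodType) (T : choiceType) (A : set T) (r : seq T) (f : T -> V) :
  uniq r -> (forall i, i \in r -> A i) -> (forall i, A i -> i \notin r -> f i = 0) ->
  \sum_(i \in A) f i = \sum_(i <- r) f i.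
Proof.
move=> ur rA h; rewrite (fsbigE r) // big_seq_cond [RHS]big_seq; apply: eq_bigl => i.
by case ir : (i \in r) => //=; apply/mem_set/rA.
Qed.

Lemma sum_iota (V : zmodType) N (g : nat -> V) :
  \sum_(a <- iota 0 N) g a = \sum_(a < N) g a.
Proof. by rewrite -[in LHS](subn0 N) -/(index_iota 0 N) big_mkord. Qed.

Lemma dpw_mul (R : fieldType) (q : R) n (A : 'M[R]_n) a (v : 'cV[R]_n) :
  dpw q (mulmx A) a v = (qfact q a)^-1 *: (A ^+ a *m v).
Proof. by rewrite dpw.unlock iter_mul. Qed.

(** * Lusztig's operators *)

Section Lusztig.
Variables (K : fieldType) (D : cartanDatum) (L : fieldExtType (kfield K)).
Local Notation k := (kfield K).
Local Notation I := 'I_(rk D).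
Local Notation hdual := 'cV[rat]_(rk D).
Local Notation coroots := 'cV[int]_(rk D).
Local Notation qL := (@qL K D L).
Local Notation gmod := (gmod D L).

Section OneModule.
Variable M : gmod.
Local Notation n := (udim M).
Local Notation Kh h := (act M (uK K h)).
Local Notation E i := (act M (uE K i)).
Local Notation F i := (act M (uF K i)).
Local Notation wtM := (wt (fun h => Kh h)).
Let H := gmod_wrep M.

(** The weight projections provide an operator with the prescribed values, so the choice in
    [by_weight] does not fall back on its default 0. *)
Lemma by_weightP (f : hdual -> fam1 D L) l v : Plat l -> wtM l v ->
  by_weight f M *m v = f l M *m v.
Proof.
have [s [P [us hs hP h1 h0]]] := wproj_ex (wr_dec H).
pose T : 'M[L]_n := \sum_(l <- s) f l M *m P l.
have hT : exists T : 'M[L]_n, forall l v, Plat l -> weight_vec (M := M) l v -> T *m v = f l M *m v.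
  exists T => l' v' pl' hv'; rewrite /T mulmx_suml.
  have hv1 : \sum_(m <- s) P m *m v' = v' by rewrite -mulmx_suml h1 mul1mx.
  have hp m : P m *m v' = if m == l' then v' else 0 := wproj_wt us hs hP h1 h0 m pl' hv'.
  transitivity (\sum_(m <- s) (f l' M *m (P m *m v'))).
    apply: eq_bigr => m _; rewrite -mulmxA hp; case: eqP => [->//|_]; by rewrite !mulmx0.
  by rewrite -mulmx_sumr hv1.
move=> pl hv; exact: (xgetPex 0 hT l v pl hv).
Qed.

Lemma Tsl_sum (F0 : fieldType) (q : F0) (V : lmodType F0) (e f : {linear V -> V}) N m
    (T : Type) (r : seq T) (g : T -> V) :
  Tsl q e f N m (\sum_(t <- r) g t) = \sum_(t <- r) Tsl q e f N m (g t).
Proof.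
rewrite /Tsl [RHS]exchange_big; apply: eq_bigr => a _ /=.
rewrite [RHS]exchange_big; apply: eq_bigr => c _ /=.
case: ifP => _; last by rewrite big1.
by rewrite !dpow_sum scaler_sumr.
Qed.

Lemma actM3 x y z : act M (x * y * z) = act M x * act M y * act M z.
Proof. by rewrite !rmorphM. Qed.

Lemma act_divE i a : act M (divE K i a) = (qfact (qL i) a)^-1 *: E i ^+ a.
Proof. by rewrite /divE actZ rmorphXn algV -in_algE qfact_rmorph. Qed.

Lemma act_divF i a : act M (divF K i a) = (qfact (qL i) a)^-1 *: F i ^+ a.
Proof. by rewrite /divF actZ rmorphXn algV -in_algE qfact_rmorph. Qed.

(** The index set of the sum is infinite but its support is finite: a, c < N by nilpotency of E_i,
    and b is then determined. *)
Lemma Tfam_wt i N l m v : E i ^+ N = 0 -> Plat l -> wtM l v -> pairing l i = m%:~R ->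
  Tfam L i M *m v = Tsl (qL i) (mulmx (E i)) (mulmx (F i)) N m v.
Proof.
move=> EN pl hv hm; rewrite (by_weightP _ pl hv) hm.
pose g (a c : nat) := ((a, absz (m + a%:Z + c%:Z)), c).
pose ok (p : nat * nat * nat) := 0 <= m + p.1.1%:Z + p.2%:Z.
pose r := [seq p <- [seq g a c | a <- iota 0 N, c <- iota 0 N] | ok p].
have okP p : p \in r -> ok p /\ exists a c, [/\ (a < N)%N, (c < N)%N & p = g a c].
  rewrite mem_filter => /andP[h /allpairsP[[a c] [ha hc e]]]; split=> //.
  by move: ha hc; rewrite !mem_iota => ha hc; exists a, c.
rewrite (fsumE (r := r)).
- rewrite /r big_filter big_mkcond big_allpairs_dep mulmx_suml /Tsl.
  rewrite sum_iota; apply: eq_bigr => a _; rewrite mulmx_suml sum_iota; apply: eq_bigr => c _.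
  rewrite {1}/ok /=; case: ifP => _; last by rewrite mul0mx.
  rewrite -[uact M _]/(act M _) actZ actM3 !act_divE act_divF -scalemxAl.
  rewrite algM algX -in_algE rmorphXn rmorphN1; congr (_ *: _).
  by rewrite !dpw_mul !mulMV -!scalemxAl.
- rewrite filter_uniq // allpairs_uniq ?iota_uniq // => -[a c] [a' c'] _ _ [-> _ ->] //.
- move=> p /okP[h [a [c [_ _ e]]]]; rewrite e /ok /= in h *.
  move: (gez0_abs h); move: (absz _) => b hb.
  have -> : m = b%:Z - a%:Z - c%:Z by rewrite hb; ring.
  by rewrite !intrB; ring.
move=> [[a b] c] /= e; apply: contraNeq => ne.
have {}e : b%:Z = m + a%:Z + c%:Z.
  apply: (@intr_inj rat); rewrite !rmorphD /= -e; ring.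
have aN : (a < N)%N.
  rewrite ltnNge; apply: contra ne => le; rewrite -[uact M _]/(act M _) actZ actM3 !act_divE.
  by rewrite -(subnK le) exprD EN mulr0 scaler0 !mul0r scaler0.
have cN : (c < N)%N.
  rewrite ltnNge; apply: contra ne => le; rewrite -[uact M _]/(act M _) actZ actM3 !act_divE.
  by rewrite -(subnK le) exprD EN mulr0 scaler0 !mulr0 scaler0.
rewrite mem_filter /ok /= -e /=; apply/allpairsP; exists (a, c) => /=.
by split; rewrite ?mem_iota // /g -e absz_nat.
Qed.

Definition Tm i : 'M[L]_n := Tfam L i M.

(** [Tfam] is specified on weight vectors, whereas the sl2-theory needs its values on eigenvectors
    of K_i. Such an eigenvector is a sum of weight vectors whose weights all take the same value on
    h_i. *)
Lemma TmP i : exists N, [/\ E i ^+ N = 0, F i ^+ N = 0 & forall m v,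
  Wvec (qL i) (Kh (Kc i)) m v -> Tm i *m v = Tsl (qL i) (mulmx (E i)) (mulmx (F i)) N m v].
Proof.
have [N hN] := wr_nil H; exists N; have [EN FN] := hN i; split=> // m v hv.
have [s [P [us hs hP h1 h0]]] := wproj_ex (wr_dec H).
have sv : \sum_(l <- s) P l *m v = v by rewrite -mulmx_suml h1 mul1mx.
have key l : l \in s -> P l *m v = 0 \/ pairing l i = m%:~R.
  move=> ls; have /intrP[ml hl] := hs l ls i.
  have h : \sum_(l <- s) (qL i ^ numq (pairing l i) - qL i ^ m) *: (P l *m v) = 0.
    have : Kh (Kc i) *m (\sum_(l <- s) P l *m v) - qL i ^ m *: (\sum_(l <- s) P l *m v) = 0.
      by rewrite sv hv subrr.
    rewrite mulmx_sumr scaler_sumr -sumrB !big_seq => h; rewrite -[RHS]h.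
    apply: eq_bigr => l' l's; have /intrP[ml' hl'] := hs l' l's i.
    by rewrite (wt_Wvec hl' (hP l' v)) -scalerBl hl' numq_int.
  have := wt_indep us hs (fun l' _ => wtZ _ (hP l' v)) h ls.
  move/eqP; rewrite scaler_eq0 => /orP[|/eqP ->]; last by left.
  rewrite hl numq_int subr_eq0 !qLX => /eqP/alg_inj h2; right; congr (_%:~R).
  have := qpow_inj _ _ h2; rewrite -!(intrM _ (eps D i)%:Z) !qok_int => /(_ isT isT).
  by move/intr_inj; apply: mulfI; rewrite eqz_nat -lt0n eps_gt0.
rewrite -[in LHS]sv -[in RHS]sv mulmx_sumr Tsl_sum !big_seq; apply: eq_bigr => l ls.
case: (key l ls) => [->|hl]; last exact: (Tfam_wt EN (hs l ls) (hP l v) hl).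
rewrite mulmx0 /Tsl big1 // => a _; rewrite big1 // => c _.
by case: ifP => // _; rewrite !dpow_0 scaler0.
Qed.

Lemma Tm_unit i : Tm i \in unitmx.
Proof.
have [N [EN FN hT]] := TmP i.
exact: (T_unit (qL_pow L i) (qL_neq0 L i) (wr_NK H _) (wr_KE2 H i) (wr_KF2 H i) (wr_EF H i) EN FN hT (wr_span H i)).
Qed.

Lemma Tm_E i : Tm i * E i = - (F i * Kh (Kc i) * Tm i).
Proof.
have [N [EN FN hT]] := TmP i.
exact: (TE (qL_pow L i) (qL_neq0 L i) (wr_NK H _) (wr_KE2 H i) (wr_KF2 H i) (wr_EF H i) EN FN hT (wr_span H i)).
Qed.

Lemma Tm_F i : Tm i * F i = - (Kh (- Kc i) * E i * Tm i).
Proof.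
have [N [EN FN hT]] := TmP i.
exact: (TF (qL_pow L i) (qL_neq0 L i) (wr_NK H _) (wr_KE2 H i) (wr_KF2 H i) (wr_EF H i) EN FN hT (wr_span H i)).
Qed.

Lemma Tm_adtop i m x : Wad (qL i) (Kh (Kc i)) (- m%:Z) x -> F i * x = x * F i ->
  Tm i * x = adtop (qL i) (E i) (Kh (Kc i)) (Kh (- Kc i)) m x * Tm i.
Proof.
have [N [EN FN hT]] := TmP i => hx hF.
exact: (T_adtop (qL_pow L i) (qL_neq0 L i) (wr_KN H _) (wr_NK H _) (wr_KE2 H i) (wr_KF2 H i) (wr_EF H i) EN FN hT (wr_span H i)).
Qed.

Lemma Tm_adtopr i m x : Wad (qL i) (Kh (Kc i)) (- m%:Z) x -> F i * x = x * F i ->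
  Tm i * adtopr (qL i) (E i) m x = x * Tm i.
Proof.
have [N [EN FN hT]] := TmP i => hx hF.
exact: (T_adtopr (qL_pow L i) (qL_neq0 L i) (wr_KN H _) (wr_NK H _) (wr_KE2 H i) (wr_KF2 H i) (wr_EF H i) EN FN hT (wr_span H i)).
Qed.

(* left and right adjoint strings under E_i *)
Definition zl i r x := dpw (qL i) (adl (E i) (Kh (Kc i)) (Kh (- Kc i))) r x.
Definition zr i r x := dpw (qL i) (adR (E i) (Kh (Kc i)) (Kh (- Kc i))) r x.

Lemma Tm_zr i m r x : Wad (qL i) (Kh (Kc i)) (- m%:Z) x -> F i * x = x * F i -> (r <= m)%N ->
  Tm i * zr i r x = zl i (m - r) x * Tm i.
Proof.
have [N [EN FN hT]] := TmP i => hx hF.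
exact: (T_adR (qL_pow L i) (qL_neq0 L i) (wr_KN H _) (wr_NK H _) (wr_KE2 H i) (wr_KF2 H i) (wr_EF H i) EN FN hT (wr_span H i)).
Qed.

Lemma Tm_adr i (m : nat) y : Wad (qL i) (Kh (Kc i)) m y ->
  adl (E i) (Kh (Kc i)) (Kh (- Kc i)) y = 0 ->
  Tm i * dpw (qL i) (adr (F i) (Kh (Kc i))) m y = y * Tm i.
Proof.
have [N [EN FN hT]] := TmP i => hy h0.
have [h1 h2 h3] := adr_low (qL_pow L i) (qL_neq0 L i) (wr_KN H _) (wr_NK H _) (wr_KE2 H i) (wr_KF2 H i) (wr_EF H i) EN FN hy h0.
by rewrite (Tm_adtop h1 h2) h3.
Qed.

Lemma adtopE' i m x : Wad (qL i) (Kh (Kc i)) (- m%:Z) x ->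
  adtop (qL i) (E i) (Kh (Kc i)) (Kh (- Kc i)) m x =
  \sum_(r < m.+1) ((-1) ^+ r * qL i ^ (- r%:Z)) *:
    (((qfact (qL i) (m - r))^-1 *: E i ^+ (m - r)) * x * ((qfact (qL i) r)^-1 *: E i ^+ r)).
Proof.
have [N [EN FN hT]] := TmP i => hx.
exact: (adtopE (qL_pow L i) (qL_neq0 L i) (wr_KN H _) (wr_NK H _) (wr_KE2 H i) (wr_KF2 H i) (wr_EF H i) EN FN).
Qed.

Lemma refl_mul i (l : hdual) : refl i *m l = l - pairing l i *: alpha i.
Proof.
rewrite mulmxBl mul1mx -mulmxA; congr (_ - _).
apply/matrixP => a b; rewrite [b]ord1 {b} !mxE big_ord1 !mxE mulrC; congr (_ * _).
by apply: eq_bigr => j _; rewrite !mxE.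
Qed.

Lemma Plat_refl i (l : hdual) : Plat l -> Plat (refl i *m l).
Proof.
move=> hl; rewrite refl_mul; apply: PlatD => //; apply: PlatN => j.
by rewrite pairingZ pairing_alpha rpredM ?intr_int.
Qed.

Lemma wt_X th x l v a : Plat th -> Plat l -> opwt (fun h => Kh h) th x -> wtM l v ->
  wtM (l + th *+ a) (x ^+ a *m v).
Proof.
by move=> pt pl hx hv; apply: (opwt_wt (th := th *+ a)) => //; [apply: PlatMn|apply: opwtX].
Qed.

Lemma Tm_wt i l v : Plat l -> wtM l v -> wtM (refl i *m l) (Tm i *m v).
Proof.
move=> pl hv; have /intrP[m hm] := pl i; have [N hN] := wr_nil H.
rewrite (Tfam_wt (hN i).1 pl hv hm) refl_mul hm.
apply: wt_sum => a _; apply: wt_sum => c _; case: ifP => [h|_]; last exact: wt0.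
rewrite /= !dpw_mul; do 2 (apply: wtZ).
set b := absz _; have hb : b%:Z = m + a%:Z + c%:Z by rewrite gez0_abs.
have -> : l - m%:~R *: alpha i = l + alpha i *+ c + (- alpha i) *+ b + alpha i *+ a.
  have -> : m%:~R = b%:R - a%:R - c%:R :> rat.
    have -> : m = b%:Z - a%:Z - c%:Z by rewrite hb; ring.
    by rewrite !intrB.
  by rewrite -!scaler_nat; apply/matrixP => x y; rewrite !mxE; ring.
have pa := Plat_alpha i.
apply: wt_X => //; [by apply: PlatD; [apply: PlatD => //; apply: PlatMn|apply/PlatMn/PlatN]|exact: (opwtE H)|].
apply: wtZ; apply: wt_X => //; [exact: PlatN|by apply: PlatD => //; apply: PlatMn|exact: (opwtF H)|].
by apply: wtZ; apply: wt_X => //; exact: (opwtE H).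
Qed.

End OneModule.
End Lusztig.

(** * Weyl groups *)

Section Weyl.
Variable D : cartanDatum.
Local Notation I := 'I_(rk D).
Local Notation hdual := 'cV[rat]_(rk D).
Implicit Types (i j t : I) (l m : hdual) (s u d : seq I) (X : {set I}).

Lemma formC l m : form l m = form m l.
Proof.
rewrite /form exchange_big; apply: eq_bigr => i _; apply: eq_bigr => j _.
have := congr1 (fun z : int => z%:~R : rat) (car_sym i j); rewrite !rmorphM /= => h.
by rewrite -[(eps D j)%:R]/((eps D j)%:~R) -h; ring.
Qed.

Lemma formDr l m m' : form l (m + m') = form l m + form l m'.
Proof. by rewrite !formE -big_split; apply: eq_bigr => i _; rewrite pairingD mulrDr. Qed.
Lemma formZr a l m : form l (a *: m) = a * form l m.
Proof. by rewrite !formE mulr_sumr; apply: eq_bigr => i _; rewrite pairingZ mulrCA. Qed.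
Lemma formNr l m : form l (- m) = - form l m.
Proof. by rewrite -scaleN1r formZr mulN1r. Qed.
Lemma formDl l l' m : form (l + l') m = form l m + form l' m.
Proof. by rewrite !(formC _ m) formDr. Qed.
Lemma formZl a l m : form (a *: l) m = a * form l m.
Proof. by rewrite !(formC _ m) formZr. Qed.
Lemma formNl l m : form (- l) m = - form l m.
Proof. by rewrite !(formC _ m) formNr. Qed.
Lemma form0r l : form l 0 = 0.
Proof. by rewrite -(scale0r 0) formZr mul0r. Qed.
Lemma form_alphar l i : form l (alpha i) = (eps D i)%:R * pairing l i.
Proof. by rewrite formC form_alpha. Qed.

Lemma form_refl i l m : form (refl i *m l) (refl i *m m) = form l m.
Proof.
rewrite !refl_mul formDl !formDr !formNl !formNr !formZl !formZr form_alpha form_alphar.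
by rewrite form_alpha pairing_alpha car_ii; ring.
Qed.

Lemma refl_refl i : refl i *m refl i = 1%:M :> 'M[rat]_(rk D).
Proof.
apply: mx_vec_eq => v; rewrite -mulmxA mul1mx !refl_mul pairingD pairingN pairingZ.
by rewrite pairing_alpha car_ii; apply/matrixP => a c; rewrite !mxE; ring.
Qed.

Lemma refl_alpha i : refl i *m alpha i = - alpha i :> hdual.
Proof. by rewrite refl_mul pairing_alpha car_ii; apply/matrixP => a c; rewrite !mxE; ring. Qed.

Lemma wprod_cons i s : wprod (i :: s) = refl i *m wprod s. Proof. by []. Qed.
Lemma wprod_cat s s' : wprod (s ++ s') = wprod s *m wprod s' :> 'M[rat]_(rk D).
Proof. by elim: s => [|i s IH]; rewrite ?mul1mx //= IH mulmxA. Qed.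
Lemma wprod1 i : wprod [:: i] = refl i :> 'M[rat]_(rk D).
Proof. exact: mulmx1. Qed.
Lemma wprod_rcons s i : wprod (rcons s i) = wprod s *m refl i :> 'M[rat]_(rk D).
Proof. by rewrite -cats1 wprod_cat wprod1. Qed.
Lemma wprod_revK s : wprod (rev s) *m wprod s = 1%:M :> 'M[rat]_(rk D).
Proof.
elim: s => [|i s IH]; first by rewrite mul1mx.
by rewrite rev_cons wprod_rcons -mulmxA wprod_cons (mulmxA (refl i)) refl_refl mul1mx.
Qed.
Lemma wprod_Krev s : wprod s *m wprod (rev s) = 1%:M :> 'M[rat]_(rk D).
Proof. by rewrite -{1}[s]revK wprod_revK. Qed.
Lemma wprod_inv s s' : wprod s = wprod s' -> wprod (rev s) = wprod (rev s').
Proof.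
move=> h; rewrite -[LHS]mulmx1 -(wprod_Krev s') -h mulmxA.
by rewrite wprod_revK mul1mx.
Qed.

Lemma form_wprod s l m : form (wprod s *m l) (wprod s *m m) = form l m.
Proof. by elim: s => [|i s IH]; rewrite ?mul1mx //= -!mulmxA form_refl. Qed.

Lemma form_wprodl s l m : form (wprod s *m l) m = form l (wprod (rev s) *m m).
Proof. by rewrite -(form_wprod s l) mulmxA wprod_Krev mul1mx. Qed.

Lemma det_refl i : \det (refl i) = -1 :> rat.
Proof.
rewrite (expand_det_row _ i) (bigD1 i) //= big1 ?addr0 => [|j ji].
  have -> : cofactor (refl i) i i = 1.
    rewrite /cofactor addnn -signr_odd odd_double expr0 mul1r.
    have -> : row' i (col' i (refl i)) = 1%:M :> 'M[rat]_((rk D).-1).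
      apply/matrixP => a c; rewrite !mxE big_ord1 alphaE.
      by rewrite [lift i a == i]eq_sym (negPf (neq_lift i a)) mul0r subr0 (inj_eq lift_inj).
    by rewrite det1.
  by rewrite mulr1 !mxE big_ord1 !mxE !eqxx car_ii.
rewrite /cofactor.
have [c hc] : exists c, lift j c = i by case: (unliftP j i) ji => [c -> _|->]; [exists c|rewrite eqxx].
rewrite (expand_det_col _ c) big1 ?mulr0 // => a _.
by rewrite !mxE hc big_ord1 alphaE eq_sym (negPf (neq_lift i a)) mul0r subr0 mul0r.
Qed.

Lemma det_wprod s : \det (wprod s) = (-1) ^+ size s :> rat.
Proof. by elim: s => [|i s IH] /=; rewrite ?det1 // det_mulmx det_refl IH exprS. Qed.

(** Reflections have determinant -1. This parity replaces the exchange condition in [red_desc]. *)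
Lemma wprod_parity s s' : wprod s = wprod s' -> odd (size s) = odd (size s').
Proof.
move=> /(congr1 (fun x => \det x)); rewrite !det_wprod -signr_odd -[RHS]signr_odd.
by do 2 case: odd.
Qed.

Lemma wprod_int s (z : 'cV[int]_(rk D)) : exists z', wprod s *m Qint z = Qint z'.
Proof.
elim: s => [|i s [z' IH]]; first by exists z; rewrite mul1mx.
exists (z' - (\sum_j car D i j * z' j 0) *: delta_mx i 0).
rewrite /= -mulmxA IH refl_mul; apply/matrixP => a c; rewrite !mxE ord1 rmorphB rmorphM.
rewrite andbT rmorph_sum; congr (_ - _ * _); last by case: eqP.
by apply: eq_bigr => j _; rewrite !mxE rmorphM.
Qed.

Definition nneg l := forall j, 0 <= l j 0.

Lemma nneg_alpha i : nneg (alpha i).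
Proof. by move=> j; rewrite alphaE ler0n. Qed.
Lemma nnegD l m : nneg l -> nneg m -> nneg (l + m).
Proof. by move=> hl hm j; rewrite mxE addr_ge0. Qed.
Lemma nnegZ a l : 0 <= a -> nneg l -> nneg (a *: l).
Proof. by move=> ha hl j; rewrite mxE mulr_ge0. Qed.
Lemma nneg_anti l : nneg l -> nneg (- l) -> l = 0.
Proof.
move=> h h'; apply/matrixP => i j; rewrite [j]ord1 !mxE; apply/eqP.
by rewrite eq_le h andbT; have := h' i; rewrite mxE oppr_ge0.
Qed.
Lemma alpha_neq0 i : alpha i != 0 :> hdual.
Proof. by apply/eqP => /matrixP/(_ i 0); rewrite alphaE !mxE eqxx => /eqP; rewrite oner_eq0. Qed.
Lemma alpha_inj : injective (@alpha D).
Proof.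
by move=> i j /matrixP/(_ i 0); rewrite !alphaE eqxx; case: eqP => // _ /eqP; rewrite oner_eq0.
Qed.
Lemma wprod_neq0 s l : l != 0 -> wprod s *m l != 0.
Proof.
apply: contra_neq => h; by rewrite -[l]mul1mx -(wprod_revK s) -mulmxA h mulmx0.
Qed.
Lemma root_neq0 s j : wprod s *m alpha j != 0.
Proof. exact/wprod_neq0/alpha_neq0. Qed.

Lemma red_ex s : exists2 s', reduced s' & wprod s' = wprod s.
Proof.
pose P n := `[< exists2 s', size s' = n & wprod s' = wprod s >].
have ex : exists n, P n by exists (size s); apply/asboolP; exists s.
case: (ex_minnP ex) => n /asboolP[s' sz e] hmin; exists s' => // s2 e2.
by rewrite sz; apply: hmin; apply/asboolP; exists s2; rewrite // e2.
Qed.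

Lemma redwordP s : reduced (redword (wprod s)) /\ wprod (redword (wprod s)) = wprod s.
Proof.
have [s' h e] := red_ex s.
exact: (xgetPex [::] (ex_intro (fun x => [set s0 | reduced s0 /\ wprod s0 = wprod s]%classic x) s' (conj h e))).
Qed.

Lemma red_size s s' : reduced s -> reduced s' -> wprod s = wprod s' -> size s = size s'.
Proof. by move=> h h' e; apply/eqP; rewrite eqn_leq h // h'. Qed.

Lemma red_same s s' : reduced s -> wprod s' = wprod s -> (size s' <= size s)%N -> reduced s'.
Proof. by move=> h e hs s2 e2; apply: leq_trans hs _; apply: h; rewrite e2. Qed.

Lemma red_mid s1 s2 s3 : reduced (s1 ++ s2 ++ s3) -> reduced s2.
Proof.
move=> h s e; have := h (s1 ++ s ++ s3); rewrite !wprod_cat e => /(_ erefl).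
by rewrite !size_cat leq_add2l leq_add2r.
Qed.

Lemma red_catl s1 s2 : reduced (s1 ++ s2) -> reduced s1.
Proof. by move=> h; apply: (@red_mid [::] s1 s2). Qed.
Lemma red_catr s1 s2 : reduced (s1 ++ s2) -> reduced s2.
Proof. by move=> h; apply: (@red_mid s1 s2 [::]); rewrite cats0. Qed.
Lemma red_rconsl s j : reduced (rcons s j) -> reduced s.
Proof. by rewrite -cats1; apply: red_catl. Qed.

Lemma red_rev s : reduced s -> reduced (rev s).
Proof.
move=> h s' e; rewrite size_rev -(size_rev s'); apply: h.
by rewrite (wprod_inv e) revK.
Qed.

(** Multiplication by a simple reflection changes the length by at most one and, by parity, does
    change it; so if [rcons s j] is not reduced, the length drops by one. *)
Lemma red_desc s j : reduced s -> ~ reduced (rcons s j) ->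
  exists s', [/\ reduced (rcons s' j), wprod (rcons s' j) = wprod s & size s = (size s').+1].
Proof.
move=> hs nr; have [s' hs' e] := red_ex (rcons s j).
have e2 : wprod (rcons s' j) = wprod s.
  by rewrite wprod_rcons e wprod_rcons -mulmxA refl_refl mulmx1.
have le1 : (size s <= (size s').+1)%N by rewrite -(size_rcons s' j); apply: hs.
have le2 : (size s' <= (size s).+1)%N by rewrite -(size_rcons s j); apply: hs'.
have ne : size s' != (size s).+1.
  apply: contra_notN nr => /eqP h; apply: (red_same hs'); by rewrite ?size_rcons ?h.
have := wprod_parity e2; rewrite size_rcons /= => hp.
have sz : size s = (size s').+1.
  apply/eqP; rewrite eqn_leq le1 /= ltn_neqAle; apply/andP; split.
    by apply/negP => /eqP h; move: hp; rewrite h; case: odd.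
  by move: le2; rewrite leq_eqVlt (negPf ne).
exists s'; split=> //; by apply: (red_same hs); rewrite ?size_rcons ?sz.
Qed.

Lemma red_nrep s1 s2 j : ~ reduced (s1 ++ [:: j, j & s2]).
Proof.
move=> h; have := h (s1 ++ s2); rewrite !wprod_cat /= (mulmxA (refl j)) refl_refl mul1mx.
by move=> /(_ erefl); rewrite !size_cat /= leq_add2l => /ltnW; rewrite ltnn.
Qed.

(** Letters j and t are stripped from the right end as long as the length drops. The remaining u is
    the shortest element of its coset modulo the dihedral group, which later makes u(alpha_j) and
    u(alpha_t) positive. *)
Lemma dih_dec j t s : reduced s -> exists u, exists d,
  [/\ {subset d <= [:: j; t]}, reduced (u ++ d), wprod (u ++ d) = wprod s,
      reduced (rcons u j) & reduced (rcons u t)].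
Proof.
have [n] := ubnP (size s); elim: n s => // n IH s; rewrite ltnS => hn hs.
have step r : r \in [:: j; t] -> ~ reduced (rcons s r) -> exists u, exists d,
  [/\ {subset d <= [:: j; t]}, reduced (u ++ d), wprod (u ++ d) = wprod s,
      reduced (rcons u j) & reduced (rcons u t)].
  move=> hr nr; have [s' [h1 h2 h3]] := red_desc hs nr.
  have [|u [d [hd hud e uj ut]]] := IH s' _ (red_rconsl h1); first by rewrite -h3.
  exists u, (rcons d r); split=> //.
  - by move=> x; rewrite mem_rcons inE => /orP[/eqP ->|/hd].
  - rewrite -rcons_cat; apply: (red_same h1); first by rewrite !wprod_rcons e.
    by rewrite !size_rcons (red_size hud (red_rconsl h1) e).
  by rewrite -rcons_cat wprod_rcons e -wprod_rcons.
have [hj|] := pselect (reduced (rcons s j)); last by apply: step; rewrite inE eqxx.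
have [ht|] := pselect (reduced (rcons s t)); last by apply: step; rewrite !inE eqxx orbT.
by exists s, [::]; rewrite cats0.
Qed.

Section Rank2.
Variables j t : I.
Hypothesis jt : j != t.
Local Notation a := (car D j t).
Local Notation a' := (car D t j).

Definition lt2 (b : bool) := if b then j else t.

Fixpoint balt (b : bool) n : seq bool := if n is n'.+1 then rcons (balt (~~ b) n') b else [::].

(** The order of the product of two simple reflections, read off from a_jt a_tj; in finite type the
    last branch is met only for the value 3. *)
Definition cox (a a' : int) : nat :=
  match absz (a * a') with 0%N => 2 | 1%N => 3 | 2%N => 4 | _ => 6 end.

Lemma size_balt b n : size (balt b n) = n.
Proof. by elim: n b => //= n IH b; rewrite size_rcons IH. Qed.

Lemma rank2_cases : [\/ a = 0 /\ a' = 0, a = -1 /\ a' = -1,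
   (a = -1 /\ a' = -2) \/ (a = -2 /\ a' = -1) | (a = -1 /\ a' = -3) \/ (a = -3 /\ a' = -1)].
Proof.
have [_ hz _ _ _] := cartanP D.
have [ha h0] := hz _ _ jt.
have [ha' h0'] : a' <= 0 /\ (a' = 0 -> a = 0) by apply: hz; rewrite eq_sym.
have hs := car_sym j t; have ej := eps_gt0 j; have et := eps_gt0 t.
(* The square length of this vector is 2 eps_t (4 - a a'), so positivity bounds a a' by 3. *)
pose v : hdual := (a%:~R) *: alpha j - 2 *: alpha t.
have v0 : v != 0.
  apply/eqP => /matrixP/(_ t 0); rewrite !mxE !eqxx andbT [t == j]eq_sym (negPf jt) /=.
  by rewrite mulr0 add0r mulr1 => /eqP; rewrite oppr_eq0 pnatr_eq0.
have := form_pos v0.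
have -> : form v v = ((2 * (eps D t)%:Z * (4 - a * a')))%:~R.
  rewrite /v formDl !formDr !formNl !formNr !formZl !formZr !form_alpha !pairing_alpha !car_ii.
  have e2 : (eps D j)%:R * a%:~R = (eps D t)%:R * a'%:~R :> rat.
    by have := congr1 (fun z : int => z%:~R : rat) hs; rewrite !rmorphM /=.
  rewrite !rmorphM rmorphB rmorphM /=.
  transitivity (2 * a%:~R * ((eps D j)%:R * a%:~R) - 2 * a%:~R * ((eps D j)%:R * a%:~R) - 2 * a%:~R * ((eps D t)%:R * a'%:~R) + 8 * (eps D t)%:R : rat); first by ring.
  by rewrite e2 -[((eps D t)%:Z)%:~R]/((eps D t)%:R : rat); ring.
rewrite ltr0z => hp.
have hp2 : a * a' < 4 by nia.
have : a = 0 /\ a' = 0 \/ a < 0 /\ a' < 0.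
  case: (eqVneq a 0) => [e|ne]; [left|right].
    by split=> //; apply: h0.
  split; first by lia.
  rewrite lt_neqAle ha' andbT; apply/eqP => e; case/eqP: ne; exact: h0'.
case=> [|[l1 l2]]; first by constructor 1.
have : a >= -3 by nia. have : a' >= -3 by nia. move=> b1 b2.
have : (a = -1 \/ a = -2 \/ a = -3) by lia. have : (a' = -1 \/ a' = -2 \/ a' = -3) by lia.
case=> [e1|[e1|e1]] [e|[e|e]]; try (exfalso; nia); rewrite e e1;
  first [by constructor 2 | by constructor 3; left | by constructor 3; right
        | by constructor 4; left | by constructor 4; right].
Qed.

Lemma refl_pairj x y l : refl j *m (l + x *: alpha j + y *: alpha t) =
  l + (- x - pairing l j - a%:~R * y) *: alpha j + y *: alpha t.
Proof.
rewrite refl_mul !pairingD !pairingZ !pairing_alpha car_ii.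
by apply/matrixP => r c; rewrite !mxE; ring.
Qed.
Lemma refl_pairt x y l : refl t *m (l + x *: alpha j + y *: alpha t) =
  l + x *: alpha j + (- y - pairing l t - a'%:~R * x) *: alpha t.
Proof.
rewrite refl_mul !pairingD !pairingZ !pairing_alpha car_ii.
by apply/matrixP => r c; rewrite !mxE; ring.
Qed.

(* action of the dihedral group on the coordinates in l + Z alpha_j + Z alpha_t,
   where p = l(h_j) and r = l(h_t) *)
Definition aw (R : pzRingType) (a a' p r : R) (s : seq bool) (z : R * R) : R * R :=
  foldr (fun b z => if b then (- z.1 - p - a * z.2, z.2) else (z.1, - z.2 - r - a' * z.1)) z s.

Lemma wprod_aw (s : seq bool) l x y :
  wprod (map lt2 s) *m (l + x *: alpha j + y *: alpha t) =
  l + (aw a%:~R a'%:~R (pairing l j) (pairing l t) s (x, y)).1 *: alpha j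
    + (aw a%:~R a'%:~R (pairing l j) (pairing l t) s (x, y)).2 *: alpha t.
Proof.
elim: s => [|b s IH]; first by rewrite mul1mx.
by rewrite /= -mulmxA IH; case: b; rewrite /= ?refl_pairj ?refl_pairt.
Qed.

Lemma wprod_awz (s : seq bool) (x y : int) :
  wprod (map lt2 s) *m (x%:~R *: alpha j + y%:~R *: alpha t) =
  (aw a a' 0 0 s (x, y)).1%:~R *: alpha j + (aw a a' 0 0 s (x, y)).2%:~R *: alpha t.
Proof.
rewrite -[X in _ *m X]add0r addrA wprod_aw !pairing0 add0r.
suff -> : aw (a%:~R : rat) a'%:~R 0 0 s (x%:~R, y%:~R) =
  ((aw a a' 0 0 s (x, y)).1%:~R, (aw a a' 0 0 s (x, y)).2%:~R) by [].
by elim: s => [|b s IH] //=; rewrite IH; case: b; rewrite /= !subr0 !rmorphB !rmorphN rmorphM.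
Qed.

Lemma braid_wprod : wprod (map lt2 (balt true (cox a a'))) = wprod (map lt2 (balt false (cox a a'))).
Proof.
apply: mx_vec_eq => l; have h (s : seq bool) := wprod_aw s l 0 0.
move: h; rewrite !scale0r !addr0 => h; rewrite !h {h}.
set p := pairing l j; set r := pairing l t.
by case: rank2_cases => [[-> ->]|[-> ->]|[[-> ->]|[-> ->]]|[[-> ->]|[-> ->]]];
  rewrite /cox /=; congr (_ + _ *: _ + _ *: _); ring.
Qed.

(** Checked in each rank two type on the coordinates [aw]. The second clause says that both simple
    roots really occur in the image except at the two extreme lengths; [Ts_simple] depends on it. *)
Lemma balt_pos n : (n < cox a a')%N -> exists x y : nat,
  [/\ wprod (map lt2 (balt false n)) *m alpha j = x%:R *: alpha j + y%:R *: alpha t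
    & (x = 0)%N \/ (y = 0)%N -> (n == 0) || (n == (cox a a').-1)%N].
Proof.
move=> hn.
have := wprod_awz (balt false n) 1 0; rewrite scale0r addr0 scale1r => ->.
suff [h1 h2] : (0 <= (aw a a' 0 0 (balt false n) (1, 0)).1) /\ (0 <= (aw a a' 0 0 (balt false n) (1, 0)).2).
  exists (absz (aw a a' 0 0 (balt false n) (1, 0)).1), (absz (aw a a' 0 0 (balt false n) (1, 0)).2).
  split; first by rewrite -[in LHS](gez0_abs h1) -[in LHS](gez0_abs h2).
  move: hn {h1 h2}; case: n => [|[|[|[|[|[|n]]]]]];
    by case: rank2_cases => [[-> ->]|[-> ->]|[[-> ->]|[-> ->]]|[[-> ->]|[-> ->]]] //= _ [].
move: hn; case: n => [|[|[|[|[|[|n]]]]]];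
  by case: rank2_cases => [[-> ->]|[-> ->]|[[-> ->]|[-> ->]]|[[-> ->]|[-> ->]]].
Qed.

Lemma balt_top : wprod (map lt2 (balt false (cox a a').-1)) *m alpha j =
  alpha (if odd (cox a a') then t else j).
Proof.
have := wprod_awz (balt false (cox a a').-1) 1 0; rewrite scale0r addr0 scale1r => ->.
by case: rank2_cases => [[-> ->]|[-> ->]|[[-> ->]|[-> ->]]|[[-> ->]|[-> ->]]]; rewrite /cox /=
  ?scale0r ?scale1r ?addr0 ?add0r.
Qed.

End Rank2.

Lemma lt2_sym j t b : lt2 t j b = lt2 j t (~~ b). Proof. by case: b. Qed.
Lemma balt_neg b n : map negb (balt b n) = balt (~~ b) n.
Proof. by elim: n b => //= n IH b; rewrite map_rcons IH. Qed.
Lemma cox_sym (a a' : int) : cox a a' = cox a' a.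
Proof. by rewrite /cox mulrC. Qed.
Lemma map_lt2_sym j t b n : map (lt2 t j) (balt b n) = map (lt2 j t) (balt (~~ b) n).
Proof. by rewrite -balt_neg -map_comp; apply: eq_map => c; apply: lt2_sym. Qed.

Lemma red_balt j t d : {subset d <= [:: j; t]} -> reduced d ->
  exists b, d = map (lt2 j t) (balt b (size d)).
Proof.
elim/last_ind: d => [|d x IH] hd hr; first by exists true.
have [||b eb] := IH; first by move=> y hy; apply: hd; rewrite mem_rcons inE hy orbT.
  exact: red_rconsl hr.
have : x \in [:: j; t] by apply: hd; rewrite mem_rcons mem_head.
rewrite size_rcons; case: (lastP d) hd hr eb IH => [|d' y] hd hr eb _.
  by rewrite !inE => /orP[] /eqP ->; [exists true|exists false].
have yb : y = lt2 j t b.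
  by move: eb; rewrite size_rcons /= map_rcons => /rcons_inj[].
have xy : x != y.
  by apply: contra_notN (@red_nrep d' [::] y) => /eqP h; move: hr; rewrite h -!cats1 -catA.
move=> hx; exists (~~ b); rewrite /= map_rcons negbK -eb; congr rcons.
by move: hx xy; rewrite yb !inE => /orP[] /eqP ->; case: b {eb yb} => /=; rewrite ?eqxx.
Qed.

(** Among cox + 1 alternating letters the first cox form a longest dihedral word. Replaced by the
    other longest word, it ends in the remaining letter, and the two cancel. *)
Lemma red_balt_size j t b n : j != t -> reduced (map (lt2 j t) (balt b n)) ->
  (n <= cox (car D j t) (car D t j))%N.
Proof.
move=> jt hr; rewrite leqNgt; apply/negP => hn.
set c := cox _ _ in hn.
have c0 : exists c', c = c'.+1 by rewrite /c /cox; case: absz => [|[|[|?]]]; eexists.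
have [c' ec] := c0.
have sub : forall n1 b1, (c < n1)%N -> reduced (map (lt2 j t) (balt b1 n1)) ->
    exists b2, reduced (map (lt2 j t) (balt b2 c.+1)).
  elim=> // n1 IH b1; rewrite ltnS leq_eqVlt => /orP[/eqP <-|h]; first by exists b1.
  by rewrite /= map_rcons => /red_rconsl; apply: IH.
have [b2 h2] := sub _ _ hn hr.
have e : wprod (map (lt2 j t) (balt (~~ b2) c)) = wprod (map (lt2 j t) (balt b2 c)).
  by case: b2 {h2}; rewrite /= (braid_wprod jt).
have := h2 (map (lt2 j t) (balt (~~ b2) c')).
have -> : wprod (map (lt2 j t) (balt b2 c.+1)) = wprod (map (lt2 j t) (balt (~~ b2) c')).
  by rewrite /= map_rcons wprod_rcons e ec /= map_rcons wprod_rcons -mulmxA refl_refl mulmx1.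
by move=> /(_ erefl); rewrite !size_map !size_balt ec; lia.
Qed.

Lemma dih_end j t d : j != t -> {subset d <= [:: j; t]} -> reduced (rcons d j) ->
  d = map (lt2 j t) (balt false (size d)) /\ (size d < cox (car D j t) (car D t j))%N.
Proof.
move=> jt hd hr; have [|b eb] := @red_balt j t (rcons d j) _ hr.
  by move=> x; rewrite mem_rcons inE => /orP[/eqP ->|/hd //]; rewrite inE eqxx.
have hr2 := hr; rewrite eb size_rcons in hr2; split; last exact: red_balt_size hr2.
rewrite size_rcons /= map_rcons in eb; have [ed ej] := rcons_inj eb.
by case: b ej ed {eb hr2} => //= h; rewrite h eqxx in jt.
Qed.

(** For reduced [rcons s j], write s = u d with d in the dihedral group of j and the last letter t
    of s. Then d is a nonempty alternating word ending in t, and u is shorter, with u s_j and u s_t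
    both reduced. Positivity of roots and the description of T_s(E_j) are proved along this
    induction. *)
Lemma pos_ind (P : seq I -> I -> Prop) :
  (forall j, P [::] j) ->
  (forall s u j t n, let d := map (lt2 j t) (balt false n.+1) in
     j != t -> (n.+1 < cox (car D j t) (car D t j))%N ->
     reduced (rcons s j) -> reduced (u ++ d) -> wprod (u ++ d) = wprod s ->
     reduced (rcons u j) -> reduced (rcons u t) -> P u j -> P u t -> P s j) ->
  forall s j, reduced (rcons s j) -> P s j.
Proof.
move=> h0 hS s j; have [n] := ubnP (size s); elim: n s j => // n IH s j; rewrite ltnS => hn hr.
case: (lastP s) hn hr => [|s' t] hn hr; first exact: h0.
have tj : j != t.
  by apply: contra_notN (@red_nrep s' [::] j) => /eqP h; move: hr; rewrite -h -!cats1 -catA.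
have hs := red_rconsl hr.
have [u [d [hd hud e uj ut]]] := dih_dec j t hs.
have d0 : d != [::].
  apply/eqP => d0; move: ut e hud; rewrite d0 cats0 => ut e hud.
  have := ut s'; rewrite wprod_rcons e wprod_rcons -mulmxA refl_refl mulmx1 => /(_ erefl).
  by rewrite size_rcons (red_size hud hs e) size_rcons; lia.
have hudj : reduced (u ++ rcons d j).
  rewrite -rcons_cat; apply: (red_same hr); first by rewrite wprod_rcons e -wprod_rcons.
  by rewrite !size_rcons (red_size hud hs e) size_rcons.
have [ed hsz] := dih_end tj hd (red_catr hudj).
have := red_size hud hs e; move: hn; rewrite size_cat => hn h.
case: (size d) ed hsz h => [ed|m ed hsz h]; first by rewrite ed in d0.
rewrite ed in hud e; apply: (hS _ u j t m) => //; apply: IH => //; lia.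
Qed.

Lemma pos_root s j : reduced (rcons s j) -> nneg (wprod s *m alpha j).
Proof.
apply: (pos_ind (P := fun s j => nneg (wprod s *m alpha j))) => {s j}.
  by move=> j; rewrite mul1mx; apply: nneg_alpha.
move=> s u j t n d jt hn _ _ <- _ _ hj ht.
have [x [y [exy _]]] := balt_pos jt hn.
by rewrite wprod_cat -mulmxA exy mulmxDr -!scalemxAr; apply: nnegD; apply: nnegZ.
Qed.

End Weyl.

Section Weyl.
Variable D : cartanDatum.
Local Notation I := 'I_(rk D).
Local Notation hdual := 'cV[rat]_(rk D).
Implicit Types (i j : I) (l m : hdual) (s u d : seq I) (X : {set I}).

Lemma root_rcons s j : wprod (rcons s j) *m alpha j = - (wprod s *m alpha j).
Proof. by rewrite wprod_rcons -mulmxA refl_alpha mulmxN. Qed.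

Lemma root_sign s j : nneg (wprod s *m alpha j) \/ nneg (- (wprod s *m alpha j)).
Proof.
have [s' hs' <-] := red_ex s; have [h|h] := pselect (reduced (rcons s' j)).
  by left; apply: pos_root.
have [s2 [h2 <- _]] := red_desc hs' h; right.
by rewrite root_rcons opprK; apply: pos_root.
Qed.

Lemma fund_weight X : exists om : hdual, forall i, pairing om i = (i \notin X)%:R.
Proof.
pose A : 'M[rat]_(rk D) := map_mx intr (car D).
have uA : A \in unitmx.
  by rewrite unitmxE det_map_mx unitfE intr_eq0 -absz_eq0 -lt0n ddet_gt0.
exists (invmx A *m \col_i (i \notin X)%:R) => i.
have -> : pairing (invmx A *m \col_i (i \notin X)%:R) i = (A *m (invmx A *m \col_i (i \notin X)%:R)) i 0.
  by rewrite mxE; apply: eq_bigr => j _; rewrite [A i j]mxE.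
by rewrite mulKVmx // mxE.
Qed.

Lemma wprod_fund om s : reduced s -> (forall i, 0 <= pairing om i) -> nneg (om - wprod s *m om).
Proof.
elim/last_ind: s => [|s j IH] hr ho; first by rewrite mul1mx subrr => i; rewrite mxE.
rewrite wprod_rcons -mulmxA refl_mul mulmxBr -scalemxAr opprB addrA addrAC.
apply: nnegD; first exact: IH (red_rconsl hr) ho.
by apply: nnegZ => //; apply: pos_root.
Qed.

(** Take a dominant om that vanishes exactly on the h_i with i in X. It is fixed by W_X, while om -
    w(om) is a sum of nonnegative terms, one per letter of a reduced word of w, and a letter outside
    X makes its term nonzero. *)
Lemma red_letters X s s' : {subset s <= X} -> reduced s' -> wprod s' = wprod s ->
  {subset s' <= X}.
Proof.
move=> hs hr e; have [om hom] := fund_weight X.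
have ho i : 0 <= pairing om i by rewrite hom ler0n.
have fix_s : wprod s *m om = om.
  elim: s hs {e} => [|i s IH] hs; first by rewrite mul1mx.
  rewrite /= -mulmxA IH => [|x hx]; last by apply: hs; rewrite inE hx orbT.
  by rewrite refl_mul hom hs ?mem_head // scale0r subr0.
have : wprod s' *m om = om by rewrite e.
elim/last_ind: s' hr {e} => [|s' j IH] hr // e x.
have h1 := wprod_fund (red_rconsl hr) ho.
have h2 := pos_root hr.
move: e; rewrite wprod_rcons -mulmxA refl_mul mulmxBr -scalemxAr => e.
have e2 : om - wprod s' *m om = - (pairing om j *: (wprod s' *m alpha j)) by rewrite -[X in X - _]e addrAC subrr add0r.
have z : om - wprod s' *m om = 0.
  by apply: nneg_anti => //; rewrite e2 opprK; apply: nnegZ.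
move: e2; rewrite z => /esym/eqP; rewrite oppr_eq0 scaler_eq0 (negPf (root_neq0 _ _)) orbF hom.
rewrite mem_rcons inE pnatr_eq0 eqb0 negbK => jX /orP[/eqP -> //|].
by apply: (IH (red_rconsl hr)); apply/eqP; rewrite eq_sym -subr_eq0 z.
Qed.

Lemma weyl_one X s : reduced s -> {subset s <= X} ->
  (forall j, j \in X -> nneg (wprod s *m alpha j)) -> s = [::].
Proof.
case: (lastP s) => // s' j hr hs hp; have := hp j; rewrite hs ?mem_rcons ?mem_head // => /(_ isT).
rewrite root_rcons => h; have := root_neq0 s' j.
by rewrite (nneg_anti (pos_root hr) h) eqxx.
Qed.

Lemma weyl_one_mx X s : {subset s <= X} ->
  (forall j, j \in X -> nneg (wprod s *m alpha j)) -> wprod s = 1%:M.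
Proof.
move=> hs hp; have [s' hr e] := red_ex s.
by rewrite -e (weyl_one hr (red_letters hs hr e)) // => j jX; rewrite e; apply: hp.
Qed.

Definition lword X := redword (longest X).

Lemma longest_weyl X : weyl X (longest X).
Proof.
rewrite /longest; case: xgetP => [w -> []//|_]; by exists [::].
Qed.

Lemma lwordP X : [/\ reduced (lword X), wprod (lword X) = longest X & {subset lword X <= X}].
Proof.
have [s hs e] := longest_weyl X; rewrite /lword e; have [h1 h2] := redwordP s.
by split=> //; apply: red_letters hs h1 h2.
Qed.

Section Diagram.
Variable g : {perm I}.
Hypothesis hg : forall i j, car D (g i) (g j) = car D i j.
Lemma diag_pairing l i : pairing (diagram g l) (g i) = pairing l i.
Proof.
rewrite /pairing (reindex_inj (@perm_inj _ g)); apply: eq_bigr => j _.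
by rewrite hg mxE permK.
Qed.
Lemma diag_alpha i : diagram g (alpha i) = alpha (g i) :> hdual.
Proof.
apply/matrixP => a b; rewrite !mxE [b]ord1 eqxx !andbT; congr (_%:R).
by rewrite -(inj_eq (@perm_inj _ g)) permKV.
Qed.
Lemma diag_lin a l m : diagram g (a *: l + m) = a *: diagram g l + diagram g m.
Proof. by apply/matrixP => i b; rewrite !mxE. Qed.
Lemma diagN l : diagram g (- l) = - diagram g l.
Proof. by apply/matrixP => i b; rewrite !mxE. Qed.
Lemma diag_wprod s l : diagram g (wprod s *m l) = wprod (map g s) *m diagram g l.
Proof.
elim: s => [|i s IH]; first by rewrite /= !mul1mx.
rewrite /= -!mulmxA !refl_mul -IH diag_pairing addrC -scaleNr diag_lin diag_alpha addrC.
by rewrite scaleNr.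
Qed.
Lemma diag_form l m : (forall i, eps D (g i) = eps D i) -> form (diagram g l) (diagram g m) = form l m.
Proof.
move=> he; rewrite !formE (reindex_inj (@perm_inj _ g)); apply: eq_bigr => i _.
by rewrite he diag_pairing mxE permK.
Qed.
End Diagram.

Section Longest.
Variables (X : {set I}) (t : {perm I}).
Hypothesis tX : forall j, j \in X -> t j \in X.
Hypothesis hL : forall j, j \in X -> longest X *m alpha j = - alpha (t j).

Lemma longest2 : longest X *m longest X = 1%:M.
Proof.
have [_ e hl] := lwordP X; rewrite -e -wprod_cat.
apply: (@weyl_one_mx X) => [i|j jX]; first by rewrite mem_cat => /orP[] /hl.
by rewrite wprod_cat e -mulmxA hL // mulmxN hL ?tX // opprK; apply: nneg_alpha.
Qed.

Lemma longest_tt j : j \in X -> t (t j) = j.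
Proof.
move=> jX; apply: alpha_inj; rewrite -[RHS]mul1mx -longest2 -mulmxA hL //.
by rewrite mulmxN hL ?tX // opprK.
Qed.

Lemma rev_longest s : wprod s = longest X -> wprod (rev s) = wprod s.
Proof.
by move=> e; rewrite -[LHS]mulmx1 -longest2 -e mulmxA wprod_revK mul1mx.
Qed.

Lemma longest_form l m : form (longest X *m l) (longest X *m m) = form l m.
Proof. by have [_ <- _] := lwordP X; apply: form_wprod. Qed.

(** The product of g(w_X) and w_X maps the simple roots of X to positive roots, so it is 1; since
    w_X is an involution, g(w_X) = w_X. *)
Lemma lword_diag (g : {perm I}) : (forall i j, car D (g i) (g j) = car D i j) ->
  (forall j, (g j \in X) = (j \in X)) ->
  wprod (map g (lword X)) = wprod (lword X) /\ reduced (map g (lword X)).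
Proof.
move=> hg gX; have [hr e hl] := lwordP X.
have lk x : x \in map g (lword X) -> x \in X by case/mapP => y /hl yX ->; rewrite gX.
have hone : wprod (map g (lword X) ++ lword X) = 1%:M.
  apply: (@weyl_one_mx X) => [i|j jX]; first by rewrite mem_cat => /orP[/lk|/hl].
  rewrite wprod_cat -mulmxA e hL // mulmxN.
  have -> : alpha (t j) = diagram g (alpha (g^-1%g (t j))) :> hdual by rewrite diag_alpha permKV.
  rewrite -diag_wprod // e hL; last by rewrite -gX permKV tX.
  by rewrite diagN diag_alpha opprK; apply: nneg_alpha.
have e1 : wprod (map g (lword X)) = wprod (lword X).
  rewrite -(rev_longest e) -[LHS]mulmx1 -(wprod_Krev (lword X)) mulmxA -wprod_cat hone.
  by rewrite mul1mx.
by split=> //; apply: (red_same hr); rewrite ?size_map.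
Qed.

(** For reduced s, the positive roots that [wprod s] makes negative. *)
Fixpoint betas s : seq hdual :=
  if s is a :: s' then (wprod (rev s') *m alpha a) :: betas s' else [::].

Lemma betasP s b : b \in betas s -> exists p c r,
  s = p ++ c :: r /\ b = wprod (rev r) *m alpha c.
Proof.
elim: s => //= a s IH; rewrite inE => /orP[/eqP ->|/IH[p [c [r [-> ->]]]]].
  by exists [::], a, s.
by exists (a :: p), c, r.
Qed.

Lemma betas_uniq s : reduced s -> uniq (betas s).
Proof.
elim: s => //= a s IH hr; rewrite (IH (red_catr (s1 := [:: a]) hr)) andbT.
apply/negP => /betasP[p [c [r [es h]]]].
have : wprod s *m (wprod (rev s) *m alpha a) = alpha a by rewrite mulmxA wprod_Krev mul1mx.
rewrite h {1}es wprod_cat wprod_cons -!mulmxA [wprod r *m _]mulmxA wprod_Krev mul1mx.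
rewrite refl_alpha mulmxN => h2.
have hp : reduced (rcons p c).
  by move: hr; rewrite es -cat_rcons -cat_cons => /red_catl/(red_catr (s1 := [:: a])).
have := nneg_alpha a; rewrite -h2 => h3.
by have := root_neq0 p c; rewrite (nneg_anti (pos_root hp) h3) eqxx.
Qed.

(** Read s from the right: the positive root g turns negative at some letter a, and the only
    positive root made negative by that reflection is alpha_a. *)
Lemma betas_in s g u i : g = wprod u *m alpha i -> nneg g -> nneg (- (wprod s *m g)) ->
  g \in betas s.
Proof.
move=> eg hg; elim: s => [|a s IH].
  rewrite mul1mx => h; have := root_neq0 u i; rewrite -eg (nneg_anti hg h) eqxx //.
move=> h; rewrite inE; apply/orP.
have ed : wprod s *m g = wprod (s ++ u) *m alpha i by rewrite eg mulmxA wprod_cat.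
case: (root_sign (s ++ u) i); rewrite -ed => hd; last by right; apply: IH.
left; move: ed hd; set de := wprod s *m g => ed hd.
suff e : de = alpha a by rewrite -e /de mulmxA wprod_revK mul1mx.
have h' : nneg (- (refl a *m de)) by move: h; rewrite /= -mulmxA.
have dz j : j != a -> de j 0 = 0.
  move=> ja; apply/eqP; rewrite eq_le hd andbT -oppr_ge0.
  by have := h' j; rewrite refl_mul !mxE (negPf ja) mulr0 subr0.
have dc : de = de a 0 *: alpha a.
  move: dz; clearbody de => dz; apply/matrixP => x y; rewrite [y]ord1 !mxE eqxx andbT.
  by case: eqP => [->|/eqP/dz ->]; rewrite ?mulr1 ?mulr0.
(* The root is known to be a multiple of alpha_a. It is integral, and so is the image of alpha_a
   under the inverse element, so the factor is a unit of Z; by positivity it is 1. *)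
have [z ez] := wprod_int (s ++ u) (delta_mx i 0); rewrite Qint_delta -ed in ez.
have [z' ez'] := wprod_int (rev (s ++ u)) (delta_mx a 0); rewrite Qint_delta in ez'.
have h1 : (z a 0 * z' i 0)%:~R = 1 :> rat.
  have := congr1 (mulmx (wprod (rev (s ++ u)))) ed.
  rewrite [RHS]mulmxA wprod_revK mul1mx dc -scalemxAr ez' ez => /matrixP/(_ i 0).
  by rewrite alphaE eqxx !mxE rmorphM.
have h2 : 0 <= z a 0 by have := hd a; rewrite ez mxE ler0z.
have h3 : z a 0 * z' i 0 = 1 by apply: (@intr_inj rat); rewrite h1.
have h4 : z a 0 = 1.
  have /eqP := congr1 absz h3; rewrite abszM muln_eq1 => /andP[/eqP h5 _].
  by rewrite -(gez0_abs h2) h5.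
by rewrite dc ez mxE h4 scale1r.
Qed.

Lemma betas_nneg s b : reduced s -> b \in betas s -> nneg b.
Proof.
move=> hr /betasP[p [c [r [es ->]]]]; apply: pos_root.
by rewrite -rev_cons; apply: red_rev; move: hr; rewrite es => /red_catr.
Qed.

(** A positive root of X is a nonnegative combination of the alpha_j with j in X, and w_X negates
    all of these, so the root is an inversion of w_X. This makes the sums in rho_X computable along
    [lword X]. *)
Lemma posrootE b : posroot X b <-> b \in betas (lword X).
Proof.
have [hr e hl] := lwordP X; split.
  move=> [[w [i [[s hs ->] iX eb]] hb]].
  apply: (betas_in eb) => //; rewrite e.
  have pX : exists p : I -> rat, [/\ forall j, 0 <= p j & b = \sum_(j in X) p j *: alpha j].
    exists (fun j => b j 0); split=> //.
    apply/matrixP => x y; rewrite [y]ord1 summxE.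
    have bz j : j \notin X -> b j 0 = 0.
      move=> jX; rewrite eb; clear eb hb b.
      suff : forall s l, {subset s <= X} -> (wprod s *m l) j 0 = l j 0.
        by move=> ->//; rewrite alphaE; case: eqP => // h; rewrite h iX in jX.
      elim=> [|a s' IH] l hs'; first by rewrite mul1mx.
      rewrite /= -mulmxA refl_mul [LHS]mxE IH => [|z hz]; last by apply: hs'; rewrite inE hz orbT.
      rewrite [X in _ + X]mxE [X in - X]mxE alphaE; case: eqP => [h|_]; last by rewrite mulr0 subr0.
      by rewrite h hs' ?mem_head in jX.
    case: (boolP (x \in X)) => xX.
      rewrite (bigD1 x) //= big1 ?addr0 => [|j /andP[_ jx]]; rewrite !mxE eqxx ?mulr1 //.
      by rewrite eq_sym (negPf jx) mulr0.
    rewrite bz // big1 // => j jX; rewrite !mxE; case: eqP => [h|_]; last by rewrite mulr0.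
    by rewrite h jX in xX.
  have [p [hp ->]] := pX.
  rewrite mulmx_sumr -sumrN => j; rewrite summxE; apply: sumr_ge0 => a aX.
  by rewrite -scalemxAr hL // scalerN opprK; apply: (nnegZ (hp a) (nneg_alpha _)).
move=> hb; split; last exact: betas_nneg hr hb.
have [p [c [r [es ->]]]] := betasP hb; exists (wprod (rev r)), c; split=> //.
  by exists (rev r) => // x; rewrite mem_rev => xr; apply: hl; rewrite es mem_cat inE xr !orbT.
by apply: hl; rewrite es mem_cat mem_head orbT.
Qed.

Lemma sum_posroot (V : zmodType) (f : hdual -> V) :
  \sum_(b \in posroot X) f b = \sum_(b <- betas (lword X)) f b.
Proof.
have [hr _ _] := lwordP X; apply: fsumE; first exact: betas_uniq.
  by move=> b /posrootE.
by move=> b /posrootE ->.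
Qed.

End Longest.
End Weyl.

(** * Braid relations *)

(** Stands for y = T x T^-1; without the inverse it composes easily and makes sense before T is
    known to be invertible. *)
Definition cj (R : pzSemiRingType) (T x y : R) := T * x = y * T.

Lemma cjM (R : pzRingType) (T x x' y y' : R) : cj T x y -> cj T x' y' -> cj T (x * x') (y * y').
Proof. by rewrite /cj => h h'; rewrite mulrA h -mulrA h' mulrA. Qed.
Lemma cj_comp (R : pzRingType) (T T' x y z : R) : cj T x y -> cj T' y z -> cj (T' * T) x z.
Proof. by rewrite /cj => h h'; rewrite -mulrA h mulrA h' mulrA. Qed.
Lemma cjD (R : pzRingType) (T x x' y y' : R) : cj T x y -> cj T x' y' -> cj T (x + x') (y + y').
Proof. by rewrite /cj mulrDr mulrDl => -> ->. Qed.
Lemma cjN (R : pzRingType) (T x y : R) : cj T x y -> cj T (- x) (- y).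
Proof. by rewrite /cj mulrN mulNr => ->. Qed.
Lemma cjB (R : pzRingType) (T x x' y y' : R) : cj T x y -> cj T x' y' -> cj T (x - x') (y - y').
Proof. by move=> h /cjN; apply: cjD. Qed.
Lemma cjX (R : pzRingType) (T x y : R) m : cj T x y -> cj T (x ^+ m) (y ^+ m).
Proof.
by move=> h; elim: m => [|m IH]; rewrite ?expr0 ?exprS; [rewrite /cj mulr1 mul1r|apply: cjM].
Qed.
Lemma cjZ (R : fieldType) n (a : R) (T x y : 'M[R]_n) : cj T x y -> cj T (a *: x) (a *: y).
Proof. by rewrite /cj scMl scMr => ->. Qed.
Lemma cj_inj (R : fieldType) n (T x y y' : 'M[R]_n) : T \in unitmx -> cj T x y -> cj T x y' -> y = y'.
Proof. by rewrite /cj => hT -> h; rewrite -(mulmxK hT y) -[y *m T]/(y * T) h mulmxK. Qed.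

Lemma cj_ex (R : fieldType) n (T x : 'M[R]_n) : T \in unitmx -> exists y, cj T x y.
Proof.
move=> hT; exists (T *m x *m invmx T).
by rewrite /cj -[RHS]/((T *m x *m invmx T) *m T) mulmxKV.
Qed.

Lemma cjV (R : fieldType) n (T x y : 'M[R]_n) (v : 'cV[R]_n) :
  cj T x y -> T *m (x *m v) = y *m (T *m v).
Proof. by move=> h; rewrite -!mulMV h. Qed.

Lemma dpwS (F : fieldType) (q : F) (V : lmodType F) (g : V -> V) n v :
  (forall n, q ^+ n.+1 != 1) -> q != 0 -> (forall a v, g (a *: v) = a *: g v) ->
  qz q n.+1 *: dpw q g n.+1 v = g (dpw q g n v).
Proof.
move=> qX q0 gZ; rewrite !dpw.unlock gZ scalerA qfactS // invfM mulrCA mulrV ?mulr1 //.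
by rewrite unitfE qzS_neq0.
Qed.

Section OneModule.
Variables (K : fieldType) (D : cartanDatum) (L : fieldExtType (kfield K)) (M : gmod D L).
Local Notation I := 'I_(rk D).
Local Notation hdual := 'cV[rat]_(rk D).
Local Notation n := (udim M).
Local Notation qL := (@qL K D L).
Local Notation Kh h := (act M (uK K h)).
Local Notation E i := (act M (uE K i)).
Local Notation F i := (act M (uF K i)).
Local Notation KM := (fun h => Kh h).
Local Notation opM := (opwt KM).
Local Notation wtM := (wt KM).
Implicit Types (i j t : I) (l b : hdual) (S X : {set I}).
Let H := gmod_wrep M.

(* the operators of the subalgebra generated by the E_i, i in S, graded by weight *)
Inductive G S : hdual -> 'M[L]_n -> Prop :=
| G_zero b : Plat b -> G S b 0
| G_one : G S 0 1
| G_E i : i \in S -> G S (alpha i) (E i)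
| G_lin a b x y : G S b x -> G S b y -> G S b (a *: x + y)
| G_mul b b' x y : G S b x -> G S b' y -> G S (b + b') (x * y).

Lemma GP S b x : G S b x -> Plat b /\ opM b x.
Proof.
elim=> {b x} [b pb||i iS|a b x y _ [pb hx] _ [_ hy]|b b' x y _ [pb hx] _ [pb' hy]].
- by split=> //; apply: opwt0.
- by split; [apply: Plat0|apply: opwt1].
- by split; [apply: Plat_alpha|apply: (opwtE H)].
- by split=> //; apply: opwt_lin.
by split; [apply: PlatD|apply: opwtM].
Qed.

Lemma opwt_uniq b b' x : Plat b -> Plat b' -> b != b' -> opM b x -> opM b' x -> x = 0.
Proof.
move=> hb hb' ne h h'; have [g hg] := Plat_sep K hb hb' ne.
have := h g; rewrite h' => /eqP; rewrite -subr_eq0 -scalerBl scaler_eq0 subr_eq0.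
rewrite (inj_eq (@alg_inj K L)) eq_sym (negPf hg) /= => /eqP e.
by rewrite -[x]mulr1 -(wr_KN H g) mulrA e mul0r.
Qed.

Lemma G_wt S b b' x : G S b x -> Plat b' -> opM b' x -> G S b' x.
Proof.
move=> h pb' h'; have [pb hb] := GP h; case: (eqVneq b b') => [<- //|ne].
by rewrite (opwt_uniq pb pb' ne hb h'); apply: G_zero.
Qed.

Lemma G_Z S b a x : G S b x -> G S b (a *: x).
Proof. by move=> h; rewrite -[_ *: _]addr0; apply: G_lin => //; apply/G_zero; case: (GP h). Qed.
Lemma G_D S b x y : G S b x -> G S b y -> G S b (x + y).
Proof. by rewrite -{2}[x]scale1r; apply: G_lin. Qed.
Lemma G_sub S S' b x : {subset S <= S'} -> G S b x -> G S' b x.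
Proof.
move=> hS; elim=> {b x} [b pb||i /hS iS|a b x y _ hx _ hy|b b' x y _ hx _ hy].
- exact: G_zero.
- exact: G_one.
- exact: G_E.
- exact: G_lin.
exact: G_mul.
Qed.

Definition Ts (s : seq I) : 'M[L]_n := foldr (fun i T => Tfam L i M *m T) 1%:M s.

Lemma Ts_cons i s : Ts (i :: s) = Tm M i * Ts s. Proof. by []. Qed.
Lemma Ts_cat s s' : Ts (s ++ s') = Ts s * Ts s'.
Proof.
elim: s => [|i s IH]; first by rewrite /= -[1%:M]/(1 : 'M[L]_n) mul1r.
by rewrite cat_cons !Ts_cons IH mulrA.
Qed.
Lemma Ts1 i : Ts [:: i] = Tm M i.
Proof. exact: mulmx1. Qed.
Lemma Ts_rcons s i : Ts (rcons s i) = Ts s * Tm M i.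
Proof. by rewrite -cats1 Ts_cat Ts1. Qed.
Lemma Ts_unit s : Ts s \in unitmx.
Proof. by elim: s => [|i s IH]; rewrite ?unitmx1 // Ts_cons unitmx_mul Tm_unit. Qed.
Lemma Ts_wt s l v : Plat l -> wtM l v -> wtM (wprod s *m l) (Ts s *m v) /\ Plat (wprod s *m l).
Proof.
move=> pl hv; elim: s => [|i s [IH IH']]; first by rewrite !mul1mx.
rewrite /= -!mulmxA; split; last exact: Plat_refl.
exact: Tm_wt.
Qed.

Lemma Plat_wprod s l : Plat l -> Plat (wprod s *m l).
Proof. by move=> pl; elim: s => [|i s IH]; rewrite ?mul1mx //= -mulmxA; apply: Plat_refl. Qed.

Lemma cj_opwt s b x y : Plat b -> opM b x -> cj (Ts s) x y -> opM (wprod s *m b) y.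
Proof.
move=> pb hx hc h.
suff e : Kh h * y * Ts s = ((qpow K D (weight_at (wprod s *m b) h))%:A *: (y * Kh h)) * Ts s.
  by have := congr1 (fun z => z *m invmx (Ts s)) e; rewrite !mulmxK ?Ts_unit.
apply: (mx_wt_eq (wr_dec H)) => l v pl hv.
have [hs ps] := Ts_wt s pl hv.
have e1 : y *m (Ts s *m v) = Ts s *m (x *m v) by rewrite -!mulMV hc.
have hxv := opwt_wt pb pl hx hv.
have [hs2 ps2] := Ts_wt s (PlatD pl pb) hxv.
rewrite scMl -scalemxAl !mulMV e1 (hs2 h) (hs h) -scalemxAr e1 scalerA -algM.
rewrite mulmxDr weight_atD qpowD 1?mulrC //; first exact: Plat_ok.
exact/Plat_ok/Plat_wprod.
Qed.

Lemma cj_K s h h' : (forall l, weight_at (wprod s *m l) h' = weight_at l h) -> cj (Ts s) (Kh h) (Kh h').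
Proof.
move=> hh; apply: (mx_wt_eq (wr_dec H)) => l v pl hv.
have [hs _] := Ts_wt s pl hv.
by rewrite !mulMV hv -scalemxAr hs hh.
Qed.

Lemma form_Kc l i : weight_at l (Kc i) = form (alpha i) l.
Proof. by rewrite form_alpha weight_at_Ki. Qed.

Lemma cj_Kc s j k : wprod s *m alpha j = alpha k -> cj (Ts s) (Kh (Kc j)) (Kh (Kc k)).
Proof. by move=> e; apply: cj_K => l; rewrite !form_Kc -e form_wprod. Qed.
Lemma cj_KcN s j k : wprod s *m alpha j = alpha k -> cj (Ts s) (Kh (- Kc j)) (Kh (- Kc k)).
Proof. by move=> e; apply: cj_K => l; rewrite !weight_atNr !form_Kc -e form_wprod. Qed.

Lemma eps_root s j k : wprod s *m alpha j = alpha k -> eps D j = eps D k.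
Proof.
move=> e; have := form_wprod s (alpha j) (alpha j); rewrite e !form_alpha !pairing_alpha !car_ii.
move/(mulIf _) => h; apply/eqP; rewrite -(eqr_nat rat); apply/eqP; symmetry; apply: h.
by rewrite intr_eq0.
Qed.

Lemma qL_sym i j : qL i ^ car D i j = qL j ^ car D j i.
Proof.
rewrite !qLX; congr ((qpow K D _)%:A).
by have := congr1 (fun z : int => z%:~R : rat) (car_sym i j); rewrite !rmorphM.
Qed.

Lemma E_Wad i j : Wad (qL i) (Kh (Kc i)) (car D i j) (E j).
Proof. exact: (wr_KE H). Qed.

Lemma EF_comm i j : i != j -> F i * E j = E j * F i.
Proof.
move=> ij; have := wrEF H j i; rewrite eq_sym (negPf ij) => /eqP.
by rewrite subr_eq0 => /eqP ->.
Qed.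

(** Let y be the conjugate of F_j. Then y - F_k commutes with E_k, since y and F_k have the same
    commutator with it, and has weight -alpha_k; by sl2-theory it is zero. *)
Lemma cj_F s j k : wprod s *m alpha j = alpha k -> cj (Ts s) (E j) (E k) -> cj (Ts s) (F j) (F k).
Proof.
move=> e hE; have he := eps_root e.
have [y hy] := cj_ex (F j) (Ts_unit s).
suff -> : F k = y by [].
have c1 := cjB (cjM hE hy) (cjM hy hE).
have c2 := cjZ ((qL j - (qL j)^-1)^-1) (cjB (cj_Kc e) (cj_KcN e)).
rewrite -(wr_EF H) in c2; have := cj_inj (Ts_unit s) c1 c2.
have -> : qL j = qL k by rewrite /qL /qi he.
rewrite -(wr_EF H) => h.
apply/eqP; rewrite eq_sym -subr_eq0; apply/eqP.
have H' := wrep_swap H.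
apply: (wr_comm_pos (m := 1) (i := k) (th := alpha k) H').
- by rewrite pairing_alpha car_ii.
- have pa : Plat (- alpha j : hdual) by apply/PlatN/Plat_alpha.
  suff ho : opM (- alpha k) (y - F k).
    by move=> g; have := ho (- g); rewrite weight_atNr weight_atN opprK.
  apply: opwtD; last exact/opwtN/(opwtF H).
  by rewrite -e -mulmxN; apply: cj_opwt hy => //; apply: (opwtF H).
rewrite mulrBr mulrBl; move/eqP: h; rewrite subr_eq => /eqP ->.
by move: (E k * F k) (F k * E k) (y * E k) => u v w; mxring.
Qed.

(** T_j is given by one universal formula in E_j, F_j and the weight, and all three are carried to
    those of k. *)
Lemma cj_T s j k : wprod s *m alpha j = alpha k -> cj (Ts s) (E j) (E k) -> cj (Ts s) (F j) (F k) ->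
  cj (Ts s) (Tm M j) (Tm M k).
Proof.
move=> e hE hF; apply: (mx_wt_eq (wr_dec H)) => l v pl hv.
have [N hN] := wr_nil H; have he := eps_root e.
have [hs ps] := Ts_wt s pl hv.
have /intrP[m hm] := pl j.
have hm' : pairing (wprod s *m l) k = m%:~R.
  rewrite -hm; apply: (@mulfI _ (eps D k)%:R); first by rewrite pnatr_eq0 -lt0n eps_gt0.
  by rewrite -form_alpha -e form_wprod form_alpha he.
rewrite !mulMV (Tfam_wt (hN j).1 pl hv hm) (Tfam_wt (hN k).1 ps hs hm').
have -> : qL j = qL k by rewrite /qL /qi he.
rewrite /Tsl mulmx_sumr; apply: eq_bigr => a _; rewrite mulmx_sumr; apply: eq_bigr => c _ /=.
case: ifP => _; last by rewrite mulmx0.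
rewrite -scalemxAr !dpw_mul -!scalemxAr; congr (_ *: (_ *: _)).
by rewrite (cjV _ (cjX a hE)) (cjV _ (cjX _ hF)) (cjV _ (cjX _ hE)).
Qed.

Lemma pairing_step i (m : int) r b : pairing b i = m%:~R ->
  pairing (b + alpha i *+ r) i = (m + 2 * r%:Z)%:~R.
Proof.
move=> hp; rewrite pairingD hp -scaler_nat pairingZ pairing_alpha car_ii.
by rewrite (intrD _ m) (intrM _ 2) mulrC.
Qed.

Lemma zlS i b m r x : Plat b -> opM b x -> pairing b i = m%:~R -> opM (b + alpha i *+ r) (zl i r x) ->
  zl i r.+1 x = (qz (qL i) r.+1)^-1 *:
    (E i * zl i r x - qL i ^ (m + 2 * r%:Z) *: (zl i r x * E i)).
Proof.
move=> pb hx hp hr; have h := qzS_neq0 (qL_pow L i) (qL_neq0 L i) r.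
apply: (scalerI h); rewrite scalerA mulrV ?unitfE // scale1r.
rewrite /zl dpwS ?qL_neq0 //; [|exact: qL_pow|by move=> a v; rewrite linearZ].
exact: (adl_W _ (wr_KN H _) (opwt_Wad (pairing_step r hp) hr)).
Qed.

Lemma zrS i b m r x : Plat b -> opM b x -> pairing b i = m%:~R -> opM (b + alpha i *+ r) (zr i r x) ->
  zr i r.+1 x = (qz (qL i) r.+1)^-1 *:
    (zr i r x * E i - qL i ^ (m + 2 * r%:Z) *: (E i * zr i r x)).
Proof.
move=> pb hx hp hr; have h := qzS_neq0 (qL_pow L i) (qL_neq0 L i) r.
apply: (scalerI h); rewrite scalerA mulrV ?unitfE // scale1r.
rewrite /zr dpwS ?qL_neq0 //; [|exact: qL_pow|].
  have := opwt_Wad (pairing_step r hp) hr; rewrite /Wad /zr.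
  set y := dpw _ _ _ _ => hw; rewrite /adR; congr (_ - _).
  by rewrite -[E i * _ * y]mulrA hw scMr scMl -!mulrA (wr_KN H) mulr1.
by move=> a v; rewrite /adR scMl scMr scMl scalerBr.
Qed.

Lemma G_zl S b i r x : G S b x -> i \in S -> G S (b + alpha i *+ r) (zl i r x).
Proof.
move=> hx iS; have [pb ox] := GP hx; have /intrP[m hm] := pb i.
elim: r => [|r IH]; first by rewrite mulr0n addr0 /zl dpow0.
rewrite (zlS pb ox hm (GP IH).2) mulrSr addrA.
have hE : G S (alpha i) (E i) by apply: G_E.
apply: G_Z; apply: G_D; first by rewrite addrC; apply: G_mul.
by rewrite -scaleN1r; do 2 apply: G_Z; apply: G_mul.
Qed.
Lemma G_zr S b i r x : G S b x -> i \in S -> G S (b + alpha i *+ r) (zr i r x).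
Proof.
move=> hx iS; have [pb ox] := GP hx; have /intrP[m hm] := pb i.
elim: r => [|r IH]; first by rewrite mulr0n addr0 /zr dpow0.
rewrite (zrS pb ox hm (GP IH).2) mulrSr addrA.
have hE : G S (alpha i) (E i) by apply: G_E.
apply: G_Z; apply: G_D; first by apply: G_mul.
by rewrite -scaleN1r addrC; do 2 apply: G_Z; apply: G_mul.
Qed.

(* T_d E_j for the alternating word d of length m in a dihedral group of order 2w *)
Definition r2spec j t m (w : nat) : Prop := exists y,
  [/\ cj (Ts (map (lt2 j t) (balt false m))) (E j) y, exists b, G [set j; t] b y
    & m = w.-1 -> y = E (if odd w then t else j)].

Lemma cj_nil x : cj (Ts [::]) x x.
Proof. by rewrite /cj /= -[1%:M]/(1 : 'M[L]_n) mulr1 mul1r. Qed.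
Lemma cj_cons s i x y z : cj (Ts s) x y -> cj (Tm M i) y z -> cj (Ts (i :: s)) x z.
Proof. by move=> h h'; rewrite Ts_cons; apply: cj_comp h h'. Qed.

Section Rank2.
Variables (j k : I) (m : nat).
Hypothesis jk : j != k.
Hypothesis ajk : car D j k = -1.
Hypothesis akj : car D k j = - m%:Z.
Hypothesis m3 : (0 < m <= 3)%N.

Let S : {set I} := [set j; k].
Let jS : j \in S. Proof. by rewrite !inE eqxx. Qed.
Let kS : k \in S. Proof. by rewrite !inE eqxx orbT. Qed.
Local Notation z r := (zl k r (E j)).
Local Notation z' r := (zr k r (E j)).

Let hz r : G S (alpha j + alpha k *+ r) (z r).
Proof. by apply: G_zl => //; apply: G_E. Qed.
Let hz' r : G S (alpha j + alpha k *+ r) (z' r).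
Proof. by apply: G_zr => //; apply: G_E. Qed.

Let pkj : pairing (alpha j) k = (- m%:Z)%:~R. Proof. by rewrite pairing_alpha akj. Qed.
Let pjk : pairing (alpha k) j = (-1)%:~R. Proof. by rewrite pairing_alpha ajk. Qed.

Let zE r : z r.+1 = (qz (qL k) r.+1)^-1 *: (E k * z r - qL k ^ (- m%:Z + 2 * r%:Z) *: (z r * E k)).
Proof. exact: (zlS (Plat_alpha _) (opwtE H _) pkj (GP (hz r)).2). Qed.
Let z'E r : z' r.+1 = (qz (qL k) r.+1)^-1 *: (z' r * E k - qL k ^ (- m%:Z + 2 * r%:Z) *: (E k * z' r)).
Proof. exact: (zrS (Plat_alpha _) (opwtE H _) pkj (GP (hz' r)).2). Qed.
Let z0 : z 0 = E j. Proof. by rewrite /zl dpow0. Qed.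
Let z'0 : z' 0 = E j. Proof. by rewrite /zr dpow0. Qed.

Let w1 : Wad (qL j) (Kh (Kc j)) (- 1%:Z) (E k).
Proof. by have := E_Wad j k; rewrite ajk. Qed.
Let wm : Wad (qL k) (Kh (Kc k)) (- m%:Z) (E j).
Proof. by have := E_Wad k j; rewrite akj. Qed.
Let Fjk : F j * E k = E k * F j. Proof. exact: EF_comm. Qed.
Let Fkj : F k * E j = E j * F k. Proof. by apply: EF_comm; rewrite eq_sym. Qed.

Let qq : qL k ^ (- m%:Z) = qL j ^ (-1). Proof. by rewrite -akj -ajk qL_sym. Qed.
Let qz1k : (qz (qL k) 1)^-1 = 1. Proof. by rewrite qz1 ?invr1 ?qL_neq0 //; apply: qL_pow. Qed.
Let qz1j : (qz (qL j) 1)^-1 = 1. Proof. by rewrite qz1 ?invr1 ?qL_neq0 //; apply: qL_pow. Qed.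

Let opk0 : opM (alpha k + alpha j *+ 0) (E k). Proof. by rewrite mulr0n addr0; apply: (opwtE H). Qed.

Let c1 : cj (Tm M j) (E k) (z' 1).
Proof.
have h := Tm_adtop w1 Fjk; rewrite /cj h; congr (_ * _).
have := @zlS j (alpha k) (-1) 0 (E k) (Plat_alpha _) (opwtE H _) pjk; rewrite {1 3 4}/zl dpow0 => /(_ opk0).
rewrite /zl -/(adtop _ _ _ _ _ _) => ->.
by rewrite z'E z'0 qz1k qz1j !mulr0 !addr0 qq.
Qed.

Let c2 r : (r <= m)%N -> cj (Tm M k) (z' r) (z (m - r)).
Proof. by move=> rm; apply: (Tm_zr wm Fkj rm). Qed.

Let c3 : cj (Tm M j) (z 1) (E k).
Proof.
have h := Tm_zr w1 Fjk (leqnn 1); rewrite subnn /zl dpow0 in h.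
have := @zrS j (alpha k) (-1) 0 (E k) (Plat_alpha _) (opwtE H _) pjk; rewrite {1 3 4}/zr dpow0 => /(_ opk0) e.
by move: h; rewrite e zE z0 qz1k qz1j !mulr0 !addr0 qq.
Qed.

Let c4 : cj (Tm M j) (z 2) (z' 2).
Proof. rewrite zE z'E; apply: cjZ; apply: cjB; [exact: cjM c1 c3|exact: cjZ (cjM c3 c1)]. Qed.

Let cE : cj (Tm M k) (E j) (z m). Proof. by have := c2 (leq0n m); rewrite z'0 subn0. Qed.
Let cm : cj (Tm M k) (z' m) (E j). Proof. by have := c2 (leqnn m); rewrite subnn z0. Qed.
Let gz r : exists b, G S b (z r). Proof. by eexists; apply: hz. Qed.
Let gz' r : exists b, G S b (z' r). Proof. by eexists; apply: hz'. Qed.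
Let gj : exists b, G S b (E j). Proof. by exists (alpha j); apply: G_E. Qed.
Let gk : exists b, G S b (E k). Proof. by exists (alpha k); apply: G_E. Qed.

(** The root alpha_j is at least as long as alpha_k. The z_r and z'_r are the strings of E_j under
    the left and right adjoint action of E_k. T_k maps z'_r to z_(m-r), and T_j maps E_k to z'_1,
    z_1 to E_k and z_2 to z'_2. Only for m = 3 must z_3 be followed through q-commutators. *)
Lemma rank2_long r : (r < cox (-1) (- m%:Z))%N -> r2spec j k r (cox (-1) (- m%:Z)).
Proof.
case: r => [_|[|r]].
- exists (E j); split=> //; first exact: cj_nil.
  by case: (m) m3 => [|[|[|[]]]].
- by move=> _; exists (z m); split=> //; [exact: (cj_cons (cj_nil _))|case: (m) m3 => [|[|[|[]]]]].
have c1m := cj_cons (cj_nil (E j)) cE.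
case: (m) m3 cE cm c1m c2 zE z'E => [|[|[|[|m']]]] // _ hE hm h1 h2 hzE hz'E; rewrite /cox /=.
- case: r => // _; exists (E k); split=> //; exact: cj_cons h1 c3.
- case: r => [|[|r]] // _.
    by exists (z' 2); split=> //; exact: cj_cons h1 c4.
  exists (E j); split=> //; exact: (cj_cons (cj_cons h1 c4) hm).
pose q1 := qL k ^ (- 3%:Z + 2 * 2%:Z); pose q2 := (qz (qL k) 3)^-1.
have z3 : z 3 = q2 *: (E k * z 2 - q1 *: (z 2 * E k)) by exact: hzE.
have z'3 : z' 3 = q2 *: (z' 2 * E k - q1 *: (E k * z' 2)) by exact: hz'E.
have d1 : cj (Tm M j) (z 3) (q2 *: (z' 1 * z' 2 - q1 *: (z' 2 * z' 1))).
  by rewrite z3; apply: cjZ; apply: cjB; [exact: cjM c1 c4|exact: cjZ (cjM c4 c1)].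
have h21 := h2 1%N isT; have h22 := h2 2%N isT.
have d2 : cj (Tm M k) (q2 *: (z' 1 * z' 2 - q1 *: (z' 2 * z' 1))) (q2 *: (z 2 * z 1 - q1 *: (z 1 * z 2))).
  by apply: cjZ; apply: cjB; [exact: cjM h21 h22|exact: cjZ (cjM h22 h21)].
have d3 : cj (Tm M j) (q2 *: (z 2 * z 1 - q1 *: (z 1 * z 2))) (z' 3).
  by rewrite z'3; apply: cjZ; apply: cjB; [exact: cjM c4 c3|exact: cjZ (cjM c3 c4)].
have h3 := cj_cons h1 d1; have h4 := cj_cons h3 d2; have h5 := cj_cons h4 d3.
have gp x y b b' : G S b x -> G S b' y -> exists c, G S c (q2 *: (x * y - q1 *: (y * x))).
  move=> gx gy; exists (b + b'); apply: G_Z; apply: G_D; first exact: G_mul.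
  by rewrite -scaleN1r addrC; do 2 apply: G_Z; apply: G_mul.
case: r => [|[|[|[|r]]]] // _.
- by exists (q2 *: (z' 1 * z' 2 - q1 *: (z' 2 * z' 1))); split; [exact: h3|exact: (gp _ _ _ _ (hz' 1%N) (hz' 2%N))|].
- exists (q2 *: (z 2 * z 1 - q1 *: (z 1 * z 2))); split; [exact: h4|exact: (gp _ _ _ _ (hz 2%N) (hz 1%N))|move=> h; exfalso; clear -h; lia].
- by exists (z' 3); split.
by exists (E j); split=> //; exact: cj_cons h5 hm.
Qed.

Lemma rank2_short r : (r < cox (-1) (- m%:Z))%N -> r2spec k j r (cox (-1) (- m%:Z)).
Proof.
have sw x : (exists b, G S b x) -> exists b, G [set k; j] b x.
  by case=> b hb; exists b; apply: G_sub hb => y; rewrite !inE orbC.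
have m1 := ltn_predL m; have h1 := cj_cons (cj_nil (E k)) c1.
case: (m) m3 c2 => [|[|[|[|m']]]] // _ h2; rewrite /cox /=.
- case: r => [|[|[|r]]] // _.
  + by exists (E k); split; [exact: cj_nil|exact: sw|].
  + by exists (z' 1); split; [exact: h1|exact: sw|].
  by exists (E j); split; [rewrite -z0; exact: (cj_cons h1 (h2 1%N isT))|exact: sw|].
- have h3 := cj_cons h1 (h2 1%N isT).
  case: r => [|[|[|[|r]]]] // _.
  + by exists (E k); split; [exact: cj_nil|exact: sw|].
  + by exists (z' 1); split; [exact: h1|exact: sw|].
  + by exists (z 1); split; [exact: h3|exact: sw|].
  by exists (E k); split; [exact: (cj_cons h3 c3)|exact: sw|].
have h3 := cj_cons h1 (h2 1%N isT); have h4 := cj_cons h3 c4.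
have h5 := cj_cons h4 (h2 2%N isT).
case: r => [|[|[|[|[|[|r]]]]]] // _.
+ by exists (E k); split; [exact: cj_nil|exact: sw|].
+ by exists (z' 1); split; [exact: h1|exact: sw|].
+ by exists (z 2); split; [exact: h3|exact: sw|].
+ by exists (z' 2); split; [exact: h4|exact: sw|].
+ by exists (z 1); split; [exact: h5|exact: sw|].
by exists (E k); split; [exact: (cj_cons h5 c3)|exact: sw|].
Qed.

End Rank2.

Lemma rank2_T j t r : j != t -> (r < cox (car D j t) (car D t j))%N ->
  r2spec j t r (cox (car D j t) (car D t j)).
Proof.
move=> jt; have tj : t != j by rewrite eq_sym.
have two (m : nat) : (0 < m <= 3)%N -> car D j t = - m%:Z -> car D t j = -1 ->
   (r < cox (- m%:Z) (-1))%N -> r2spec j t r (cox (- m%:Z) (-1)).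
  by move=> hm a1 a2; rewrite cox_sym; exact: (rank2_short tj a2 a1 hm).
have one (m : nat) : (0 < m <= 3)%N -> car D j t = -1 -> car D t j = - m%:Z ->
   (r < cox (-1) (- m%:Z))%N -> r2spec j t r (cox (-1) (- m%:Z)).
  by move=> hm a1 a2; exact: (rank2_long jt a1 a2 hm).
case: (rank2_cases jt) => [[a1 a2]|[a1 a2]|[[a1 a2]|[a1 a2]]|[[a1 a2]|[a1 a2]]]; rewrite a1 a2.
- have gj : exists b, G [set j; t] b (E j) by exists (alpha j); apply: G_E; rewrite !inE eqxx.
  case: r {one two} => [|[|r]] // _; exists (E j); split=> //; first exact: cj_nil.
  apply: (cj_cons (cj_nil _)).
  have w0 : Wad (qL t) (Kh (Kc t)) (- 0%:Z) (E j) by have := E_Wad t j; rewrite a2.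
  by have := Tm_adtop w0 (EF_comm tj); rewrite /adtop dpow0.
- exact: (one 1%N).
- exact: (one 2%N).
- exact: (two 2%N).
- exact: (one 3%N).
exact: (two 3%N).
Qed.

Lemma balt_cons (b : bool) r : balt b r.+1 = (if odd r then ~~ b else b) :: balt b r.
Proof. by elim: r b => //= r IH b; rewrite IH rcons_cons; case: odd; rewrite ?negbK. Qed.

(** The alternating word of length w - 1 sends E_j to a simple E_k, hence conjugates T_j into T_k by
    [cj_F] and [cj_T]; written out, this is the braid relation. *)
Lemma braid_T j t : j != t -> let w := cox (car D j t) (car D t j) in
  Ts (map (lt2 j t) (balt true w)) = Ts (map (lt2 j t) (balt false w)).
Proof.
move=> jt w; have w0 : (0 < w)%N by rewrite /w /cox; case: absz => [|[|[]]].
have [|y [hc _ hy]] := @rank2_T j t w.-1 jt; first by rewrite ltn_predL.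
rewrite hy // in hc; have e := balt_top jt.
have hF := cj_F e hc; have := cj_T e hc hF; rewrite /cj -/w.
case: (w) w0 {hc hy e hF} => // w' _ h.
rewrite [balt true _]/= map_rcons Ts_rcons -[X in _ = X]/(Ts _) balt_cons map_cons Ts_cons.
by move: h => /= ->; case: odd.
Qed.

(** If the words end in different letters j and t, split off the dihedral part d. Both letters are
    descents, so d has full length, and induction links each word to u followed by the longest
    dihedral word with the same last letter; [braid_T] joins these two. *)
Lemma matsumoto s s' : reduced s -> reduced s' -> wprod s = wprod s' -> Ts s = Ts s'.
Proof.
have [m] := ubnP (size s); elim: m s s' => // m IH s s'; rewrite ltnS => hm hs hs' e.
have sz := red_size hs hs' e.
case: (lastP s) hm hs e sz => [|s1 j] hm hs e sz; first by case: s' sz {hs' e}.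
case: (lastP s') hs' e sz => [|s1' t] hs' e sz; first by rewrite size_rcons in sz.
rewrite size_rcons in hm.
have canc s2 s2' i : wprod (rcons s2 i) = wprod (rcons s2' i) -> wprod s2 = wprod s2'.
  move=> /(congr1 (fun z => z *m refl i)); rewrite !wprod_rcons -!mulmxA !refl_refl !mulmx1 //.
have fin s2 i : (size s2 <= m)%N -> (size s2 < m)%N -> True by [].
have step s2 s2' i : (size s2 < m)%N -> reduced (rcons s2 i) -> reduced (rcons s2' i) ->
    wprod (rcons s2 i) = wprod (rcons s2' i) -> Ts (rcons s2 i) = Ts (rcons s2' i).
  move=> h h1 h2 e2; rewrite !Ts_rcons; congr (_ * _).
  by apply: IH => //; [exact: red_rconsl h1|exact: red_rconsl h2|exact: canc e2].
case: (eqVneq j t) => [ejt|jt]; first by rewrite -ejt in hs' e *; apply: step.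
have [u [d [hd hud eud uj ut]]] := dih_dec j t hs.
have [b eb] := red_balt hd (red_catr hud).
have hsz : (size d <= cox (car D j t) (car D t j))%N.
  by apply: (red_balt_size jt (b := b)); rewrite -eb; apply: red_catr hud.
have nj : nneg (- (wprod (u ++ d) *m alpha j)).
  by rewrite eud root_rcons opprK; apply: pos_root.
have nt : nneg (- (wprod (u ++ d) *m alpha t)).
  by rewrite eud e root_rcons opprK; apply: pos_root.
have hpos (b' : bool) : b' != b -> (size d < cox (car D j t) (car D t j))%N ->
    nneg (wprod (u ++ d) *m alpha (lt2 j t b')).
  move=> bb hlt; rewrite wprod_cat -mulmxA eb.
  have [pj pt] := (pos_root uj, pos_root ut).
  have tj : t != j by rewrite eq_sym.
  case: b' bb => bb.
    have -> : b = false by case: b bb {eb}.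
    have [x [y [-> _]]] := balt_pos jt hlt.
    by rewrite mulmxDr -!scalemxAr; apply: nnegD; apply: nnegZ.
  have -> : b = true by case: b bb {eb}.
  rewrite -[true]/(~~ false) -map_lt2_sym; rewrite cox_sym in hlt.
  have [x [y [-> _]]] := balt_pos tj hlt.
  by rewrite mulmxDr -!scalemxAr; apply: nnegD; apply: nnegZ.
have hcox : size d = cox (car D j t) (car D t j).
  apply/eqP; rewrite eqn_leq hsz leqNgt; apply/negP => hlt.
  have := hpos (~~ b); have : ~~ b != b by case: b {eb hpos}.
  move=> bb /(_ bb hlt) h; have := root_neq0 (u ++ d) (lt2 j t (~~ b)).
  by rewrite (nneg_anti h) ?eqxx //; case: b {eb hpos bb h} => //=.
rewrite hcox in eb; set w := cox _ _ in eb hcox.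
have [w' ew] : exists w', w = w'.+1 by rewrite /w /cox; case: absz => [|[|[]]]; eexists.
have wb (b' : bool) : wprod (map (lt2 j t) (balt b' w)) = wprod d.
  by rewrite eb; case: b' b {eb hpos} => -[] //; rewrite braid_wprod.
have hb (b' : bool) : wprod (u ++ map (lt2 j t) (balt b' w)) = wprod (rcons s1 j).
  by rewrite wprod_cat wb -wprod_cat.
have rb (b' : bool) : reduced (u ++ map (lt2 j t) (balt b' w)).
  apply: (red_same hs) (hb b') _.
  by rewrite -(red_size hud hs eud) !size_cat size_map size_balt hcox.
have szs : (size s1 < m)%N := hm.
transitivity (Ts (u ++ map (lt2 j t) (balt true w))).
  have := rb true; have := hb true; rewrite ew /= map_rcons -rcons_cat => h1 h2.
  by apply: step.
rewrite Ts_cat braid_T // -Ts_cat.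
have := rb false; have := hb false; rewrite ew /= map_rcons -rcons_cat => h1 h2.
symmetry; rewrite -/w ew /= map_rcons -rcons_cat; apply: step => //; last by rewrite h1.
by move: sz; rewrite !size_rcons => -[<-].
Qed.

Definition ht l : rat := \sum_j l j 0.
Lemma ht_lin a l b : ht (a *: l + b) = a * ht l + ht b.
Proof. by rewrite /ht mulr_sumr -big_split; apply: eq_bigr => i _; rewrite !mxE. Qed.
Lemma ht_alpha i : ht (alpha i) = 1.
Proof.
by rewrite /ht (bigD1 i) //= alphaE eqxx big1 ?addr0 // => j ji; rewrite alphaE (negPf ji).
Qed.
Lemma ht_root s j : reduced (rcons s j) -> 1 <= ht (wprod s *m alpha j).
Proof.
move=> hr; have hp := pos_root hr; have := root_neq0 s j.
have [z ez] := wprod_int s (delta_mx j 0); rewrite Qint_delta in ez; rewrite ez in hp *.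
have -> : ht (Qint z) = (\sum_i z i 0)%:~R by rewrite rmorph_sum; apply: eq_bigr => i _; rewrite mxE.
have hz i : 0 <= z i 0 by have := hp i; rewrite mxE ler0z.
move=> nz; rewrite ler1z -gtz0_ge1 lt_neqAle sumr_ge0 // andbT eq_sym.
apply: contra nz => /eqP h; apply/eqP/matrixP => i c; rewrite [c]ord1 !mxE.
by rewrite (psumr_eq0P (fun i _ => hz i) h).
Qed.

(** Height is additive and at least 1 on the roots u(alpha_j) and u(alpha_t), so x u(alpha_j) + y
    u(alpha_t) can be simple only if x or y is 0. The dihedral part then has extreme length and
    sends E_j to E_j or E_t, where the induction hypothesis for u applies. *)
Lemma Ts_simple s j k : reduced (rcons s j) -> wprod s *m alpha j = alpha k ->
  cj (Ts s) (E j) (E k).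
Proof.
move=> hr; move: s j hr k; apply: (pos_ind (P := fun s j => forall k, _ -> _)).
  by move=> j k; rewrite mul1mx => /alpha_inj <-; exact: cj_nil.
move=> s u j t r d jt hn hr hud eud uj ut IHj IHt k ek.
have [x [y [exy hxy]]] := balt_pos jt hn.
have e1 : x%:R *: (wprod u *m alpha j) + y%:R *: (wprod u *m alpha t) = alpha k.
  by rewrite !scalemxAr -mulmxDr -exy mulmxA -wprod_cat eud.
have hx : (x = 0)%N \/ (y = 0)%N.
  have := congr1 ht e1; rewrite ht_lin -[_ *: (wprod u *m alpha t)]addr0 ht_lin ht_alpha.
  have -> : ht 0 = 0 by rewrite /ht big1 // => i _; rewrite mxE.
  have := ht_root uj; have := ht_root ut; case: (x) (y) => [|x'] [|y'] h3 h4 h5; [by left|by left|by right|].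
  exfalso; have h1 : 1 <= x'.+1%:R :> rat by rewrite ler1n.
  have h2 : 1 <= y'.+1%:R :> rat by rewrite ler1n.
  move: h1 h2 h3 h4 h5; move: (ht _) (ht _) (x'.+1%:R) (y'.+1%:R); clear; move=> *; nra.
have := hxy hx => /= /eqP ern.
have [y' [hc _ hy']] := rank2_T jt hn.
rewrite (hy' ern) in hc; rewrite -(matsumoto hud (red_rconsl hr) eud) Ts_cat.
apply: cj_comp hc _.
have e2 : wprod u *m alpha (if odd (cox (car D j t) (car D t j)) then t else j) = alpha k.
  by rewrite -(balt_top jt) -ern mulmxA -wprod_cat eud.
by move: e2; case: odd => e2; [apply: IHt|apply: IHj].
Qed.

Lemma Ts_simpleN s j k : reduced s -> wprod s *m alpha j = - alpha k ->
  cj (Ts s) (E j) (- (F k * Kh (Kc k))) /\ cj (Ts s) (F j) (- (Kh (- Kc k) * E k)).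
Proof.
move=> hs e; have nr : ~ reduced (rcons s j).
  move=> /pos_root; rewrite e => h.
  by have := alpha_neq0 k; rewrite (nneg_anti (nneg_alpha k) h) eqxx.
have [s' [hr e' _]] := red_desc hs nr.
have ek : wprod s' *m alpha j = alpha k.
  by apply: oppr_inj; rewrite -root_rcons e'.
have hE := Ts_simple hr ek; have hF := cj_F ek hE.
rewrite -(matsumoto hr hs e') Ts_rcons; split.
  apply: cj_comp (cjN (cjM hF (cj_Kc ek))); rewrite /cj Tm_E mulNr //.
by apply: cj_comp (cjN (cjM (cj_KcN ek) hE)); rewrite /cj Tm_F mulNr.
Qed.

(** The dihedral factor yields an element generated by E_j and E_t, and T_u is known on both by
    induction; [G_wt] then corrects the weight label. *)
Lemma Ts_pos S s j : reduced (rcons s j) -> {subset rcons s j <= S} ->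
  exists2 y, G S (wprod s *m alpha j) y & cj (Ts s) (E j) y.
Proof.
move: s j; apply: (pos_ind (P := fun s j => _ -> _)).
  move=> j hj; exists (E j); last exact: cj_nil.
  by rewrite mul1mx; apply: G_E; apply: hj; rewrite mem_head.
move=> s u j t r d jt hn hr hud eud uj ut IHj IHt hS.
have sS : {subset s <= S} by move=> x xs; apply: hS; rewrite mem_rcons inE xs orbT.
have udS := red_letters sS hud eud.
have uS : {subset u <= S} by move=> x xu; apply: udS; rewrite mem_cat xu.
have jS : j \in S by apply: hS; rewrite mem_rcons mem_head.
have tS : t \in S by apply: udS; rewrite mem_cat /d /= map_rcons mem_rcons mem_head orbT.
have [|yj gj cj1] := IHj; first by move=> x; rewrite mem_rcons inE => /orP[/eqP -> //|/uS].
have [|yt gt cj2] := IHt; first by move=> x; rewrite mem_rcons inE => /orP[/eqP -> //|/uS].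
have [y' [hc [b gb] _]] := rank2_T jt hn.
have im b' x : G [set j; t] b' x -> exists2 z, G S (wprod u *m b') z & cj (Ts u) x z.
  elim=> {b' x} [b' pb||i|a b' x y _ [z1 g1 h1] _ [z2 g2 h2]|b1 b2 x y _ [z1 g1 h1] _ [z2 g2 h2]].
  - by exists 0; [apply/G_zero/Plat_wprod|rewrite /cj mulr0 mul0r].
  - by exists 1; [rewrite mulmx0; apply: G_one|rewrite /cj mulr1 mul1r].
  - by rewrite !inE => /orP[] /eqP ->; [exists yj|exists yt].
  - by exists (a *: z1 + z2); [apply: G_lin|apply: cjD => //; apply: cjZ].
  by exists (z1 * z2); [rewrite mulmxDr; apply: G_mul|apply: cjM].
have [z gz hz] := im _ _ gb.
have hcs : cj (Ts s) (E j) z.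
  rewrite -(matsumoto hud (red_rconsl hr) eud) Ts_cat; exact: cj_comp hc hz.
exists z => //; apply: (G_wt gz); first exact/Plat_wprod/Plat_alpha.
exact: cj_opwt (Plat_alpha j) (opwtE H j) hcs.
Qed.

End OneModule.

(** * Tensor products and the bar involution *)

Section TevalMorph.
Variables (k : fieldType) (G : Type) (A B : pzRingType) (f : {rmorphism A -> B}).
Lemma teval_morph (iota : k -> A) (v : G -> A) t :
  f (teval iota v t) = teval (f \o iota) (f \o v) t.
Proof. by elim: t => //= t1 h1 t2 h2; rewrite ?rmorphD ?rmorphM /= h1 h2. Qed.
Lemma plift_morph (P : forall A : pzRingType, (k -> A) -> (G -> A) -> Prop) (iota : k -> A) (v : G -> A) (x : presAlg P) :
  f (plift iota v x) = plift (f \o iota) (f \o v) x.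
Proof. exact: teval_morph. Qed.
End TevalMorph.

Lemma eq_plift (k : fieldType) (G : Type) (A : pzRingType)
   (P : forall A : pzRingType, (k -> A) -> (G -> A) -> Prop) (i i' : k -> A) (v v' : G -> A) (x : presAlg P) :
  i =1 i' -> v =1 v' -> plift i v x = plift i' v' x.
Proof. by move=> /funext -> /funext ->. Qed.

Section Tensors.
Variables (F : fieldType) (m n : nat).
Implicit Types (A : 'M[F]_m) (B : 'M[F]_n).
Definition tm A B : 'M[F]_(m * n) := tensmx A B.
Lemma tmM A A' B B' : tm A B * tm A' B' = tm (A * A') (B * B').
Proof. exact: tensmx_mul. Qed.
Lemma tm1 : tm 1 1 = 1.
Proof. exact: tens_scalar1mx_eq1 || (by apply/matrixP => x y; case: (mxtens_indexP x) (mxtens_indexP y) => i j [i' j']; rewrite tensmxE !mxE (inj_eq (can_inj (@mxtens_indexK _ _))) xpair_eqE -natrM mulnb). Qed.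
Lemma tmDl A A' B : tm (A + A') B = tm A B + tm A' B.
Proof. by apply/matrixP => x y; rewrite !mxE mulrDl. Qed.
Lemma tmDr A B B' : tm A (B + B') = tm A B + tm A B'.
Proof. by apply/matrixP => x y; rewrite !mxE mulrDr. Qed.
Lemma tmZl a A B : tm (a *: A) B = a *: tm A B.
Proof. by apply/matrixP => x y; rewrite !mxE mulrA. Qed.
Lemma tmZr a A B : tm A (a *: B) = a *: tm A B.
Proof. by apply/matrixP => x y; rewrite !mxE mulrCA. Qed.
Lemma tmNl A B : tm (- A) B = - tm A B.
Proof. by rewrite -scaleN1r tmZl scaleN1r. Qed.
Lemma tmNr A B : tm A (- B) = - tm A B.
Proof. by rewrite -scaleN1r tmZr scaleN1r. Qed.
Lemma tm0l B : tm 0 B = 0. Proof. by rewrite -(scale0r (0 : 'M_m)) tmZl scale0r. Qed.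
Lemma tm0r A : tm A 0 = 0. Proof. by rewrite -(scale0r (0 : 'M_n)) tmZr scale0r. Qed.
Lemma tm_suml (J : Type) (r : seq J) (g : J -> 'M[F]_m) B :
  tm (\sum_(j <- r) g j) B = \sum_(j <- r) tm (g j) B.
Proof. by elim: r => [|j r IH]; rewrite ?big_nil ?tm0l // !big_cons tmDl IH. Qed.
Definition tv (v : 'cV[F]_m) (w : 'cV[F]_n) : 'cV[F]_(m * n) := tensmx v w.
Lemma tm_tv A B v w : tm A B *m tv v w = tv (A *m v) (B *m w).
Proof. exact: (tensmx_mul A B v w). Qed.
Lemma tvZl a v w : tv (a *: v) w = a *: tv v w.
Proof. by apply/matrixP => x y; rewrite !mxE mulrA. Qed.
Lemma tvZr a v w : tv v (a *: w) = a *: tv v w.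
Proof. by apply/matrixP => x y; rewrite !mxE mulrCA. Qed.
Lemma tvDl v v' w : tv (v + v') w = tv v w + tv v' w.
Proof. by apply/matrixP => x y; rewrite !mxE mulrDl. Qed.
Lemma tvDr v w w' : tv v (w + w') = tv v w + tv v w'.
Proof. by apply/matrixP => x y; rewrite !mxE mulrDr. Qed.

Lemma tv_ind (P : 'cV[F]_(m * n) -> Prop) : P 0 -> (forall u v, P u -> P v -> P (u + v)) ->
  (forall v w, P (tv v w)) -> forall v, P v.
Proof.
move=> P0 PD Pt v; have -> : v = \sum_x tv (v x 0 *: delta_mx (mxtens_unindex x).1 0) (delta_mx (mxtens_unindex x).2 0).
  apply/matrixP => x y; rewrite [y]ord1 summxE (bigD1 x) //= big1 => [|z zx].
    by rewrite tvZl !mxE ?eqxx /= ?mulr1 addr0 [v x _]/(v x _) // mulr1.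
  rewrite tvZl !mxE; case: (eqVneq (mxtens_unindex x).1 (mxtens_unindex z).1) => [e1|_]; last by rewrite !(mul0r, mulr0).
  case: (eqVneq (mxtens_unindex x).2 (mxtens_unindex z).2) => [e2|_]; last by rewrite !mulr0.
  case/eqP: zx; rewrite -(mxtens_unindexK z) -(mxtens_unindexK x); congr mxtens_index.
  by case: (mxtens_unindex x) (mxtens_unindex z) e1 e2 => ? ? [? ?] /= -> ->.
by apply: (big_ind P).
Qed.
End Tensors.

Section Bar.
Variables (K : fieldType) (D : cartanDatum).
Local Notation k := (kfield K).
Local Notation I := 'I_(rk D).
Local Notation coroots := 'cV[int]_(rk D).
Local Notation UQ := (Uq K D).

Lemma coroot_ofN (mu : coroots) : coroot_of (- mu) = - coroot_of mu.
Proof. by apply/matrixP => i j; rewrite !mxE mulNr. Qed.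
Lemma coroot_ofD (mu nu : coroots) : coroot_of (mu + nu) = coroot_of mu + coroot_of nu.
Proof. by apply/matrixP => i j; rewrite !mxE mulrDl. Qed.
Lemma uKVE (i : I) : uKV K i = uK K (- Kc i).
Proof. by rewrite /uKV /uKmu coroot_ofN. Qed.

Lemma kbar_qi (i : I) : kbar K (qi K i) = (qi K i)^-1.
Proof. exact: kbar_qpow. Qed.

Lemma ubar_model : model (@uq_rel K D) (ucst K D \o kbar K) (fun g : ugen D =>
    match g with GE i => uE K i | GF i => uF K i | GK h => uK K (- h) end).
Proof.
have [[r0 rD] rE rF rEF [sE sF]] := Uq_rel K D.
have kq r : qok D r -> kbar K (qpow K D r) = qpow K D (- r).
  by move=> h; rewrite kbar_qpow qpowN.
have bs (x : I -> UQ) : serre (@pcst k (ugen D) (@uq_rel K D)) x -> serre (ucst K D \o kbar K) x.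
  move=> h i j ij N; rewrite -[RHS](h i j ij); apply: eq_bigr => m _.
  congr (_ * _ * _ * _); rewrite -[LHS]/(pcst (kbar K _)); congr pcst.
  by rewrite rmorphM rmorphXn rmorphN1 qbinom_rmorph kbar_qi qbinomV.
split; first by move=> c g; apply: pcst_comm.
split=> /=.
- by rewrite oppr0; split=> // h h'; rewrite opprD; apply: rD.
- move=> h i; rewrite kq ?(Plat_ok _ (Plat_alpha i)) // -weight_atNr; exact: rE.
- move=> h i; rewrite kq ?qokN ?(Plat_ok _ (Plat_alpha i)) //.
  by have := rF (- h) i; rewrite weight_atNr.
- move=> i j; rewrite -[RHS]/(if i == j then _ else 0); have := rEF i j => /= ->.
  case: eqP => // _; rewrite opprK fmorphV rmorphB fmorphV kbar_qi invrK -opprB invrN rmorphN.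
  by rewrite mulNr -mulrN opprB.
by split; apply: bs.
Qed.

Definition ubar_am := AMor (plift_alg_morph ubar_model).
Lemma ubar_amE u : ubar u = ubar_am u. Proof. by []. Qed.
Lemma ubarE (i : I) : ubar (uE K i) = uE K i.
Proof. exact: (plift_gen ubar_model (GE i)). Qed.
Lemma ubarF (i : I) : ubar (uF K i) = uF K i.
Proof. exact: (plift_gen ubar_model (GF i)). Qed.
Lemma ubarK h : ubar (uK K h) = uK K (- h) :> UQ.
Proof. exact: (plift_gen ubar_model (GK h)). Qed.
Lemma ubarM : {morph @ubar K D : u v / u * v}.
Proof. by move=> u v; rewrite !ubar_amE rmorphM. Qed.
Lemma ubarD : {morph @ubar K D : u v / u + v}.
Proof. by move=> u v; rewrite !ubar_amE rmorphD. Qed.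
Lemma ubarZ c u : ubar (c *: u) = kbar K c *: ubar u :> UQ.
Proof. by rewrite !ubar_amE amorZ. Qed.
Lemma ubarC c : ubar (pcst c) = pcst (kbar K c) :> UQ.
Proof. by rewrite !ubar_amE amorC. Qed.

Lemma kbarK c : kbar K (kbar K c) = c.
Proof.
have [p [r [r0 ->]]] := fracP c.
have h (x : {poly K}) : kbar K (kbar K (kemb K x)) = kemb K x.
  elim/poly_ind: x => [|x a IH]; first by rewrite !rmorph0.
  pose g : {rmorphism {poly K} -> k} := kbar K \o (kbar K \o kemb K).
  rewrite -[LHS]/(g _) (rmorphD g) (rmorphM g) (rmorphD (kemb K)) (rmorphM (kemb K)).
  rewrite /= -/(kbar K); congr (_ * _ + _); first exact: IH.
    by rewrite -/(kt K) -/(kbar K) kbar_t fmorphV kbar_t invrK.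
  by rewrite -/(kcst a) -/(kbar K) !kbar_cst.
have e1 (a b : k) : kbar K (a / b) = kbar K a / kbar K b by exact: fmorph_div.
have e (a b : k) : kbar K (kbar K (a / b)) = kbar K (kbar K a) / kbar K (kbar K b).
  by rewrite !e1.
by etransitivity; [exact: (e (kemb K p) (kemb K r))|rewrite !h].
Qed.

Lemma ubarKK u : ubar (ubar u) = u :> UQ.
Proof.
elim/pres_ind: u => [[i|i|h]|c|u v hu hv|u v hu hv].
- by rewrite -/(uE K i) !ubarE.
- by rewrite -/(uF K i) !ubarF.
- by rewrite -/(uK K h) !ubarK opprK.
- by rewrite !ubarC kbarK.
- by rewrite !ubarD hu hv.
by rewrite !ubarM hu hv.
Qed.

Section UUmorph.
Variables (A : pzRingType) (iota : {rmorphism k -> A}) (f g : UQ -> A).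
Hypothesis central : forall c x, iota c * f x = f x * iota c.
Hypothesis central' : forall c x, iota c * g x = g x * iota c.
Hypothesis hf : alg_morph iota f.
Hypothesis hg : alg_morph iota g.
Hypothesis fg : forall x y, f x * g y = g y * f x.
Lemma tens_model : model (@tens_rel k (ugen D) (@uq_rel K D)) iota
  (fun z => match z with inl x => f x | inr y => g y end).
Proof. by split=> [c [x|y]|]; [apply: central|apply: central'|]. Qed.
End UUmorph.

Lemma alg_morph_central (A : pzRingType) (iota : {rmorphism k -> A}) (f : UQ -> A) :
  alg_morph iota f -> forall c x, iota c * f x = f x * iota c.
Proof. by move=> [_ fM fc] c x; rewrite -fc -!fM pcst_comm. Qed.

Lemma UU_rel : [/\ alg_morph (uucst K D) (fun x : UQ => tens x 1 : UU K D), alg_morph (uucst K D) (fun x : UQ => tens 1 x : UU K D)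
   & forall x y : UQ, tens x 1 * tens 1 y = tens 1 y * tens x 1 :> UU K D].
Proof.
have hA (A : pzRingType) (i : {rmorphism k -> A}) v (m : model (@tens_rel k (ugen D) (@uq_rel K D)) i v) :
   {f : amor (@tens_rel k (ugen D) (@uq_rel K D)) i | f =1 plift i v & forall g, f (pgen g) = v g}.
  by exists (AMor (plift_alg_morph m)) => // g; rewrite /= (plift_gen m).
have l1 : forall x : UQ, tens x 1 = pgen (inl x) :> UU K D.
  move=> x; apply: plift_inj => A i v m; have [f e g] := hA A i v m; rewrite -!e.
  rewrite /tens rmorphM /= !g; have [[_ _ c] _ _] := m.2; have [_ [_ _ c'] _] := m.2.
  by rewrite -[v (inr 1)]/(v (inr (pcst 1))) c' rmorph1 mulr1.
have l2 : forall x : UQ, tens 1 x = pgen (inr x) :> UU K D.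
  move=> x; apply: plift_inj => A i v m; have [f e g] := hA A i v m; rewrite -!e.
  rewrite /tens rmorphM /= !g; have [[_ _ c] _ _] := m.2.
  by rewrite -[v (inl 1)]/(v (inl (pcst 1))) c rmorph1 mul1r.
split; [split=> [x y|x y|c]|split=> [x y|x y|c]|move=> x y]; rewrite ?l1 ?l2;
  apply: plift_inj => A i v m; have [f e g] := hA A i v m; rewrite -!e;
  rewrite ?(rmorphD f) ?(rmorphM f) /= ?g ?(amorC f);
  have [[a1 a2 a3] [b1 b2 b3] c3] := m.2 => //.
Qed.

Lemma tensE (x y : UQ) : tens x y = tens x 1 * tens 1 y :> UU K D.
Proof.
apply: plift_inj => A i v m; pose f := AMor (plift_alg_morph m).
rewrite -[LHS]/(f _) -[RHS]/(f _) /tens !rmorphM /= !(plift_gen m); have [[_ _ c] _ _] := m.2; have [_ [_ _ c'] _] := m.2.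
rewrite -[v (inr 1)]/(v (inr (pcst 1))) -[v (inl 1)]/(v (inl (pcst 1))) c c' rmorph1 mul1r mulr1 //.
Qed.

Lemma uubar_model : model (@tens_rel k (ugen D) (@uq_rel K D)) (uucst K D \o kbar K)
  (fun z => match z with inl x => tens (ubar x) 1 | inr y => tens 1 (ubar y) end).
Proof.
have [[a1 a2 a3] [b1 b2 b3] c3] := UU_rel.
apply: tens_model => //.
- by move=> c x; apply: (alg_morph_central (And3 a1 a2 a3)).
- by move=> c x; apply: (alg_morph_central (And3 b1 b2 b3)).
- by split=> [x y|x y|c]; rewrite ?ubarD ?ubarM ?ubarC ?a1 ?a2 ?a3.
- by split=> [x y|x y|c]; rewrite ?ubarD ?ubarM ?ubarC ?b1 ?b2 ?b3.
Qed.
Definition uubar_am := AMor (plift_alg_morph uubar_model).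
Lemma uubar_amE z : uubar z = uubar_am z. Proof. by []. Qed.
Lemma uubar_tens x y : uubar (tens x y) = tens (ubar x) (ubar y) :> UU K D.
Proof.
rewrite uubar_amE /tens rmorphM /= !(plift_gen uubar_model).
have [_ _ _] := UU_rel; by rewrite -tensE.
Qed.
End Bar.

Section TensorModules.
Variables (K : fieldType) (D : cartanDatum) (L : fieldExtType (kfield K)).
Local Notation k := (kfield K).
Local Notation I := 'I_(rk D).
Local Notation hdual := 'cV[rat]_(rk D).
Local Notation coroots := 'cV[int]_(rk D).
Local Notation UQ := (Uq K D).
Local Notation qL := (@qL K D L).

Lemma act2_model (M N : gmod D L) : model (@tens_rel k (ugen D) (@uq_rel K D))
  (@mxcst K L (udim M * udim N)) (fun z => match z with
     inl u => tensmx (uact M u) 1%:M | inr u => tensmx 1%:M (uact N u) end).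
Proof.
apply: tens_model.
- by move=> c x; apply: mxcstC.
- by move=> c x; apply: mxcstC.
- have [aD aM aC] := (gmP M).1.
  split=> [x y|x y|c]; rewrite -[1%:M]/(1 : 'M[L]__) -!/(tm _ _).
  + by rewrite aD tmDl.
  + by rewrite aM tmM mulr1.
  + by rewrite aC -[mxcst _ _ _]mulr1 mxcstM tmZl tm1 -mxcstM mulr1.
- have [aD aM aC] := (gmP N).1.
  split=> [x y|x y|c]; rewrite -[1%:M]/(1 : 'M[L]__) -!/(tm _ _).
  + by rewrite aD tmDr.
  + by rewrite aM tmM mulr1.
  + by rewrite aC -[mxcst _ _ _]mulr1 mxcstM tmZr tm1 -mxcstM mulr1.
by move=> x y; rewrite -!/(act _ _) -[1%:M]/(1 : 'M[L]__) -!/(tm _ _) !tmM !(mulr1, mul1r).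
Qed.

Definition act2m (M N : gmod D L) : UU K D -> 'M[L]_(udim M * udim N) :=
  amf (AMor (plift_alg_morph (act2_model M N))).
HB.instance Definition _ (M N : gmod D L) := GRing.RMorphism.on (act2m M N).
Lemma act2E (M N : gmod D L) z : act2 M N z = act2m M N z. Proof. by []. Qed.
Lemma act2_tens (M N : gmod D L) x y : act2m M N (tens x y) = tm (act M x) (act N y).
Proof.
rewrite /act2m /tens rmorphM /= !(plift_gen (act2_model M N)).
by have := tmM (act M x) 1 1 (act N y); rewrite mulr1 mul1r.
Qed.
Lemma act2C (M N : gmod D L) c : act2m M N (pcst c) = mxcst L _ c.
Proof. by rewrite /act2m amorC. Qed.
Section TensorReps.
Variables (m n : nat) (E F : I -> 'M[L]_m) (Kh : coroots -> 'M[L]_m).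
Variables (E' F' : I -> 'M[L]_n) (Kh' : coroots -> 'M[L]_n).
Hypothesis H : wrep E F Kh.
Hypothesis H' : wrep E' F' Kh'.

Lemma wt_tens l l' v w : Plat l -> Plat l' -> wt Kh l v -> wt Kh' l' w ->
  wt (fun h => tm (Kh h) (Kh' h)) (l + l') (tv v w).
Proof.
move=> pl pl' hv hw h; rewrite tm_tv hv hw tvZl tvZr scalerA -algM weight_atD qpowD //; exact: Plat_ok.
Qed.

Lemma tens_dec (v : 'cV[L]_(m * n)) : exists2 s : seq 'cV[L]_(m * n),
    (forall w, w \in s -> exists2 l, Plat l & wt (fun h => tm (Kh h) (Kh' h)) l w) & v = \sum_(w <- s) w.
Proof.
pose P (l : hdual) u := wt (fun h => tm (Kh h) (Kh' h)) l u.
elim/tv_ind: v => [|u v [s hs ->] [s' hs' ->]|v w].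
- by exists [::]; rewrite ?big_nil.
- exists (s ++ s'); last by rewrite big_cat.
  by move=> x; rewrite mem_cat => /orP[/hs|/hs'].
have [s hs ->] := wr_dec H v; have [s' hs' ->] := wr_dec H' w.
exists [seq tv x y | x <- s, y <- s'].
  move=> z /allpairsP[[x y] /= [/hs[l pl hl] /hs'[l' pl' hl'] ->]].
  by exists (l + l'); [apply: PlatD|apply: wt_tens].
rewrite big_allpairs_dep; elim: s {hs} => [|x s IH]; first by rewrite !big_nil -(scale0r (0 : 'cV_m)) tvZl scale0r.
rewrite !big_cons tvDl IH; congr (_ + _).
elim: s' {hs' IH} => [|y s' IH]; first by rewrite !big_nil -(scale0r (0 : 'cV_n)) tvZr scale0r.
by rewrite !big_cons tvDr IH.
Qed.

Let nrm := (wr_NK H, wr_KN H, wr_NK H', wr_KN H', mulr1, mul1r).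

Definition sgn_co (b : bool) (h : coroots) := if b then - h else h.

(* b = false is the action through the coproduct, b = true through its bar conjugate *)
Lemma tens_wrep (b : bool) : wrep (fun i => tm (E i) 1 + tm (Kh (sgn_co b (Kc i))) (E' i))
  (fun i => tm (F i) (Kh' (- sgn_co b (Kc i))) + tm 1 (F' i)) (fun h => tm (Kh h) (Kh' h)).
Proof.
split.
- by rewrite (wr0 H) (wr0 H') tm1.
- by move=> h h'; rewrite (wrD H) (wrD H') tmM.
- move=> h i; rewrite mulrDr mulrDl !tmM !nrm (wrE H) (wrE H') tmZl tmZr scalerDr.
  by rewrite (wr_KC H h).
- move=> h i; rewrite mulrDr mulrDl !tmM !nrm (wrF H) (wrF H') tmZl tmZr scalerDr.
  by rewrite (wr_KC H' h).
- move=> i j; rewrite !(mulrDr, mulrDl, tmM, mulr1, mul1r).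
  set si := sgn_co b (Kc i); set sj := sgn_co b (Kc j).
  have e1 : tm (Kh si * F j) (E' i * Kh' (- sj)) = tm (F j * Kh si) (Kh' (- sj) * E' i).
    rewrite (wrF H) (wrE H') tmZl tmZr; congr ((qpow K D _)%:A *: _).
    rewrite weight_atNr; congr (- _); rewrite /si /sj /sgn_co.
    by case: (b); rewrite ?weight_atNr !form_Kc formC.
  rewrite e1.
  have h1 := congr1 (fun z => tm z (Kh' (- sj))) (wrEF H i j).
  have h2 := congr1 (tm (Kh si)) (wrEF H' i j).
  rewrite tmDl tmNl in h1; rewrite tmDr tmNr in h2.
  transitivity ((tm (E i * F j) (Kh' (- sj)) - tm (F j * E i) (Kh' (- sj))) +
    (tm (Kh si) (E' i * F' j) - tm (Kh si) (F' j * E' i))).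
    move: (tm (E i * F j) _) (tm (F j * E i) _) (tm _ (E' i * F' j)) (tm _ (F' j * E' i)) => a c d e.
    by move: (tm (E i) (F' j)) (tm (F j * Kh si) _) => f g; mxring.
  rewrite h1 h2 {h1 h2 e1}; case: eqP => [ij|_]; last by rewrite tm0l tm0r addr0.
  rewrite tmZl tmZr -scalerDr tmDl tmDr tmNl tmNr -/(Kc i) /si /sj /sgn_co -ij; congr (_ *: _).
  case: (b); rewrite ?opprK; move: (tm (Kh (Kc i)) (Kh' (Kc i))) (tm (Kh (- Kc i)) (Kh' (- Kc i))) => u v.
    by move: (tm _ _) => w; mxring.
  by move: (tm _ _) => w; mxring.
exact: tens_dec.
Qed.

Variables (ka ka' : I -> 'M[L]_m).
Hypothesis kaC : forall i j, ka i * ka' j = ka' j * ka i.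
Hypothesis kaK : forall i, ka i * ka' i = 1.

Lemma tens2_wt l v w : wt Kh' l w -> wt (fun h => tm (1 : 'M[L]_m) (Kh' h)) l (tv v w).
Proof. by move=> hw h; rewrite tm_tv hw tvZr [1 *m v]mul1mx. Qed.

(** With ka = ka' = 1 this is the action on the second factor alone; with ka = K_i it is the module
    through which X_K2 acts. *)
Lemma tens2_wrep : wrep (fun i => tm (ka i) (E' i)) (fun i => tm (ka' i) (F' i)) (fun h => tm 1 (Kh' h)).
Proof.
split.
- by rewrite (wr0 H') tm1.
- by move=> h h'; rewrite (wrD H') tmM mul1r.
- by move=> h i; rewrite !tmM (wrE H') tmZr mul1r mulr1.
- by move=> h i; rewrite !tmM (wrF H') tmZr mul1r mulr1.
- move=> i j; rewrite !tmM -kaC -tmNr -tmDr (wrEF H'); case: eqP => [->|_]; last exact: tm0r.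
  by rewrite kaK tmZr tmDr tmNr.
elim/tv_ind => [|u v [s hs ->] [s' hs' ->]|v w].
- by exists [::]; rewrite ?big_nil.
- exists (s ++ s'); last by rewrite big_cat.
  by move=> x; rewrite mem_cat => /orP[/hs|/hs'].
have [s hs ->] := wr_dec H' w; exists [seq tv v y | y <- s].
  by move=> z /mapP[y /hs[l pl hl] ->]; exists l => //; apply: tens2_wt.
rewrite big_map; elim: s {hs} => [|y s IH]; first by rewrite !big_nil -(scale0r (0 : 'cV_n)) tvZr scale0r.
by rewrite !big_cons tvDr IH.
Qed.

End TensorReps.

(* [coprod] is not shown to be multiplicative; only its action on modules is used. *)
Section Coprod.
Variables (M N : gmod D L).
Local Notation KM h := (act M (uK K h)).
Local Notation KN h := (act N (uK K h)).
Let HD b := tens_wrep (gmod_wrep M) (gmod_wrep N) b.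

Definition Dmod b : gmod D L := GMod (Oint_rmod (HD b)).

Lemma Dmod_gen b :
  [/\ forall i, act (Dmod b) (uE K i) = tm (act M (uE K i)) 1 + tm (KM (sgn_co b (Kc i))) (act N (uE K i)),
      forall i, act (Dmod b) (uF K i) = tm (act M (uF K i)) (KN (- sgn_co b (Kc i))) + tm 1 (act N (uF K i))
    & forall h, act (Dmod b) (uK K h) = tm (KM h) (KN h)].
Proof.
by split=> x; exact: (plift_gen (wrep_model (HD b)) _).
Qed.

Lemma coprod_act u : act2 M N (coprod u) = act (Dmod false) u.
Proof.
rewrite act2E /coprod plift_morph; apply: eq_plift => [c|[i|i|h]] /=; rewrite ?act2C //.
- by rewrite rmorphD /= !act2_tens rmorph1.
- by rewrite rmorphD /= !act2_tens rmorph1 uKVE.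
by rewrite act2_tens.
Qed.

Lemma tensmod_act u : uact (tensmod M N) u = act (Dmod false) u.
Proof. exact: coprod_act. Qed.

(** The bar-conjugated coproduct acts through the module with E_i |-> E_i (x) 1 + K_i^-1 (x) E_i.
    The defining relation of a quasi R-matrix thus says that it intertwines two module structures on
    M (x) N. *)
Lemma uubar_coprod_act u : act2 M N (uubar (coprod u)) = act (Dmod true) (ubar u).
Proof.
rewrite act2E uubar_amE /coprod (plift_morph (uubar_am K D)) (plift_morph (act2m M N)).
rewrite /ubar (plift_morph (act (Dmod true))).
have b1 : ubar (1 : UQ) = 1 by rewrite ubar_amE rmorph1.
have uD (x y : UU K D) : uubar (x + y) = uubar x + uubar y by rewrite !uubar_amE rmorphD.
have [hE hF hK] := Dmod_gen true.
apply: eq_plift => [c|[i|i|h]].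
- transitivity (act2m M N (uucst K D (kbar K c))); last by rewrite act2C [RHS]actC.
  by congr (act2m M N _); rewrite -[LHS]/(uubar_am K D (pcst c)) amorC.
- rewrite -[LHS]/(act2m M N (uubar (tens (uE K i) 1 + tens (uKi K i) (uE K i)))).
  rewrite uD !uubar_tens rmorphD /= !act2_tens b1 !ubarE ubarK rmorph1.
  by rewrite -[RHS]/(act (Dmod true) (uE K i)) hE.
- rewrite -[LHS]/(act2m M N (uubar (tens (uF K i) (uKV K i) + tens 1 (uF K i)))).
  rewrite uD !uubar_tens rmorphD /= !act2_tens b1 !ubarF uKVE ubarK rmorph1.
  by rewrite -[RHS]/(act (Dmod true) (uF K i)) hF.
rewrite -[LHS]/(act2m M N (uubar (tens (uK K h) (uK K h)))) uubar_tens act2_tens ubarK.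
by rewrite -[RHS]/(act (Dmod true) (uK K (- h))) hK.
Qed.
End Coprod.
End TensorModules.

Lemma UU_span (K : fieldType) (D : cartanDatum) (z : UU K D) :
  exists s : seq (Uq K D * Uq K D), z = \sum_(p <- s) tens p.1 p.2.
Proof.
have [[a1 a2 a3] [b1 b2 b3] c3] := UU_rel K D.
have tM (x y x' y' : Uq K D) : tens x y * tens x' y' = tens (x * x') (y * y') :> UU K D.
  rewrite (tensE x y) (tensE x' y') (tensE (x * x')) a2 b2.
  move: (tens x 1) (tens x' 1) (tens 1 y) (tens 1 y') (c3 x' y) => a b c d h.
  by rewrite !mulrA -[a * c * b]mulrA -h !mulrA.
elim/pres_ind: z => [[x|y]|c|u v [s ->] [s' ->]|u v [s ->] [s' ->]].
- exists [:: (x, 1)]; rewrite big_seq1 /=; apply: plift_inj => A i v m.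
  have [fD fM fc] := plift_alg_morph m; rewrite /tens fM !(plift_gen m).
  have [_ [_ _ c'] _] := m.2.
  by rewrite -[v (inr 1)]/(v (inr (pcst 1))) c' rmorph1 mulr1.
- exists [:: (1, y)]; rewrite big_seq1 /=; apply: plift_inj => A i v m.
  have [fD fM fc] := plift_alg_morph m; rewrite /tens fM !(plift_gen m).
  have [[_ _ c'] _ _] := m.2.
  by rewrite -[v (inl 1)]/(v (inl (pcst 1))) c' rmorph1 mul1r.
- by exists [:: (pcst c, 1)]; rewrite big_seq1 /= a3.
- by exists (s ++ s'); rewrite big_cat.
exists [seq (p.1 * p'.1, p.2 * p'.2) | p <- s, p' <- s'].
rewrite big_allpairs_dep mulr_suml; apply: eq_bigr => p _.
by rewrite mulr_sumr; apply: eq_bigr => p' _; rewrite tM.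
Qed.

(** * Equality of actions under the bar involution *)

Section BarStability.
Variables (K : fieldType) (D : cartanDatum) (L : fieldExtType (kfield K)).
Local Notation k := (kfield K).
Local Notation I := 'I_(rk D).
Local Notation hdual := 'cV[rat]_(rk D).
Local Notation coroots := 'cV[int]_(rk D).
Local Notation UQ := (Uq K D).
Local Notation r := (\dim {:L}).
Local Notation bs := (vbasis {:L}).
Local Notation co u x := (coord bs u x).

Lemma co_sum (x : L) : x = \sum_u co u x *: bs`_u.
Proof. exact: (coord_vbasis (memvf x)). Qed.

Lemma co_basis (u s : 'I_r) : co u bs`_s = (s == u)%:R.
Proof. by rewrite coord_free // (basis_free (vbasisP _)). Qed.

Section Res.
Variable n : nat.
(* Restriction of scalars from L to k, followed by the bar involution of k: it turns an L-linear
   module into one on which u acts as ubar u did, so that x acts by 0 on all modules iff ubar x does. *)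
Definition flat (A : 'M[L]_n) : 'M[L]_(n * r) := \matrix_(x, y)
  (kbar K (co (mxtens_unindex x).2 (A (mxtens_unindex x).1 (mxtens_unindex y).1 * bs`_(mxtens_unindex y).2)))%:A.

Lemma flat_zmod : zmod_morphism flat.
Proof. by move=> A B; apply/matrixP => x y; rewrite !mxE mulrBl linearB rmorphB scalerBl. Qed.
HB.instance Definition _ := GRing.isZmodMorphism.Build 'M[L]_n 'M[L]_(n * r) flat flat_zmod.

Lemma flat_monoid : monoid_morphism flat.
Proof.
split=> [|A B]; apply/matrixP => x y; rewrite !mxE.
  have -> : (x == y) = (mxtens_unindex x == mxtens_unindex y).
    by rewrite (inj_eq (can_inj (@mxtens_unindexK _ _))).
  case: (mxtens_unindex x) (mxtens_unindex y) => i u [j s] /=; rewrite xpair_eqE.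
  case: eqP => _; rewrite ?mul0r ?linear0 ?rmorph0 ?scale0r // mul1r co_basis eq_sym.
  by case: eqP => _; rewrite ?rmorph1 ?rmorph0 ?scale1r ?scale0r.
transitivity (\sum_l \sum_t flat A x (mxtens_index (l, t)) * flat B (mxtens_index (l, t)) y).
  rewrite mulr_suml linear_sum rmorph_sum scaler_suml; apply: eq_bigr => l _.
  rewrite -mulrA {1}[B _ _ * _]co_sum mulr_sumr linear_sum rmorph_sum scaler_suml.
  apply: eq_bigr => t _; rewrite !mxE mxtens_indexK /=.
  by rewrite -scalerAr linearZ rmorphM -algM mulrC.
rewrite pair_bigA [RHS](reindex (@mxtens_index n r)) /=; first by apply: eq_bigr => -[].
by exists (@mxtens_unindex n r) => z _; rewrite ?mxtens_indexK ?mxtens_unindexK.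
Qed.
HB.instance Definition _ := GRing.isMonoidMorphism.Build 'M[L]_n 'M[L]_(n * r) flat flat_monoid.

Lemma flatZ (c : k) A : flat ((c%:A : L) *: A) = ((kbar K c)%:A : L) *: flat A.
Proof.
apply/matrixP => x y; rewrite !mxE -mulrA -in_algE /= -scalerAl mul1r linearZ rmorphM algM //.
Qed.

(** Writing 1 in the basis recovers each entry from its products with the basis vectors, so [flat]
    loses no information. *)
Lemma flat_recover (A : 'M[L]_n) i j :
  A i j = \sum_s \sum_u (co s 1 * co u (A i j * bs`_s)) *: bs`_u.
Proof.
transitivity (A i j * 1); first by rewrite mulr1.
rewrite {1}[1]co_sum mulr_sumr; apply: eq_bigr => s _.
by rewrite -scalerAr {1}[A i j * _]co_sum scaler_sumr; apply: eq_bigr => u _; rewrite scalerA.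
Qed.

Lemma flat_co (A : 'M[L]_n) i j u s :
  flat A (mxtens_index (i, u)) (mxtens_index (j, s)) = (kbar K (co u (A i j * bs`_s)))%:A.
Proof. by rewrite mxE !mxtens_indexK. Qed.

Lemma flat_inj0 (A : 'M[L]_n) : flat A = 0 -> A = 0.
Proof.
move=> /matrixP h; apply/matrixP => i j; rewrite flat_recover mxE big1 // => s _.
rewrite big1 // => u _; have := h (mxtens_index (i, u)) (mxtens_index (j, s)).
rewrite flat_co mxE => /eqP; rewrite scaler_eq0 oner_eq0 orbF fmorph_eq0 => /eqP ->.
by rewrite mulr0 scale0r.
Qed.
End Res.

Section FlatModule.
Variable M : gmod D L.
Let H := gmod_wrep M.

Lemma flat_wrep : wrep (fun i => flat (act M (uE K i))) (fun i => flat (act M (uF K i)))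
  (fun h => flat (act M (uK K (- h)))).
Proof.
split.
- by rewrite oppr0 (wr0 H) rmorph1.
- by move=> h h'; rewrite opprD (wrD H) rmorphM.
- move=> h i; rewrite -!(rmorphM (@flat _)) /= (wrE H) flatZ kbar_qpow -qpowN ?(Plat_ok _ (Plat_alpha i)) //.
  by rewrite weight_atNr opprK.
- move=> h i; rewrite -!(rmorphM (@flat _)) /= (wrF H) flatZ kbar_qpow -qpowN ?qokN ?(Plat_ok _ (Plat_alpha i)) //.
  by rewrite weight_atNr opprK.
- move=> i j; rewrite -!(rmorphM (@flat _)) -!(rmorphB (@flat _)) /= (wrEF H); case: eqP => _; last by rewrite rmorph0.
  rewrite flatZ opprK -[act M (uK K (- _)) - _]opprB (raddfN (@flat _)) scalerN -scaleNr; congr (_ *: _).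
  by rewrite -scaleNr fmorphV rmorphB fmorphV kbar_qi invrK -[- (_ - _)^-1]invrN opprB.
move=> v; have [s [P [us hs hP h1 h0]]] := wproj_ex (wr_dec H).
exists [seq flat (P l) *m v | l <- s].
  move=> w /mapP[l ls ->]; exists l; first exact: hs.
  move=> h; rewrite -mulMV -(rmorphM (@flat _)) /=.
  have -> : act M (uK K (- h)) * P l = ((qpow K D (weight_at l (- h)))%:A : L) *: P l.
    by apply: mx_vec_eq => w'; rewrite mulMV (hP l w' (- h)) scalemxAl.
  rewrite flatZ kbar_qpow -qpowN ?weight_atNr ?opprK -?scalemxAl //.
  by rewrite -weight_atNr; apply/Plat_ok/hs.
by rewrite big_map -mulmx_suml -rmorph_sum h1 rmorph1 [RHS]mul1mx.
Qed.

Definition flatm : gmod D L := GMod (Oint_rmod flat_wrep).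

Lemma act_flat u : act flatm u = flat (act M (ubar u)).
Proof.
rewrite /ubar (plift_morph (act M)) (plift_morph (@flat (udim M))); apply: eq_plift => [c|[i|i|h]] //.
rewrite /= -[act M _]/(act M (pcst (kbar K c))) actC.
rewrite -[mxcst _ _ (kbar K c)]mulr1 mxcstM flatZ rmorph1 kbarK -mxcstM mulr1 //.
Qed.
End FlatModule.

Lemma bar_stab u : (forall M : gmod D L, act M u = 0) -> forall M : gmod D L, act M (ubar u) = 0.
Proof. by move=> h M; apply: flat_inj0; rewrite -act_flat h. Qed.

Lemma bar_stab_eq u v : (forall M : gmod D L, act M u = act M v) ->
  forall M : gmod D L, act M (ubar u) = act M (ubar v).
Proof.
have e : ubar u - ubar v = ubar (u - v) by rewrite !ubar_amE rmorphB.
move=> h M; apply/eqP; rewrite -subr_eq0 -rmorphB e; apply/eqP.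
by apply: bar_stab => N; rewrite rmorphB /= h subrr.
Qed.

(** On flattened modules the entries of z are sums of products of coordinates taken on M and on N.
    As multiplication in L is bilinear over k, these sums determine the entries of [uubar z]. *)
Lemma uubar_stab z : (forall M N : gmod D L, act2m M N z = 0) ->
  forall M N : gmod D L, act2m M N (uubar z) = 0.
Proof.
have [s ->] := UU_span z => h M N; have := h (flatm M) (flatm N).
rewrite uubar_amE (rmorph_sum (uubar_am K D)) (rmorph_sum (act2m M N)) rmorph_sum => /matrixP h0.
apply/matrixP => x y; case: (mxtens_indexP x) (mxtens_indexP y) => i i' [j j'].
rewrite summxE [RHS]mxE.
pose A (p : UQ * UQ) := act M (ubar p.1) i j; pose B (p : UQ * UQ) := act N (ubar p.2) i' j'.
transitivity (\sum_(p <- s) A p * B p).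
  apply: eq_bigr => p _; transitivity (act2m M N (uubar (tens p.1 p.2)) (mxtens_index (i, i')) (mxtens_index (j, j'))); first by [].
  by rewrite uubar_tens act2_tens tensmxE.
have key (u u' t t' : 'I_r) : \sum_(p <- s) co u (A p * bs`_t) * co u' (B p * bs`_t') = 0.
  have := h0 (mxtens_index (mxtens_index (i, u), mxtens_index (i', u')))
             (mxtens_index (mxtens_index (j, t), mxtens_index (j', t'))).
  rewrite summxE [RHS]mxE => e; apply: (fmorph_inj (kbar K)); apply: (@alg_inj K L).
  rewrite rmorph0 scale0r -[RHS]e rmorph_sum scaler_suml; apply: eq_bigr => p _.
  by rewrite /= act2_tens tensmxE !act_flat !flat_co rmorphM algM.
transitivity (\sum_(p <- s) \sum_t \sum_u \sum_t' \sum_u'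
   (co t 1 * co t' 1 * (co u (A p * bs`_t) * co u' (B p * bs`_t'))) *: (bs`_u * bs`_u')).
  apply: eq_bigr => p _; rewrite /A /B {1}(flat_recover (act M _) i j) {1}(flat_recover (act N _) i' j').
  rewrite mulr_suml; apply: eq_bigr => t _; rewrite mulr_suml; apply: eq_bigr => u _.
  rewrite mulr_sumr; apply: eq_bigr => t' _; rewrite mulr_sumr; apply: eq_bigr => u' _.
  rewrite -scalerAl -scalerAr scalerA; congr (_ *: _); ring.
rewrite exchange_big big1 //= => t _; rewrite exchange_big big1 //= => u _.
rewrite exchange_big big1 //= => t' _; rewrite exchange_big big1 //= => u' _.
by rewrite -scaler_suml -mulr_sumr key mulr0 scale0r.
Qed.

End BarStability.

Lemma cj_inv (R : fieldType) n (T x y : 'M[R]_n) : T \in unitmx -> cj T x y -> cj (invmx T) y x.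
Proof.
rewrite /cj => hT h; have hT' : invmx T * T = 1 := mulVmx hT.
have hT2 : T * invmx T = 1 := mulmxV hT.
by rewrite -[LHS]mulr1 -hT2 !mulrA -[_ * y * T]mulrA -h !mulrA hT' mul1r.
Qed.

Lemma sign_exprz (F : fieldType) (m : nat) : (-1) ^+ m = (-1) ^ (- m%:Z) :> F.
Proof. by rewrite -exprz_inv invrN1. Qed.
Lemma sign_mul_neq0 (F : fieldType) a (x y : F) : x != 0 -> y != 0 -> (-1) ^+ a * x * y != 0.
Proof. by move=> hx hy; rewrite !mulf_neq0 // signr_eq0. Qed.

(** * Conjugation by T_w *)

Section TInverse.
Variables (K : fieldType) (D : cartanDatum) (L : fieldExtType (kfield K)).
Local Notation k := (kfield K).
Local Notation I := 'I_(rk D).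
Local Notation hdual := 'cV[rat]_(rk D).
Local Notation coroots := 'cV[int]_(rk D).
Local Notation UQ := (Uq K D).
Local Notation qL := (@qL K D L).
Local Notation E i := (uE K i).
Local Notation F i := (uF K i).
Local Notation KU h := (uK K h).

Lemma act_iter (M : gmod D L) (f : UQ -> UQ) (g : 'M[L]_(udim M) -> 'M[L]_(udim M)) m x :
  (forall y, act M (f y) = g (act M y)) -> act M (iter m f x) = iter m g (act M x).
Proof. by move=> h; elim: m => //= m IH; rewrite h IH. Qed.

Lemma act_qfactZ (M : gmod D L) (i : I) m x :
  act M ((qfact (qi K i) m)^-1 *: x) = (qfact (qL i) m)^-1 *: act M x.
Proof. by rewrite actZ algV -in_algE qfact_rmorph. Qed.

Lemma TKP (M : gmod D L) (i : I) : cj (Tm M i) (act M (KU (Kc i))) (act M (KU (- Kc i))).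
Proof.
rewrite -(Ts1 M i); apply: cj_K => l.
rewrite wprod1 refl_mul weight_atNr !form_Kc formDr formNr formZr !form_alpha.
by rewrite pairing_alpha car_ii; ring.
Qed.
Lemma TKN (M : gmod D L) (i : I) : cj (Tm M i) (act M (KU (- Kc i))) (act M (KU (Kc i))).
Proof.
rewrite -(Ts1 M i); apply: cj_K => l.
rewrite wprod1 refl_mul weight_atNr !form_Kc formDr formNr formZr !form_alpha.
by rewrite pairing_alpha car_ii; ring.
Qed.

Lemma cj_TE (M : gmod D L) (i : I) :
  cj (Tm M i) (act M (E i)) (- (act M (F i) * act M (KU (Kc i)))).
Proof. by rewrite /cj Tm_E mulNr. Qed.
Lemma cj_TF (M : gmod D L) (i : I) :
  cj (Tm M i) (act M (F i)) (- (act M (KU (- Kc i)) * act M (E i))).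
Proof. by rewrite /cj Tm_F mulNr. Qed.

Lemma TinvK_ex (i : I) h : exists u', forall M : gmod D L, cj (Tm M i) (act M u') (act M (KU h)).
Proof.
exists (KU (h - (\sum_j h j 0 * car D j i) *: delta_mx i 0)) => M.
rewrite -(Ts1 M i); apply: cj_K => l; rewrite wprod1.
rewrite weight_atDr weight_atNr refl_mul weight_atD weight_atN weight_atZ; congr (_ - _).
rewrite /weight_at [RHS](bigD1 i) //= [X in _ = _ + X]big1 ?addr0 => [|j ji].
  rewrite !mxE !eqxx mulr1 rmorph_sum mulrC; congr (_ * _); apply: eq_bigr => j _.
  by rewrite rmorphM pairing_alpha.
by rewrite !mxE (negPf ji) mulr0 mul0r.
Qed.

(** One preimage serves all modules, as the choice in [Ad] requires. For i different from j it is a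
    right adjoint string of E_i through E_j, respectively an adjoint string of F_i through F_j
    K_j. *)
Lemma Tinv_ex (i : I) (u : UQ) : exists u', forall M : gmod D L, cj (Tm M i) (act M u') (act M u).
Proof.
elim/pres_ind: u => [[j|j|h]|c|u v [u' hu] [v' hv]|u v [u' hu] [v' hv]].
- case: (eqVneq i j) => [<-|ij].
    exists (- (KU (- Kc i) * F i)) => M; rewrite rmorphN rmorphM.
    have hK : cj (Tm M i) (act M (KU (- Kc i))) (act M (KU (Kc i))) by exact: TKN.
    have := cjN (cjM hK (cj_TF M i)).
    by rewrite mulrN opprK mulrA (wr_KN (gmod_wrep M)) mul1r.
  have aij : car D i j = - (absz (car D i j))%:Z by have := car_le0 ij; lia.
  set m := absz _ in aij.
  exists ((qfact (qi K i) m)^-1 *: iter m (fun x => x * E i - E i * KU (Kc i) * x * KU (- Kc i)) (E j)) => M.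
  have w : Wad (qL i) (act M (KU (Kc i))) (- m%:Z) (act M (E j)) by rewrite -aij; apply: E_Wad.
  have := Tm_zr w (EF_comm M ij) (leqnn m); rewrite subnn /zl /zr dpow0 dpw.unlock => h.
  rewrite /cj act_qfactZ (act_iter (g := adR (act M (E i)) (act M (KU (Kc i))) (act M (KU (- Kc i))))) // => y.
  by rewrite rmorphB !rmorphM.
- case: (eqVneq i j) => [<-|ij].
    exists (- (E i * KU (Kc i))) => M; rewrite rmorphN rmorphM.
    have := cjN (cjM (cj_TE M i) (TKP M i)).
    by rewrite mulNr opprK -mulrA (wr_KN (gmod_wrep M)) mulr1.
  have aij : car D i j = - (absz (car D i j))%:Z by have := car_le0 ij; lia.
  (* F_j K_j, unlike F_j, is a highest weight vector of the adjoint action; the factor K_j^-1 is put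
     back through [k']. *)
  set m := absz _ in aij; have [k' hk'] := TinvK_ex i (- Kc j).
  exists ((qfact (qi K i) m)^-1 *: iter m (fun x => (F i * x - x * F i) * KU (Kc i)) (F j * KU (Kc j)) * k') => M.
  have hW := gmod_wrep M; rewrite rmorphM /=.
  pose y := act M (F j) * act M (KU (Kc j)).
  have -> : act M (F j) = y * act M (KU (- Kc j)) by rewrite -mulrA (wr_KN hW) mulr1.
  apply: cjM (hk' M); have w : Wad (qL i) (act M (KU (Kc i))) m y.
    have hp : pairing (- alpha j + 0 : hdual) i = m%:~R.
      by rewrite addr0 pairingN pairing_alpha aij rmorphN opprK.
    exact: (opwt_Wad hp (opwtM (PlatN (Plat_alpha j)) (@Plat0 D) (opwtF hW j) (opwtK hW _))).
  have h0 : adl (act M (E i)) (act M (KU (Kc i))) (act M (KU (- Kc i))) y = 0.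
    rewrite (adl_W _ (wr_KN hW _) w) /y.
    have := wrEF hW i j; rewrite (negPf ij) => /eqP; rewrite subr_eq0 => /eqP e.
    have e2 := wrE hW (Kc j) i.
    rewrite -[act M (F j) * act M _ * _]mulrA e2 scMr !mulrA e scalerA qLX -algM.
    have -> : qpow K D ((eps D i)%:R * m%:~R) * qpow K D (weight_at (alpha i) (Kc j)) = 1.
      rewrite -qpowD ?(Plat_ok _ (Plat_alpha i)) //.
        have -> : (eps D i)%:R * m%:~R + weight_at (alpha i) (Kc j) = 0.
          have -> : m%:~R = - (car D i j)%:~R :> rat by rewrite aij rmorphN opprK.
          by rewrite form_Kc formC form_alpha pairing_alpha mulrN addNr.
        exact: qpow0.
      by rewrite -[(eps D i)%:R]/((eps D i)%:~R) -rmorphM qok_int.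
    by rewrite scale1r scale1r subrr.
  rewrite /cj -(Tm_adr w h0) act_qfactZ dpw.unlock.
  have ha x : act M ((F i * x - x * F i) * KU (Kc i)) = adr (act M (F i)) (act M (KU (Kc i))) (act M x).
    by rewrite rmorphM rmorphB !rmorphM.
  have ey : act M (F j * KU (Kc j)) = y by rewrite rmorphM.
  by rewrite (act_iter _ _ ha) ey.
- by have [u hu] := TinvK_ex i h; exists u.
- by exists (pcst c) => M; rewrite /cj !actC mxcstC.
- by exists (u' + v') => M; rewrite !rmorphD; exact: cjD (hu M) (hv M).
by exists (u' * v') => M; rewrite !rmorphM; exact: cjM (hu M) (hv M).
Qed.

Lemma Tsinv_ex s (u : UQ) : exists u', forall M : gmod D L, cj (Ts M s) (act M u') (act M u).
Proof.
elim: s u => [|i s IH] u; first by exists u => M; apply: cj_nil.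
have [u1 h1] := Tinv_ex i u; have [u' h'] := IH u1.
by exists u' => M; apply: cj_cons (h' M) (h1 M).
Qed.

(** The existence hypothesis keeps [Ad] away from its default value 0. *)
Lemma Ad_ex (f : fam1 D L) (u : UQ) : (forall M : gmod D L, f M \in unitmx) ->
  (exists u', forall M : gmod D L, cj (f M) (act M u) (act M u')) ->
  forall M : gmod D L, cj (f M) (act M u) (act M (Ad L f u)).
Proof.
move=> fu [u' hu'].
have ex : exists v, eq1 (emb1 L v) (mul1 (mul1 f (emb1 L u)) (inv1 f)).
  exists u' => M0 oM; pose M := GMod oM; have := hu' M; rewrite /cj /mul1 /emb1 /inv1 => e.
  transitivity (act M u' *m f M *m invmx (f M)); first by rewrite mulmxK ?(fu M).
  by congr (_ *m _); exact: esym e.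
have h := xgetPex 0 ex.
move=> M; have := h M (gmP M); rewrite /mul1 /emb1 /inv1 /cj => e.
by rewrite [X in _ = X * _]e -[RHS]/(_ *m _) mulmxKV ?(fu M).
Qed.

Lemma Tw_unit w (M : gmod D L) : Tw L w M \in unitmx.
Proof. exact: Ts_unit. Qed.

Lemma Ad_Tw_inv w (u : UQ) (M : gmod D L) :
  cj (Ts M (redword w)) (act M (Ad L (inv1 (Tw L w)) u)) (act M u).
Proof.
have [u' hu'] := Tsinv_ex (redword w) u.
have h := @Ad_ex (inv1 (Tw L w)) u _ _ M.
rewrite -[Ts M _](invmxK (Ts M (redword w))); apply: cj_inv.
  by rewrite unitmx_inv Ts_unit.
apply: h => [N|]; first by rewrite /inv1 unitmx_inv Ts_unit.
by exists u' => N; apply: cj_inv (hu' N); apply: Ts_unit.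
Qed.

Lemma Ad_Tw w (u u' : UQ) (M : gmod D L) :
  (forall M : gmod D L, cj (Ts M (redword w)) (act M u) (act M u')) ->
  act M (Ad L (Tw L w) u) = act M u'.
Proof.
move=> h; have h2 := @Ad_ex (Tw L w) u (@Tw_unit w) (ex_intro _ u' h) M.
exact: cj_inj (Ts_unit M _) h2 (h M).
Qed.

Definition adtU (j : I) m (x : UQ) : UQ :=
  \sum_(r < m.+1) ((-1) ^+ r * qi K j ^ (- r%:Z)) *: (divE K j (m - r) * x * divE K j r).
Definition adrU (j : I) m (x : UQ) : UQ :=
  \sum_(r < m.+1) ((-1) ^+ r * qi K j ^ (- r%:Z)) *: (divE K j r * x * divE K j (m - r)).

Lemma act_adtU (M : gmod D L) j m x : Wad (qL j) (act M (KU (Kc j))) (- m%:Z) (act M x) ->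
  act M (adtU j m x) = adtop (qL j) (act M (E j)) (act M (KU (Kc j))) (act M (KU (- Kc j))) m (act M x).
Proof.
move=> w; rewrite (adtopE' w) rmorph_sum; apply: eq_bigr => r _ /=.
by rewrite actZ actM3 !act_divE algM algX -in_algE rmorphXn rmorphN1.
Qed.
Lemma act_adrU (M : gmod D L) j m x :
  act M (adrU j m x) = adtopr (qL j) (act M (E j)) m (act M x).
Proof.
rewrite /adtopr rmorph_sum; apply: eq_bigr => r _ /=.
by rewrite actZ actM3 !act_divE algM algX -in_algE rmorphXn rmorphN1.
Qed.

Lemma adrUZ j m a x : adrU j m (a *: x) = a *: adrU j m x.
Proof.
rewrite /adrU scaler_sumr; apply: eq_bigr => r _.
by rewrite pscaleMr pscaleMl !scalerA mulrC.
Qed.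

Lemma ubarX u m : ubar (u ^+ m) = ubar u ^+ m :> UQ.
Proof.
elim: m => [|m IH]; last by rewrite !exprS ubarM IH.
by rewrite !expr0 -[X in ubar X]/(pcst 1) ubarC rmorph1.
Qed.
Lemma ubar_sum (J : Type) (r : seq J) (g : J -> UQ) :
  ubar (\sum_(x <- r) g x) = \sum_(x <- r) ubar (g x).
Proof. exact: (raddf_sum (ubar_am K D)). Qed.

Lemma ubar_divE j m : ubar (divE K j m) = divE K j m :> UQ.
Proof.
by rewrite /divE ubarZ fmorphV qfact_rmorph kbar_qi qfactV ubarX ubarE.
Qed.

(** Bar fixes divided powers and inverts q, so it reverses the sum by r |-> m - r: the left string
    becomes the right one, up to (-1)^m q^m. *)
Lemma ubar_adtU j m x :
  ubar (adtU j m x) = ((-1) ^+ m * qi K j ^ m) *: adrU j m (ubar x).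
Proof.
rewrite /adtU /adrU ubar_sum scaler_sumr (reindex_inj rev_ord_inj).
apply: eq_bigr => r _; rewrite ubarZ (ubarM (_ * _) (divE K j _)) (ubarM (divE K j _) x) !ubar_divE scalerA -[rev_ord r : nat]/(m.+1 - r.+1)%N subSS.
have rm : (r <= m)%N by rewrite leq_ord.
rewrite (subKn rm); congr (_ *: _).
rewrite rmorphM rmorphXn rmorphN1 fmorphXz kbar_qi exprz_inv opprK.
have q0 := qi_neq0 K j.
rewrite mulrACA -exprD -expfzDr //; congr (_ * _ ^ _); last by lia.
by rewrite -signr_odd -[in RHS]signr_odd oddB // oddD.
Qed.

Definition mk (l : hdual) (j : I) : nat := absz (numq (pairing l j)).
(* Explicit elements acting as T_s (E_i0) and T_(rev s)^-1 (E_i0) for reduced s *)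
Fixpoint chn (i0 : I) (s : seq I) : UQ :=
  if s is j :: s' then adtU j (mk (wprod s' *m alpha i0) j) (chn i0 s') else E i0.
Fixpoint chb (i0 : I) (s : seq I) : UQ :=
  if s is j :: s' then adrU j (mk (wprod s' *m alpha i0) j) (chb i0 s') else E i0.
(** The scalar between bar(T_s(E_i0)) and T_(rev s)^-1(E_i0); [kappaE] expresses it through rho_X
    and rho_X^vee. *)
Fixpoint kappa (i0 : I) (s : seq I) : kfield K :=
  if s is j :: s' then (-1) ^+ (mk (wprod s' *m alpha i0) j) * qi K j ^ (mk (wprod s' *m alpha i0) j) * kappa i0 s'
  else 1.

Lemma ubar_chn i0 s : ubar (chn i0 s) = kappa i0 s *: chb i0 s.
Proof.
elim: s => [|j s IH] /=; first by rewrite scale1r ubarE.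
by rewrite ubar_adtU IH adrUZ scalerA.
Qed.

Lemma kappa_neq0 i0 s : kappa i0 s != 0.
Proof.
elim: s => [|j s IH]; first exact: oner_neq0.
exact: (sign_mul_neq0 _ (expfz_neq0 _ (qi_neq0 K j)) IH).
Qed.

Section Chain.
Variables (X : {set I}) (t : {perm I}) (i0 : I).
Hypothesis tX : forall j, j \in X -> t j \in X.
Hypothesis hL : forall j, j \in X -> longest X *m alpha j = - alpha (t j).
Hypothesis i0X : i0 \notin X.
Variable sX : seq I.
Hypothesis sXr : reduced sX.
Hypothesis sXe : wprod sX = longest X.
Hypothesis sXl : {subset sX <= X}.
Let sXP : [/\ reduced sX, wprod sX = longest X & {subset sX <= X}]. Proof. by []. Qed.
Local Notation v0 := (longest X *m alpha i0).

Lemma wprod_off s (l : hdual) j : {subset s <= X} -> j \notin X -> (wprod s *m l) j 0 = l j 0.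
Proof.
move=> hs jX; elim: s hs => [|a s IH] hs; first by rewrite mul1mx.
rewrite /= -mulmxA refl_mul [LHS]mxE IH => [|z hz]; last by apply: hs; rewrite inE hz orbT.
rewrite [X in _ + X]mxE [X in - X]mxE alphaE; case: eqP => [h|_]; last by rewrite mulr0 subr0.
by rewrite h hs ?mem_head in jX.
Qed.

(** The root obtained from alpha_j by the inverse of s is positive and supported on X, hence pairs
    nonpositively with alpha_i0. So the absolute value in [mk] only removes a sign. *)
Lemma mkE s j : reduced (j :: s) -> {subset j :: s <= X} ->
  pairing (wprod s *m alpha i0) j = (- (mk (wprod s *m alpha i0) j)%:Z)%:~R.
Proof.
move=> hr hs; have /intrP[m hm] := Plat_wprod s (Plat_alpha i0) j.
suff h : m <= 0 by rewrite /mk hm numq_int; congr (_%:~R); lia.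
have hrr := red_rev hr; rewrite rev_cons in hrr; have hp := pos_root hrr.
have sX' : {subset rev s <= X} by move=> x; rewrite mem_rev => xs; apply: hs; rewrite inE xs orbT.
have e0 : (wprod (rev s) *m alpha j) i0 0 = 0.
  rewrite wprod_off // alphaE; by case: eqP => // h; move: (i0X); rewrite h hs ?mem_head.
have : form (wprod (rev s) *m alpha j) (alpha i0) <= 0.
  rewrite formE sumr_le0 // => a _; case: (eqVneq a i0) => [->|ne]; first by rewrite e0 !mul0r.
  rewrite pairing_alpha mulr_ge0_le0 ?lerz0 ?car_le0 // mulr_ge0 //.
rewrite form_wprodl revK form_alpha hm pmulr_rle0 ?lerz0 // ltr0n; exact: eps_gt0.
Qed.

Section OneMod.
Variable M : gmod D L.
Let H := gmod_wrep M.
Local Notation opM := (opwt (fun h => act M (KU h))).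

Lemma E0_comm j : j \in X -> act M (F j) * act M (E i0) = act M (E i0) * act M (F j).
Proof. by move=> jX; apply: EF_comm; apply: contraNneq i0X => <-. Qed.

Variable v : 'M[L]_(udim M).
Hypothesis hv : cj (Ts M sX) (act M (E i0)) v.

Lemma v_wt : opM v0 v.
Proof.
have [_ e _] := sXP; rewrite -e.
exact: cj_opwt (Plat_alpha i0) (opwtE H i0) hv.
Qed.

Lemma v0_int : exists z, v0 = Qint z.
Proof.
have [_ e _] := sXP; rewrite -e -Qint_delta; exact: wprod_int.
Qed.

Lemma form_v0_ok b : Plat b -> qok D (form b v0).
Proof.
by move=> pb; have [z ez] := v0_int; rewrite formC -(weight_at_coroot b ez); apply: Plat_ok.
Qed.

Lemma levi_Fcj j : j \in X ->
  cj (Ts M sX) (act M (F (t j))) (- (act M (KU (- Kc j)) * act M (E j))).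
Proof.
move=> jX; have [hr e hl] := sXP.
apply: (Ts_simpleN M (j := t j) (k := j) hr _).2.
by rewrite e hL ?tX // (longest_tt tX hL).
Qed.

(** E_i0 commutes with F_(t j). Conjugation by T_(w_X) turns F_(t j) into -K_j^-1 E_j and E_i0 into
    v, which leaves a q-commutation relation. *)
Lemma Ej_v j : j \in X -> act M (E j) * v = (qpow K D (form (alpha j) v0))%:A *: (v * act M (E j)).
Proof.
move=> jX; have c := levi_Fcj jX.
have h1 := cjM c hv; have h2 := cjM hv c; rewrite (E0_comm (tX jX)) in h1.
have := cj_inj (Ts_unit M sX) h1 h2; rewrite mulNr mulrN => /oppr_inj h.
have := congr1 (fun z => act M (KU (Kc j)) * z) h.
rewrite /= !mulrA (wr_KN H) mul1r v_wt form_Kc => ->.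
by rewrite !scMl -[v * _ * _]mulrA (wr_KN H) mulr1.
Qed.

Lemma G_v b e : G X b e -> e * v = (qpow K D (form b v0))%:A *: (v * e).
Proof.
elim=> {b e} [b pb||j jX|a b x y _ hx _ hy|b b' x y gx hx gy hy].
- by rewrite mul0r mulr0 scaler0.
- by rewrite formC form0r qpow0 scale1r scale1r mul1r mulr1.
- exact: Ej_v.
- by rewrite mulrDl mulrDr scMl scMr hx hy scalerDr !scalerA mulrC.
have [pb _] := GP gx; have [pb' _] := GP gy.
rewrite -mulrA hy scMr [x * (v * y)]mulrA hx scMl scalerA -algM formDl qpowD ?form_v0_ok //.
by rewrite mulrC mulrA.
Qed.

(** Apply T_p T_j: x becomes v, and F_j becomes -K y with K in the torus and y in the positive part
    of U_q(g_X). These commute by [G_v], because the powers of q from K and from y cancel. *)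
Lemma F_chain p j s x : sX = p ++ j :: s -> cj (Ts M s) (act M (E i0)) x ->
  act M (F j) * x = x * act M (F j).
Proof.
move=> es hx; have [hr e hl] := sXP.
have hpj : reduced (rcons p j) by move: hr; rewrite es -cat_rcons => /red_catl.
have pS : {subset rcons p j <= X}.
  by move=> y hy; apply: hl; rewrite es -cat_rcons mem_cat hy.
have [y gy cy] := Ts_pos M hpj pS.
have [z ez] := wprod_int p (delta_mx j 0); rewrite Qint_delta in ez.
have cK : cj (Ts M p) (act M (KU (- Kc j))) (act M (KU (- coroot_of z))).
  apply: cj_K => l; rewrite !weight_atNr form_Kc (weight_at_coroot _ (erefl (Qint z))) -ez.
  by rewrite form_wprod.
have cF : cj (Ts M (rcons p j)) (act M (F j)) (- (act M (KU (- coroot_of z)) * y)).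
  by rewrite Ts_rcons; apply: cj_comp (cj_TF M j) (cjN (cjM cK cy)).
have cX : cj (Ts M (rcons p j)) x v.
  have [w hw] := cj_ex x (Ts_unit M (rcons p j)).
  suff -> : v = w by [].
  apply: (cj_inj (Ts_unit M sX) hv); rewrite es -cat_rcons Ts_cat; exact: cj_comp hx hw.
have hcomm : act M (KU (- coroot_of z)) * y * v = v * (act M (KU (- coroot_of z)) * y).
  rewrite -mulrA (G_v gy) scMr [X in _ *: X = _]mulrA v_wt scMl scalerA mulrA -algM weight_atNr.
  rewrite (weight_at_coroot _ (erefl (Qint z))) -ez -qpowD; last first.
    - by apply/qokN/form_v0_ok/Plat_wprod/Plat_alpha.
    - by apply/form_v0_ok/Plat_wprod/Plat_alpha.
  by rewrite subrr qpow0 scale1r scale1r.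
have h1 := cjM cF cX; have h2 := cjM cX cF.
rewrite mulNr hcomm in h1; rewrite mulrN in h2.
have := Ts_unit M (rcons p j) => hu; have := etrans h1 (esym h2).
by move=> /(congr1 (mulmx (invmx (Ts M (rcons p j))))); rewrite !mulKmx.
Qed.
End OneMod.

(** [mkE] and [F_chain] supply the hypotheses under which one more T_j is the top of an adjoint
    string. *)
Lemma chn_cj p s (M : gmod D L) : sX = p ++ s ->
  cj (Ts M s) (act M (E i0)) (act M (chn i0 s)).
Proof.
elim: s p => [|j s IH] p es; first exact: cj_nil.
have es' : sX = rcons p j ++ s by rewrite cat_rcons.
have h := IH _ es'; have [hr e hl] := sXP.
have [v hv] := cj_ex (act M (E i0)) (Ts_unit M sX).
have hF := F_chain hv es h.
have hjs : reduced (j :: s) by move: hr; rewrite es => /red_catr.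
have hsub : {subset j :: s <= X} by move=> x hx; apply: hl; rewrite es mem_cat hx orbT.
have w : Wad (qL j) (act M (KU (Kc j))) (- (mk (wprod s *m alpha i0) j)%:Z) (act M (chn i0 s)).
  exact: opwt_Wad (mkE hjs hsub) (cj_opwt (Plat_alpha i0) (opwtE (gmod_wrep M) i0) h).
by apply: cj_cons h _; rewrite /= (act_adtU w) /cj (Tm_adtop w hF).
Qed.

Lemma chn_wt p s (M : gmod D L) : sX = p ++ s ->
  opwt (fun h => act M (KU h)) (wprod s *m alpha i0) (act M (chn i0 s)).
Proof.
by move=> es; apply: cj_opwt (Plat_alpha i0) (opwtE (gmod_wrep M) i0) (chn_cj M es).
Qed.

Lemma chn_F p j s (M : gmod D L) : sX = p ++ j :: s ->
  act M (F j) * act M (chn i0 s) = act M (chn i0 s) * act M (F j).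
Proof.
move=> es; have [v hv] := cj_ex (act M (E i0)) (Ts_unit M sX).
apply: (F_chain hv es); apply: (@chn_cj (rcons p j)); by rewrite cat_rcons.
Qed.

(** Carried over from [chn] by the bar involution, which sends [chn] to a nonzero multiple of [chb];
    so is [chb_F]. *)
Lemma chb_wt p s (M : gmod D L) : sX = p ++ s ->
  opwt (fun h => act M (KU h)) (wprod s *m alpha i0) (act M (chb i0 s)).
Proof.
move=> es h; have k0 := alg_neq0 L (kappa_neq0 i0 s).
have e (N : gmod D L) : act N (KU (- h) * chn i0 s) =
    act N (qpow K D (weight_at (wprod s *m alpha i0) (- h)) *: (chn i0 s * KU (- h))).
  by rewrite actZ !rmorphM; apply: (chn_wt N es).
have := bar_stab_eq e M; rewrite ubarZ !ubarM ubarK opprK ubar_chn kbar_qpow.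
rewrite pscaleMl pscaleMr !actZ !rmorphM /= scalerA mulrC -scalerA => /(scalerI k0) ->.
rewrite -qpowN; last by apply/Plat_ok/Plat_wprod/Plat_alpha.
by rewrite weight_atNr opprK.
Qed.

Lemma chb_F p j s (M : gmod D L) : sX = p ++ j :: s ->
  act M (F j) * act M (chb i0 s) = act M (chb i0 s) * act M (F j).
Proof.
move=> es; have k0 := alg_neq0 L (kappa_neq0 i0 s).
have e (N : gmod D L) : act N (F j * chn i0 s) = act N (chn i0 s * F j).
  by rewrite !rmorphM; apply: (chn_F N es).
have := bar_stab_eq e M; rewrite !ubarM ubarF ubar_chn pscaleMl pscaleMr !actZ !rmorphM /=.
by move/(scalerI k0).
Qed.

Lemma chb_cj p s (M : gmod D L) : sX = p ++ s ->
  cj (Ts M (rev s)) (act M (chb i0 s)) (act M (E i0)).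
Proof.
elim: s p => [|j s IH] p es; first exact: cj_nil.
have es' : sX = rcons p j ++ s by rewrite cat_rcons.
rewrite rev_cons Ts_rcons; apply: cj_comp (IH _ es').
have [hr e hl] := sXP.
have hjs : reduced (j :: s) by move: hr; rewrite es => /red_catr.
have hsub : {subset j :: s <= X} by move=> x hx; apply: hl; rewrite es mem_cat hx orbT.
have w : Wad (qL j) (act M (KU (Kc j))) (- (mk (wprod s *m alpha i0) j)%:Z) (act M (chb i0 s)).
  exact: opwt_Wad (mkE hjs hsub) (chb_wt M es').
by rewrite /= act_adrU /cj (Tm_adtopr w (chb_F M es)).
Qed.

Lemma chn_lword (M : gmod D L) : cj (Ts M sX) (act M (E i0)) (act M (chn i0 sX)).
Proof. exact: (@chn_cj [::]). Qed.

(** As w_X is an involution, the reversed word is another reduced word of w_X and gives the same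
    T. *)
Lemma chb_lword (M : gmod D L) : cj (Ts M sX) (act M (chb i0 sX)) (act M (E i0)).
Proof.
have [hr _ _] := sXP.
rewrite -(matsumoto M (red_rev hr) hr (rev_longest tX hL sXe)); exact: (@chb_cj [::]).
Qed.

(** A letter j contributes (-1)^m q_j^m, where -m is the value of alpha_i0 on the coroot of the
    corresponding positive root b of X, and eps_j m = -(alpha_i0, b). Running over all b produces
    rho_X^vee and rho_X. *)
Lemma kappaE : sX = lword X -> kappa i0 sX =
  (-1) ^ numq (2 * at_rhoV X (alpha i0)) * qpow K D (- form (alpha i0) (2 *: rho X)).
Proof.
move=> esX; have [hr e hl] := sXP.
rewrite /at_rhoV /rho !(sum_posroot hL) -!esX scalerA mulrA divff ?pnatr_eq0 // scale1r mul1r.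
suff h p s : sX = p ++ s -> exists m : nat,
   [/\ \sum_(b <- betas s) 2 * form (alpha i0) b / form b b = (- m%:Z)%:~R,
     qok D (- form (alpha i0) (\sum_(b <- betas s) b)) &
     kappa i0 s = (-1) ^+ m * qpow K D (- form (alpha i0) (\sum_(b <- betas s) b))].
  have [m [h1 _ h2]] := h [::] sX erefl; rewrite h1 h2 numq_int; congr (_ * _).
  exact: sign_exprz.
elim: s p => [|j s IH] p es.
  exists 0%N; rewrite !big_nil form0r oppr0 qpow0 /= mulr1 oppr0; split=> //; exact: (qok_int D 0).
have es' : sX = rcons p j ++ s by rewrite cat_rcons.
have [m [h1 h2 h3]] := IH _ es'.
have hjs : reduced (j :: s) by move: hr; rewrite es => /red_catr.
have hsub : {subset j :: s <= X} by move=> x hx; apply: hl; rewrite es mem_cat hx orbT.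
have hm := mkE hjs hsub; set m' := mk _ _ in hm.
pose be := wprod (rev s) *m alpha j.
have hb : form (alpha i0) be = (eps D j)%:R * (- m'%:Z)%:~R.
  by rewrite /be formC form_wprodl revK form_alpha hm.
have hbb : form be be = 2 * (eps D j)%:R.
  by rewrite /be form_wprod form_alpha pairing_alpha car_ii mulrC.
have e0 : (eps D j)%:R != 0 :> rat by rewrite pnatr_eq0 -lt0n eps_gt0.
have ok1 : qok D (- form (alpha i0) be).
  by apply: qokN; rewrite hb -[(eps D j)%:R]/((eps D j)%:~R) -rmorphM qok_int.
exists (m' + m)%N; rewrite /= !big_cons -/be formDr opprD qpowD //; split.
- by rewrite h1 hb hbb PoszD opprD rmorphD; congr (_ + _); field.
- exact: qokD.
have -> : qpow K D (- form (alpha i0) be) = qi K j ^ m'.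
  by rewrite hb qiX rmorphN mulrN opprK.
by rewrite -/m' h3 exprD mulrACA.
Qed.

End Chain.
End TInverse.

(** * Parity of the adjugate under a symmetry of the matrix *)

Lemma F2P (a : 'F_2) : a = 0 \/ a = 1.
Proof. by case: a => [[|[|]]] // h; [left|right]; apply: val_inj. Qed.

(* Over F_2 either the kernel of A is a line, fixed pointwise by t, or adj A = 0. *)
Lemma adj_perm_F2 n (A : 'M['F_2]_n) (t : {perm 'I_n}) (p : 'cV['F_2]_n) :
  \det A = 0 -> (forall i j, A (t i) (t j) = A i j) ->
  forall i, (\adj A *m p) (t i) 0 = (\adj A *m p) i 0.
Proof.
move=> dA ht; set x := \adj A *m p; pose x' : 'cV['F_2]_n := \col_i x (t i) 0.
suff : x' = x by move=> e i; transitivity (x' i 0); [rewrite [RHS]mxE|rewrite e].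
have Ax : A *m x = 0 by rewrite mulmxA mul_mx_adj dA mul_scalar_mx scale0r.
have Ax' : A *m x' = 0.
  apply/matrixP => i c; rewrite [c]ord1 [RHS]mxE mxE.
  have := congr1 (fun m : 'cV_n => m (t i) 0) Ax; rewrite [RHS]mxE mxE (reindex_inj (@perm_inj _ t)) => h.
  by rewrite -[RHS]h; apply: eq_bigr => j _; rewrite mxE ht.
apply: contrapT => ne.
suff adj0 : \adj A = 0 by apply: ne; apply/matrixP => i c; rewrite [c]ord1 mxE /x adj0 mul0mx !mxE.
(* Two distinct nonzero kernel vectors over F_2 give, for every i, a nonzero kernel vector whose
   i-th coordinate is 0; then all minors of size n - 1 vanish. *)
have ker i : exists2 v : 'cV['F_2]_n, v != 0 & A *m v = 0 /\ v i 0 = 0.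
  have nz : x != 0.
    by apply/eqP => h; apply: ne; apply/matrixP => a c; rewrite [c]ord1 mxE h !mxE.
  have nz' : x' != 0.
    apply/eqP => h; apply: ne; rewrite h; apply/matrixP => a c; rewrite [c]ord1.
    have := congr1 (fun m : 'cV_n => m ((t^-1)%g a) 0) h; rewrite !mxE permKV => ->//.
  case: (F2P (x i 0)) => h1; first by exists x.
  case: (F2P (x' i 0)) => h2; first by exists x'.
  exists (x + x').
    apply/eqP => /(congr1 (fun z => z - x')); rewrite addrK sub0r => h; apply: ne.
    by rewrite h; apply/matrixP => a c; rewrite [RHS]mxE; case: (F2P (x' a c)) => ->; apply: val_inj.
  by rewrite mulmxDr Ax Ax' addr0 mxE h1 h2; split=> //; apply: val_inj.
apply/matrixP => i j; rewrite !mxE /cofactor.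
have [v nv [Av vi]] := ker i.
suff -> : \det (row' j (col' i A)) = 0 by rewrite mulr0.
rewrite -det_tr; apply/eqP/det0P; exists (row' i v)^T.
  apply: contraNneq nv => /matrixP h; apply/eqP/matrixP => a c; rewrite [c]ord1 [RHS]mxE.
  by case: (unliftP i a) => [b ->|->//]; have := h 0 b; rewrite !mxE.
rewrite -trmx_mul; apply/matrixP => c a; rewrite [c]ord1 !mxE.
have := congr1 (fun m : 'cV_n => m (lift j a) 0) Av; rewrite !mxE (bigD1_ord i) //= vi mulr0 add0r => h.
by rewrite -[RHS]h; apply: eq_bigr => b _; rewrite !mxE.
Qed.

Lemma adj_perm_even n (A : 'M[int]_n) (t : {perm 'I_n}) (p : 'cV[int]_n) :
  (2 %| \det A)%Z -> (forall i j, A (t i) (t j) = A i j) ->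
  forall i, (2 %| (\adj A *m p) (t i) ord0 - (\adj A *m p) i ord0)%Z.
Proof.
move=> dA ht i; have ch : 2%N \in [pchar 'F_2] by apply: pchar_Fp.
pose f : {rmorphism int -> 'F_2} := intmul 1.
rewrite (dvdz_pcharf ch); rewrite (dvdz_pcharf ch) in dA.
have d0 : \det (map_mx f A) = 0 by rewrite det_map_mx; apply/eqP.
have h : forall a b, map_mx f A (t a) (t b) = map_mx f A a b by move=> a b; rewrite !mxE ht.
have e (j : 'I_n) : f ((\adj A *m p) j ord0) = (\adj (map_mx f A) *m map_mx f p) j ord0.
  by rewrite -map_mx_adj -map_mxM [RHS]mxE.
rewrite -[_%:~R]/(f _) rmorphB !e subr_eq0; apply/eqP.
exact: adj_perm_F2 d0 h i.
Qed.

(** * The function xi *)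

Definition evr (x : rat) := exists m : int, x = (2 * m)%:~R.
Lemma evrD x y : evr x -> evr y -> evr (x + y).
Proof. by move=> [a ->] [b ->]; exists (a + b); rewrite mulrDr rmorphD. Qed.
Lemma evrN x : evr x -> evr (- x).
Proof. by move=> [a ->]; exists (- a); rewrite mulrN rmorphN. Qed.
Lemma evrM x (a : int) : evr x -> evr (a%:~R * x).
Proof. by move=> [b ->]; exists (a * b); rewrite -rmorphM mulrCA. Qed.
Lemma evr2 x : x \is a Num.int -> evr (2 * x).
Proof. by move=> /intrP[m ->]; exists m; rewrite rmorphM. Qed.
Lemma evr0 : evr 0. Proof. by exists 0. Qed.
Lemma evr_sum (J : finType) (P : pred J) (f : J -> rat) : (forall j, evr (f j)) -> evr (\sum_(j | P j) f j).
Proof. by move=> h; apply: (big_ind evr) => //; [apply: evr0|apply: evrD]. Qed.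

(** Off-diagonal terms occur in equal pairs, and z_i (z_i - 1) is even. *)
Lemma quad_even n (S : 'I_n -> 'I_n -> rat) (z : 'I_n -> int) :
  (forall i j, S i j \is a Num.int) -> (forall i j, S i j = S j i) ->
  evr (\sum_i \sum_j (z i)%:~R * S i j * (z j)%:~R - \sum_i S i i * (z i)%:~R).
Proof.
move=> hS sS; pose x i j := (z i)%:~R * S i j * (z j)%:~R.
have xint i j : x i j \is a Num.int by rewrite !rpredM ?intr_int.
have -> : \sum_i \sum_j (z i)%:~R * S i j * (z j)%:~R =
   \sum_i x i i + 2 * \sum_(i < n) \sum_(j < n | (j < i)%N) x i j.
  transitivity (\sum_i (x i i + (\sum_(j < n | (j < i)%N) x i j + \sum_(j < n | (i < j)%N) x i j))).
    apply: eq_bigr => i _; rewrite (bigD1 i) //=; congr (_ + _).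
    rewrite (bigID (fun j : 'I_n => (j < i)%N)) /=; congr (_ + _); apply: eq_bigl => j.
      by case: ltngtP => h; rewrite ?andbF ?andbT //; apply/eqP => e; rewrite e ltnn in h.
    rewrite -leqNgt; case: ltngtP => h; rewrite ?andbF ?andbT //.
      by apply/eqP => e; rewrite e ltnn in h.
    by apply/negbTE/negPn/eqP/val_inj.
  rewrite big_split big_split /=.
  congr (_ + _).
  have -> : \sum_(i < n) \sum_(j < n | (i < j)%N) x i j = \sum_(j < n) \sum_(i < n | (i < j)%N) x i j.
    by rewrite (exchange_big_dep predT).
  have -> : \sum_(j < n) \sum_(i < n | (i < j)%N) x i j = \sum_(i < n) \sum_(j < n | (j < i)%N) x i j.
    apply: eq_bigr => i _; apply: eq_bigr => j _; rewrite /x sS; ring.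
  by ring.
rewrite addrAC; apply: evrD; last by apply: evr2; apply: rpred_sum => i _; apply: rpred_sum => j _.
rewrite -sumrB; apply: evr_sum => i.
have /intrP[s hs] := hS i i; rewrite /x hs.
have -> : (z i)%:~R * s%:~R * (z i)%:~R - s%:~R * (z i)%:~R = s%:~R * ((z i) * (z i - 1))%:~R :> rat.
  by rewrite rmorphM rmorphB; ring.
apply: evrM; have [m hm] : exists m : int, z i * (z i - 1) = 2 * m.
  exists ((z i * (z i - 1)) %/ 2)%Z; have := divz_eq (z i) 2; have := ltz_pmod (z i) (isT : 0 < 2 :> int).
  have := modz_ge0 (z i) (isT : 2 != 0 :> int); move: (z i %% 2)%Z (z i %/ 2)%Z => r q h0 h2 ->.
  have [->|->] : r = 0 \/ r = 1 by lia.
    rewrite addr0; have -> : q * 2 * (q * 2 - 1) = (q * (q * 2 - 1)) * 2 by ring.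
    by rewrite mulzK // mulrC.
  have -> : (q * 2 + 1) * (q * 2 + 1 - 1) = ((q * 2 + 1) * q) * 2 by ring.
  by rewrite mulzK // mulrC.
by exists m; rewrite hm.
Qed.

Section XiExponent.
Variables (K : fieldType) (D : cartanDatum).
Local Notation I := 'I_(rk D).
Local Notation hdual := 'cV[rat]_(rk D).
Variables (X : {set I}) (t : {perm I}).
Hypothesis hc : forall i j, car D (t i) (t j) = car D i j.
Hypothesis he : forall i, eps D (t i) = eps D i.
Hypothesis tX : forall j, (t j \in X) = (j \in X).
Hypothesis tt : forall i, t (t i) = i.
Hypothesis hL : forall j, j \in X -> longest X *m alpha j = - alpha (t j).

Let tX' j : j \in X -> t j \in X. Proof. by rewrite tX. Qed.

(** The map -Theta, an isometric involution. *)
Definition Bop (l : hdual) := longest X *m diagram t l.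
Lemma ThetaE l : Theta X t l = - Bop l. Proof. by []. Qed.

Lemma diagK (l : hdual) : diagram t (diagram t l) = l.
Proof.
apply/matrixP => i c; rewrite [c]ord1 !mxE; congr (l _ 0).
by apply: (@perm_inj _ t); apply: (@perm_inj _ t); rewrite !permKV tt.
Qed.

Lemma Bop_form l m : form (Bop l) (Bop m) = form l m.
Proof. by rewrite longest_form diag_form. Qed.
Lemma Bop_lin a l m : Bop (a *: l + m) = a *: Bop l + Bop m.
Proof. by rewrite /Bop diag_lin mulmxDr -scalemxAr. Qed.
Lemma BopN l : Bop (- l) = - Bop l.
Proof. by rewrite /Bop diagN mulmxN. Qed.
Lemma BopD l m : Bop (l + m) = Bop l + Bop m.
Proof. by rewrite -[l in LHS]scale1r Bop_lin scale1r. Qed.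

Lemma diag_longest l : diagram t (longest X *m l) = longest X *m diagram t l.
Proof.
have [_ e _] := lwordP X; have [h _] := lword_diag tX' hL hc tX.
by rewrite -e diag_wprod // h.
Qed.

Lemma BopK l : Bop (Bop l) = l.
Proof.
by rewrite /Bop diag_longest mulmxA (longest2 tX' hL) mul1mx diagK.
Qed.

Lemma Bop_adj l m : form l (Bop m) = form (Bop l) m.
Proof. by rewrite -[LHS]Bop_form BopK. Qed.

Lemma diag_Plat (l : hdual) : Plat l -> Plat (diagram t l).
Proof. by move=> pl i; rewrite -[i]tt diag_pairing. Qed.

Lemma Bop_Plat l : Plat l -> Plat (Bop l).
Proof.
by move=> pl; have [_ e _] := lwordP X; rewrite /Bop -e; apply/Plat_wprod/diag_Plat.
Qed.

Lemma wprod_sub_int s (l : hdual) : Plat l -> exists z, l - wprod s *m l = Qint z.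
Proof.
move=> pl; elim: s => [|i s [z hz]].
  by exists 0; rewrite mul1mx subrr; apply/matrixP => a c; rewrite !mxE.
have /intrP[m hm] := Plat_wprod s pl i.
exists (z + m *: delta_mx i 0); rewrite /= -mulmxA refl_mul opprB addrCA addrC hz hm.
apply/matrixP => a c; rewrite !mxE rmorphD rmorphM /=; congr (_ + _ * _).
by rewrite [c]ord1 eqxx; case: eqP.
Qed.

Lemma Bop_int i : exists z, Bop (alpha i) = Qint z.
Proof.
have [_ e _] := lwordP X; rewrite /Bop -e diag_alpha // -Qint_delta; exact: wprod_int.
Qed.

Lemma form_int (l : hdual) (z : 'cV[int]_(rk D)) : Plat l -> form l (Qint z) \is a Num.int.
Proof. by move=> pl; rewrite formC -(weight_at_coroot l (erefl (Qint z))); apply: Plat_wt. Qed.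

(* the exponent of q in xi *)
Definition ee (l : hdual) := let lplus := 2^-1 *: (l + Theta X t l) in
  let atilde j := 2^-1 *: (alpha j - Theta X t (alpha j)) in
  - form lplus lplus + \sum_j form (atilde j) (atilde j) * coweight l j.

(** Doubling clears the halves in lambda^+ and in the tilde alpha_j; the isometry of [Bop] then
    merges the quadratic terms. *)
Lemma ee2 l : 2 * ee l = - form l l + form l (Bop l) +
   \sum_j (2 * (eps D j)%:R + form (alpha j) (Bop (alpha j))) * l j 0.
Proof.
rewrite /ee !ThetaE mulrDr; congr (_ + _).
  rewrite formZl formZr !(formDl, formDr) !(formNl, formNr) Bop_form (formC (Bop l)).
  by field.
rewrite mulr_sumr; apply: eq_bigr => j _; rewrite /coweight ThetaE opprK mulrA; congr (_ * _).
rewrite formZl formZr !(formDl, formDr) Bop_form (formC (Bop _)) form_alpha pairing_alpha car_ii.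
by field.
Qed.

(* The delicate case is det A even, where adj_perm_F2 is needed. *)
Lemma ee_ok l : Plat l -> qok D (ee l).
Proof.
move=> pl; pose de := \det (car D).
suff [m hm] : evr (de%:~R * (2 * ee l)).
  have e : de%:~R * ee l = m%:~R.
    by apply: (@mulfI rat 2); rewrite ?pnatr_eq0 // mulrCA hm rmorphM.
  rewrite /qok /ddet; have [h|h] : (absz de = de :> int) \/ (absz de = - de :> int) by lia.
    by rewrite -[(absz _)%:R]/((absz de)%:Z%:~R) h mulrC e intr_int.
  by rewrite -[(absz _)%:R]/((absz de)%:Z%:~R) h rmorphN mulrN mulrC e rpredN intr_int.
have [p hp] : exists p : 'cV[int]_(rk D), forall i, pairing l i = (p i 0)%:~R.
  have /choice[p hp] : forall i, exists m, pairing l i = m%:~R by move=> i; apply/intrP/pl.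
  by exists (\col_i p i) => i; rewrite mxE.
(* By Cramer's rule det(A) l has the integral coordinates adj(A) p, where p lists the values
   l(h_i). *)
pose n := \adj (car D) *m p.
have mu : de%:~R *: l = Qint n.
  apply: pairing_inj => i; rewrite pairingZ hp.
  have := congr1 (fun m : 'cV_(rk D) => m i ord0) (mulmxA (car D) (\adj (car D)) p).
  rewrite mul_mx_adj mul_scalar_mx mxE [RHS]mxE => h.
  rewrite -rmorphM -h rmorph_sum; apply: eq_bigr => j _.
  by rewrite [Qint n j 0]mxE -rmorphM.
have n_l j : de%:~R * l j 0 = (n j 0)%:~R.
  by have := congr1 (fun m : 'cV_(rk D) => m j 0) mu; rewrite !mxE.
pose S i j := form (alpha i) (Bop (alpha j)).
have Sint i j : S i j \is a Num.int.
  by rewrite /S; have [z ->] := Bop_int j; apply/form_int/Plat_alpha.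
have Ssym i j : S i j = S j i by rewrite /S Bop_adj formC.
have mu_sum : Qint n = \sum_i (n i 0)%:~R *: alpha i.
  apply/matrixP => a c; rewrite [c]ord1 summxE (bigD1 a) //= big1 => [|b ba].
    by rewrite !mxE !eqxx mulr1 addr0.
  by rewrite !mxE eq_sym (negPf ba) mulr0.
have Bsum : Bop (Qint n) = \sum_i (n i 0)%:~R *: Bop (alpha i).
  rewrite mu_sum /Bop; elim: (index_enum _) => [|b r IH].
    rewrite !big_nil; have -> : diagram t (0 : hdual) = 0 by apply/matrixP => a c; rewrite !mxE.
    by rewrite mulmx0.
  by rewrite !big_cons diag_lin mulmxDr -scalemxAr IH.
have sum_l (f : hdual) (g : I -> hdual) : form f (\sum_i (n i 0)%:~R *: g i) = \sum_i (n i 0)%:~R * form f (g i).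
  elim: (index_enum _) => [|b r IH]; first by rewrite !big_nil form0r.
  by rewrite !big_cons formDr formZr IH.
have quad : evr (form (Qint n) (Bop (Qint n)) - \sum_i S i i * (n i 0)%:~R).
  have := quad_even (fun i => n i 0) Sint Ssym; congr (evr (_ - _)).
  rewrite Bsum sum_l mu_sum exchange_big; apply: eq_bigr => j _.
  rewrite formC sum_l mulr_sumr; apply: eq_bigr => i _; rewrite /S (formC (Bop _)); ring.
have red : de%:~R * (2 * ee l) = - form (Qint n) l + form (Qint n) (Bop l) +
    (\sum_i S i i * (n i 0)%:~R + 2 * \sum_i (eps D i)%:R * (n i 0)%:~R).
  rewrite ee2 -mu !formZl mulrDr mulrDr mulrN; congr (_ + _).
  rewrite !mulr_sumr -big_split; apply: eq_bigr => j _ /=.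
  by rewrite -n_l /S; ring.
have eps_ev : evr (2 * \sum_i (eps D i)%:R * (n i 0)%:~R).
  by apply: evr2; apply: rpred_sum => i _; rewrite rpredM ?intr_int ?natr_int.
have mu_l (f : hdual) : form (Qint n) f = de%:~R * form l f by rewrite -mu formZl.
have BQ : Bop (Qint n) = de%:~R *: Bop l.
  by rewrite -mu -[de%:~R *: l]addr0 Bop_lin -(subrr l) BopD BopN !subrr addr0.
have a_int : form (Qint n) l \is a Num.int by rewrite formC; apply: form_int.
have b_int : form (Qint n) (Bop l) \is a Num.int by rewrite formC; apply/form_int/Bop_Plat.
rewrite BQ formZr in quad.
suff h : evr (- form (Qint n) l + form (Qint n) (Bop l) + de%:~R * form (Qint n) (Bop l)).
  rewrite red; have := evrD (evrD h (evrN quad)) eps_ev; congr evr.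
  by move: (form _ _) (form _ _) (\sum_i _) (\sum_i _) => u v w x; ring.
have [q hq] : exists q, de = 2 * q \/ de = 2 * q + 1.
  exists (de %/ 2)%Z; have := divz_eq de 2; have := ltz_pmod de (isT : 0 < 2 :> int).
  have := modz_ge0 de (isT : 2 != 0 :> int); move: (de %% 2)%Z (de %/ 2)%Z => r q; lia.
case: hq => hq; last first.
  (* det A odd: the form is even on the root lattice, so det(A) (n, l) = (n, n) is even, and hence
     (n, l) is. *)
  have haa : evr (form (Qint n) (Qint n)).
    have S2 (i j : I) : form (alpha i) (alpha j) \is a Num.int.
      by rewrite -(Qint_delta j); apply/form_int/Plat_alpha.
    have := evrD (quad_even (fun i => n i 0) S2 (fun i j => formC _ _)) eps_ev; congr evr.
    have -> : \sum_i form (alpha i) (alpha i) * (n i 0)%:~R = 2 * \sum_i (eps D i)%:R * (n i 0)%:~R :> rat.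
      rewrite mulr_sumr; apply: eq_bigr => i _; rewrite form_alpha pairing_alpha car_ii; ring.
    rewrite subrK {2}mu_sum sum_l exchange_big; apply: eq_bigr => j _.
    rewrite formC mu_sum sum_l mulr_sumr; apply: eq_bigr => i _; rewrite (formC (alpha j)); ring.
  rewrite -{2}mu formZr in haa; have [c hcc] := haa.
  have /intrP[b hb] := b_int; have /intrP[a ha] := a_int.
  exists (- (c - q * a) + (q + 1) * b).
  rewrite ha in hcc; have hcc' : de * a = 2 * c by apply: (@intr_inj rat); rewrite rmorphM.
  by rewrite ha hb -rmorphM -rmorphN -!rmorphD; congr (_%:~R); rewrite hq in hcc' *; lia.
(* det A even: l - Bop l splits into l - tau(l), handled by [adj_perm_even], and tau(l) - w_X
   tau(l), which lies in the root lattice and pairs with n to a multiple of det(A). *)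
have h2 : evr (form (Qint n) (l - Bop l)).
  have -> : l - Bop l = (l - diagram t l) + (diagram t l - Bop l) by rewrite addrA subrK.
  rewrite formDr; apply: evrD.
    have -> : form (Qint n) (l - diagram t l) = \sum_i ((n i 0 - n ((t^-1)%g i) 0) * ((eps D i)%:Z * p i 0))%:~R.
      have -> : form (Qint n) (l - diagram t l) = form (Qint n) l - form (diagram t (Qint n)) l.
        by rewrite formDr formNr -[form _ (diagram t l)](diag_form hc) // diagK.
      rewrite !formE -sumrB; apply: eq_bigr => i _; rewrite hp [diagram _ _ _ _]mxE ![Qint n _ _]mxE.
      by rewrite !rmorphM rmorphB /=; ring.
    apply: evr_sum => i; have d2 : (2 %| \det (car D))%Z by rewrite -/de hq; apply: dvdz_mulr.
    have := adj_perm_even p d2 hc ((t^-1)%g i); rewrite permKV -/n => /dvdzP[r hr].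
    by exists (r * ((eps D i)%:Z * p i 0)); rewrite hr; congr (_%:~R); ring.
  have [_ e _] := lwordP X; have [z hz] := wprod_sub_int (lword X) (diag_Plat pl).
  rewrite /Bop -e hz mu_l hq; have /intrP[r hr] := form_int z pl.
  by exists (q * r); rewrite hr -rmorphM mulrA.
have /intrP[b hb] := b_int.
have h3 : evr (de%:~R * form (Qint n) (Bop l)) by exists (q * b); rewrite hq hb -rmorphM mulrA.
have := evrD (evrN h2) h3; congr (evr (_ + _)); rewrite formDr formNr opprB; ring.
Qed.

End XiExponent.

(** * Diagram automorphisms of the quantum group *)

Section DiagramAutomorphism.
Variables (K : fieldType) (D : cartanDatum).
Local Notation I := 'I_(rk D).
Local Notation UQ := (Uq K D).
Local Notation hdual := 'cV[rat]_(rk D).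
Local Notation coroots := 'cV[int]_(rk D).
Variable g : {perm I}.
Hypothesis hc : forall i j, car D (g i) (g j) = car D i j.
Hypothesis he : forall i, eps D (g i) = eps D i.

Definition pk (h : coroots) : coroots := \col_i h ((g^-1)%g i) 0.

Lemma weight_pk (l : hdual) h : weight_at (diagram g l) (pk h) = weight_at l h.
Proof.
rewrite /weight_at (reindex_inj (@perm_inj _ g)); apply: eq_bigr => i _.
by rewrite diag_pairing // mxE permK.
Qed.

Lemma weight_pk_alpha i h : weight_at (alpha (g i)) (pk h) = weight_at (alpha i : hdual) h.
Proof. by rewrite -diag_alpha weight_pk. Qed.

Lemma pk_coroot i : pk (Kc i) = Kc (g i).
Proof.
apply/matrixP => a c; rewrite !mxE -(inj_eq (@perm_inj _ g)) permKV.
by rewrite -(he ((g^-1)%g a)) permKV.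
Qed.

Lemma qi_perm i : qi K (g i) = qi K i.
Proof. by rewrite /qi he. Qed.

Lemma udiag_model : model (@uq_rel K D) (ucst K D) (fun a : ugen D => match a with
    | GE i => uE K (g i) | GF i => uF K (g i) | GK h => uK K (pk h) end).
Proof.
have [[r0 rD] rE rF rEF [sE sF]] := Uq_rel K D.
split; first by move=> c a; apply: pcst_comm.
split=> /=.
- split; first by rewrite -[RHS]r0; congr uK; apply/matrixP => a c; rewrite !mxE.
  by move=> h h'; rewrite -rD; congr uK; apply/matrixP => a c; rewrite !mxE.
- by move=> h i; rewrite -weight_pk_alpha; apply: rE.
- by move=> h i; rewrite -weight_pk_alpha; apply: rF.
- move=> i j; have := rEF (g i) (g j) => /= ->; rewrite (inj_eq (@perm_inj _ g)).
  case: eqP => // _; rewrite qi_perm -/(Kc (g i)) -/(Kc i) -pk_coroot; congr (_ * (_ - uK _ _)).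
  by apply/matrixP => a c; rewrite !mxE.
split=> i j ij N; have := sE (g i) (g j); have := sF (g i) (g j); rewrite (inj_eq (@perm_inj _ g)) hc qi_perm.
  by move=> _ /(_ ij).
by move=> /(_ ij).
Qed.
Definition udiag_am := AMor (plift_alg_morph udiag_model).
Lemma udiag_amE u : udiag g u = udiag_am u. Proof. by []. Qed.
Lemma udiagE i : udiag g (uE K i) = uE K (g i).
Proof. exact: (plift_gen udiag_model (GE i)). Qed.
Lemma udiagF i : udiag g (uF K i) = uF K (g i).
Proof. exact: (plift_gen udiag_model (GF i)). Qed.
Lemma udiagK h : udiag g (uK K h) = uK K (pk h).
Proof. exact: (plift_gen udiag_model (GK h)). Qed.
Lemma udiagM : {morph @udiag K D g : u v / u * v}.
Proof. by move=> u v; rewrite !udiag_amE rmorphM. Qed.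
Lemma udiagD : {morph @udiag K D g : u v / u + v}.
Proof. by move=> u v; rewrite !udiag_amE rmorphD. Qed.
Lemma udiagZ c u : udiag g (c *: u) = c *: udiag g u :> UQ.
Proof. by rewrite !udiag_amE amorZ. Qed.
Lemma udiagC c : udiag g (pcst c) = pcst c :> UQ.
Proof. by rewrite !udiag_amE amorC. Qed.
Lemma udiag_sum (J : Type) (r : seq J) (f : J -> UQ) :
  udiag g (\sum_(x <- r) f x) = \sum_(x <- r) udiag g (f x).
Proof. exact: (raddf_sum udiag_am). Qed.
Lemma udiagX u m : udiag g (u ^+ m) = udiag g u ^+ m :> UQ.
Proof.
elim: m => [|m IH]; last by rewrite !exprS udiagM IH.
by rewrite !expr0 -[X in udiag _ X]/(pcst 1) udiagC rmorph1.
Qed.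
Lemma udiag_divE j m : udiag g (divE K j m) = divE K (g j) m.
Proof. by rewrite /divE udiagZ udiagX udiagE qi_perm. Qed.

Lemma udiag_chn i0 s : udiag g (chn K i0 s) = chn K (g i0) (map g s).
Proof.
elim: s => [|j s IH] /=; first exact: udiagE.
have -> : mk (wprod (map g s) *m alpha (g i0)) (g j) = mk (wprod s *m alpha i0) j.
  by rewrite /mk -diag_alpha -diag_wprod // diag_pairing.
rewrite /adtU udiag_sum; apply: eq_bigr => r _; rewrite udiagZ.
by rewrite (udiagM (_ * _) (divE K j _)) (udiagM (divE K j _) _) !udiag_divE IH qi_perm.
Qed.
End DiagramAutomorphism.

Section Xi.
Variables (K : fieldType) (D : cartanDatum) (L : fieldExtType (kfield K)).
Local Notation I := 'I_(rk D).
Local Notation UQ := (Uq K D).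
Local Notation hdual := 'cV[rat]_(rk D).
Variables (X : {set I}) (t : {perm I}) (gam : hdual -> L).
Hypothesis hc : forall i j, car D (t i) (t j) = car D i j.
Hypothesis he : forall i, eps D (t i) = eps D i.
Hypothesis tX : forall j, (t j \in X) = (j \in X).
Hypothesis tt : forall i, t (t i) = i.
Hypothesis hL : forall j, j \in X -> longest X *m alpha j = - alpha (t j).
Hypothesis g0 : forall l, Plat l -> gam l != 0.
Hypothesis gD : forall l m, Plat l -> Plat m -> gam (l + m) = gam l * gam m.
Local Notation xi := (xi X t gam).
Local Notation Bop := (Bop X t).

Lemma gam0 : gam 0 = 1.
Proof.
have h := gD (@Plat0 D) (@Plat0 D); rewrite addr0 in h.
by apply: (mulfI (g0 (@Plat0 D))); rewrite -h mulr1.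
Qed.
Lemma gamN l : Plat l -> gam (- l) = (gam l)^-1.
Proof.
move=> pl; apply: (mulfI (g0 pl)).
by rewrite -gD ?subrr ?gam0 ?divff ?g0 //; apply: PlatN.
Qed.

Lemma xiE l : xi l = gam l * (qpow K D (ee X t l))%:A. Proof. by []. Qed.
Lemma xi_neq0 l : Plat l -> xi l != 0.
Proof. by move=> pl; rewrite xiE mulf_neq0 ?g0 // alg_neq0 // qpow_neq0. Qed.

Definition xiM (M : gmod D L) : 'M[L]_(udim M) := scalar_fam xi M.
Lemma xi_vec (M : gmod D L) l v : Plat l -> wt (fun h => act M (uK K h)) l v -> xiM M *m v = xi l *: v.
Proof. by move=> pl hv; rewrite (by_weightP _ pl hv) mul_scalar_mx. Qed.

Lemma xi_unit (M : gmod D L) : xiM M \in unitmx.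
Proof.
pose T := by_weight (fun l (M : umod D L) => ((xi l)^-1)%:M) M.
have h : xiM M *m T = 1%:M.
  apply: (mx_wt_eq (wr_dec (gmod_wrep M))) => l v pl hv.
  have -> : 1%:M *m v = v by rewrite mul1mx.
  rewrite -mulmxA (by_weightP _ pl hv) (mul_scalar_mx _ v) -scalemxAr (xi_vec pl hv).
  by rewrite scalerA mulVf ?xi_neq0 // scale1r.
by have [] := mulmx1_unit h.
Qed.

Lemma xi_K (M : gmod D L) h : cj (xiM M) (act M (uK K h)) (act M (uK K h)).
Proof.
apply: (mx_wt_eq (wr_dec (gmod_wrep M))) => l v pl hv.
by rewrite !mulMV hv -scalemxAr (xi_vec pl hv) -scalemxAr hv !scalerA mulrC.
Qed.

Lemma eeD l b : ee X t (l + b) = ee X t l + ee X t b - form l (b - Bop b).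
Proof.
apply: (@mulfI rat 2); first by rewrite pnatr_eq0.
have -> : 2 * (ee X t l + ee X t b - form l (b - Bop b)) = 2 * ee X t l + 2 * ee X t b - 2 * form l (b - Bop b).
  by move: (ee X t l) (ee X t b) (form _ _) => u v w; ring.
rewrite !(ee2 X hc he) !(BopD, formDl, formDr).
have -> : \sum_j (2 * (eps D j)%:R + form (alpha j) (Bop (alpha j))) * (l + b) j 0 =
  \sum_j (2 * (eps D j)%:R + form (alpha j) (Bop (alpha j))) * l j 0 +
  \sum_j (2 * (eps D j)%:R + form (alpha j) (Bop (alpha j))) * b j 0.
  by rewrite -big_split; apply: eq_bigr => j _ /=; rewrite mxE mulrDr.
rewrite (formC b l) (Bop_adj hc he tX tt hL b l) (formC (Bop b) l) !formNr.
by move: (\sum_j _) (\sum_j _) => u v; ring.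
Qed.

(** By [eeD] the exponent of xi is quadratic, so xi(l + b) / xi(l) depends on l only through (l, b -
    Bop b), which is how a torus element acts. This is why Ad(xi) preserves U_q(g). *)
Lemma xi_cj (M : gmod D L) b x z : Plat b -> opwt (fun h => act M (uK K h)) b x ->
  b - Bop b = Qint z ->
  cj (xiM M) x ((gam b * (qpow K D (ee X t b))%:A) *: (x * act M (uK K (- coroot_of z)))).
Proof.
move=> pb hx hz; apply: (mx_wt_eq (wr_dec (gmod_wrep M))) => l v pl hv.
rewrite !mulMV (xi_vec pl hv) (xi_vec (PlatD pl pb) (opwt_wt pb pl hx hv)).
rewrite -scalemxAr -[in RHS]scalemxAl mulMV hv -scalemxAr !scalerA; congr (_ *: _).
rewrite !xiE gD // weight_atNr (weight_at_coroot l (erefl (Qint z))) -hz.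
have okl := ee_ok hc he tX tt hL pl; have okb := ee_ok hc he tX tt hL pb.
have okf : qok D (- form (b - Bop b) l).
  by rewrite hz formC; apply/qokN/qok_Num/form_int.
rewrite eeD (formC l) qpowD //; last exact: qokD.
rewrite qpowD // !algM; move: (gam l) (gam b) => u w; ring.
Qed.

(** The values of gamma on simple roots are required in k because the conjugate has to be an element
    of U_q(g), which is defined over k and not over L. *)
Lemma xi_ex u : (forall i, exists c : kfield K, gam (alpha i) = c%:A) ->
  exists u', forall M : gmod D L, cj (xiM M) (act M u) (act M u').
Proof.
move=> hg; have gen b (x : UQ) (c : kfield K) : Plat b -> (exists z, b = Qint z) ->
    (exists z, Bop b = Qint z) -> (forall M : gmod D L, opwt (fun h => act M (uK K h)) b (act M x)) ->
    gam b = c%:A -> exists u', forall M : gmod D L, cj (xiM M) (act M x) (act M u').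
  move=> pb [z1 h1] [z2 h2] hx hcb.
  exists ((c * qpow K D (ee X t b)) *: (x * uK K (- coroot_of (z1 - z2)))) => M.
  have hz : b - Bop b = Qint (z1 - z2).
    by rewrite h2 {1}h1; apply/matrixP => a a'; rewrite !mxE rmorphB.
  by have := xi_cj pb (hx M) hz; rewrite actZ rmorphM algM hcb.
elim/pres_ind: u => [[i|i|h]|c|u v [u' hu] [v' hv]|u v [u' hu] [v' hv]].
- have [c hci] := hg i; apply: (gen (alpha i) _ c) => //; first exact: Plat_alpha.
  + by exists (delta_mx i 0); rewrite Qint_delta.
  + exact: (Bop_int X t i).
  by move=> M; apply: (opwtE (gmod_wrep M)).
- have [c hci] := hg i; apply: (gen (- alpha i) _ c^-1).
  + exact/PlatN/Plat_alpha.
  + by exists (- delta_mx i 0); rewrite -Qint_delta; apply/matrixP => a a'; rewrite !mxE rmorphN.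
  + have [z hz] := Bop_int X t i; exists (- z); rewrite BopN hz.
    by apply/matrixP => a a'; rewrite !mxE rmorphN.
  + by move=> M; apply: (opwtF (gmod_wrep M)).
  by rewrite gamN ?hci ?algV //; apply: Plat_alpha.
- by exists (uK K h) => M; apply: xi_K.
- by exists (pcst c) => M; rewrite /cj !actC mxcstC.
- by exists (u' + v') => M; rewrite !rmorphD; exact: cjD (hu M) (hv M).
by exists (u' * v') => M; rewrite !rmorphM; exact: cjM (hu M) (hv M).
Qed.
End Xi.

Lemma refl_wprod (D : cartanDatum) s (j k : 'I_(rk D)) :
  wprod s *m alpha j = - alpha k -> refl k *m wprod s = wprod s *m refl j.
Proof.
move=> h; rewrite /refl mulmxBl mulmxBr mul1mx mulmx1 mulmxA h mulNmx -mulmxA; congr (_ - _).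
have e : (\row_a (car D k a)%:~R : 'rV[rat]_(rk D)) *m wprod s = - \row_a (car D j a)%:~R.
  apply/rowP => a; rewrite [LHS]mxE.
  transitivity (pairing (wprod s *m alpha a) k).
    rewrite /pairing; apply: eq_bigr => b _; rewrite mxE; congr (_ * _).
    by rewrite -colE mxE.
  have e0 : (eps D k)%:R != 0 :> rat by rewrite pnatr_eq0 -lt0n eps_gt0.
  apply: (mulfI e0); rewrite -form_alpha -[alpha k]opprK -h formNl form_wprod form_alpha pairing_alpha !mxE mulrN.
  congr (- (_ * _)); congr (_%:R).
  have : form (wprod s *m alpha j) (wprod s *m alpha j) = form (alpha k) (alpha k).
    by rewrite h formNl formNr opprK.
  rewrite form_wprod !form_alpha !pairing_alpha !car_ii => /(mulIf _) -/(_ _)/eqP.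
  by rewrite pnatr_eq0 eqr_nat => /(_ isT)/eqP.
by rewrite e mulmxN.
Qed.

Lemma QintN (D : cartanDatum) z : Qint (- z) = - Qint z :> 'cV[rat]_(rk D).
Proof. by apply/matrixP => a b; rewrite !mxE rmorphN. Qed.

Lemma ubarN (K : fieldType) (D : cartanDatum) (x : Uq K D) : ubar (- x) = - ubar x.
Proof. by rewrite !ubar_amE rmorphN. Qed.

(** * The twisted module *)

Section Twist.
Variables (K : fieldType) (D : cartanDatum) (L : fieldExtType (kfield K)).
Local Notation I := 'I_(rk D).
Local Notation UQ := (Uq K D).
Local Notation hdual := 'cV[rat]_(rk D).
Local Notation coroots := 'cV[int]_(rk D).
Variables (X : {set I}) (t t0 : {perm I}) (s : I -> K) (c sp : I -> kfield K) (gam : hdual -> L).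
Hypothesis adm : admissible X t.
Hypothesis sgn : sign_fun X t s.
Hypothesis par : parameters X t c sp.
Hypothesis com : compatible_tau0 X t t0 s c sp.
Hypothesis gmh : is_gamma X t s c gam.

Lemma hcT i j : car D (t i) (t j) = car D i j. Proof. by case: adm => -[]. Qed.
Lemma heT i : eps D (t i) = eps D i. Proof. by case: adm => -[]. Qed.
Lemma tXT j : (t j \in X) = (j \in X).
Proof. by case: adm => -[_ e _] _ _ _; rewrite -{1}e mem_imset //; apply: perm_inj. Qed.
Lemma ttT i : t (t i) = i. Proof. by case: adm. Qed.
Lemma hLT j : j \in X -> longest X *m alpha j = - alpha (t j). Proof. by case: adm => _ _ h _; apply: h. Qed.
Lemma tXT' j : j \in X -> t j \in X. Proof. by rewrite tXT. Qed.
Lemma hc0 i j : car D (t0 i) (t0 j) = car D i j. Proof. by case: com => -[[]]. Qed.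
Lemma he0 i : eps D (t0 i) = eps D i. Proof. by case: com => -[[]]. Qed.
Lemma tX0 j : (t0 j \in X) = (j \in X).
Proof. by case: com => -[[_ e _] _] _ _ _ _; rewrite -{1}e mem_imset //; apply: perm_inj. Qed.
Lemma hL0 j : longest [set: I]%SET *m alpha j = - alpha (t0 j). Proof. by case: com => -[_ h] _ _ _ _; apply: h. Qed.
Lemma tt0 i : t0 (t0 i) = i.
Proof. by apply: (@longest_tt D [set: I]%SET t0) => [j _|j _|]; rewrite ?inE ?hL0. Qed.
Lemma comT i : t (t0 i) = t0 (t i). Proof. by case: com. Qed.

Local Notation TX M := (Ts M (lword X)).
Local Notation T0 M := (Ts M (lword [set: I]%SET)).
Local Notation Bop := (Bop X t).
Local Notation th i := (longest X *m alpha (t i)).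

(** Every letter is a descent of w_0, so w_0 = s' s_j = s_(t0 j) s' with both words reduced; compare
    the two factorisations of T_(w_0). *)
Lemma T0_Tm (M : gmod D L) j : T0 M * Tm M j = Tm M (t0 j) * T0 M.
Proof.
have [hr e _] := lwordP [set: I]%SET; set w := lword _ in hr e *.
have nr : ~ reduced (rcons w j).
  move=> /pos_root; rewrite e hL0 => h.
  by have := alpha_neq0 (t0 j); rewrite (nneg_anti (nneg_alpha (t0 j)) h) eqxx.
have [s' [h1 h2 h3]] := red_desc hr nr.
have e3 : Ts M w = Ts M s' * Tm M j by rewrite (matsumoto M hr h1 (esym h2)) Ts_rcons.
have e4 : wprod (t0 j :: s') = wprod w.
  have : wprod s' = wprod w *m refl j.
    by rewrite -h2 wprod_rcons -mulmxA refl_refl mulmx1.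
  move=> es; rewrite wprod_cons es -(refl_wprod (k := t0 j)) ?mulmxA ?refl_refl ?mul1mx //.
  by rewrite e hL0.
have hr4 : reduced (t0 j :: s') by apply: (red_same hr) => //=; rewrite h3.
have e5 : Ts M w = Tm M (t0 j) * Ts M s' by rewrite -(matsumoto M hr4 hr e4) Ts_cons.
by rewrite {1}e5 -mulrA -e3.
Qed.

Lemma T0_TX (M : gmod D L) : T0 M * TX M = TX M * T0 M.
Proof.
have [hr e _] := lwordP X.
have h w : T0 M * Ts M w = Ts M (map t0 w) * T0 M.
  elim: w => [|j w IH]; first by rewrite -[Ts M [::]]/1 mulr1 mul1r.
  by rewrite [map _ _]/= !Ts_cons mulrA T0_Tm -mulrA IH mulrA.
rewrite h; have [h1 h2] := lword_diag tXT' hLT hc0 tX0.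
by rewrite (matsumoto M h2 hr h1).
Qed.

(** Conjugation by this operator sends the action of [twist u] to that of u under the diagram
    automorphisms alone. Hence the twisted module is M with permuted generators up to isomorphism,
    and lies in O_int. *)
Definition Vt (M : gmod D L) := TX M * T0 M * invmx (xiM X t gam M).

Lemma g0T l : Plat l -> gam l != 0. Proof. by case: gmh => h _ _ _; apply: h. Qed.
Lemma gDT l m : Plat l -> Plat m -> gam (l + m) = gam l * gam m.
Proof. by case: gmh => _ h _ _; apply: h. Qed.
Lemma gXT i : exists a : kfield K, gam (alpha i) = a%:A.
Proof.
case: gmh => _ _ h1 h2; case: (boolP (i \in X)) => iX.
  by exists 1; rewrite h1 // scale1r.
by exists (c i * kcst (s (t i))); rewrite h2.
Qed.

Lemma xiM_unit (M : gmod D L) : xiM X t gam M \in unitmx.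
Proof. exact: (xi_unit X t g0T). Qed.

Lemma Vt_unit M : Vt M \in unitmx.
Proof. by rewrite /Vt !unitmx_mul !Ts_unit unitmx_inv xiM_unit. Qed.

Lemma cj_inj' n (T x x' y : 'M[L]_n) : T \in unitmx -> cj T x y -> cj T x' y -> x = x'.
Proof.
rewrite /cj => hT h h'; have : T *m x = T *m x' by rewrite -[LHS]/(T * x) h -h'.
by move/(congr1 (mulmx (invmx T))); rewrite !mulKmx.
Qed.

(** Lets the twist be evaluated forwards: instead of inverting the T_w, one guesses x and verifies
    where T_(w_X) T_(w_0) sends it. *)
Lemma twist_val (M : gmod D L) u x y : cj (TX M * T0 M) x (act M (udiag t (udiag t0 u))) ->
  cj (xiM X t gam M) x y -> act M (twist X t t0 gam u) = y.
Proof.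
move=> h1 h2; set v := udiag _ _ in h1.
pose v1 := Ad L (inv1 (Tw L (longest X))) v; pose v2 := Ad L (inv1 (Tw L (longest [set: I]%SET))) v1.
have c1 : cj (TX M) (act M v1) (act M v) by exact: Ad_Tw_inv.
have c2 : cj (T0 M) (act M v2) (act M v1) by exact: Ad_Tw_inv.
have ex : x = act M v2.
  by apply: cj_inj' h1 (cj_comp c2 c1); rewrite unitmx_mul !Ts_unit.
have h3 := @Ad_ex K D L (scalar_fam (xi X t gam)) v2 (fun N => xiM_unit N)
  (xi_ex hcT heT tXT ttT hLT g0T gDT v2 gXT) M.
by apply: (cj_inj (xiM_unit M) h3); rewrite -ex.
Qed.

Local Notation udd u := (udiag t (udiag t0 u)).

Lemma uddM u v : udd (u * v) = udd u * udd v :> UQ.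
Proof. by rewrite (udiagM hc0 he0) (udiagM hcT heT). Qed.
Lemma uddD u v : udd (u + v) = udd u + udd v :> UQ.
Proof. by rewrite (udiagD hc0 he0) (udiagD hcT heT). Qed.
Lemma uddC a : udd (pcst a) = pcst a :> UQ.
Proof. by rewrite (udiagC hc0 he0) (udiagC hcT heT). Qed.
Lemma uddE i : udd (uE K i) = uE K (t (t0 i)).
Proof. by rewrite (udiagE K hc0 he0) (udiagE K hcT heT). Qed.
Lemma uddF i : udd (uF K i) = uF K (t (t0 i)).
Proof. by rewrite (udiagF K hc0 he0) (udiagF K hcT heT). Qed.
Lemma uddK h : udd (uK K h) = uK K (pk t (pk t0 h)).
Proof. by rewrite (udiagK K hc0 he0) (udiagK K hcT heT). Qed.

Lemma twist_cj (M : gmod D L) u : cj (Vt M) (act M (twist X t t0 gam u)) (act M (udd u)).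
Proof.
set W := TX M * T0 M; have Wu : W \in unitmx by rewrite unitmx_mul !Ts_unit.
have xu := xiM_unit M; set xi := xiM X t gam M in xu.
pose a := act M (udd u); pose x := invmx W *m a *m W.
have h1 : cj W x a by rewrite /cj -[LHS]/(W *m x) -[RHS]/(a *m W) /x -mulmxA (mulKVmx Wu).
have h2 : cj xi x (xi *m x *m invmx xi).
  by rewrite /cj -[LHS]/(xi *m x) -[RHS]/(xi *m x *m invmx xi *m xi) (mulmxKV xu).
rewrite (twist_val h1 h2) /cj -/a /Vt -/W -/xi.
rewrite -[LHS]/(W *m invmx xi *m (xi *m x *m invmx xi)) -[RHS]/(a *m (W *m invmx xi)).
rewrite !mulmxA; congr (_ *m _).
transitivity (W *m (invmx xi *m xi) *m (invmx W *m a *m W)); first by rewrite /x !mulmxA.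
by rewrite (mulVmx xu) mulmx1 !mulmxA (mulmxV Wu) mul1mx.
Qed.

Definition twm (M : gmod D L) : umod D L := UMod (fun u => act M (twist X t t0 gam u)).

Lemma twm_Oint M : Oint (twm M).
Proof.
have V := Vt_unit M; have tc := twist_cj M.
split; first split=> [u v|u v|a].
- by apply: (cj_inj' V (tc _)); rewrite uddD rmorphD; exact: cjD (tc u) (tc v).
- by apply: (cj_inj' V (tc _)); rewrite uddM rmorphM; exact: cjM (tc u) (tc v).
- by apply: (cj_inj' V (tc _)); rewrite uddC actC /cj mxcstC.
move=> v; have [r hr er] := wr_dec (gmod_wrep M) (Vt M *m v).
exists [seq invmx (Vt M) *m w | w <- r]; last first.
  by rewrite big_map -mulmx_sumr -er mulmxA mulVmx // mul1mx.
move=> _ /mapP[w /hr[l pl hw] ->]; exists (diagram t0 (diagram t l)).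
  exact: (diag_Plat hc0 tt0 (diag_Plat hcT ttT pl)).
move=> h; rewrite -[LHS]/(act M (twist X t t0 gam (uK K h)) *m _).
have -> : weight_at (diagram t0 (diagram t l)) h = weight_at l (pk t (pk t0 h)).
  rewrite -(weight_pk hc0 _ h) (diagK tt0) -(weight_pk hcT _ (pk t0 h)) (diagK ttT) //.
have e := tc (uK K h); rewrite uddK in e.
have e2 (z : 'cV[L]_(udim M)) : Vt M *m (act M (twist X t t0 gam (uK K h)) *m z) = act M (uK K (pk t (pk t0 h))) *m (Vt M *m z).
  by rewrite -!mulMV; congr (_ *m _); exact: e.
by rewrite -[LHS](mulKmx V) e2 [Vt M *m _](mulKVmx V) hw scalemxAr.
Qed.
(* The module M twisted by Ad(xi) T_(w_0)^-1 T_(w_X)^-1 tau tau_0 *)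
Definition twistM M : gmod D L := GMod (twm_Oint M).
Lemma twistM_val (M : gmod D L) u x y : cj (TX M * T0 M) x (act M (udd u)) ->
  cj (xiM X t gam M) x y -> act (twistM M) u = y.
Proof. exact: twist_val. Qed.

Lemma cj_KcNN (M : gmod D L) w j k : wprod w *m alpha j = - alpha k ->
  cj (Ts M w) (act M (uK K (Kc j))) (act M (uK K (- Kc k))) /\
  cj (Ts M w) (act M (uK K (- Kc j))) (act M (uK K (Kc k))).
Proof.
move=> h; split; apply: cj_K => l; rewrite ?weight_atNr !form_Kc -[alpha k]opprK -h formNl ?opprK form_wprod //.
Qed.

Section Values.
Variable M : gmod D L.
Let H := gmod_wrep M.
Local Notation E i := (act M (uE K i)).
Local Notation F i := (act M (uF K i)).
Local Notation Kh h := (act M (uK K h)).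
Local Notation opM := (opwt (fun h => act M (uK K h))).

Lemma T0E j : cj (T0 M) (E j) (- (F (t0 j) * Kh (Kc (t0 j)))) /\
  cj (T0 M) (F j) (- (Kh (- Kc (t0 j)) * E (t0 j))).
Proof. by have [hr e _] := lwordP [set: I]%SET; apply: Ts_simpleN; rewrite // e hL0. Qed.
Lemma TXE j : j \in X -> cj (TX M) (E j) (- (F (t j) * Kh (Kc (t j)))) /\
  cj (TX M) (F j) (- (Kh (- Kc (t j)) * E (t j))).
Proof. by move=> jX; have [hr e _] := lwordP X; apply: Ts_simpleN; rewrite // e hLT. Qed.
Lemma T0Kc j : cj (T0 M) (Kh (Kc j)) (Kh (- Kc (t0 j))) /\ cj (T0 M) (Kh (- Kc j)) (Kh (Kc (t0 j))).
Proof. by have [hr e _] := lwordP [set: I]%SET; apply: cj_KcNN; rewrite e hL0. Qed.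
Lemma TXKc j : j \in X -> cj (TX M) (Kh (Kc j)) (Kh (- Kc (t j))) /\ cj (TX M) (Kh (- Kc j)) (Kh (Kc (t j))).
Proof. by move=> jX; have [hr e _] := lwordP X; apply: cj_KcNN; rewrite e hLT. Qed.

Lemma ee_alpha i : ee X t (alpha i) = form (alpha i) (Bop (alpha i)) /\
  ee X t (- alpha i) = - form (alpha i) (alpha i).
Proof.
have f2 : 2 * (eps D i)%:R = form (alpha i) (alpha i) :> rat.
  by rewrite form_alpha pairing_alpha car_ii mulrC.
have sm a : \sum_j (2 * (eps D j)%:R + form (alpha j) (Bop (alpha j))) * (a *: alpha i : hdual) j 0 =
    a * (2 * (eps D i)%:R + form (alpha i) (Bop (alpha i))).
  rewrite (bigD1 i) //= big1 ?addr0 => [|j ji]; rewrite !mxE ?eqxx ?mulr1 1?mulrC //.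
  by rewrite (negPf ji) mulr0 mul0r.
split; apply: (@mulfI rat 2); rewrite ?pnatr_eq0 // (ee2 X hcT heT).
  by rewrite -[alpha i in X in _ + X]scale1r sm f2; ring.
rewrite BopN !(formNl, formNr) -[- alpha i in X in _ + X]scaleN1r sm f2; ring.
Qed.

Lemma xi_xK b x z h : Plat b -> opM b x -> b - Bop b = Qint z ->
  cj (xiM X t gam M) (x * Kh h) ((gam b * (qpow K D (ee X t b))%:A) *: (x * Kh (h - coroot_of z))).
Proof.
move=> pb hx hz; have h1 := cjM (xi_cj hcT heT tXT ttT hLT gDT pb hx hz) (xi_K X t gam M h).
by move: h1; rewrite scMl -mulrA -(wrD H) [- _ + _]addrC.
Qed.

Lemma Bop_alpha i : Bop (alpha i) = th i. Proof. by rewrite /Bop diag_alpha. Qed.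
Lemma Bop_alphaX j : j \in X -> Bop (alpha j) = - alpha j.
Proof. by move=> jX; rewrite Bop_alpha hLT ?tXT // ttT. Qed.
Lemma ff_perm i : form (alpha (t (t0 i))) (alpha (t (t0 i))) = form (alpha i) (alpha i).
Proof. by rewrite !form_alpha !pairing_alpha !car_ii heT he0. Qed.
Lemma ok_alpha i j : qok D (form (alpha i : hdual) (alpha j)).
Proof. rewrite -form_Kc; exact/Plat_ok/Plat_alpha. Qed.

(** The two operators T send E_j K_j^2, up to a power of q, to E_(tau tau_0 j). Since Theta fixes
    alpha_j, Ad(xi) contributes K_j^-2 and the inverse power of q. *)
Lemma twistM_E j : j \in X -> act (twistM M) (uE K j) = E j.
Proof.
move=> jX; set f := form (alpha j) (alpha j).
apply: (@twistM_val M _ ((qpow K D f)%:A *: (E j * Kh (Kc j + Kc j)))).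
  rewrite uddE; have [e0 _] := T0E j; have [k0 _] := T0Kc j.
  have c0 : cj (T0 M) (E j * Kh (Kc j + Kc j)) (- (F (t0 j) * Kh (- Kc (t0 j)))).
    have := cjM e0 (cjM k0 k0); rewrite -!(wrD H) mulNr -[F _ * _ * _]mulrA -(wrD H).
    by rewrite addrA addrN add0r.
  have aX : t0 j \in X by rewrite tX0.
  have := cj_comp c0 (cjN (cjM (TXE aX).2 (TXKc aX).2)); rewrite mulNr opprK.
  rewrite (wrE H) scMl -[X in _ *: X]mulrA (wr_NK H) mulr1 weight_atNr form_Kc ff_perm -/f => h.
  have := cjZ ((qpow K D f)%:A) h; rewrite scalerA -algM -qpowD ?qokN ?ok_alpha //.
  by rewrite addrN qpow0 scale1r scale1r.
have hz : alpha j - Bop (alpha j) = Qint (delta_mx j 0 + delta_mx j 0) :> hdual.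
  by rewrite Bop_alphaX // opprK -!Qint_delta; apply/matrixP => a b; rewrite !mxE rmorphD.
have := cjZ ((qpow K D f)%:A) (xi_xK (Kc j + Kc j) (Plat_alpha j) (opwtE H j) hz).
rewrite coroot_ofD subrr (wr0 H) mulr1 scalerA (ee_alpha j).1 Bop_alphaX // formNr -/f.
case: gmh => _ _ -> // _; rewrite mul1r -algM -qpowD ?qokN ?ok_alpha //.
by rewrite addrN qpow0 scale1r scale1r.
Qed.

Lemma twistM_FX j : j \in X -> act (twistM M) (uF K j) = F j.
Proof.
move=> jX; set f := form (alpha j) (alpha j).
apply: (@twistM_val M _ ((qpow K D f)%:A *: (F j * Kh (- Kc j - Kc j)))).
  rewrite uddF; have [_ e0] := T0E j; have [_ k0] := T0Kc j.
  have aX : t0 j \in X by rewrite tX0.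
  have c0 : cj (T0 M) (F j * Kh (- Kc j - Kc j)) (- ((qpow K D (- f))%:A *: (E (t0 j) * Kh (Kc (t0 j))))).
    have := cjM e0 (cjM k0 k0); rewrite -(wrD H) mulNr (wrE H) scMl weight_atNr form_Kc.
    have -> : form (alpha (t0 j)) (alpha (t0 j)) = f by rewrite -(ff_perm (t0 j)) tt0 /f !form_alpha !pairing_alpha !car_ii heT.
    by rewrite -!mulrA -!(wrD H) addKr.
  have := cj_comp c0 (cjN (cjZ ((qpow K D (- f))%:A) (cjM (TXE aX).1 (TXKc aX).1))).
  rewrite mulNr scalerN opprK -mulrA (wr_KN H) mulr1 => h.
  have := cjZ ((qpow K D f)%:A) h; rewrite scalerA -algM -qpowD ?qokN ?ok_alpha //.
  by rewrite addrN qpow0 scale1r scale1r.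
have hz : - alpha j - Bop (- alpha j) = Qint (- delta_mx j 0 - delta_mx j 0) :> hdual.
  by rewrite BopN Bop_alphaX // opprK -!Qint_delta; apply/matrixP => a b; rewrite !mxE rmorphB rmorphN.
have := cjZ ((qpow K D f)%:A) (xi_xK (- Kc j - Kc j) (PlatN (Plat_alpha j)) (opwtF H j) hz).
rewrite coroot_ofD !coroot_ofN subrr (wr0 H) mulr1 scalerA (ee_alpha j).2 -/f.
rewrite (gamN g0T gDT (Plat_alpha j)); case: gmh => _ _ -> // _; rewrite invr1 mul1r -algM -qpowD ?qokN ?ok_alpha //.
by rewrite addrN qpow0 scale1r scale1r.
Qed.

Lemma longest0 (l : hdual) : longest [set: I]%SET *m l = - diagram t0 l.
Proof.
have e : l = \sum_i l i 0 *: alpha i.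
  apply/matrixP => a b; rewrite [b]ord1 summxE (bigD1 a) //= big1 => [|i ia]; rewrite !mxE ?eqxx ?mulr1 ?addr0 //.
  by rewrite eq_sym (negPf ia) mulr0.
rewrite {1}e {2}e; elim: (index_enum _) => [|i r IH].
  by rewrite !big_nil mulmx0; apply/matrixP => a b; rewrite !mxE oppr0.
by rewrite !big_cons mulmxDr -scalemxAr hL0 IH diag_lin diag_alpha opprD scalerN.
Qed.

(** On weights w_0 acts as -tau_0, which cancels tau_0 up to sign; what remains of w_X, tau and the
    sign is Theta. *)
Lemma twistM_K mu nu : Theta X t (Qint mu) = Qint nu ->
  act (twistM M) (uK K (coroot_of mu)) = Kh (coroot_of nu).
Proof.
move=> hT; apply: (twistM_val _ (xi_K X t gam M _)); rewrite uddK -Ts_cat; apply: cj_K => l.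
have [_ eX _] := lwordP X; have [_ e0 _] := lwordP [set: I]%SET.
have -> : weight_at (wprod (lword X ++ lword [set: I]%SET) *m l) (pk t (pk t0 (coroot_of mu))) =
   weight_at (diagram t0 (diagram t (wprod (lword X ++ lword [set: I]%SET) *m l))) (coroot_of mu).
  rewrite -(weight_pk hc0 (diagram t0 _)) (diagK tt0) -(weight_pk hcT (diagram t _)) (diagK ttT) //.
rewrite wprod_cat eX e0 -mulmxA longest0 mulmxN (diagN t) (diagN t0).
rewrite (diag_longest hcT tXT hLT) -{1}eX (diag_wprod hc0).
have [-> _] := lword_diag tXT' hLT hc0 tX0; rewrite eX.
have -> : diagram t0 (diagram t (diagram t0 l)) = diagram t l.
  rewrite -[RHS](diagK tt0); congr (diagram t0 _); apply/matrixP => a b; rewrite !mxE; congr (l _ 0).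
  by apply: (@perm_inj _ t); apply: (@perm_inj _ t0); rewrite -comT !permKV.
rewrite (weight_at_coroot _ (erefl (Qint mu))) (weight_at_coroot _ (erefl (Qint nu))) -hT ThetaE.
by rewrite formNr formNl -/(Bop l) formC -(Bop_adj hcT heT tXT ttT hLT) formC.
Qed.

Lemma iX_t i : i \notin X -> t i \notin X. Proof. by rewrite tXT. Qed.

Lemma act_Xelt (N : gmod D L) i : i \notin X ->
  act N (Xelt L X t s i) = act N (- (kcst (s (t i)) *: chn K (t i) (lword X))).
Proof.
move=> iX; have [hr e hl] := lwordP X; rewrite /Xelt !rmorphN /= !actZ; congr (- (_ *: _)).
by apply: Ad_Tw => N'; exact: (chn_lword tXT' hLT (iX_t iX) hr e hl N').
Qed.
Lemma act_bXelt (N : gmod D L) i : i \notin X ->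
  act N (ubar (Xelt L X t s i)) = - ((kcst (s (t i)) * kappa K (t i) (lword X))%:A *: act N (chb K (t i) (lword X))).
Proof.
move=> iX; rewrite (bar_stab_eq (fun N => act_Xelt N iX) N).
have -> : ubar (- (kcst (s (t i)) *: chn K (t i) (lword X))) = - ((kcst (s (t i)) * kappa K (t i) (lword X)) *: chb K (t i) (lword X)).
  by rewrite ubarN ubarZ kbar_cst ubar_chn scalerA.
by rewrite rmorphN /= actZ.
Qed.

Lemma th_int i : exists z, th i = Qint z.
Proof. by have [z hz] := Bop_int X t i; exists z; rewrite -Bop_alpha. Qed.

Lemma Plat_th i : Plat (th i).
Proof. by have [z ->] := th_int i; exact: Plat_Qint. Qed.

(** gamma is 1 on the simple roots of X, and l - w_X(l) is an integral combination of these. *)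
Lemma gam_lword l : Plat l -> gam (longest X *m l) = gam l.
Proof.
move=> pl; have [_ <- hl] := lwordP X; elim: (lword X) hl => [|i w IH] hl; first by rewrite mul1mx.
have iX : i \in X by apply: hl; rewrite mem_head.
have hw : {subset w <= X} by move=> x xw; apply: hl; rewrite inE xw orbT.
have pw := Plat_wprod w pl; have /intrP[m hm] := pw i.
have pn n : Plat (alpha i *+ n : hdual) by apply/PlatMn/Plat_alpha.
have gn n : gam (alpha i *+ n) = 1.
  elim: n => [|n IHn]; first by rewrite mulr0n (gam0 g0T gDT).
  rewrite mulrSr gDT ?IHn //; last exact: Plat_alpha.
  by case: gmh => _ _ -> //; rewrite mulr1.
rewrite /= -mulmxA refl_mul -scaleNr hm.
case: m {hm} => n; rewrite ?NegzE.
  have -> : - (Posz n)%:~R *: alpha i = - (alpha i *+ n) :> hdual by rewrite scaleNr scaler_nat.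
  rewrite gDT //; last exact: (PlatN (pn n)).
  by rewrite (gamN g0T gDT (pn n)) gn invr1 mulr1 IH.
have -> : - (- n.+1%:Z)%:~R *: alpha i = alpha i *+ n.+1 :> hdual by rewrite rmorphN opprK scaler_nat.
by rewrite gDT // gn mulr1 IH.
Qed.

Lemma form_alphaB i : form (alpha (t i)) (Bop (alpha (t i))) = form (alpha i) (Bop (alpha i)).
Proof.
rewrite -[alpha (t i)](diag_alpha t) /Bop -(diag_longest hcT tXT hLT) (diag_form hcT) //; exact: heT.
Qed.

Lemma ee_th i : i \notin X -> ee X t (th i) = form (alpha i) (Bop (alpha i)).
Proof.
move=> iX; apply: (@mulfI rat 2); rewrite ?pnatr_eq0 // (ee2 X hcT heT).
have f2 j : 2 * (eps D j)%:R = form (alpha j) (alpha j) :> rat.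
  by rewrite form_alpha pairing_alpha car_ii mulrC.
have -> : \sum_j (2 * (eps D j)%:R + form (alpha j) (Bop (alpha j))) * (th i : hdual) j 0 =
   2 * (eps D (t i))%:R + form (alpha (t i)) (Bop (alpha (t i))).
  rewrite (bigD1 (t i)) //= [X in _ + X]big1 ?addr0 => [|j ji].
    by have [_ <- hl] := lwordP X; rewrite (wprod_off _ hl) ?iX_t // alphaE eqxx mulr1.
  case: (boolP (j \in X)) => jX; first by rewrite Bop_alphaX // formNr f2 subrr mul0r.
  by have [_ <- hl] := lwordP X; rewrite (wprod_off _ hl) // alphaE (negPf ji) mulr0.
rewrite -Bop_alpha (BopK hcT tXT ttT hLT) (formC _ (alpha i)) (Bop_form X hcT heT) form_alphaB heT f2; ring.
Qed.

Lemma rho_ok i : qok D (form (alpha i) (2 *: rho X : hdual)).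
Proof.
rewrite /rho scalerA divff ?pnatr_eq0 // scale1r (sum_posroot hLT) formC.
suff [z ->] : exists z, \sum_(b <- betas (lword X)) b = Qint z by rewrite formC; apply/qok_Num/form_int/Plat_alpha.
elim: (lword X) => [|a w [z IH]]; first by exists 0; rewrite big_nil; apply/matrixP => a b; rewrite !mxE.
have [z' hz] := wprod_int (rev w) (delta_mx a 0); rewrite Qint_delta in hz.
by exists (z' + z); rewrite big_cons IH hz; apply/matrixP => x y; rewrite !mxE rmorphD.
Qed.

(** The parameter condition at tau(i), after applying bar to it. *)
Lemma par_bar i : i \notin X -> kbar K (c i) =
  qpow K D (form (alpha i) (Bop (alpha i)) + form (alpha (t i)) (2 *: rho X)) * c (t i).
Proof.
move=> iX; case: par => _ _ _ h _; have := h (t i) (iX_t iX); rewrite ttT => ->.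
rewrite rmorphM /= kbar_qpow kbarK ThetaE formDr !formNr form_alphaB -opprD; congr (_ * _).
rewrite qpowN ?invrK //; apply: qokD; last exact: rho_ok.
by have [z hz] := th_int i; rewrite Bop_alpha hz; apply/qok_Num/form_int/Plat_alpha.
Qed.

(** For tau(i) = i admissibility makes alpha_i(rho_X^vee) an integer, so the sign is 1; otherwise
    this is the condition on s at tau(i). *)
Lemma sgn_t i : i \notin X ->
  kcst (s i) = kcst (s (t i)) * (-1) ^ numq (2 * at_rhoV X (alpha (t i))).
Proof.
move=> iX; case: sgn => s0 s1 s2; case: (eqVneq (t i) i) => [e|ne].
  case: adm => _ _ _ /(_ i iX e)/intrP[m hm]; rewrite e hm -[2]/(2%:~R) -rmorphM numq_int -exprz_exp.
  by rewrite -[(-1) ^ 2]/((-1) * (-1)) mulrNN mulr1 exp1rz mulr1.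
have ne' : t (t i) != t i by rewrite (inj_eq (@perm_inj _ t)).
have := s2 (t i) (iX_t iX) ne'; rewrite ttT => h.
pose km : {rmorphism K -> kfield K} := kemb K \o polyC.
rewrite -![kcst _]/(km _) -(rmorphN1 km) -(fmorphXz km) -(rmorphM km); congr (km _).
rewrite -h mulrCA -[X in _ = X * _](divfK (s0 i)) h; move: (numq _) => n.
by rewrite mulrAC -expfzMl mulrNN mulr1 exp1rz mul1r.
Qed.

(** bar(X_i) is a multiple of T_(w_X)^-1(E_(tau i)), which T_(w_X) and then T_(w_0) carry to a
    multiple of an F, up to torus factors. The remaining scalar identity is where [kappaE], the
    condition on bar(c_i) and the sign condition on s meet. *)
Lemma twistM_F i : i \notin X -> act (twistM M) (uF K i) =
  ((kbar K (c i))%:A : L) *: (act M (ubar (Xelt L X t s i)) * Kh (Kc i)).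
Proof.
move=> iX; have bX := iX_t iX; have [hr e hl] := lwordP X; have [z hz] := th_int i.
set v := act M (chb K (t i) (lword X)).
have c1 : cj (TX M) (v * Kh (coroot_of z)) (E (t i) * Kh (Kc (t i))).
  apply: cjM (chb_lword tXT' hLT bX hr e hl M) _.
  apply: cj_K => l; rewrite form_Kc (weight_at_coroot _ (erefl (Qint z))) -hz e formC.
  by rewrite -[RHS](longest_form X) mulmxA (longest2 tXT' hLT) mul1mx formC.
have c0 : cj (T0 M) (E (t i) * Kh (Kc (t i))) (- F (t0 (t i))).
  have := cjM (T0E (t i)).1 (T0Kc (t i)).1.
  by rewrite mulNr -mulrA (wr_KN H) mulr1.
have wv : opM (th i) v.
  by have := chb_wt tXT' hLT bX hr e hl (p := [::]) (s := lword X) M erefl; rewrite e.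
have Bz : th i - Bop (th i) = Qint (z - delta_mx i 0).
  rewrite -Bop_alpha (BopK hcT tXT ttT hLT) Bop_alpha hz -Qint_delta.
  by apply/matrixP => a b; rewrite !mxE rmorphB.
have h1 := xi_xK (coroot_of z) (Plat_th i) wv Bz.
have := cjN (cj_comp c1 c0); rewrite opprK T0_TX -comT => c2.
rewrite (twistM_val (u := uF K i) (x := - (v * Kh (coroot_of z))) _ (cjN h1)); last by rewrite uddF.
have -> : coroot_of z - coroot_of (z - delta_mx i 0) = Kc i.
  by rewrite coroot_ofD coroot_ofN /Kc opprD opprK addrA subrr add0r.
rewrite (act_bXelt M iX) -/v mulNr scalerN scMl scalerA.
congr (- _); congr (_ *: _).
rewrite (gam_lword (Plat_alpha _)) (ee_th iX); case: (gmh) => _ _ _ -> //; rewrite -!algM; congr (_%:A).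
rewrite ttT (kappaE K hLT bX hr e hl erefl) (par_bar iX).
have -> : kcst (s i) = kcst (s (t i)) * (-1) ^ numq (2 * at_rhoV X (alpha (t i))) by apply: sgn_t.
set r := form (alpha (t i)) (2 *: rho X); have rok : qok D r by exact: rho_ok.
have fok : qok D (form (alpha i) (Bop (alpha i))).
  by rewrite Bop_alpha hz; apply/qok_Num/form_int/Plat_alpha.
rewrite qpowD // (qpowN _ rok); move: (kcst _) (_ ^ _) (qpow K D _) => a1 a2 a3.
move: (qpow_neq0 K D r); move: (qpow K D r) => a4 h4; rewrite -[LHS]mulr1 -(mulfV h4).
by move: (c (t i)) => a5; ring.
Qed.

(** Here T_(w_X) cancels against the one inside X_i. The diagram automorphisms permute the letters
    of the chosen word of w_X, so [lword_diag] and [matsumoto] are needed to recognise the same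
    operator. *)
Lemma twistM_X i : i \notin X ->
  (c i)%:A *: (act (twistM M) (Xelt L X t s i) * act (twistM M) (uK K (- Kc i))) = F i.
Proof.
move=> iX; have bX := iX_t iX; have [hr e hl] := lwordP X; have [z hz] := th_int i.
set f := form (alpha i) (alpha i).
have hK : act (twistM M) (uK K (- Kc i)) = Kh (coroot_of z).
  rewrite /Kc -coroot_ofN; apply: twistM_K; rewrite ThetaE -hz -Bop_alpha -BopN; congr (Bop _).
  by rewrite QintN opprK Qint_delta.
have tt0i : t (t0 (t i)) = t0 i by rewrite comT ttT.
have ex : udd (chn K (t i) (lword X)) = chn K (t0 i) (map t (map t0 (lword X))).
  by rewrite (udiag_chn K hc0 he0) (udiag_chn K hcT heT) tt0i.
have [w1 r1] := lword_diag tXT' hLT hc0 tX0.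
pose g : {perm I} := (t0 * t)%g.
have gE x : g x = t (t0 x) by rewrite permM.
have [w2 r2] : wprod (map g (lword X)) = wprod (lword X) /\ reduced (map g (lword X)).
  by apply: (lword_diag tXT' hLT) => [a b|j]; rewrite !gE ?hcT ?hc0 // tXT tX0.
have eg : map t (map t0 (lword X)) = map g (lword X).
  by rewrite -map_comp; apply: eq_map => x; rewrite gE.
have hl2 : {subset map g (lword X) <= X}.
  by move=> x /mapP[y /hl yX ->]; rewrite gE tXT tX0.
have c1 := chn_lword tXT' hLT (i0 := t0 i) _ r2 (etrans w2 e) hl2 M.
rewrite (matsumoto M r2 hr w2) -eg -ex in c1.
have c0 : cj (T0 M) (- ((qpow K D f)%:A *: (F i * Kh (- Kc i)))) (E (t0 i)).
  have := cjN (cjZ ((qpow K D f)%:A) (cjM (T0E i).2 (T0Kc i).2)).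
  rewrite mulNr scalerN opprK (wrE H) scMl -mulrA (wr_NK H) mulr1 scalerA weight_atNr form_Kc.
  have -> : form (alpha (t0 i)) (alpha (t0 i)) = f by rewrite -(ff_perm (t0 i)) tt0 /f !form_alpha !pairing_alpha !car_ii heT.
  by rewrite -algM -qpowD ?qokN ?ok_alpha // addrN qpow0 scale1r scale1r.
have Bz : - alpha i - Bop (- alpha i) = Qint (z - delta_mx i 0).
  rewrite BopN opprK Bop_alpha hz -Qint_delta addrC.
  by apply/matrixP => a b; rewrite !mxE rmorphB.
have h1 := cjN (cjZ ((qpow K D f)%:A) (xi_xK (- Kc i) (PlatN (Plat_alpha i)) (opwtF H i) Bz)).
have hv := twistM_val (cj_comp c0 (c1 _)) h1.
rewrite act_Xelt // rmorphN /= actZ hK hv ?tX0 //.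
rewrite coroot_ofD coroot_ofN opprB addrA addNr add0r (ee_alpha i).2 -/f (gamN g0T gDT (Plat_alpha i)).
have gi : gam (alpha i) = (c i)%:A * (kcst (s (t i)))%:A.
  by rewrite -algM; case: (gmh) => _ _ _ ->.
have eY (a b d g' : L) (y z' : 'M[L]_(udim M)) : g' *: (- (a *: - (b *: (d *: y))) * z') = (g' * a * b * d) *: (y * z').
  by rewrite scalerN opprK !scMl !scalerA !mulrA.
have gi0 := g0T (Plat_alpha i).
have qq : (qpow K D f)%:A * (qpow K D (- f))%:A = 1 :> L.
  by rewrite -algM -qpowD ?qokN ?ok_alpha // addrN qpow0 scale1r.
rewrite eY -[F i * _ * _]mulrA (wr_NK H) mulr1 -gi -[RHS]scale1r; congr (_ *: _).
rewrite -mulrA [_ * (_^-1 * _)]mulrCA qq mulr1 mulfV //.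
Qed.
End Values.
End Twist.

Lemma sum_uniq_eq (V : zmodType) (T : choiceType) (r s : seq T) (f : T -> V) : uniq r -> uniq s ->
  (forall x, x \notin r -> f x = 0) -> (forall x, x \notin s -> f x = 0) ->
  \sum_(x <- r) f x = \sum_(x <- s) f x.
Proof. by move=> ur us hr hs; rewrite -!(@fsumE _ _ setT) // => x _; [apply: hs|apply: hr]. Qed.

(** * Uniqueness by gradings *)

Section Components.
Variables (K : fieldType) (D : cartanDatum) (L : fieldExtType (kfield K)).
Local Notation I := 'I_(rk D).
Local Notation hdual := 'cV[rat]_(rk D).
Local Notation Qplus := 'cV[nat]_(rk D).
Local Notation coroots := 'cV[int]_(rk D).

Record comps n (Kh : coroots -> 'M[L]_n) (ss : seq hdual) (cm : hdual -> 'M[L]_n -> 'M[L]_n) : Prop := Comps {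
  cm_uniq : uniq ss; cm_Plat : forall b, b \in ss -> Plat b;
  cm_lin : forall b a x y, cm b (a *: x + y) = a *: cm b x + cm b y;
  cm_delta : forall b b' x, Plat b -> opwt Kh b x -> cm b' x = if b' == b then x else 0;
  cm_sum : forall x, x = \sum_(b <- ss) cm b x;
  cm_out : forall b x, b \notin ss -> cm b x = 0;
  cm_opwt : forall b x, opwt Kh b (cm b x) }.

Lemma comps_ex n (Kh : coroots -> 'M[L]_n) : (forall v : 'cV[L]_n, exists2 s : seq 'cV[L]_n,
    (forall w, w \in s -> exists2 l, Plat l & wt Kh l w) & v = \sum_(w <- s) w) ->
  exists ss cm, comps Kh ss cm.
Proof.
move=> dec; have [s [P [us hs hP h1 h0]]] := wproj_ex dec.
have hw := wproj_wt us hs hP h1 h0.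
pose ss := undup [seq (l' - l : hdual) | l' <- s, l <- s].
(* The component of weight b maps the weight space of l to that of l + b; only differences of
   occurring weights contribute. *)
pose cm b (x : 'M[L]_n) := \sum_(l <- s) P (l + b) * x * P l.
have Pss b : b \in ss -> Plat b.
  rewrite mem_undup => /allpairsP[[l l'] /= [ls l's ->]].
  exact: (PlatD (hs _ ls) (PlatN (hs _ l's))).
have out b x : b \notin ss -> cm b x = 0.
  move=> bs; rewrite /cm big_seq big1 // => l ls; rewrite h0 ?mul0r //.
  apply: contra bs => lb; rewrite mem_undup; apply/allpairsP; exists (l + b, l); split=> //=.
  by rewrite addrC addKr.
exists ss, cm; split=> //.
- exact: undup_uniq.
- move=> b a x y; rewrite /cm scaler_sumr -big_split; apply: eq_bigr => l _.
  by rewrite mulrDr mulrDl scMr scMl.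
- move=> b b' x pb hx; transitivity (\sum_(l <- s) (if b' == b then x * P l else 0)).
    rewrite /cm !big_seq; apply: eq_bigr => l ls; apply: mx_vec_eq => v.
    rewrite !mulMV (hw _ (l + b)) ?(inj_eq (addrI l)); last first.
    - exact: opwt_wt pb (hs _ ls) hx (hP l v).
    - exact: PlatD (hs _ ls) pb.
    by case: eqP => _; rewrite ?mulMV ?mul0mx.
  by case: (b' == b); [rewrite -mulr_sumr h1 mulr1|rewrite big1].
- move=> x; rewrite /cm exchange_big /= -[LHS]mulr1 -h1 mulr_sumr big_seq [RHS]big_seq.
  apply: eq_bigr => l ls; rewrite -!mulr_suml; congr (_ * _); rewrite -[LHS]mul1r -h1; congr (_ * _).
  rewrite -(big_map (fun b => l + b) xpredT P); apply: sum_uniq_eq => //.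
    by rewrite map_inj_uniq ?undup_uniq //; apply: addrI.
  move=> m hm; apply: h0; apply: contra hm => ms; apply/mapP; exists (m - l); last by rewrite addrC subrK.
  by rewrite mem_undup; apply/allpairsP; exists (m, l).
move=> b x; case: (boolP (b \in ss)) => [bs|/out ->]; last exact: opwt0.
rewrite /cm big_seq; apply: (big_ind (opwt Kh b)); [exact: opwt0|by move=> u v; apply: opwtD|].
move=> l ls h; have e1 : Kh h * P (l + b) = (qpow K D (weight_at (l + b) h))%:A *: P (l + b).
  by apply: mx_vec_eq => v; rewrite mulMV hP -scalemxAl.
have e2 : P l * Kh h = (qpow K D (weight_at l h))%:A *: P l.
  apply: (mx_wt_eq dec) => m v pm hv; rewrite mulMV hv -scalemxAr (hw _ _ _ pm hv) -scalemxAl (hw _ _ _ pm hv).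
  by case: eqP => [->|_]; rewrite ?scaler0.
rewrite !mulrA e1 -[_ * P l * Kh h]mulrA e2 scMr !scMl scalerA -algM addrC weight_atD qpowD //.
  exact: (Plat_ok _ (Pss _ bs)).
exact: (Plat_ok _ (hs _ ls)).
Qed.

Section Graded.
Variables (n : nat) (Kh : coroots -> 'M[L]_n) (ss : seq hdual) (cm : hdual -> 'M[L]_n -> 'M[L]_n).
Hypothesis C : comps Kh ss cm.
Local Notation op := (opwt Kh).

Lemma cmD b x y : cm b (x + y) = cm b x + cm b y.
Proof. by rewrite -[x in LHS]scale1r (cm_lin C) scale1r. Qed.
Lemma cm0 b : cm b 0 = 0.
Proof. by have := cm_lin C b (-1) 0 0; rewrite scaler0 addr0 scaleN1r addNr. Qed.
Lemma cmN b x : cm b (- x) = - cm b x.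
Proof. by rewrite -[- x]addr0 -scaleN1r (cm_lin C) cm0 addr0 scaleN1r. Qed.
Lemma cmB b x y : cm b (x - y) = cm b x - cm b y. Proof. by rewrite cmD cmN. Qed.
Lemma cm_bigs b (J : Type) (r : seq J) (P : pred J) (f : J -> 'M[L]_n) :
  cm b (\sum_(j <- r | P j) f j) = \sum_(j <- r | P j) cm b (f j).
Proof. by apply: (big_morph (cm b)) => [x y|]; rewrite ?cmD ?cm0. Qed.
Lemma cm_eq0 x : (forall b, Plat b -> cm b x = 0) -> x = 0.
Proof. by move=> h; rewrite (cm_sum C x) big_seq big1 // => b /(cm_Plat C)/h. Qed.

Lemma cm_mull b v y x : Plat v -> op v y -> cm b (y * x) = y * cm (b - v) x.
Proof.
move=> pv hy; rewrite {1}(cm_sum C x) mulr_sumr cm_bigs.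
transitivity (\sum_(b' <- ss) if b' == b - v then y * cm b' x else 0).
  rewrite !big_seq; apply: eq_bigr => b' bs; have pb := cm_Plat C bs.
  rewrite (cm_delta C _ (PlatD pv pb) (opwtM pv pb hy (cm_opwt C _ _))).
  by rewrite addrC -subr_eq eq_sym.
case: (boolP (b - v \in ss)) => hs.
  by rewrite -big_mkcond -big_filter filter_pred1_uniq ?(cm_uniq C) // big_seq1.
rewrite (cm_out C _ hs) mulr0 big_seq big1 // => b' bs.
by case: eqP => // e; rewrite -e bs in hs.
Qed.
Lemma cm_mulr b v y x : Plat v -> op v y -> cm b (x * y) = cm (b - v) x * y.
Proof.
move=> pv hy; rewrite {1}(cm_sum C x) mulr_suml cm_bigs.
transitivity (\sum_(b' <- ss) if b' == b - v then cm b' x * y else 0).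
  rewrite !big_seq; apply: eq_bigr => b' bs; have pb := cm_Plat C bs.
  rewrite (cm_delta C _ (PlatD pb pv) (opwtM pb pv (cm_opwt C _ _) hy)).
  by rewrite -subr_eq eq_sym.
case: (boolP (b - v \in ss)) => hs.
  by rewrite -big_mkcond -big_filter filter_pred1_uniq ?(cm_uniq C) // big_seq1.
rewrite (cm_out C _ hs) mul0r big_seq big1 // => b' bs.
by case: eqP => // e; rewrite -e bs in hs.
Qed.
End Graded.

(** Sums of homogeneous operators whose weights satisfy P. With the torus of the second tensor
    factor, [Qgt] expresses positive weight there. *)
Inductive span n (Kh : coroots -> 'M[L]_n) (P : hdual -> Prop) : 'M[L]_n -> Prop :=
| span0 : span Kh P 0
| span_add b x y : P b -> opwt Kh b x -> span Kh P y -> span Kh P (x + y).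

Definition Qge (b : hdual) := exists mu : Qplus, b = Qnat mu.
Definition Qgt (b : hdual) := exists2 mu : Qplus, b = Qnat mu & mu != 0.

Lemma Qge_Plat b : Qge b -> Plat b. Proof. by case=> mu ->; apply: Plat_Qnat. Qed.
Lemma Qgt_ge b : Qgt b -> Qge b. Proof. by case=> mu -> _; exists mu. Qed.
Lemma QnatD mu nu : Qnat (mu + nu) = Qnat mu + Qnat nu :> hdual.
Proof. by apply/matrixP => i j; rewrite !mxE natrD. Qed.
Lemma Qnat0 : Qnat 0 = 0 :> hdual. Proof. by apply/matrixP => i j; rewrite !mxE. Qed.
Lemma Qnat_inj : injective (@Qnat D).
Proof.
move=> mu nu /matrixP h; apply/matrixP => i j; rewrite [j]ord1; have := h i 0.
by rewrite !mxE => /eqP; rewrite eqr_nat => /eqP.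
Qed.
Lemma addQ_eq0 (mu nu : Qplus) : mu + nu = 0 -> mu = 0.
Proof. by move=> /matrixP h; apply/matrixP => i j; have := h i j; rewrite !mxE => /eqP; rewrite addn_eq0 => /andP[/eqP]. Qed.
Lemma QgeD b b' : Qge b -> Qge b' -> Qge (b + b').
Proof. by move=> [m ->] [m' ->]; exists (m + m'); rewrite QnatD. Qed.
Lemma Qge0 : Qge 0. Proof. by exists 0; rewrite Qnat0. Qed.
Lemma QgtDl b b' : Qgt b -> Qge b' -> Qgt (b + b').
Proof.
move=> [m -> m0] [m' ->]; exists (m + m'); first by rewrite QnatD.
by apply: contra m0 => /eqP/addQ_eq0 ->.
Qed.
Lemma QgtDr b b' : Qge b -> Qgt b' -> Qgt (b + b').
Proof. by move=> h h'; rewrite addrC; apply: QgtDl. Qed.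
Lemma Qnat_delta i : Qnat (delta_mx i 0) = alpha i :> hdual.
Proof. apply/matrixP => a b; rewrite !mxE.
 by rewrite [b]ord1; case: (a == i).
Qed.
Lemma Qgt_alpha i : Qgt (alpha i).
Proof.
exists (delta_mx i 0); first by rewrite Qnat_delta.
by apply/eqP => /matrixP/(_ i 0); rewrite !mxE !eqxx.
Qed.

Section Span.
Variables (n : nat) (Kh : coroots -> 'M[L]_n).
Local Notation op := (opwt Kh).
Local Notation sp := (span Kh).

Lemma span1 (P : hdual -> Prop) b x : P b -> op b x -> sp P x.
Proof. by move=> h hx; rewrite -[x]addr0; apply: span_add h hx (span0 _ _). Qed.
Lemma spanD (P : hdual -> Prop) x y : sp P x -> sp P y -> sp P (x + y).
Proof. by elim=> [|b u v hb hu _ IH] hy; rewrite ?add0r // -addrA; apply: span_add hb hu (IH hy). Qed.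
Lemma spanZ (P : hdual -> Prop) a x : sp P x -> sp P (a *: x).
Proof.
elim=> [|b u v hb hu _ IH]; first by rewrite scaler0; apply: span0.
by rewrite scalerDr; apply: span_add hb (opwtZ _ hu) IH.
Qed.
Lemma spanB (P : hdual -> Prop) x y : sp P x -> sp P y -> sp P (x - y).
Proof. by move=> hx hy; rewrite -scaleN1r; apply: spanD hx (spanZ _ hy). Qed.
Lemma span_sum (P : hdual -> Prop) (J : eqType) (r : seq J) (f : J -> 'M[L]_n) :
  (forall j, j \in r -> sp P (f j)) -> sp P (\sum_(j <- r) f j).
Proof.
move=> h; rewrite big_seq; apply: (big_ind (sp P)) => //; first exact: span0.
by move=> x y; apply: spanD.
Qed.
Lemma spanM (P P' P'' : hdual -> Prop) x y : (forall b, P b -> Plat b) -> (forall b, P' b -> Plat b) ->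
  (forall b b', P b -> P' b' -> P'' (b + b')) -> sp P x -> sp P' y -> sp P'' (x * y).
Proof.
move=> pP pP' hP hx hy; elim: hx => [|b u v hb hu _ IH]; first by rewrite mul0r; apply: span0.
rewrite mulrDl; apply: spanD => //; elim: hy => [|b' u' v' hb' hu' _ IH']; first by rewrite mulr0; apply: span0.
by rewrite mulrDr; apply: span_add (hP _ _ hb hb') (opwtM (pP _ hb) (pP' _ hb') hu hu') IH'.
Qed.
Lemma span_sub (P P' : hdual -> Prop) x : (forall b, P b -> P' b) -> sp P x -> sp P' x.
Proof. by move=> h; elim=> [|b u v /h hb hu _]; [apply: span0|apply: span_add hb hu]. Qed.

Lemma spanM_ge x y : sp Qge x -> sp Qge y -> sp Qge (x * y).
Proof. by apply: spanM => [b|b|b b']; [exact: Qge_Plat..|exact: QgeD]. Qed.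
Lemma spanM_gtl x y : sp Qgt x -> sp Qge y -> sp Qgt (x * y).
Proof. by apply: spanM => [b /Qgt_ge|b|b b']; [exact: Qge_Plat..|exact: QgtDl]. Qed.
Lemma spanM_gtr x y : sp Qge x -> sp Qgt y -> sp Qgt (x * y).
Proof. by apply: spanM => [b|b /Qgt_ge|b b']; [exact: Qge_Plat..|exact: QgtDr]. Qed.

Variables (ss : seq hdual) (cm : hdual -> 'M[L]_n -> 'M[L]_n).
Hypothesis C : comps Kh ss cm.
Lemma cm_span (P : hdual -> Prop) x b : (forall b, P b -> Plat b) -> sp P x -> ~ P b -> cm b x = 0.
Proof.
move=> pP; elim=> [|b' u v hb' hu _ IH] hb; first exact: (cm0 C).
rewrite (cmD C) IH // addr0 (cm_delta C _ (pP _ hb') hu).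
by case: eqP => // e; rewrite e in hb.
Qed.
End Span.

(* The component of W of least height commutes with all F_i, so it vanishes by sl2-theory. *)
Lemma graded_uniq n (E F : I -> 'M[L]_n) (Kh : coroots -> 'M[L]_n) W : wrep E F Kh ->
  span Kh Qgt W ->
  (forall i, exists A B, [/\ span Kh Qge A, span Kh Qge B & (F i + A) * W = W * (F i + B)]) -> W = 0.
Proof.
move=> H hW hF; have [ss [cm C]] := comps_ex (wr_dec H).
pose h (mu : Qplus) := (\sum_i mu i ord0)%N.
suff key m (mu : Qplus) : (h mu <= m)%N -> cm (Qnat mu) W = 0.
  apply: (cm_eq0 C) => b pb; case: (pselect (Qge b)) => [[mu ->]|nb]; first exact: key (leqnn _).
  by apply: (cm_span C _ hW) => [b' /Qgt_ge/Qge_Plat|/Qgt_ge].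
elim: m mu => [|m IH] mu hm.
  apply: (cm_span C _ hW) => [b' /Qgt_ge/Qge_Plat //|[nu /Qnat_inj <- /eqP[]]].
  apply/matrixP => i j; rewrite [j]ord1 [RHS]mxE; apply/eqP.
  by move: hm; rewrite leqn0 sum_nat_eq0 => /forallP/(_ i).
case: (eqVneq mu 0) => [->|mu0].
  by apply: (cm_span C _ hW) => [b' /Qgt_ge/Qge_Plat //|[nu /Qnat_inj <- /eqP[]]].
(* Otherwise (mu, mu) <= 0 although mu is nonzero. *)
have [i hi] : exists i, 0 < pairing (Qnat mu) i.
  apply: contrapT => /forallNP hn.
  have : form (Qnat mu) (Qnat mu) <= 0.
    rewrite formE sumr_le0 // => i _; rewrite mulr_ge0_le0 ?mulr_ge0 ?mxE ?ler0n //.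
    by rewrite leNgt; apply/negP/hn.
  rewrite leNgt form_pos //; apply: contra mu0 => /eqP e; apply/eqP/Qnat_inj; rewrite e Qnat0 //.
have /intrP[p hp] := Plat_Qnat mu i; rewrite hp ltr0z in hi.
case: p hp hi => // -[//|p] hp _.
apply: (wr_comm_pos H hp (cm_opwt C _ _)).
have [A [B [hA hB e]]] := hF i.
(* A contribution of A or B to this weight involves a component of W of height smaller than that of
   mu, which is zero by induction. *)
have low x b : span Kh Qge x -> b = Qnat mu - alpha i -> cm b (x * W) = 0 /\ cm b (W * x) = 0.
  move=> hx eb; elim: hx => [|b' u v hb' hu _ [IH1 IH2]]; first by rewrite mul0r mulr0 (cm0 C).
  rewrite mulrDl mulrDr !(cmD C) IH1 IH2 !addr0 (cm_mull C _ _ (Qge_Plat hb') hu) (cm_mulr C _ _ (Qge_Plat hb') hu).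
  suff -> : cm (b - b') W = 0 by rewrite mulr0 mul0r.
  case: (pselect (Qge (b - b'))) => [[nu hnu]|nb]; last first.
    by apply: (cm_span C _ hW) => [b'' /Qgt_ge/Qge_Plat //|/Qgt_ge].
  rewrite hnu; apply: IH; case: hb' => mu' eb'.
  have {}hnu : mu = nu + mu' + delta_mx i 0.
    by apply: Qnat_inj; rewrite !QnatD -hnu eb eb' Qnat_delta !subrK.
  have : h mu = (h nu + h mu' + 1)%N.
    have e1 : (\sum_a (delta_mx i ord0 : Qplus) a ord0)%N = 1%N.
      rewrite (bigD1 i) //= big1 => [|a ai]; rewrite !mxE ?eqxx //.
      by rewrite (negPf ai).
    rewrite -e1 /h hnu -!big_split; apply: eq_bigr => a _ /=; by rewrite !mxE.
  by lia.
have [a1 a2] := low A _ hA erefl; have [b1 b2] := low B _ hB erefl.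
have := congr1 (cm (Qnat mu - alpha i)) e; rewrite mulrDl mulrDr !(cmD C) a1 b2 !addr0.
have pa := PlatN (Plat_alpha i); rewrite (cm_mull C _ _ pa (opwtF H i)) (cm_mulr C _ _ pa (opwtF H i)).
by rewrite opprK subrK.
Qed.

(** A finite box containing the support of a series on a fixed module; it may be enlarged, so
    several series can share one. *)
Definition qbox (B : nat) : seq Qplus := [seq (\col_i (f i : nat))%R | f : {ffun I -> 'I_B} <- enum {: {ffun I -> 'I_B}}].
Lemma qboxP B (mu : Qplus) : reflect (forall i, (mu i ord0 < B)%N) (mu \in qbox B).
Proof.
apply: (iffP mapP) => [[f _ ->] i|h]; first by rewrite mxE.
exists [ffun i => Ordinal (h i)]; first by rewrite mem_enum.
by apply/matrixP => i j; rewrite [j]ord1 mxE ffunE.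
Qed.
Lemma qbox_uniq B : uniq (qbox B).
Proof.
rewrite map_inj_uniq ?enum_uniq // => f g /matrixP h; apply/ffunP => i; apply/val_inj.
by have := h i 0; rewrite !mxE.
Qed.
Lemma qbox_sub B B' : (B <= B')%N -> {subset qbox B <= qbox B'}.
Proof. by move=> h mu /qboxP hm; apply/qboxP => i; apply: leq_trans (hm i) h. Qed.
Lemma qbox_bound n (Kh : coroots -> 'M[L]_n) (f : Qplus -> 'M[L]_n) : (forall v : 'cV[L]_n, exists2 s : seq 'cV[L]_n,
    (forall w, w \in s -> exists2 l, Plat l & wt Kh l w) & v = \sum_(w <- s) w) ->
  (forall mu, opwt Kh (Qnat mu) (f mu)) -> exists B, forall B', (B <= B')%N -> forall mu, mu \notin qbox B' -> f mu = 0.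
Proof.
move=> dec hf; have [B hB] := opwt_big dec; exists B => B' BB mu hm.
have [i hi] : exists i, (B' <= mu i ord0)%N.
  apply: contrapT => /forallNP hn; move/negP: hm; apply; apply/qboxP => i.
  by rewrite ltnNge; apply/negP/hn.
apply: (hB _ _ (Plat_Qnat mu) (hf mu) i); rewrite mxE normr_nat ler_nat.
exact: leq_trans BB hi.
Qed.
Lemma fsum_qbox n (f : Qplus -> 'M[L]_n) B : (forall mu, mu \notin qbox B -> f mu = 0) ->
  \sum_(mu \in setT) f mu = \sum_(mu <- qbox B) f mu.
Proof. by move=> h; apply: fsumE (qbox_uniq B) _ _ => // mu _; apply: h. Qed.
End Components.

(** * Coproducts of the root vectors *)

Section Chains.
Variables (K : fieldType) (D : cartanDatum) (L : fieldExtType (kfield K)).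
Local Notation I := 'I_(rk D).
Local Notation UQ := (Uq K D).
Local Notation hdual := 'cV[rat]_(rk D).
Local Notation coroots := 'cV[int]_(rk D).
Local Notation qL := (@qL K D L).

Section Mats.
Variables (n : nat) (E : I -> 'M[L]_n).
Definition dE j r : 'M[L]_n := (qfact (qL j) r)^-1 *: E j ^+ r.
Definition chS (b : bool) j m (x : 'M[L]_n) : 'M[L]_n :=
  \sum_(r < m.+1) ((-1) ^+ r * qL j ^ (- r%:Z)) *:
    (dE j (if b then r : nat else m - r)%N * x * dE j (if b then m - r else r)%N).
(* [chn] (b = false) and [chb] (b = true) with E_a replaced by an arbitrary operator x *)
Fixpoint ChM (b : bool) a (s : seq I) x : 'M[L]_n :=
  if s is j :: s' then chS b j (mk (wprod s' *m alpha a : hdual) j) (ChM b a s' x) else x.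
Lemma chSD b j m x y : chS b j m (x + y) = chS b j m x + chS b j m y.
Proof.
by rewrite /chS -big_split; apply: eq_bigr => r _; rewrite mulrDr mulrDl scalerDr.
Qed.
Lemma ChMD b a s x y : ChM b a s (x + y) = ChM b a s x + ChM b a s y.
Proof. by elim: s => //= j s ->; rewrite chSD. Qed.
End Mats.

Lemma ChM_ind (n n' : nat) (E : I -> 'M[L]_n) (E' : I -> 'M[L]_n') (Q : 'M[L]_n -> 'M[L]_n' -> Prop) b a s x x' :
  Q 0 0 -> (forall x x' y y', Q x x' -> Q y y' -> Q (x + y) (x' + y')) ->
  (forall c x x', Q x x' -> Q (c *: x) (c *: x')) ->
  (forall j x x', j \in s -> Q x x' -> Q (E j * x) (E' j * x')) ->
  (forall j x x', j \in s -> Q x x' -> Q (x * E j) (x' * E' j)) ->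
  Q x x' -> Q (ChM E b a s x) (ChM E' b a s x').
Proof.
move=> Q0 QD QZ; elim: s => //= j s IH QL QR hx.
have {}IH : Q (ChM E b a s x) (ChM E' b a s x').
  by apply: IH => // i y y' iS; [apply: QL|apply: QR]; rewrite inE iS orbT.
have hj : j \in j :: s by rewrite mem_head.
have QLX r y y' : Q y y' -> Q (E j ^+ r * y) (E' j ^+ r * y').
  by move=> hy; elim: r => [|r IHr]; rewrite ?expr0 ?mul1r // !exprS -!mulrA; apply: QL.
have QRX r y y' : Q y y' -> Q (y * E j ^+ r) (y' * E' j ^+ r).
  by move=> hy; elim: r => [|r IHr]; rewrite ?expr0 ?mulr1 // !exprSr !mulrA; apply: QR.
apply: (big_ind2 Q) => // r _; apply: (QZ); rewrite /dE !scMr !scMl.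
by apply: (QZ); apply: (QZ); apply: QRX; apply: QLX.
Qed.

Definition chx (b : bool) (a : I) (s : seq I) : UQ := if b then chb K a s else chn K a s.

Lemma act_chx (M : gmod D L) b a s :
  act M (chx b a s) = ChM (fun i => act M (uE K i)) b a s (act M (uE K a)).
Proof.
case: b; elim: s => //= j s <-; rewrite rmorph_sum; apply: eq_bigr => r _ /=;
  by rewrite actZ actM3 !act_divE algM algX -in_algE rmorphXn rmorphN1.
Qed.

Definition adb (b : bool) (M : gmod D L) j : 'M[L]_(udim M) -> 'M[L]_(udim M) :=
  if b then adR (act M (uE K j)) (act M (uK K (Kc j))) (act M (uK K (- Kc j)))
  else adl (act M (uE K j)) (act M (uK K (Kc j))) (act M (uK K (- Kc j))).

Arguments adb : clear implicits.

Lemma chS_adb b (M : gmod D L) j m x : Wad (qL j) (act M (uK K (Kc j))) (- m%:Z) x ->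
  chS (fun i => act M (uE K i)) b j m x = (qfact (qL j) m)^-1 *: iter m (adb b M j) x.
Proof.
move=> hx; have H := gmod_wrep M; have [N hN] := wr_nil H; have [EN FN] := hN j.
case: b.
  rewrite -(adtoprE (qL_pow L j) (qL_neq0 L j) (wr_KN H _) (wr_NK H _) (wr_KE2 H j) (wr_KF2 H j) (wr_EF H j) EN FN hx).
  by [].
by have := adtopE' hx; rewrite /adtop dpw.unlock => ->.
Qed.

Lemma adb_opwt b (M : gmod D L) j l x : Plat l -> opwt (fun h => act M (uK K h)) l x ->
  opwt (fun h => act M (uK K h)) (l + alpha j) (adb b M j x).
Proof.
move=> pl hx; have H := gmod_wrep M; have pa := Plat_alpha j; have p0 := @Plat0 D.
have hK h := opwtK H h; have hE := opwtE H j.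
have kx h h' : opwt (fun h => act M (uK K h)) l (act M (uK K h) * x * act M (uK K h')).
  by have := opwtM (PlatD p0 pl) p0 (opwtM p0 pl (hK h) hx) (hK h'); rewrite add0r addr0.
case: b; rewrite /adb.
  rewrite /adR -!mulrA [act M (uK K (Kc j)) * _]mulrA; apply: opwtD; first exact: opwtM.
  by apply: opwtN; rewrite addrC; apply: opwtM.
rewrite /adl; apply: opwtD; first by rewrite addrC; apply: opwtM.
by apply: opwtN; apply: opwtM.
Qed.

Lemma Wad_wt (M : gmod D L) j l m x : pairing l j = m%:~R -> opwt (fun h => act M (uK K h)) l x ->
  Wad (qL j) (act M (uK K (Kc j))) m x.
Proof. exact: opwt_Wad. Qed.

(* If f z carries operators of weight z on A to operators on B and intertwines the
   adjoint actions of the E_j (shifting z), it carries chains to chains. *)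
Lemma ChM_transport b (A B : gmod D L) (f : coroots -> 'M[L]_(udim A) -> 'M[L]_(udim B)) (X : {set I}) a s :
  (forall z c v, f z (c *: v) = c *: f z v) ->
  (forall z v, opwt (fun h => act A (uK K h)) (Qint z) v -> opwt (fun h => act B (uK K h)) (Qint z) (f z v)) ->
  (forall j z v, opwt (fun h => act A (uK K h)) (Qint z) v ->
     adb b B j (f z v) = f (z + delta_mx j 0) (adb b A j v)) ->
  a \notin X -> reduced s -> {subset s <= X} ->
  exists2 z, wprod s *m alpha a = Qint z &
    ChM (fun i => act B (uE K i)) b a s (f (delta_mx a 0) (act A (uE K a))) =
    f z (act A (chx b a s)).
Proof.
move=> fZ f1 f2 aX hr hs; rewrite act_chx.
suff [z [h1 h2 _]] : exists z, [/\ wprod s *m alpha a = Qint z,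
   ChM (fun i => act B (uE K i)) b a s (f (delta_mx a 0) (act A (uE K a))) =
   f z (ChM (fun i => act A (uE K i)) b a s (act A (uE K a))) &
   opwt (fun h => act A (uK K h)) (Qint z) (ChM (fun i => act A (uE K i)) b a s (act A (uE K a)))].
  by exists z.
elim: s hr hs => [|j s IH] hr hs.
  exists (delta_mx a 0); rewrite mul1mx Qint_delta; split=> //; exact: (opwtE (gmod_wrep A)).
have hr' : reduced s by apply: (@red_catr D [:: j]).
have [|z [h1 h2 h3]] := IH hr'; first by move=> x xs; apply: hs; rewrite inE xs orbT.
have hm := mkE aX hr hs; set m := mk _ _ in hm.
rewrite [ChM _ _ _ (j :: s) _]/= [ChM (fun i => act A _) _ _ (j :: s) _]/= -/m h2.
set v := ChM (fun i => act A _) _ _ _ _ in h3 *.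
have hmz : pairing (Qint z) j = (- m%:Z)%:~R by rewrite -h1.
have Q k : Qint (z + delta_mx j 0 *+ k) = Qint z + alpha j *+ k :> hdual.
  elim: k => [|k IHk]; first by rewrite !mulr0n !addr0.
  by rewrite !mulrSr !addrA -IHk -Qint_delta; apply/matrixP => x y; rewrite !mxE rmorphD.
have it k : opwt (fun h => act A (uK K h)) (Qint (z + delta_mx j 0 *+ k)) (iter k (adb b A j) v) /\
    iter k (adb b B j) (f z v) = f (z + delta_mx j 0 *+ k) (iter k (adb b A j) v).
  elim: k => [|k [o e]]; first by rewrite !mulr0n addr0.
  have e2 : z + delta_mx j 0 *+ k.+1 = z + delta_mx j 0 *+ k + delta_mx j 0 by rewrite mulrSr addrA.
  split; last by rewrite !iterS e f2 // e2.
  by rewrite Q mulrSr addrA -Q iterS; apply: adb_opwt => //; apply: Plat_Qint.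
exists (z + delta_mx j 0 *+ m); split.
- by rewrite /= -mulmxA refl_mul h1 Q hmz rmorphN scaleNr opprK scaler_nat.
- rewrite (chS_adb b (Wad_wt hmz (f1 _ _ h3))) (chS_adb b (Wad_wt hmz h3)).
  by rewrite (it m).2 fZ.
by rewrite (chS_adb b (Wad_wt hmz h3)); apply: opwtZ; exact: (it m).1.
Qed.
End Chains.
Arguments adb {K D L} b M j _.
Arguments chx K {D} b a s.

Section ChainCoproducts.
Variables (K : fieldType) (D : cartanDatum) (L : fieldExtType (kfield K)).
Local Notation I := 'I_(rk D).
Local Notation UQ := (Uq K D).
Local Notation hdual := 'cV[rat]_(rk D).
Local Notation coroots := 'cV[int]_(rk D).

Lemma Qint_inj : injective (@Qint D).
Proof.
move=> x y /matrixP h; apply/matrixP => i j; have := h i j; rewrite !mxE => /eqP.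
by rewrite eqr_int => /eqP.
Qed.

Variables (M N : gmod D L).
Local Notation EM i := (act M (uE K i)).
Local Notation KM h := (act M (uK K h)).
Local Notation EN i := (act N (uE K i)).
Local Notation KN h := (act N (uK K h)).
Local Notation opN := (opwt (fun h => KN h)).
Local Notation opM := (opwt (fun h => KM h)).
Let HM := gmod_wrep M.
Let HN := gmod_wrep N.

Definition ka i : 'M[L]_(udim M) := KM (Kc i).
Definition kav i : 'M[L]_(udim M) := KM (- Kc i).
Lemma secondM_wrep : wrep (fun i => tm (ka i) (EN i)) (fun i => tm (kav i) (act N (uF K i))) (fun h => tm 1 (KN h)).
Proof. by apply: (tens2_wrep HN) => [i j|i]; [apply: (wr_KC HM)|apply: (wr_KN HM)]. Qed.
(* The module structure on M (x) N for which the quasi K-matrix acts by its image under u |-> K_mu (x) u *)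
Definition secondM : gmod D L := GMod (Oint_rmod secondM_wrep).
Lemma secondM_gen : [/\ forall i, act secondM (uE K i) = tm (ka i) (EN i),
    forall i, act secondM (uF K i) = tm (kav i) (act N (uF K i))
  & forall h, act secondM (uK K h) = tm 1 (KN h)].
Proof. by split=> x; exact: (plift_gen (wrep_model secondM_wrep) _). Qed.

Lemma conj_K (A : gmod D L) z j v : opwt (fun h => act A (uK K h)) (Qint z) v ->
  act A (uK K (Kc j)) * v * act A (uK K (- Kc j)) = (qpow K D (form (alpha j) (Qint z)))%:A *: v.
Proof.
by move=> h; rewrite h form_Kc scMl -mulrA (wr_KN (gmod_wrep A)) mulr1.
Qed.
Lemma K_E (A : gmod D L) z j : act A (uK K (coroot_of z)) * act A (uE K j) =
  (qpow K D (form (alpha j) (Qint z)))%:A *: (act A (uE K j) * act A (uK K (coroot_of z))).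
Proof. by rewrite (wrE (gmod_wrep A)) (weight_at_coroot _ (erefl (Qint z))) formC. Qed.
Lemma E_Kn (A : gmod D L) z j : act A (uE K j) * act A (uK K (- coroot_of z)) =
  (qpow K D (form (alpha j) (Qint z)))%:A *: (act A (uK K (- coroot_of z)) * act A (uE K j)).
Proof.
have H := gmod_wrep A; have h := K_E A z j.
have h2 : act A (uK K (- coroot_of z)) * (act A (uK K (coroot_of z)) * act A (uE K j)) * act A (uK K (- coroot_of z)) =
   act A (uE K j) * act A (uK K (- coroot_of z)) by rewrite mulrA (wr_NK H) mul1r.
by rewrite -h2 h scMr scMl !mulrA -[_ * _ * _ * act A (uK K (- _))]mulrA (wr_KN H) mulr1.
Qed.

Local Notation D0 := (Dmod M N false).
Local Notation D1 := (Dmod M N true).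
Variables (X : {set I}) (a : I) (s : seq I).
Hypothesis aX : a \notin X.
Hypothesis hr : reduced s.
Hypothesis hs : {subset s <= X}.

Let f1 (z : coroots) (v : 'M[L]_(udim M)) : 'M[L]_(udim M * udim N) := tm v 1.
Let f1Z z c v : f1 z (c *: v) = c *: f1 z v. Proof. exact: tmZl. Qed.
Let f1w b z v : opM (Qint z) v -> opwt (fun h => act (Dmod M N b) (uK K h)) (Qint z) (f1 z v).
Proof. by move=> hv h; have [_ _ ->] := Dmod_gen M N b; rewrite !tmM mul1r mulr1 hv tmZl. Qed.

(** On v (x) 1 the summand K_j (x) E_j of the coproduct cancels in the left adjoint action. The same
    cancellation takes place in [ChM_D1_l] for the right adjoint action and the bar-conjugated
    coproduct. *)
Lemma ChM_D0_l : ChM (fun i => act D0 (uE K i)) false a s (tm (EM a) 1) = tm (act M (chn K a s)) 1.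
Proof.
have [|z _ h] := ChM_transport (b := false) (A := M) (B := D0) f1Z (f1w false) _ aX hr hs; last exact: h.
move=> j z v hv; have [hE _ hK] := Dmod_gen M N false.
rewrite /adb /adl hE !hK /sgn_co !(mulrDr, mulrDl) !tmM !mul1r !mulr1 (wr_KN HN) !mul1r -[_ * KM (- _) * KM (Kc j)]mulrA (wr_NK HM) mulr1.
by rewrite opprD addrACA subrr addr0 -tmNl -tmDl.
Qed.

Lemma ChM_D1_l : ChM (fun i => act D1 (uE K i)) true a s (tm (EM a) 1) = tm (act M (chb K a s)) 1.
Proof.
have [|z _ h] := ChM_transport (b := true) (A := M) (B := D1) f1Z (f1w true) _ aX hr hs; last exact: h.
move=> j z v hv; have [hE _ hK] := Dmod_gen M N true.
rewrite /adb /adR hE !hK /sgn_co !(mulrDr, mulrDl) !tmM !mul1r !mulr1 -[EN j * KN _ * KN _]mulrA (wr_KN HN) mulr1 (wr_NK HM) !mul1r.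
by rewrite opprD addrACA subrr addr0 -tmNl -tmDl.
Qed.

Let f2 (z : coroots) (v : 'M[L]_(udim N)) : 'M[L]_(udim M * udim N) := tm (KM (coroot_of z)) v.
Let f3 (z : coroots) (v : 'M[L]_(udim N)) : 'M[L]_(udim M * udim N) := tm (KM (- coroot_of z)) v.
Let f2Z z c v : f2 z (c *: v) = c *: f2 z v. Proof. exact: tmZr. Qed.
Let f3Z z c v : f3 z (c *: v) = c *: f3 z v. Proof. exact: tmZr. Qed.
Let f2w b z v : opN (Qint z) v -> opwt (fun h => act (Dmod M N b) (uK K h)) (Qint z) (f2 z v).
Proof. by move=> hv h; have [_ _ ->] := Dmod_gen M N b; rewrite !tmM hv tmZr (wr_KC HM). Qed.
Let f3w b z v : opN (Qint z) v -> opwt (fun h => act (Dmod M N b) (uK K h)) (Qint z) (f3 z v).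
Proof. by move=> hv h; have [_ _ ->] := Dmod_gen M N b; rewrite !tmM hv tmZr (wr_KC HM). Qed.
Let f2wN z v : opN (Qint z) v -> opwt (fun h => act secondM (uK K h)) (Qint z) (f2 z v).
Proof. by move=> hv h; have [_ _ ->] := secondM_gen; rewrite !tmM hv tmZr mul1r mulr1. Qed.

Lemma KMshift z j : KM (coroot_of z) * KM (Kc j) = KM (coroot_of (z + delta_mx j 0)).
Proof. by rewrite -(wrD HM) coroot_ofD. Qed.
Lemma KMshiftN z j : KM (- coroot_of z) * KM (- Kc j) = KM (- coroot_of (z + delta_mx j 0)).
Proof. by rewrite -(wrD HM) coroot_ofD opprD. Qed.

(** On the second factor the roles are exchanged: left chains fit the bar-conjugated coproduct and
    right chains the ordinary one, provided the first factor carries the torus element of the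
    accumulated weight. *)
Lemma ChM_D1_r z : wprod s *m alpha a = Qint z ->
  ChM (fun i => act D1 (uE K i)) false a s (tm (KM (- Kc a)) (EN a)) = tm (KM (- coroot_of z)) (act N (chn K a s)).
Proof.
move=> hz; have [|z' hz'] := ChM_transport (b := false) (A := N) (B := D1) f3Z (f3w true) _ aX hr hs; last first.
  by rewrite -(Qint_inj (etrans (esym hz) hz')).
move=> j y v hv; have [hE _ hK] := Dmod_gen M N true.
rewrite /adb /adl hE !hK /sgn_co !(mulrDr, mulrDl) !tmM !mul1r !mulr1 (conj_K j hv) E_Kn.
have e1 : KM (Kc j) * KM (- coroot_of y) * KM (- Kc j) = KM (- coroot_of y).
  by rewrite (wr_KC HM (Kc j)) -mulrA (wr_KN HM) mulr1.
rewrite e1 tmZl [tm _ (_ *: v)]tmZr opprD addrACA subrr add0r (wr_KC HM (- Kc j)) KMshiftN.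
by rewrite -tmNr -tmDr.
Qed.

Lemma ChM_D0_r z : wprod s *m alpha a = Qint z ->
  ChM (fun i => act D0 (uE K i)) true a s (tm (KM (Kc a)) (EN a)) = tm (KM (coroot_of z)) (act N (chb K a s)).
Proof.
move=> hz; have [|z' hz'] := ChM_transport (b := true) (A := N) (B := D0) f2Z (f2w false) _ aX hr hs; last first.
  by rewrite -(Qint_inj (etrans (esym hz) hz')).
move=> j y v hv; have [hE _ hK] := Dmod_gen M N false.
rewrite /adb /adR hE !hK /sgn_co !(mulrDr, mulrDl) !tmM !mul1r !mulr1.
have e1 h : KM h * KM (Kc j) * KM (coroot_of y) * KM (- Kc j) = KM h * KM (coroot_of y).
  by rewrite -!(wrD HM); congr (act M (uK K _)); rewrite [_ + _ + coroot_of y]addrAC addrK.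
have e0 : EM j * KM (Kc j) * KM (coroot_of y) * KM (- Kc j) = EM j * KM (coroot_of y).
  by rewrite -!mulrA -!(wrD HM) addrCA addrN addr0.
have e2 x : x * KN (Kc j) * v * KN (- Kc j) = (qpow K D (form (alpha j) (Qint y)))%:A *: (x * v).
  by rewrite -!mulrA [KN _ * (_ * _)]mulrA (conj_K j hv) scMr.
rewrite e1 e0 e2 -[KN (Kc j) * v * _]mul1r !mulrA e2 K_E mul1r tmZl [tm _ (_ *: v)]tmZr opprD addrACA subrr add0r (wr_KC HM (Kc j)) KMshift.
by rewrite -tmNr -tmDr.
Qed.

Lemma act_secondM_chx b z : wprod s *m alpha a = Qint z ->
  act secondM (chx K b a s) = tm (KM (coroot_of z)) (act N (chx K b a s)).
Proof.
move=> hz; rewrite act_chx; have [hE _ hK] := secondM_gen; rewrite hE.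
have [|z' hz'] := ChM_transport (b := b) (A := N) (B := secondM) f2Z f2wN _ aX hr hs; last first.
  by rewrite -(Qint_inj (etrans (esym hz) hz')).
move=> j y v hv; rewrite /f2 -KMshift /adb; case: b; rewrite ?/adR ?/adl hE !hK !tmM ?mul1r ?mulr1 /ka.
  by rewrite [KM (Kc j) * KM _](wr_KC HM) -tmNr -tmDr.
by rewrite [KM (Kc j) * KM _](wr_KC HM) -tmNr -tmDr.
Qed.

Lemma act_D0_chn : act D0 (chn K a s) = tm (act M (chn K a s)) 1 +
  ChM (fun i => act D0 (uE K i)) false a s (tm (KM (Kc a)) (EN a)).
Proof.
rewrite -[chn K a s]/(chx K false a s) act_chx; have [hE _ _] := Dmod_gen M N false.
by rewrite hE ChMD ChM_D0_l.
Qed.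
Lemma act_D1_chn z : wprod s *m alpha a = Qint z -> act D1 (chn K a s) =
  ChM (fun i => act D1 (uE K i)) false a s (tm (EM a) 1) + tm (KM (- coroot_of z)) (act N (chn K a s)).
Proof.
move=> hz; rewrite -[chn K a s]/(chx K false a s) act_chx; have [hE _ _] := Dmod_gen M N true.
by rewrite hE ChMD (ChM_D1_r hz).
Qed.
Lemma act_D0_chb z : wprod s *m alpha a = Qint z -> act D0 (chb K a s) =
  ChM (fun i => act D0 (uE K i)) true a s (tm (EM a) 1) + tm (KM (coroot_of z)) (act N (chb K a s)).
Proof.
move=> hz; rewrite -[chb K a s]/(chx K true a s) act_chx; have [hE _ _] := Dmod_gen M N false.
by rewrite hE ChMD (ChM_D0_r hz).
Qed.
End ChainCoproducts.

Lemma addr4E (V : zmodType) (x y z w : V) : x + y - (z + w) = y - w + x - z.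
Proof. by rewrite opprD [x + y]addrC [- z - w]addrC addrACA addrA. Qed.

(** * Quasi R-matrices *)

Section Series.
Variables (K : fieldType) (D : cartanDatum) (L : fieldExtType (kfield K)).
Local Notation I := 'I_(rk D).
Local Notation UQ := (Uq K D).
Local Notation hdual := 'cV[rat]_(rk D).
Local Notation Qplus := 'cV[nat]_(rk D).
Local Notation coroots := 'cV[int]_(rk D).
Implicit Types (X : {set I}) (mu : Qplus) (M N : gmod D L).

Definition TS X mu : UU K D -> Prop := tens_set (@Uminus K D X mu) (@Uplus K D X mu).

Lemma ubar_gen (g : I -> UQ) X u : (forall i, ubar (g i) = g i) ->
  gen_subalg [set g i | i in [set` X]]%classic u -> gen_subalg [set g i | i in [set` X]]%classic (ubar u).
Proof.
move=> hg; elim/gen_subalg_ind => {u} [u [i iX <-]||c u v hu hv|u v hu hv].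
- by rewrite hg; apply: gen_subalgS; exists i.
- have -> : ubar (1 : UQ) = 1 by rewrite ubar_amE rmorph1.
  exact: gen_subalg1.
- by rewrite ubarD ubarZ; apply: gen_subalg_lin.
by rewrite ubarM; apply: gen_subalgM.
Qed.

Lemma ubar_wt (u : UQ) l : Plat l -> (forall h, uK K h * u = qpow K D (weight_at l h) *: (u * uK K h)) ->
  forall h, uK K h * ubar u = qpow K D (weight_at l h) *: (ubar u * uK K h).
Proof.
move=> pl hu h; have := congr1 (@ubar K D) (hu (- h)).
rewrite ubarM ubarZ ubarM ubarK opprK => ->; congr (_ *: _).
by rewrite kbar_qpow weight_atNr qpowN ?invrK //; apply: Plat_ok.
Qed.

Lemma uubar_TS X mu z : TS X mu z -> TS X mu (uubar z).
Proof.
move=> [s hs ->]; exists [seq (ubar p.1, ubar p.2) | p <- s].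
  move=> _ /mapP[p /hs[[h1 h2] [h3 h4]] ->] /=; split; split.
  - exact: (ubar_gen (@ubarF K D)).
  - by move=> h; rewrite -weight_atN; apply: ubar_wt => [|h']; rewrite ?weight_atN //; apply/PlatN/Plat_Qnat.
  - exact: (ubar_gen (@ubarE K D)).
  - by apply: ubar_wt => //; apply: Plat_Qnat.
rewrite uubar_amE (rmorph_sum (uubar_am K D)) big_map; apply: eq_bigr => p _.
exact: uubar_tens.
Qed.

Section TwoModules.
Variables (M N : gmod D L).
Local Notation K2 := (fun h => tm (1 : 'M[L]_(udim M)) (act N (uK K h))).
Let HM := gmod_wrep M.
Let HN := gmod_wrep N.

Lemma H2 : wrep (fun i => tm (1 : 'M[L]_(udim M)) (act N (uE K i))) (fun i => tm 1 (act N (uF K i))) K2.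
Proof. by apply: (tens2_wrep HN) => *; rewrite mulr1. Qed.

Lemma TS_ind X mu z (Q : 'M[L]_(udim M * udim N) -> Prop) : TS X mu z -> Q 0 ->
  (forall x y, Q x -> Q y -> Q (x + y)) ->
  (forall f e, Uminus X mu f -> Uplus X mu e -> Q (tm (act M f) (act N e))) -> Q (act2m M N z).
Proof.
move=> [s hs ->] Q0 QD Qt; rewrite rmorph_sum big_seq; apply: (big_ind Q) => // p /hs[h1 h2].
by rewrite /= act2_tens; apply: Qt.
Qed.

Lemma Uplus_opwt (A : gmod D L) X mu e : Uplus X mu e -> opwt (fun h => act A (uK K h)) (Qnat mu) (act A e).
Proof. by move=> [_ he] h; rewrite -!rmorphM -actZ he. Qed.
Lemma Uminus_opwt (A : gmod D L) X mu f : Uminus X mu f -> opwt (fun h => act A (uK K h)) (- Qnat mu) (act A f).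
Proof. by move=> [_ he] h; rewrite weight_atN -!rmorphM -actZ he. Qed.

Lemma TS_opwt2 X mu z : TS X mu z -> opwt K2 (Qnat mu) (act2m M N z).
Proof.
move=> hz; apply: (TS_ind hz); [exact: opwt0|by move=> x y; apply: opwtD|].
by move=> f e hf he h; rewrite !tmM mul1r mulr1 (Uplus_opwt N he) tmZr.
Qed.

Lemma comm_ind (x : 'M[L]_(udim M * udim N)) X mu z : TS X mu z ->
  (forall f e, Uminus X mu f -> Uplus X mu e -> x * tm (act M f) (act N e) = tm (act M f) (act N e) * x) ->
  x * act2m M N z = act2m M N z * x.
Proof.
move=> hz h; apply: (TS_ind (Q := fun w => x * w = w * x) hz) => //; first by rewrite mulr0 mul0r.
by move=> u v hu hv; rewrite mulrDr mulrDl hu hv.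
Qed.

(** The two tensor factors have opposite weights. *)
Lemma TS_total X mu z h : TS X mu z ->
  tm (act M (uK K h)) (act N (uK K h)) * act2m M N z = act2m M N z * tm (act M (uK K h)) (act N (uK K h)).
Proof.
move=> hz; apply: (comm_ind hz) => f e hf he; rewrite !tmM (Uminus_opwt M hf) (Uplus_opwt N he).
rewrite tmZl tmZr scalerA -algM -qpowD ?Plat_ok //; try exact: Plat_Qnat; try exact/PlatN/Plat_Qnat.
by rewrite weight_atN addNr qpow0 !scale1r.
Qed.

Lemma gen_comm (A : gmod D L) (S : set UQ) x u : (forall g, S g -> x * act A g = act A g * x) ->
  gen_subalg S u -> x * act A u = act A u * x.
Proof.
move=> hS; elim/gen_subalg_ind => {u} [u /hS //||c u v hu hv|u v hu hv].
- by rewrite rmorph1 mulr1 mul1r.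
- by rewrite rmorphD /= actZ mulrDr mulrDl scMr scMl hu hv.
by rewrite rmorphM mulrA hu -mulrA hv mulrA.
Qed.

Lemma TS_E X mu z a : a \notin X -> TS X mu z ->
  tm (act M (uE K a)) 1 * act2m M N z = act2m M N z * tm (act M (uE K a)) 1.
Proof.
move=> aX hz; apply: (comm_ind hz) => f e [hf _] _; rewrite !tmM mul1r mulr1; congr (tm _ _).
apply: gen_comm hf => _ [i iX <-]; apply/esym/EF_comm.
by apply: contraNneq aX => <-.
Qed.

Lemma TS_F X mu z i : i \notin X -> TS X mu z ->
  tm 1 (act N (uF K i)) * act2m M N z = act2m M N z * tm 1 (act N (uF K i)).
Proof.
move=> iX hz; apply: (comm_ind hz) => f e _ [he _]; rewrite !tmM mul1r mulr1; congr (tm _ _).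
apply: gen_comm he => _ [j jX <-]; apply: EF_comm.
by apply: contraNneq iX => ->.
Qed.

(* v twisted by the torus commutes with U^+_X, so it commutes with e of weight mu up to q^(mu,z) *)
Lemma TS_Kv X mu z y v : (forall j, j \in X -> act N (uE K j) * v = (qpow K D (form (alpha j) (Qint y)))%:A *: (v * act N (uE K j))) ->
  TS X mu z ->
  tm (act M (uK K (- coroot_of y))) v * act2m M N z = act2m M N z * tm (act M (uK K (- coroot_of y))) v.
Proof.
move=> hv hz; apply: (comm_ind hz) => f e hf he; rewrite !tmM (Uminus_opwt M hf) tmZl.
pose v' := v * act N (uK K (coroot_of y)).
have c1 : v' * act N e = act N e * v'.
  have [he1 _] := he; apply: gen_comm he1 => _ [j jX <-].
  by rewrite /v' mulrA hv // scMl -mulrA (K_E N y j) scMr mulrA.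
have -> : act N e * v = (qpow K D (weight_at (Qnat mu) (coroot_of y)))%:A *: (v * act N e).
  have -> : v = v' * act N (uK K (- coroot_of y)) by rewrite /v' -mulrA (wr_KN HN) mulr1.
  rewrite mulrA -c1 -[v' * _ * act N e]mulrA (Uplus_opwt N he) scMr scalerA -algM weight_atNr -qpowD.
  - by rewrite addrN qpow0 !scale1r mulrA.
  - exact/Plat_ok/Plat_Qnat.
  - exact/qokN/Plat_ok/Plat_Qnat.
by rewrite tmZr weight_atN weight_atNr opprK.
Qed.

Section OneSeries.
Variables (X : {set I}) (x : Qplus -> UU K D).
Hypothesis hx : forall mu, TS X mu (x mu).
Local Notation S2 := (sum2 L x M N).
Lemma sum2E : S2 = \sum_(mu \in setT) act2m M N (x mu). Proof. by []. Qed.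

Lemma series_bound : exists B, forall B', (B <= B')%N ->
  (forall mu, mu \notin qbox D B' -> act2m M N (x mu) = 0) /\ S2 = \sum_(mu <- qbox D B') act2m M N (x mu).
Proof.
have [B hB] := qbox_bound (wr_dec H2) (fun mu => TS_opwt2 (hx mu)).
by exists B => B' BB; split; [exact: hB|apply: fsum_qbox; apply: hB].
Qed.

(* the component of weight b of the series x *)
Definition rq (b : hdual) : UU K D := xget 0 [set z | exists2 mu, b = Qnat mu & z = x mu]%classic.
Lemma rq_nat mu : rq (Qnat mu) = x mu.
Proof. by rewrite /rq; case: xgetP => [_ -> [nu /Qnat_inj -> ->] //|/(_ (x mu))[]]; exists mu. Qed.
Lemma rq_out b : ~ Qge b -> rq b = 0.
Proof. by move=> nb; rewrite /rq; case: xgetP => // z _ [mu e _]; case: (nb); exists mu. Qed.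

Lemma cm_series ss cm b : comps K2 ss cm -> cm b S2 = act2m M N (rq b).
Proof.
move=> C; have [B /(_ B (leqnn _))[h0 ->]] := series_bound; rewrite (cm_bigs C).
have d mu : cm b (act2m M N (x mu)) = if b == Qnat mu then act2m M N (x mu) else 0.
  exact: (cm_delta C _ (Plat_Qnat mu) (TS_opwt2 (hx mu))).
case: (pselect (Qge b)) => [[mu e]|nb]; last first.
  rewrite rq_out // rmorph0 big1 // => mu _; rewrite d; case: eqP => // e.
  by case: nb; exists mu.
transitivity (\sum_(nu <- qbox D B) if nu == mu then act2m M N (x nu) else 0).
  by apply: eq_bigr => nu _; rewrite d e (inj_eq (@Qnat_inj D)) eq_sym.
rewrite e rq_nat.
rewrite -big_mkcond; case: (boolP (mu \in qbox D B)) => hm.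
  by rewrite -big_filter filter_pred1_uniq ?qbox_uniq // big_seq1.
rewrite h0 // big_seq_cond big1 // => nu /andP[hn /eqP en]; by rewrite -en hn in hm.
Qed.

Lemma series_span : span K2 (@Qge D) S2 /\ span K2 (@Qgt D) (S2 - act2m M N (x 0)).
Proof.
have [B /(_ (maxn B 1) (leq_maxl _ _))[h0 ->]] := series_bound.
have h1 mu : span K2 (@Qge D) (act2m M N (x mu)).
  by apply: (span1 (b := Qnat mu)); [exists mu|exact: TS_opwt2].
split; first by apply: span_sum => mu _.
rewrite (bigD1_seq 0) ?qbox_uniq //=; last first.
  by apply/qboxP => i; rewrite mxE leq_max orbT.
rewrite addrAC subrr add0r -big_filter; apply: span_sum => mu; rewrite mem_filter => /andP[m0 _].
by apply: (span1 (b := Qnat mu)); [exists mu|exact: TS_opwt2].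
Qed.
End OneSeries.

Lemma S2_comm X x v : (forall mu, TS X mu (x mu)) -> (forall mu z, TS X mu z -> v * act2m M N z = act2m M N z * v) ->
  v * sum2 L x M N = sum2 L x M N * v.
Proof. move=> hx h; rewrite sum2E mulr_sumr mulr_suml; apply: eq_bigr => mu _; exact: (h mu (x mu) (hx mu)). Qed.

End TwoModules.

Lemma uubar_rq (x : Qplus -> UU K D) b : uubar (rq x b) = rq (fun mu => uubar (x mu)) b.
Proof.
case: (pselect (Qge b)) => [[mu ->]|nb]; first by rewrite !rq_nat.
by rewrite !rq_out // uubar_amE rmorph0.
Qed.

Lemma uubarM (x y : UU K D) : uubar (x * y) = uubar x * uubar y.
Proof. by rewrite !uubar_amE rmorphM. Qed.
Lemma uubarD (x y : UU K D) : uubar (x + y) = uubar x + uubar y.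
Proof. by rewrite !uubar_amE rmorphD. Qed.
Lemma uubarB (x y : UU K D) : uubar (x - y) = uubar x - uubar y.
Proof. by rewrite !uubar_amE rmorphB. Qed.
Lemma ubar_1 : ubar (1 : UQ) = 1. Proof. by rewrite ubar_amE rmorph1. Qed.

Lemma act2mM M N (x y : UU K D) : act2m M N (x * y) = act2m M N x * act2m M N y.
Proof. by rewrite rmorphM. Qed.
Lemma act2mD M N (x y : UU K D) : act2m M N (x + y) = act2m M N x + act2m M N y.
Proof. by rewrite rmorphD. Qed.
Lemma act2mB M N (x y : UU K D) : act2m M N (x - y) = act2m M N x - act2m M N y.
Proof. by rewrite rmorphB. Qed.

Section QuasiR.
Variables (X : {set I}) (S : UQ -> Prop) (R : Qplus -> UU K D).
Hypothesis hR : quasiR L X S R.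
Hypothesis SF : forall j, j \in X -> S (uF K j).
Local Notation Rb := (fun mu => uubar (R mu)).

Lemma R_TS mu : TS X mu (R mu). Proof. by case: hR => h _ _; exact: h. Qed.
Lemma Rb_TS mu : TS X mu (Rb mu). Proof. exact/uubar_TS/R_TS. Qed.

Lemma R_rel M N v : S (ubar v) ->
  act (Dmod M N false) v * sum2 L R M N = sum2 L R M N * act (Dmod M N true) v.
Proof.
move=> hv; case: hR => _ _ /(_ _ hv) /(_ M N (gmP M) (gmP N)).
rewrite /mul2 /emb2 ubarKK coprod_act uubar_coprod_act ubarKK; exact.
Qed.

Lemma act_D0F M N j : act (Dmod M N false) (uF K j) =
  tm (act M (uF K j)) (act N (uK K (- Kc j))) + tm 1 (act N (uF K j)).
Proof. by have [_ -> _] := Dmod_gen M N false. Qed.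
Lemma act_D1F M N j : act (Dmod M N true) (uF K j) =
  tm (act M (uF K j)) (act N (uK K (Kc j))) + tm 1 (act N (uF K j)).
Proof. by have [_ -> _] := Dmod_gen M N true; rewrite /sgn_co opprK. Qed.

(** Bar applies to elements, not to the sum of a series on a module. So the relation of R is split
    by weights in the second factor; each component is an identity on all pairs of modules, where
    [uubar_stab] applies, and the components are reassembled afterwards. *)
Lemma Rb_F M N j : j \in X ->
  act (Dmod M N true) (uF K j) * sum2 L Rb M N = sum2 L Rb M N * act (Dmod M N false) (uF K j).
Proof.
move=> jX; set F2 := tens 1 (uF K j) : UU K D.
have key b (M' N' : gmod D L) : Plat b ->
    act2m M' N' (F2 * rq R (b + alpha j) - rq R (b + alpha j) * F2 +
      tens (uF K j) (uK K (- Kc j)) * rq R b - rq R b * tens (uF K j) (uK K (Kc j))) = 0.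
  move=> pb; have [ss [cm C]] := comps_ex (wr_dec (H2 M' N')).
  have e0 := @R_rel M' N' (uF K j); rewrite ubarF in e0; have := congr1 (cm b) (e0 (SF jX)).
  rewrite act_D0F act_D1F mulrDl mulrDr !(cmD C).
  have w0 h : opwt (fun h => tm (1 : 'M[L]_(udim M')) (act N' (uK K h))) 0 (tm (act M' (uF K j)) (act N' (uK K h))).
    by move=> h'; rewrite !tmM mul1r mulr1 (wr_KC (gmod_wrep N') h') weight_at0 qpow0 !scale1r.
  have wF : opwt (fun h => tm (1 : 'M[L]_(udim M')) (act N' (uK K h))) (- alpha j) (tm 1 (act N' (uF K j))).
    exact: (opwtF (H2 M' N')).
  have p0 := @Plat0 D; have pa := PlatN (Plat_alpha j).
  rewrite !(cm_mull C _ _ p0 (w0 _)) !(cm_mulr C _ _ p0 (w0 _)) !(cm_mull C _ _ pa wF) !(cm_mulr C _ _ pa wF).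
  rewrite !(cm_series R_TS _ C) subr0 opprK => e.
  rewrite act2mB act2mD act2mB (act2mM _ _ F2) (act2mM _ _ _ F2) (act2mM _ _ (tens _ _)) (act2mM _ _ (rq R b)).
  by rewrite /F2 !act2_tens rmorph1 -addr4E e subrr.
have keyb b : Plat b ->
    act2m M N (F2 * rq Rb (b + alpha j) - rq Rb (b + alpha j) * F2 +
      tens (uF K j) (uK K (Kc j)) * rq Rb b - rq Rb b * tens (uF K j) (uK K (- Kc j))) = 0.
  move=> pb; rewrite -(uubar_stab (fun M' N' => key b M' N' pb) M N); congr (act2m M N _).
  rewrite uubarB uubarD uubarB (uubarM F2) (uubarM _ F2) (uubarM (tens _ _) (rq R b)) (uubarM (rq R b)).
  by rewrite !uubar_rq !uubar_tens ubarF !ubarK opprK ubar_1.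
have [ss [cm C]] := comps_ex (wr_dec (H2 M N)).
apply/eqP; rewrite -subr_eq0; apply/eqP/(cm_eq0 C) => b pb; rewrite (cmB C).
have w0 h : opwt (fun h => tm (1 : 'M[L]_(udim M)) (act N (uK K h))) 0 (tm (act M (uF K j)) (act N (uK K h))).
  by move=> h'; rewrite !tmM mul1r mulr1 (wr_KC (gmod_wrep N) h') weight_at0 qpow0 !scale1r.
have wF : opwt (fun h => tm (1 : 'M[L]_(udim M)) (act N (uK K h))) (- alpha j) (tm 1 (act N (uF K j))).
  exact: (opwtF (H2 M N)).
have p0 := @Plat0 D; have pa := PlatN (Plat_alpha j).
rewrite act_D0F act_D1F mulrDl mulrDr !(cmD C).
rewrite !(cm_mull C _ _ p0 (w0 _)) !(cm_mulr C _ _ p0 (w0 _)) !(cm_mull C _ _ pa wF) !(cm_mulr C _ _ pa wF).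
rewrite !(cm_series Rb_TS _ C) subr0 opprK -[RHS](keyb b pb).
rewrite act2mB act2mD act2mB (act2mM _ _ F2) (act2mM _ _ _ F2) (act2mM _ _ (tens _ _)) (act2mM _ _ (rq Rb b)).
by rewrite /F2 !act2_tens rmorph1 -addr4E.
Qed.

Lemma tens11 M N : act2m M N (tens 1 1) = 1.
Proof. by rewrite act2_tens !rmorph1 tm1. Qed.
Lemma R_span M N : span (fun h => tm (1 : 'M[L]_(udim M)) (act N (uK K h))) (@Qgt D) (sum2 L R M N - 1).
Proof. by have [_ h] := series_span M N R_TS; case: hR => _ e _; rewrite e tens11 in h. Qed.
Lemma Rb_span M N : span (fun h => tm (1 : 'M[L]_(udim M)) (act N (uK K h))) (@Qgt D) (sum2 L Rb M N - 1).
Proof.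
have [_ h] := series_span M N Rb_TS; case: hR => _ e _.
by rewrite e uubar_tens ubar_1 tens11 in h.
Qed.

Lemma tmF_wt M N j h : span (fun h => tm (1 : 'M[L]_(udim M)) (act N (uK K h))) (@Qge D) (tm (act M (uF K j)) (act N (uK K h))).
Proof.
apply: (span1 (b := 0)); first exact: Qge0.
by move=> h'; rewrite !tmM mul1r mulr1 (wr_KC (gmod_wrep N) h') weight_at0 qpow0 !scale1r.
Qed.

(** R bar(R) commutes with the action of each coproduct of F_j, j in X, and with 1 (x) F_i for the
    other i; as it is 1 plus terms of positive weight, [graded_uniq] shows that it is 1. *)
Lemma R_Rb M N : sum2 L R M N * sum2 L Rb M N = 1.
Proof.
apply/eqP; rewrite -subr_eq0; apply/eqP/(graded_uniq (H2 M N)).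
  have -> : sum2 L R M N * sum2 L Rb M N - 1 = (sum2 L R M N - 1) * sum2 L Rb M N + (sum2 L Rb M N - 1).
    by rewrite mulrBl mul1r addrA subrK.
  apply: spanD (Rb_span M N); apply: spanM_gtl; first exact: R_span.
  by have [] := series_span M N Rb_TS.
move=> i; case: (boolP (i \in X)) => iX; last first.
  exists 0, 0; split; [exact: span0..|rewrite !addr0 mulrBl mulrBr mul1r mulr1; congr (_ - _)].
  rewrite mulrA (S2_comm R_TS (fun mu z => TS_F M N iX)) -mulrA.
  by rewrite (S2_comm Rb_TS (fun mu z => TS_F M N iX)) mulrA.
set A := tm (act M (uF K i)) (act N (uK K (- Kc i))).
exists A, A; split; [exact: tmF_wt..|].
rewrite addrC -act_D0F mulrBl mulrBr mul1r mulr1; congr (_ - _).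
pose d0 : 'M[L]_(udim M * udim N) := act (Dmod M N false) (uF K i).
pose d1 : 'M[L]_(udim M * udim N) := act (Dmod M N true) (uF K i).
have e1 : d0 * sum2 L R M N = sum2 L R M N * d1 by apply: R_rel; rewrite ubarF; apply: SF.
have e2 : d1 * sum2 L Rb M N = sum2 L Rb M N * d0 by exact: Rb_F.
by rewrite -/d0 mulrA e1 -mulrA e2 mulrA.
Qed.
End QuasiR.

(** Both series are finite on M (x) N, so all sums are moved to boxes: B for the factors, B + B for
    the product, and C, depending on mu, for the pairs with sum mu. *)
Lemma mul_series_act M N X X' (x y : Qplus -> UU K D) :
  (forall mu, TS X mu (x mu)) -> (forall mu, TS X' mu (y mu)) ->
  \sum_(mu \in setT) act2m M N (mul_series x y mu) = sum2 L x M N * sum2 L y M N.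
Proof.
move=> hx hy; have [B1 hB1] := series_bound M N hx; have [B2 hB2] := series_bound M N hy.
pose B := maxn B1 B2; have [x0 ->] := hB1 B (leq_maxl _ _); have [y0 ->] := hB2 B (leq_maxr _ _).
pose f mu := act2m M N (x mu); pose g mu := act2m M N (y mu).
pose z mu := \sum_(p <- qbox D B) \sum_(p' <- qbox D B) if p + p' == mu then f p * g p' else 0.
have hz mu : act2m M N (mul_series x y mu) = z mu.
  pose C := maxn B (\max_i (mu i ord0)).+1.
  have inC p p' : p + p' = mu -> p \in qbox D C /\ p' \in qbox D C.
    move=> e; split; apply/qboxP => i; rewrite leq_max ltnS; apply/orP; right;
      apply: leq_trans (leq_bigmax i); rewrite -e mxE; [exact: leq_addr|exact: leq_addl].
  rewrite /mul_series (@fsumE _ _ _ [seq p <- [seq (a, b) | a <- qbox D C, b <- qbox D C] | p.1 + p.2 == mu]).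
  - rewrite rmorph_sum big_filter big_mkcond big_allpairs_dep /=.
    rewrite /z; transitivity (\sum_(p <- qbox D C) \sum_(p' <- qbox D C) if p + p' == mu then f p * g p' else 0).
      by apply: eq_bigr => p _; apply: eq_bigr => p' _; case: eqP => // _; rewrite act2mM.
    have sub : {subset qbox D B <= qbox D C} by apply: qbox_sub; apply: leq_maxl.
    transitivity (\sum_(p <- qbox D C) \sum_(p' <- qbox D B) if p + p' == mu then f p * g p' else 0).
      apply: eq_bigr => p _; apply: sum_uniq_eq; try exact: qbox_uniq; move=> p' hp'.
        by case: eqP => // /inC[_ h]; rewrite h in hp'.
      by case: eqP => // _; rewrite /g y0 ?mulr0.
    apply: sum_uniq_eq; try exact: qbox_uniq; move=> p hp; apply: big1 => p' _.
      by case: eqP => // /inC[h _]; rewrite h in hp.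
    by case: eqP => // _; rewrite /f x0 ?mul0r.
  - by rewrite filter_uniq // allpairs_uniq ?qbox_uniq // => -[a b] [a' b'].
  - by move=> p; rewrite mem_filter => /andP[/eqP].
  move=> [a b] /= e; rewrite mem_filter e eqxx /= => /negP[]; have [h1 h2] := inC _ _ e.
  by apply/allpairsP; exists (a, b).
have z0 mu : mu \notin qbox D (B + B) -> z mu = 0.
  move=> hmu; rewrite /z big_seq big1 // => p hp; rewrite big_seq big1 // => p' hp'.
  case: eqP => // e; case/negP: hmu; apply/qboxP => i; rewrite -e mxE.
  by have /qboxP/(_ i) h := hp; have /qboxP/(_ i) h' := hp'; rewrite -addSn; apply: leq_add (ltnW h').
transitivity (\sum_(mu \in setT) z mu); first by apply: eq_fsbigr => mu _; exact: hz.
rewrite (fsum_qbox z0) /z exchange_big mulr_suml big_seq [RHS]big_seq; apply: eq_bigr => p hp.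
rewrite exchange_big mulr_sumr big_seq [RHS]big_seq; apply: eq_bigr => p' hp' /=.
have hpp : p + p' \in qbox D (B + B).
  apply/qboxP => i; rewrite mxE.
  by have /qboxP/(_ i) h := hp; have /qboxP/(_ i) h' := hp'; rewrite -addSn; apply: leq_add (ltnW h').
under eq_bigr => mu _ do rewrite eq_sym.
by rewrite -big_mkcond -big_filter filter_pred1_uniq ?qbox_uniq // big_seq1.
Qed.

(** * The factor X_K2 as a quasi K-matrix *)

Section XK2.
Variables (M N : gmod D L).
(* pairs of operators (x, sum_z K_z x_z), where x = sum_z x_z with x_z of weight z *)
Inductive prs : 'M[L]_(udim N) -> 'M[L]_(udim M * udim N) -> Prop :=
| prs0 : prs 0 0
| prs_add z x y y' : opwt (fun h => act N (uK K h)) (Qint z) x -> prs y y' ->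
    prs (x + y) (tm (act M (uK K (coroot_of z))) x + y').
Lemma prsD x x' y y' : prs x x' -> prs y y' -> prs (x + y) (x' + y').
Proof. by elim=> [|z u v v' hu _ IH] hy; rewrite ?add0r // -!addrA; apply: prs_add hu (IH hy). Qed.
Lemma prsZ a x x' : prs x x' -> prs (a *: x) (a *: x').
Proof.
elim=> [|z u v v' hu _ IH]; first by rewrite !scaler0; apply: prs0.
by rewrite !scalerDr -tmZr; apply: prs_add (opwtZ _ hu) IH.
Qed.
Lemma prs1 z x : opwt (fun h => act N (uK K h)) (Qint z) x -> prs x (tm (act M (uK K (coroot_of z))) x).
Proof. by move=> h; rewrite -[x in prs x]addr0 -[tm _ _]addr0; apply: prs_add h prs0. Qed.
Lemma prsM x x' y y' : prs x x' -> prs y y' -> prs (x * y) (x' * y').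
Proof.
move=> hx hy; elim: hx => [|z u v v' hu _ IH]; first by rewrite !mul0r; apply: prs0.
rewrite !mulrDl; apply: prsD IH; elim: hy => [|z1 u1 v1 v1' hu1 _ IH1]; first by rewrite !mulr0; apply: prs0.
rewrite !mulrDr; apply: prsD IH1; rewrite tmM -(wrD (gmod_wrep M)) -coroot_ofD; apply: prs1.
have -> : Qint (z + z1) = Qint z + Qint z1 :> hdual by apply/matrixP => i j; rewrite !mxE rmorphD.
exact: (opwtM (Plat_Qint _) (Plat_Qint _)).
Qed.
Lemma prs_gen X u : gen_subalg [set uE K i | i in [set` X]]%classic u -> prs (act N u) (act (secondM M N) u).
Proof.
elim/gen_subalg_ind => {u} [u [i iX <-]||c u v hu hv|u v hu hv].
- have [-> _ _] := secondM_gen M N; apply: prs1; rewrite Qint_delta; exact: (opwtE (gmod_wrep N)).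
- rewrite !rmorph1; have := @prs1 0 1; rewrite (_ : coroot_of 0 = 0); last first.
    by apply/matrixP => i j; rewrite !mxE mul0r.
  rewrite (wr0 (gmod_wrep M)) tm1; apply.
  have -> : Qint 0 = 0 :> hdual by apply/matrixP => i j; rewrite !mxE.
  exact: opwt1.
- by rewrite !rmorphD /= !actZ; apply: prsD hv; apply: prsZ.
by rewrite !rmorphM; apply: prsM.
Qed.

(** The relation [prs] follows an element of U^+ through both modules; comparing components of
    weight mu leaves the single torus factor K_mu. *)
Lemma act_secondM_Uplus X mu u : Uplus X mu u ->
  act (secondM M N) u = tm (act M (uK K (coroot_of (map_mx Posz mu)))) (act N u).
Proof.
move=> hu; set z0 := map_mx Posz mu; have e0 : Qnat mu = Qint z0 :> hdual.
  by apply/matrixP => i j; rewrite [j]ord1 !mxE.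
have [ss [cm C]] := comps_ex (wr_dec (gmod_wrep N)).
have [ss' [cm' C']] := comps_ex (wr_dec (gmod_wrep (secondM M N))).
have p0 := Plat_Qnat mu.
have := cm_delta C (Qnat mu) p0 (Uplus_opwt N hu); rewrite eqxx => e1.
have := cm_delta C' (Qnat mu) p0 (Uplus_opwt (secondM M N) hu); rewrite eqxx => e2.
rewrite -e2 -e1; clear e1 e2; elim: (prs_gen hu.1) => [|z x y y' hx _ IH].
  by rewrite (cm0 C) (cm0 C') tm0r.
rewrite (cmD C) (cmD C') tmDr IH; congr (_ + _).
have hx' : opwt (fun h => act (secondM M N) (uK K h)) (Qint z) (tm (act M (uK K (coroot_of z))) x).
  by move=> h; have [_ _ ->] := secondM_gen M N; rewrite !tmM mul1r mulr1 hx tmZr.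
rewrite (cm_delta C _ (Plat_Qint z) hx) (cm_delta C' _ (Plat_Qint z) hx') e0.
by rewrite (inj_eq (@Qint_inj D)); case: eqP => [->|_] //; rewrite tm0r.
Qed.

Lemma XK2_act XX : (forall mu, Uplus [set: I]%SET mu (XX mu)) -> XK2 (L := L) XX M N = sum1 L XX (secondM M N).
Proof.
move=> h; rewrite /XK2 /sum2 /sum1; apply: eq_fsbigr => mu _.
transitivity (act2m M N (tens (uKmu K (map_mx Posz mu)) (XX mu))); first by [].
by rewrite act2_tens -(act_secondM_Uplus (h mu)).
Qed.
End XK2.
End Series.

(** Bookkeeping for [Zb_intertwines], stated for abstract matrices to keep the terms small. *)
Lemma intertwine_sum (F : fieldType) n (p p' q : F) (u k v m f w u' v' S : 'M[F]_n) :
  u * S = S * u' -> v * S = S * v' -> k * S = S * k -> m * S = S * m -> f * S = S * f -> w * S = S * w ->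
  (p *: (u * k) + p' *: (v * m) + (f + p *: (w * k) + q *: k)) * S =
  S * (p' *: (v' * m) + f + p *: ((u' + w) * k) + q *: k).
Proof.
move=> hu hv hk hm hf hw.
have e1 : u * k * S = S * (u' * k) by rewrite -mulrA hk mulrA hu mulrA.
have e2 : v * m * S = S * (v' * m) by rewrite -mulrA hm mulrA hv mulrA.
have e3 : w * k * S = S * (w * k) by rewrite -mulrA hk mulrA hw mulrA.
rewrite [(u' + w) * k]mulrDl scalerDr !mulrDl !mulrDr !scMl !scMr e1 e2 e3 hf hk.
by rewrite !addrA; congr (_ + _ + _); rewrite -addrA addrC.
Qed.

Lemma add5E (V : zmodType) (v w x y z : V) : v + w + (x + y) + z = v + x + z + w + y.
Proof. by rewrite addrACA [LHS]addrAC [LHS]addrA. Qed.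

(** * The factorisation of the coproduct of the quasi K-matrix *)

Section Main.
Variables (K : fieldType) (D : cartanDatum) (L : fieldExtType (kfield K)).
Local Notation I := 'I_(rk D).
Local Notation UQ := (Uq K D).
Local Notation hdual := 'cV[rat]_(rk D).
Local Notation Qplus := 'cV[nat]_(rk D).
Local Notation coroots := 'cV[int]_(rk D).
Variables (X : {set I}) (t t0 : {perm I}) (s : I -> K) (c sp : I -> kfield K) (gam : hdual -> L).
Variables (barB : UQ -> UQ) (XX : Qplus -> UQ) (R RX : Qplus -> UU K D).
Hypothesis adm : admissible X t.
Hypothesis sgn : sign_fun X t s.
Hypothesis par : parameters X t c sp.
Hypothesis com : compatible_tau0 X t t0 s c sp.
Hypothesis gmh : is_gamma X t s c gam.
Hypothesis hB : is_barB L X t s c sp barB.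
Hypothesis hXX : quasiK L X t s c sp barB XX.
Hypothesis hR : quasiR L [set: I]%SET setT R.
Hypothesis hRX : quasiR L X (leviX X) RX.

Local Notation B i := (Bgen L X t s c sp i).
Local Notation XM A := (sum1 L XX A).
Local Notation twistM := (twistM adm com gmh).

Lemma levi_mem j u : j \in X -> [\/ u = uE K j, u = uF K j, u = uKi K j | u = uKV K j] -> leviX X u.
Proof. by move=> jX h; apply: gen_subalgS; exists j. Qed.
Lemma Bcs_levi u : leviX X u -> Bcs L X t s c sp u /\ leviTheta X t u.
Proof. by move=> h; split; apply: gen_subalgS; [left; left|left]. Qed.
Lemma qk (A : gmod D L) u : Bcs L X t s c sp u -> act A (barB u) * XM A = XM A * act A (ubar u).
Proof. by case: hXX => _ _ h hu; exact: (h u hu A (gmP A)). Qed.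
Lemma qk_levi (A : gmod D L) u : leviX X u -> act A (ubar u) * XM A = XM A * act A (ubar u).
Proof.
move=> hu; have [h1 h2] := Bcs_levi hu; have := qk A h1.
by case: hB => _ _ _ hb _; rewrite (hb _ h2).
Qed.
Lemma qkE A j : j \in X -> act A (uE K j) * XM A = XM A * act A (uE K j).
Proof. by move=> jX; rewrite -(ubarE K j); apply: qk_levi; apply: (levi_mem jX); constructor 1. Qed.
Lemma qkF A j : j \in X -> act A (uF K j) * XM A = XM A * act A (uF K j).
Proof. by move=> jX; rewrite -(ubarF K j); apply: qk_levi; apply: (levi_mem jX); constructor 2. Qed.
Lemma qkK A mu : Theta X t (Qint mu) = Qint mu ->
  act A (uK K (coroot_of mu)) * XM A = XM A * act A (uK K (coroot_of mu)).
Proof.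
move=> hmu; have hT : KTheta X t (uK K (coroot_of (- mu))).
  by exists (- mu) => //; rewrite QintN ThetaE BopN -ThetaE hmu.
have e : ubar (uK K (coroot_of (- mu))) = uK K (coroot_of mu) by rewrite ubarK coroot_ofN opprK.
have := qk A (u := uK K (coroot_of (- mu))); rewrite e; case: hB => _ _ _ hb _.
rewrite hb ?e => [h|]; last by apply: gen_subalgS; right.
by apply: h; apply: gen_subalgS; left; right.
Qed.
Lemma qkB A i : i \notin X -> act A (B i) * XM A = XM A * act A (ubar (B i)).
Proof.
move=> iX; case: hB => _ _ _ _ hb; rewrite -{1}(hb i iX); apply: qk.
by apply: gen_subalgS; right; exists i.
Qed.

Let hc := hcT adm. Let he := heT adm. Let tX := tXT adm. Let tt := ttT adm. Let hL := hLT adm.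
Let tX' := tXT' adm.

Lemma diagB (l m : hdual) : diagram t (l - m) = diagram t l - diagram t m.
Proof. by apply/matrixP => a b; rewrite !mxE. Qed.

(** Put d = alpha_i - alpha_(tau i) and S = w_X(d) - d, a combination of the alpha_j with j in X.
    Then tau(d) = -d gives tau(S) = -S, and w_X(S) = -S as w_X is an involution. But w_X = -tau on
    the span of X, so w_X(S) = S and S = 0. *)
Lemma Theta_diff i : Theta X t (Qint (delta_mx i 0 - delta_mx (t i) 0)) = Qint (delta_mx i 0 - delta_mx (t i) 0).
Proof.
have -> : Qint (delta_mx i 0 - delta_mx (t i) 0) = alpha i - alpha (t i) :> hdual.
  by rewrite -!Qint_delta; apply/matrixP => x y; rewrite !mxE rmorphB.
have key l : exists2 f : I -> rat, forall j, j \notin X -> f j = 0 & longest X *m l - l = \sum_j f j *: alpha j.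
  have [_ <- hl] := lwordP X; elim: (lword X) hl => [|j w IH] hl.
    by exists (fun _ => 0) => //; rewrite mul1mx subrr big1 // => j _; rewrite scale0r.
  have [|f hf e] := IH; first by move=> x xw; apply: hl; rewrite inE xw orbT.
  exists (fun a => f a - (a == j)%:R * pairing (wprod w *m l) j) => [a aX|].
    rewrite hf //; case: eqP => [aj|_]; last by rewrite mul0r subr0.
    by move: aX; rewrite aj hl ?mem_head.
  transitivity (\sum_a f a *: alpha a - pairing (wprod w *m l) j *: alpha j : hdual).
    by rewrite /= -mulmxA refl_mul addrAC e.
  have e1 : pairing (wprod w *m l) j *: alpha j = \sum_a ((a == j)%:R * pairing (wprod w *m l) j) *: alpha a :> hdual.
    rewrite (bigD1 j) //= eqxx mul1r big1 ?addr0 // => a /negPf ->.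
    by rewrite mul0r scale0r.
  by rewrite e1 -sumrB; apply: eq_bigr => a _; rewrite scalerBl.
have [f hf e] := key (alpha i - alpha (t i)).
have e2 : alpha i - alpha (t i) = - (diagram t (alpha i - alpha (t i))) :> hdual.
  by rewrite diagB !diag_alpha tt opprB.
rewrite /Theta; set d := alpha i - alpha (t i) in e e2 *.
rewrite -[diagram t d]opprK -e2 mulmxN opprK; apply/eqP; rewrite -subr_eq0 e; apply/eqP.
have fd : diagram t (\sum_j f j *: alpha j) = - \sum_j f j *: alpha j.
  rewrite -e diagB (diag_longest hc tX hL).
  by have td : diagram t d = - d by [rewrite {2}e2 opprK]; rewrite td mulmxN opprK opprB addrC.
have wS : longest X *m (\sum_j f j *: alpha j) = - \sum_j f j *: alpha j.
  by rewrite -e mulmxBr mulmxA (longest2 tX' hL) mul1mx opprB.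
have wS2 : longest X *m (\sum_j f j *: alpha j) = - diagram t (\sum_j f j *: alpha j).
  rewrite mulmx_sumr.
  transitivity (\sum_j f j *: (- alpha (t j)) : hdual).
    apply: eq_bigr => j _; rewrite -scalemxAr; case: (boolP (j \in X)) => jX; first by rewrite hL.
    by rewrite hf // !scale0r.
  have -> : diagram t (\sum_j f j *: alpha j) = \sum_j f j *: alpha (t j) :> hdual.
    elim: (index_enum _) => [|j r IH]; first by rewrite !big_nil; apply/matrixP => a b; rewrite !mxE.
    by rewrite !big_cons diag_lin IH diag_alpha.
  by rewrite -sumrN; apply: eq_bigr => j _; rewrite scalerN.
have /eqP := wS; rewrite wS2 fd opprK -subr_eq0 opprK -mulr2n -scaler_nat scaler_eq0 pnatr_eq0 /=.
by move/eqP.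
Qed.

Section OneIndex.
Variables (M N : gmod D L).
Local Notation n := (udim M * udim N)%N.
Local Notation M' := (twistM M).
Local Notation D0 := (Dmod M N false).
Local Notation Eo A j := (act A (uE K j)).
Local Notation Fo A j := (act A (uF K j)).
Local Notation Ko A h := (act A (uK K h)).
Local Notation XKm := (XM (secondM M N)).
Let HM := gmod_wrep M.
Let HN := gmod_wrep N.

Lemma Theta_X j : j \in X -> Theta X t (Qint (delta_mx j 0)) = Qint (delta_mx j 0).
Proof. by move=> jX; rewrite Qint_delta ThetaE (Bop_alphaX adm jX) opprK. Qed.
Lemma Theta_XN j : j \in X -> Theta X t (Qint (- delta_mx j 0)) = Qint (- delta_mx j 0).
Proof. by move=> jX; rewrite QintN ThetaE BopN -ThetaE Theta_X. Qed.

Lemma twistM_Kj j : j \in X -> Ko M' (Kc j) = Ko M (Kc j).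
Proof. by move=> jX; exact: (twistM_K adm com gmh M (Theta_X jX)). Qed.

Lemma XXu mu : Uplus [set: I]%SET mu (XX mu). Proof. by case: hXX. Qed.

Definition aD (A A' : gmod D L) b u : 'M[L]_(udim A * udim A') := act (Dmod A A' b) u.
Definition aN u : 'M[L]_n := act (secondM M N) u.
Definition XK : 'M[L]_n := XM (secondM M N).

Lemma aD_E (A A' : gmod D L) b j : aD A A' b (uE K j) = tm (Eo A j) 1 + tm (Ko A (sgn_co b (Kc j))) (Eo A' j).
Proof. by have [h _ _] := Dmod_gen A A' b; apply: h. Qed.
Lemma aD_F (A A' : gmod D L) b j : aD A A' b (uF K j) = tm (Fo A j) (Ko A' (- sgn_co b (Kc j))) + tm 1 (Fo A' j).
Proof. by have [_ h _] := Dmod_gen A A' b; apply: h. Qed.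
Lemma aD_K (A A' : gmod D L) b h : aD A A' b (uK K h) = tm (Ko A h) (Ko A' h).
Proof. by have [_ _ e] := Dmod_gen A A' b; apply: e. Qed.
Lemma aN_E j : aN (uE K j) = tm (Ko M (Kc j)) (Eo N j). Proof. by have [h _ _] := secondM_gen M N; apply: h. Qed.
Lemma aN_F j : aN (uF K j) = tm (Ko M (- Kc j)) (Fo N j). Proof. by have [_ h _] := secondM_gen M N; apply: h. Qed.
Lemma aN_K h : aN (uK K h) = tm 1 (Ko N h). Proof. by have [_ _ e] := secondM_gen M N; apply: e. Qed.

Lemma XK_E : XK = \sum_(mu \in setT) tm (Ko M (coroot_of (map_mx Posz mu))) (act N (XX mu)).
Proof. by apply: eq_fsbigr => mu _; exact: (act_secondM_Uplus M N (XXu mu)). Qed.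

Lemma XK_Kl h : tm (Ko M h) 1 * XK = XK * tm (Ko M h) 1.
Proof. by rewrite XK_E mulr_sumr mulr_suml; apply: eq_bigr => mu _; rewrite !tmM mul1r mulr1 (wr_KC HM). Qed.

(** Moving x past K_mu and K_z past the term of weight mu produces powers of q with the same
    exponent (mu, z), and these balance. *)
Lemma XK_bal z x : opwt (fun h => Ko M h) (Qint z) x ->
  tm x (Ko N (coroot_of z)) * XK = XK * tm x (Ko N (coroot_of z)).
Proof.
move=> hx; rewrite XK_E mulr_sumr mulr_suml; apply: eq_bigr => mu _; rewrite !tmM (Uplus_opwt N (XXu mu)) hx tmZl tmZr.
congr (_%:A *: _); congr (qpow K D _).
have e0 : Qnat mu = Qint (map_mx Posz mu) :> hdual by apply/matrixP => i j; rewrite [j]ord1 !mxE.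
by rewrite e0 !(weight_at_coroot _ (erefl (Qint _))) formC.
Qed.

Lemma XK_Kr mu : Theta X t (Qint mu) = Qint mu -> tm 1 (Ko N (coroot_of mu)) * XK = XK * tm 1 (Ko N (coroot_of mu)).
Proof. by move=> h; rewrite -aN_K; exact: (qkK (secondM M N) h). Qed.

Lemma XK_E1 j : j \in X -> tm (Eo M j) 1 * XK = XK * tm (Eo M j) 1.
Proof.
move=> jX; have -> : tm (Eo M j) 1 = tm (Eo M j) (Ko N (coroot_of (delta_mx j 0))) * tm 1 (Ko N (coroot_of (- delta_mx j 0))).
  by rewrite tmM mulr1 coroot_ofN (wr_KN HN).
have h : opwt (fun h => Ko M h) (Qint (delta_mx j 0)) (Eo M j) by rewrite Qint_delta; apply: (opwtE HM).
by rewrite mulrA -(XK_bal h) -!mulrA (XK_Kr (Theta_XN jX)).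
Qed.
Lemma XK_NE j : j \in X -> aN (uE K j) * XK = XK * aN (uE K j).
Proof. by move=> jX; exact: (qkE (secondM M N) jX). Qed.
Lemma XK_D0E j : j \in X -> aD M N false (uE K j) * XK = XK * aD M N false (uE K j).
Proof. by move=> jX; rewrite aD_E mulrDl mulrDr (XK_E1 jX) -aN_E XK_NE. Qed.
Lemma XK_F i : tm (Fo M i) (Ko N (- Kc i)) * XK = XK * tm (Fo M i) (Ko N (- Kc i)).
Proof.
have h : opwt (fun h => Ko M h) (Qint (- delta_mx i 0)) (Fo M i) by rewrite QintN Qint_delta; apply: (opwtF HM).
by have := XK_bal h; rewrite coroot_ofN.
Qed.
Lemma XK_D0F j : j \in X -> aD M N false (uF K j) * XK = XK * aD M N false (uF K j).
Proof.
move=> jX; rewrite aD_F mulrDl mulrDr /sgn_co XK_F; congr (_ + _).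
(* This factors off the action of F_j on [secondM], to which the relation of the quasi K-matrix
   applies. *)
have -> : tm 1 (Fo N j) = tm (Ko M (Kc j)) 1 * aN (uF K j) by rewrite aN_F tmM mul1r (wr_KN HM).
have e : aN (uF K j) * XK = XK * aN (uF K j) by exact: (qkF (secondM M N) jX).
by rewrite mulrA -XK_Kl -!mulrA e.
Qed.

Definition mE u : 'M[L]_(udim M) := act M' u.
Definition aT b u : 'M[L]_n := act (Dmod M' N b) u.
Definition A1 : 'M[L]_n := tm (XM M) 1.
Definition Zr : 'M[L]_n := sum2 L R M' N.
Definition Zb : 'M[L]_n := sum2 L (fun mu => uubar (RX mu)) M' N.
Definition RXt : 'M[L]_n := sum2 L RX M' N.

Lemma aT_E b j : aT b (uE K j) = tm (mE (uE K j)) 1 + tm (mE (uK K (sgn_co b (Kc j)))) (Eo N j).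
Proof. exact: (aD_E M' N b j). Qed.
Lemma aT_F b j : aT b (uF K j) = tm (mE (uF K j)) (Ko N (- sgn_co b (Kc j))) + tm 1 (Fo N j).
Proof. exact: (aD_F M' N b j). Qed.
Lemma aT_K b h : aT b (uK K h) = tm (mE (uK K h)) (Ko N h).
Proof. exact: (aD_K M' N b h). Qed.

Lemma leviF j : j \in X -> leviX X (uF K j).
Proof. by move=> jX; apply: (levi_mem jX); constructor 2. Qed.

Lemma RX_TS mu : TS X mu (RX mu). Proof. exact: (R_TS hRX). Qed.
Lemma RXt_Zb : RXt * Zb = 1. Proof. exact: (R_Rb hRX leviF M' N). Qed.
Lemma Zb_RXt : Zb * RXt = 1. Proof. exact: (mulmx1C RXt_Zb). Qed.

Lemma twistM_Uminus mu f : Uminus X mu f -> mE f = act M f.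
Proof.
move=> [hf _]; move: hf; rewrite /mE.
elim/gen_subalg_ind => {f} [u [j jX <-]||a u v hu hv|u v hu hv].
- exact: twistM_FX.
- by rewrite !rmorph1.
- by rewrite !rmorphD /= !actZ; congr (_ *: _ + _).
by rewrite !rmorphM; congr (_ * _).
Qed.
(** The first tensor factors of R_X lie in the negative part of U_q(g_X), where the twist is the
    identity. *)
Lemma RXtE : RXt = sum2 L RX M N.
Proof.
apply: eq_fsbigr => mu _; rewrite -[LHS]/(act2m M' N (RX mu)) -[RHS]/(act2m M N (RX mu)).
have [r hr ->] := RX_TS mu; rewrite !rmorph_sum !big_seq; apply: eq_bigr => q /hr[h1 _] /=.
by rewrite !act2_tens; congr (tm _ _); exact: twistM_Uminus h1.
Qed.

Lemma RX_comm (A : gmod D L) v : (forall mu z, TS X mu z -> v * act2m A N z = act2m A N z * v) ->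
  v * sum2 L RX A N = sum2 L RX A N * v.
Proof. exact: (S2_comm RX_TS). Qed.

(** R_X intertwines the two coproducts of E_j for j in X and commutes with E_a (x) 1, so it
    intertwines the chains built from these. *)
Lemma chainR (A : gmod D L) b a : a \notin X ->
  ChM (fun j => aD A N false (uE K j)) b a (lword X) (tm (Eo A a) 1) * sum2 L RX A N =
  sum2 L RX A N * ChM (fun j => aD A N true (uE K j)) b a (lword X) (tm (Eo A a) 1).
Proof.
move=> aX; have [hr e hl] := lwordP X; set S := sum2 L RX A N.
have hE j : j \in X -> aD A N false (uE K j) * S = S * aD A N true (uE K j).
  by move=> jX; apply: (R_rel hRX); rewrite ubarE; apply: (levi_mem jX); constructor 1.
apply: (@ChM_ind K D L _ _ _ _ (fun x x' => x * S = S * x')).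
- by rewrite mul0r mulr0.
- by move=> x x' y y' hx hy; rewrite mulrDl mulrDr hx hy.
- by move=> q x x' hx; rewrite scMl scMr hx.
- by move=> j x x' /hl jX hx; rewrite -mulrA hx !mulrA hE.
- by move=> j x x' /hl jX hx; rewrite -mulrA hE // !mulrA hx.
by apply: RX_comm => mu z; apply: TS_E.
Qed.

Section Index.
Variables (i : I) (z : coroots).
Hypothesis iX : i \notin X.
Hypothesis hz : longest X *m alpha (t i) = Qint z.
Local Notation a := (t i).
Local Notation sX := (lword X).
Local Notation ki := (Kc i).
Definition pc : L := (c i)%:A * - (kcst (s a))%:A.
Definition pb : L := (kbar K (c i))%:A * - (kcst (s a) * kappa K a sX)%:A.
Definition sg : L := (sp i)%:A.

Lemma aX : a \notin X. Proof. by rewrite tX. Qed.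
Lemma sXr : reduced sX. Proof. by case: (lwordP X). Qed.
Lemma sXe : wprod sX = longest X. Proof. by case: (lwordP X). Qed.
Lemma sXl : {subset sX <= X}. Proof. by case: (lwordP X). Qed.
Lemma hzw : wprod sX *m alpha a = Qint z. Proof. by rewrite sXe. Qed.

Lemma act_B (A : gmod D L) : act A (B i) =
  Fo A i + pc *: (act A (chn K a sX) * Ko A (- ki)) + sg *: Ko A (- ki).
Proof.
rewrite /Bgen !rmorphD /= !actZ rmorphM /= (act_Xelt s adm A iX) rmorphN /= actZ uKVE.
by rewrite mulNr scMl scalerN scalerA /pc mulrN scaleNr.
Qed.
Lemma act_bB (A : gmod D L) : act A (ubar (B i)) =
  Fo A i + pb *: (act A (chb K a sX) * Ko A ki) + sg *: Ko A ki.
Proof.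
have -> : ubar (B i) = uF K i + kbar K (c i) *: (ubar (Xelt L X t s i) * uK K ki) + sp i *: uK K ki.
  have hs : kbar K (sp i) = sp i by case: par => _ _ _ _; apply.
  rewrite /Bgen !ubarD (ubarZ (c i) (_ * _)) (ubarZ (sp i) (uKV K i)) (ubarM (Xelt L X t s i)) ubarF uKVE ubarK opprK.
  by rewrite hs.
rewrite !rmorphD /= !actZ rmorphM /= (act_bXelt s adm A iX).
by rewrite mulNr scMl scalerN scalerA /pb mulrN scaleNr.
Qed.
Lemma mE_F : mE (uF K i) = pb *: (act M (chb K a sX) * Ko M ki).
Proof.
rewrite /mE (twistM_F adm sgn par com gmh M iX) (act_bXelt s adm M iX).
by rewrite mulNr scMl scalerN scalerA /pb mulrN scaleNr.
Qed.
Lemma mE_X : pc *: (mE (chn K a sX) * mE (uK K (- ki))) = Fo M i.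
Proof.
rewrite -[RHS](twistM_X adm com gmh M iX) (act_Xelt s adm _ iX) rmorphN /= actZ.
by rewrite mulNr scMl scalerN scalerA /pc mulrN scaleNr.
Qed.
Lemma mE_Kz : mE (uK K (- coroot_of z)) * mE (uK K (- ki)) = Ko M (coroot_of z) * Ko M ki.
Proof.
rewrite -(wrD (gmod_wrep M')) -(wrD HM) -!coroot_ofN -!coroot_ofD.
apply: (twistM_K adm com gmh M); rewrite ThetaE -BopN.
have -> : - Qint (- z - delta_mx i 0) = Qint z + alpha i :> hdual.
  by rewrite -QintN -Qint_delta; apply/matrixP => x y; rewrite !mxE opprD !opprK rmorphD.
rewrite BopD -hz -(Bop_alpha X t) (BopK hc tX tt hL) (Bop_alpha X t) hz -Qint_delta addrC.
by apply/matrixP => x y; rewrite !mxE rmorphD.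
Qed.
(** If s_i is nonzero, then i lies in I_ns: tau fixes i and w_X fixes alpha_i, so the twist
    exchanges K_i and its inverse. *)
Lemma sg_K : sg *: mE (uK K (- ki)) = sg *: Ko M ki.
Proof.
case: (eqVneq (sp i) 0) => [e|n0]; first by rewrite /sg e !scale0r.
congr (_ *: _); rewrite /mE /Kc -coroot_ofN; apply: (twistM_K adm com gmh M).
case: par => _ _ /(_ i iX n0)[[_ ti hi] _] _ _.
rewrite QintN ThetaE BopN opprK Qint_delta (Bop_alpha X t) ti.
have [_ <- hl] := lwordP X; elim: (lword X) hl => [|j w IH] hl; first by rewrite mul1mx.
have jX : j \in X by apply: hl; rewrite mem_head.
rewrite /= -mulmxA IH => [|x xw]; last by apply: hl; rewrite inE xw orbT.
have : car D j i == 0.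
  have := car_sym i j; rewrite (hi j jX) mulr0 => /esym/eqP; rewrite mulf_eq0 => /orP[|//].
  by rewrite -[_ == 0]/((eps D j) == 0%N) eqn0Ngt eps_gt0.
by rewrite refl_mul pairing_alpha => /eqP ->; rewrite scale0r subr0.
Qed.

Definition chbL : 'M[L]_n := ChM (fun j => aD M N false (uE K j)) true a sX (tm (Eo M a) 1).
(* Deforming Delta(ubar B_i) step by step through the factors X_K2, bar R_X, R and X (x) 1 of the
   right-hand side gives G_i, the two coproducts of B_i on the twisted module, and Delta(B_i). *)
Definition midB : 'M[L]_n := tm (Fo M i) (Ko N (- ki)) + pb *: (chbL * tm (Ko M ki) (Ko N ki)) +
  tm (Ko M ki) 1 * aN (B i).

Lemma aD_chb : aD M N false (chb K a sX) = chbL + tm (Ko M (coroot_of z)) (act N (chb K a sX)).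
Proof. exact: (act_D0_chb M N aX sXr sXl hzw). Qed.
Lemma aN_chx b : aN (chx K b a sX) = tm (Ko M (coroot_of z)) (act N (chx K b a sX)).
Proof. exact: (act_secondM_chx M N aX sXr sXl b hzw). Qed.

Lemma aD_bB : aD M N false (ubar (B i)) = tm (Fo M i) (Ko N (- ki)) + pb *: (chbL * tm (Ko M ki) (Ko N ki)) +
  tm (Ko M ki) 1 * aN (ubar (B i)).
Proof.
have -> : aD M N false (ubar (B i)) = aD M N false (uF K i) +
    pb *: (aD M N false (chb K a sX) * aD M N false (uK K ki)) + sg *: aD M N false (uK K ki) by exact: (act_bB (Dmod M N false)).
have -> : aN (ubar (B i)) = aN (uF K i) + pb *: (aN (chb K a sX) * aN (uK K ki)) + sg *: aN (uK K ki) by exact: (act_bB (secondM M N)).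
rewrite aD_F aD_chb aD_K aN_F aN_K -[chb K a sX]/(chx K true a sX) aN_chx !mulrDr !scMr !mulrDl !tmM.
rewrite !mul1r !mulr1 (wr_KN HM) (wr_KC HM ki) scalerDr /sgn_co.
by rewrite -!addrA; congr (_ + _); rewrite addrCA; congr (_ + (_ + _)); rewrite !addrA.
Qed.

Lemma XK_chbL : chbL * tm (Ko M ki) (Ko N ki) * XK = XK * (chbL * tm (Ko M ki) (Ko N ki)).
Proof.
set P := tm (Ko M ki) (Ko N ki); set e := fun j => aD M N false (uE K j).
apply: (@ChM_ind K D L n n e e (fun x _ => x * P * XK = XK * (x * P)) true a sX (tm (Eo M a) 1) (tm (Eo M a) 1)).
- by rewrite !mul0r mulr0.
- by move=> x x' y y' hx hy; rewrite !mulrDl mulrDr hx hy.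
- by move=> q x x' hx; rewrite !scMl scMr hx.
- by move=> j x x' /sXl jX hx; rewrite -!mulrA [x * (P * _)]mulrA hx !mulrA XK_D0E.
- move=> j x x' /sXl jX hx.
  have [q eP] : exists q : L, e j * P = q *: (P * e j).
    exists ((qpow K D (- form (alpha j) (alpha i)))%:A); rewrite /P -(aD_K M N false) /e.
    have := wrE (gmod_wrep D0) ki j; rewrite form_Kc formC => h.
    have h' : aD M N false (uK K ki) * aD M N false (uE K j) = (qpow K D (form (alpha j) (alpha i)))%:A *: (aD M N false (uE K j) * aD M N false (uK K ki)) by exact: h.
    by rewrite h' scalerA -algM -qpowD ?qokN ?(ok_alpha j i) // addNr qpow0 !scale1r.
  have ej : e j * XK = XK * e j by exact: XK_D0E.
  have xe : x * e j * P = q *: (x * P * e j) by rewrite -mulrA eP scMr mulrA.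
  by rewrite xe scMl scMr -[x * P * e j * XK]mulrA ej [x * P * _]mulrA hx -[XK * _ * e j]mulrA.
(* The splitting is (E_a (x) K_a)(K_i (x) 1)(1 (x) K_i K_a^-1): the first factor commutes with X_K2
   by balance of weights, the second trivially, and the third because Theta fixes alpha_i -
   alpha_a. *)
have -> : tm (Eo M a) 1 * P = tm (Eo M a) (Ko N (coroot_of (delta_mx a 0))) * (tm (Ko M ki) 1 * tm 1 (Ko N (coroot_of (delta_mx i 0 - delta_mx a 0)))).
  by rewrite /P !tmM !mul1r !mulr1 -(wrD HN) -coroot_ofD addrC subrK.
have h : opwt (fun h => Ko M h) (Qint (delta_mx a 0)) (Eo M a) by rewrite Qint_delta; apply: (opwtE HM).
rewrite [RHS]mulrA -(XK_bal h) -[LHS]mulrA -[RHS]mulrA; congr (_ * _).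
by rewrite -mulrA (XK_Kr (Theta_diff i)) !mulrA XK_Kl.
Qed.

Lemma XK_NB : aN (B i) * XK = XK * aN (ubar (B i)). Proof. exact: (qkB (secondM M N) iX). Qed.

Lemma XK_intertwines : XK * aD M N false (ubar (B i)) = midB * XK.
Proof.
rewrite aD_bB /midB !mulrDr !mulrDl XK_F !scMr !scMl XK_chbL; congr (_ + _).
by rewrite mulrA -XK_Kl -!mulrA XK_NB.
Qed.

Lemma Zb_intertwines : Zb * midB = aT true (B i) * Zb.
Proof.
(* bar(R_X) is the inverse of R_X, so it suffices to treat R_X, whose intertwining properties are at
   hand. *)
suff h : midB * RXt = RXt * aT true (B i).
  rewrite -[Zb * midB]mulr1 -RXt_Zb -!mulrA [midB * (_ * _)]mulrA h !mulrA Zb_RXt mul1r //.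
have -> : aT true (B i) = aT true (uF K i) + pc *: (aT true (chn K a sX) * aT true (uK K (- ki))) +
    sg *: aT true (uK K (- ki)) by exact: (act_B (Dmod M' N true)).
have eN : aN (B i) = aN (uF K i) + pc *: (aN (chn K a sX) * aN (uK K (- ki))) + sg *: aN (uK K (- ki)) by exact: (act_B (secondM M N)).
set C0 : 'M[L]_n := ChM (fun j => aT true (uE K j)) false a sX (tm (mE (uE K a)) 1).
have eT : aT true (chn K a sX) = C0 + tm (mE (uK K (- coroot_of z))) (act N (chn K a sX)).
  exact: (act_D1_chn M' N aX sXr sXl hzw).
have k1 : tm (mE (chn K a sX)) 1 * RXt = RXt * C0.
  have <- : ChM (fun j => aT false (uE K j)) false a sX (tm (mE (uE K a)) 1) = tm (mE (chn K a sX)) 1.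
    exact: (ChM_D0_l M' N aX sXr sXl).
  exact: (chainR M' false aX).
have k2 : chbL * RXt = RXt * tm (act M (chb K a sX)) 1.
  have <- : ChM (fun j => aD M N true (uE K j)) true a sX (tm (Eo M a) 1) = tm (act M (chb K a sX)) 1.
    exact: (ChM_D1_l M N aX sXr sXl).
  by rewrite RXtE; exact: (chainR M true aX).
have kT : tm (mE (uK K (- ki))) (Ko N (- ki)) * RXt = RXt * tm (mE (uK K (- ki))) (Ko N (- ki)).
  by apply: (RX_comm (A := M')) => mu w; apply: TS_total.
have kM h : tm (Ko M h) (Ko N h) * RXt = RXt * tm (Ko M h) (Ko N h).
  by rewrite RXtE; apply: RX_comm => mu w; apply: TS_total.
have kF : tm 1 (Fo N i) * RXt = RXt * tm 1 (Fo N i).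
  by rewrite RXtE; apply: RX_comm => mu w; apply: TS_F.
have kv : tm (mE (uK K (- coroot_of z))) (act N (chn K a sX)) * RXt = RXt * tm (mE (uK K (- coroot_of z))) (act N (chn K a sX)).
  apply: (RX_comm (A := M')) => mu w; apply: TS_Kv => j jX.
  rewrite -hz; apply: (Ej_v tX' hL aX sXr sXe sXl) => //.
  exact: (chn_lword tX' hL aX sXr sXe sXl N).
(* The values of the twist on F_i, on the torus and on X_i rewrite [midB] through the twisted
   module, in the grouping that [intertwine_sum] expects. *)
have -> : midB = pc *: (tm (mE (chn K a sX)) 1 * tm (mE (uK K (- ki))) (Ko N (- ki))) +
    pb *: (chbL * tm (Ko M ki) (Ko N ki)) + (tm 1 (Fo N i) +
    pc *: (tm (mE (uK K (- coroot_of z))) (act N (chn K a sX)) * tm (mE (uK K (- ki))) (Ko N (- ki))) +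
    sg *: tm (mE (uK K (- ki))) (Ko N (- ki))).
  rewrite /midB tmM mul1r -tmZl mE_X; congr (_ + _).
  rewrite eN aN_F aN_K -[chn K a sX]/(chx K false a sX) aN_chx !mulrDr !scMr !tmM !mul1r !mulr1 (wr_KN HM).
  by rewrite mE_Kz (wr_KC HM ki); congr (_ + _); rewrite -!tmZl sg_K.
have -> : aT true (uF K i) = pb *: (tm (act M (chb K a sX)) 1 * tm (Ko M ki) (Ko N ki)) + tm 1 (Fo N i).
  by rewrite aT_F mE_F /sgn_co opprK tmM mul1r tmZl.
rewrite eT (aT_K true (- ki)); exact: intertwine_sum k1 k2 kT (kM ki) kF kv.
Qed.
Local Notation B0 := (ChM (fun j => aD M N false (uE K j)) false a sX (tm (Ko M (Kc a)) (Eo N a))).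
Local Notation B0' := (ChM (fun j => aT false (uE K j)) false a sX (tm (mE (uK K (Kc a))) (Eo N a))).
Local Notation k1 := (tm (Ko M (- ki)) 1).
Local Notation k1' := (tm (mE (uK K (- ki))) 1).

(** After multiplication by K_i^-1 the first tensor factors are products of E_j and K_j with j in X
    and of K_a K_i^-1, whose weight is fixed by Theta. There the twist is the identity, and the
    quasi K-matrix commutes with all of them. *)
Lemma A1_B0 : A1 * (B0' * k1') = B0 * k1 * A1.
Proof.
have commE j (q : L) : j \in X -> A1 * (q *: tm (Eo M j) 1 + tm (Ko M (Kc j)) (Eo N j)) = (q *: tm (Eo M j) 1 + tm (Ko M (Kc j)) (Eo N j)) * A1.
  move=> jX; have kj : Ko M (Kc j) * XM M = XM M * Ko M (Kc j) by exact: (qkK M (Theta_X jX)).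
  by rewrite mulrDr mulrDl scMl scMr /A1 !tmM (qkE M jX) kj !mul1r !mulr1.
have eE j : j \in X -> aT false (uE K j) = 1 *: tm (Eo M j) 1 + tm (Ko M (Kc j)) (Eo N j).
  move=> jX; rewrite aT_E scale1r; congr (tm _ _ + tm _ _).
    exact: twistM_E.
  exact: twistM_Kj.
have eE' j : aD M N false (uE K j) = 1 *: tm (Eo M j) 1 + tm (Ko M (Kc j)) (Eo N j).
  by rewrite aD_E scale1r.
have eK j : exists q : L, Eo M j * Ko M (- ki) = q *: (Ko M (- ki) * Eo M j) /\
    (j \in X -> Eo M j * mE (uK K (- ki)) = q *: (mE (uK K (- ki)) * Eo M j)).
  exists ((qpow K D (form (alpha j) (Qint (delta_mx i 0))))%:A); split; first exact: E_Kn.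
  move=> jX; have e : mE (uE K j) = Eo M j by exact: twistM_E.
  by rewrite -e; exact: (E_Kn M').
have [h1 h2] : B0' * k1' = B0 * k1 /\ A1 * (B0 * k1) = B0 * k1 * A1.
  apply: (@ChM_ind K D L _ _ _ _ (fun x x' => x * k1' = x' * k1 /\ A1 * (x' * k1) = x' * k1 * A1)).
  - by rewrite !mul0r mulr0.
  - by move=> x x' y y' [e1 e2] [e3 e4]; rewrite !mulrDl mulrDr e1 e3 e2 e4.
  - by move=> q x x' [e1 e2]; rewrite !scMl scMr e1 e2.
  - move=> j x x' /sXl jX [e1 e2]; rewrite eE // eE' -!mulrA e1; split=> //.
    by rewrite mulrA commE // -mulrA e2 !mulrA.
  - move=> j x x' /sXl jX [e1 e2]; rewrite eE // eE'; have [q [q1 q2]] := eK j.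
    set w := q *: tm (Eo M j) 1 + tm (Ko M (Kc j)) (Eo N j).
    have f1 : (1 *: tm (Eo M j) 1 + tm (Ko M (Kc j)) (Eo N j)) * k1 = k1 * w.
      by rewrite scale1r mulrDl mulrDr scMr !tmM q1 tmZl !mul1r !mulr1 (wr_KC HM).
    have f2 : (1 *: tm (Eo M j) 1 + tm (Ko M (Kc j)) (Eo N j)) * k1' = k1' * w.
      have kc : Ko M (Kc j) * mE (uK K (- ki)) = mE (uK K (- ki)) * Ko M (Kc j).
        by rewrite -(twistM_Kj jX); exact: (wr_KC (gmod_wrep M')).
      by rewrite scale1r mulrDl mulrDr scMr !tmM (q2 jX) tmZl !mul1r !mulr1 kc.
    rewrite -[x * _ * k1']mulrA f2 -[x' * _ * k1]mulrA f1 !mulrA e1; split=> //.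
    by rewrite -[A1 * x' * _]mulrA e2 -mulrA commE // mulrA.
  have hT : Theta X t (Qint (delta_mx a 0 - delta_mx i 0)) = Qint (delta_mx a 0 - delta_mx i 0).
    have -> : delta_mx a 0 - delta_mx i 0 = - (delta_mx i 0 - delta_mx a 0) :> coroots by rewrite opprB.
    by rewrite QintN ThetaE BopN -ThetaE Theta_diff.
  have e1 (A : gmod D L) : Ko A (Kc a) * Ko A (- ki) = Ko A (coroot_of (delta_mx a 0 - delta_mx i 0)).
    by rewrite -(wrD (gmod_wrep A)) coroot_ofD coroot_ofN.
  have e2 : mE (uK K (Kc a)) * mE (uK K (- ki)) = Ko M (coroot_of (delta_mx a 0 - delta_mx i 0)).
    rewrite -[LHS]/(Ko M' (Kc a) * Ko M' (- ki)) (e1 M'); exact: (twistM_K adm com gmh M hT).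
  rewrite /A1 !tmM !mulr1 !mul1r e2 e1; split=> //.
  by rewrite (qkK M hT).
by rewrite h1 h2.
Qed.

Lemma aD_B : aD M N false (B i) = tm (act M (B i)) (Ko N (- ki)) + tm 1 (Fo N i) + pc *: (B0 * k1 * tm 1 (Ko N (- ki))).
Proof.
have -> : aD M N false (B i) = aD M N false (uF K i) +
    pc *: (aD M N false (chn K a sX) * aD M N false (uK K (- ki))) + sg *: aD M N false (uK K (- ki)) by exact: (act_B (Dmod M N false)).
have -> : aD M N false (chn K a sX) = tm (act M (chn K a sX)) 1 + B0 by exact: (act_D0_chn M N aX sXr sXl).
rewrite act_B aD_F aD_K mulrDl scalerDr !tmM mul1r !tmDl !tmZl /sgn_co.
by rewrite -mulrA tmM mul1r mulr1 add5E.
Qed.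

Lemma aT_B : aT false (B i) = tm (act M (ubar (B i))) (Ko N (- ki)) + tm 1 (Fo N i) + pc *: (B0' * k1' * tm 1 (Ko N (- ki))).
Proof.
have -> : aT false (B i) = aT false (uF K i) +
    pc *: (aT false (chn K a sX) * aT false (uK K (- ki))) + sg *: aT false (uK K (- ki)) by exact: (act_B (Dmod M' N false)).
have -> : aT false (chn K a sX) = tm (mE (chn K a sX)) 1 + B0' by exact: (act_D0_chn M' N aX sXr sXl).
rewrite act_bB aT_F aT_K mulrDl scalerDr !tmM mul1r /sgn_co.
rewrite -!tmZl mE_X mE_F sg_K !tmDl !tmZl.
by rewrite -mulrA tmM mul1r mulr1 add5E [_ + tm (Fo M i) _]addrC.
Qed.

Lemma A1_intertwines : A1 * aT false (B i) = aD M N false (B i) * A1.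
Proof.
rewrite aT_B aD_B !mulrDr !mulrDl scMl scMr.
have -> : A1 * tm (act M (ubar (B i))) (Ko N (- ki)) = tm (act M (B i)) (Ko N (- ki)) * A1.
  by rewrite /A1 !tmM mul1r mulr1 (qkB M iX).
have -> : A1 * (B0' * k1' * tm 1 (Ko N (- ki))) = B0 * k1 * tm 1 (Ko N (- ki)) * A1.
  rewrite mulrA A1_B0 -!mulrA; do 2 congr (_ * _).
  by rewrite /A1 !tmM !mul1r !mulr1.
by rewrite /A1 !tmM !mul1r !mulr1.
Qed.
End Index.

Lemma Zr_rel v : aT false v * Zr = Zr * aT true v.
Proof. exact: (R_rel hR M' N). Qed.

Definition DeltaX : 'M[L]_n := XM (Dmod M N false).
Definition factX : 'M[L]_n := A1 * (Zr * Zb) * XK.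

Lemma DeltaX_B i : i \notin X -> aD M N false (B i) * DeltaX = DeltaX * aD M N false (ubar (B i)).
Proof. exact: (qkB (Dmod M N false)). Qed.
Lemma DeltaX_F j : j \in X -> aD M N false (uF K j) * DeltaX = DeltaX * aD M N false (uF K j).
Proof. exact: (qkF (Dmod M N false)). Qed.

Lemma factX_B i : i \notin X -> aD M N false (B i) * factX = factX * aD M N false (ubar (B i)).
Proof.
move=> iX; have [z hz] := th_int X t i; rewrite /factX -[RHS]mulrA (XK_intertwines iX hz) !mulrA.
rewrite -(A1_intertwines iX) -[A1 * _ * Zr]mulrA Zr_rel !mulrA; congr (_ * _).
by rewrite -[_ * aT true _ * Zb]mulrA -(Zb_intertwines iX hz) mulrA.
Qed.

Lemma aT_FX b j : j \in X -> aT b (uF K j) = aD M N b (uF K j).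
Proof. by move=> jX; rewrite aT_F aD_F; congr (tm _ _ + _); exact: twistM_FX. Qed.

Lemma factX_F j : j \in X -> aD M N false (uF K j) * factX = factX * aD M N false (uF K j).
Proof.
move=> jX; set d := aD M N false (uF K j).
have e1 : d * A1 = A1 * d.
  by rewrite /d aD_F mulrDl mulrDr /A1 !tmM (qkF M jX) !mul1r !mulr1.
have e2 : d * Zr = Zr * aT true (uF K j) by rewrite /d -aT_FX // Zr_rel.
have e3 : aT true (uF K j) * Zb = Zb * d.
  by rewrite /d -(aT_FX _ jX); exact: (Rb_F hRX leviF M' N jX).
have e4 : d * XK = XK * d by exact: XK_D0F.
by rewrite /factX -[RHS]mulrA -e4 !mulrA e1 -[A1 * d * Zr]mulrA e2 -!mulrA [aT _ _ * _]mulrA e3 !mulrA.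
Qed.

Local Notation K2 := (fun h => tm (1 : 'M[L]_(udim M)) (Ko N h)).
Local Notation SP := (span K2).

Lemma SP0 x h : SP (@Qge D) (tm x (Ko N h)).
Proof.
apply: (span1 (b := 0)); first exact: Qge0.
by move=> h'; rewrite !tmM mul1r mulr1 (wr_KC HN h') weight_at0 qpow0 !scale1r.
Qed.
Lemma SP01 x : SP (@Qge D) (tm x 1).
Proof. by rewrite -(wr0 HN); exact: SP0. Qed.
Lemma SP_KE h j : SP (@Qgt D) (tm (Ko M h) (Eo N j)).
Proof.
apply: (span1 (b := alpha j)); first exact: Qgt_alpha.
by move=> h'; rewrite !tmM mul1r mulr1 (opwtE HN j h') tmZr.
Qed.
Lemma SP_ge x : SP (@Qgt D) x -> SP (@Qge D) x.
Proof. exact/span_sub/Qgt_ge. Qed.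
Lemma SP_1 x : SP (@Qgt D) (x - 1) -> SP (@Qge D) x.
Proof. by move=> h; rewrite -[x](subrK 1) -tm1; apply: spanD (SP01 1); rewrite tm1; exact: SP_ge. Qed.
Lemma SP_unip x y : SP (@Qgt D) (x - 1) -> SP (@Qgt D) (y - 1) -> SP (@Qgt D) (x * y - 1).
Proof.
move=> hx hy; have -> : x * y - 1 = (x - 1) * y + (y - 1) by rewrite mulrBl mul1r addrA subrK.
exact: (spanD (spanM_gtl hx (SP_1 hy)) hy).
Qed.

(** On E_j the difference is K_j (x) E_j, and the property is multiplicative by a b - a' b' = (a -
    a') b + a' (b - b'). *)
Lemma SP_aE u : gen_subalg [set uE K i | i in [set` [set: I]%SET]]%classic u ->
  SP (@Qgt D) (aD M N false u - tm (act M u) 1).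
Proof.
elim/gen_subalg_ind => {u} [u [j _ <-]||q u v hu hv|u v hu hv].
- by rewrite aD_E addrAC subrr add0r; exact: SP_KE.
- by rewrite /aD !rmorph1 tm1 subrr; apply: span0.
- have -> : aD M N false (q *: u + v) = q%:A *: aD M N false u + aD M N false v by rewrite /aD rmorphD /= actZ.
  by rewrite rmorphD /= actZ tmDl tmZl opprD addrACA -scalerBr; apply: spanD (spanZ _ hu) hv.
have -> : aD M N false (u * v) = aD M N false u * aD M N false v by rewrite /aD rmorphM.
have -> : tm (act M (u * v)) (1 : 'M[L]_(udim N)) = tm (act M u) 1 * tm (act M v) 1 by rewrite tmM mulr1 rmorphM.
set a := aD M N false u; set b := aD M N false v in hv *.
set a' := tm (act M u) _ in hu *; set b' := tm (act M v) _ in hv *.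
have -> : a * b - a' * b' = (a - a') * b + a' * (b - b') by rewrite mulrBl mulrBr addrA subrK.
have hb : SP (@Qge D) b by rewrite -[b](subrK b'); apply: spanD (SP01 _); exact: SP_ge.
by apply: spanD; [apply: spanM_gtl hu hb|apply: spanM_gtr (SP01 _) hv].
Qed.

Lemma DeltaX_A1 : SP (@Qgt D) (DeltaX - A1).
Proof.
have [B1 h1] := qbox_bound (wr_dec HM) (fun mu => Uplus_opwt M (XXu mu)).
have [B2 h2] := qbox_bound (wr_dec (gmod_wrep D0)) (fun mu => Uplus_opwt D0 (XXu mu)).
have -> : DeltaX = \sum_(mu <- qbox D (maxn B1 B2)) aD M N false (XX mu).
  exact: (fsum_qbox (h2 _ (leq_maxr _ _))).
have e : XM M = \sum_(mu <- qbox D (maxn B1 B2)) act M (XX mu).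
  exact: (fsum_qbox (h1 _ (leq_maxl _ _))).
rewrite /A1 e tm_suml -sumrB; apply: span_sum => mu _; apply: SP_aE.
by case: (XXu mu).
Qed.

Lemma XK_1 : SP (@Qgt D) (XK - 1).
Proof.
have hw mu : opwt K2 (Qnat mu) (tm (Ko M (coroot_of (map_mx Posz mu))) (act N (XX mu))).
  by move=> h'; rewrite !tmM mul1r mulr1 (Uplus_opwt N (XXu mu)) tmZr.
have [b0 hb] := qbox_bound (wr_dec (H2 M N)) hw.
rewrite XK_E (fsum_qbox (hb (maxn b0 1) (leq_maxl _ _))) (bigD1_seq 0) ?qbox_uniq //=; last first.
  by apply/qboxP => i; rewrite mxE leq_max orbT.
have e0 : tm (Ko M (coroot_of (map_mx Posz (0 : Qplus)))) (act N (XX 0)) = 1.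
  have -> : coroot_of (map_mx Posz (0 : Qplus)) = 0 :> coroots by apply/matrixP => i j; rewrite !mxE mul0r.
  by case: hXX => _ -> _; rewrite rmorph1 (wr0 HM) tm1.
rewrite e0 addrAC subrr add0r -big_filter; apply: span_sum => mu; rewrite mem_filter => /andP[m0 _].
by apply: (span1 (b := Qnat mu)); [exists mu|exact: hw].
Qed.

Lemma SP_chx b a s' : SP (@Qge D) (aD M N false (chx K b a s')).
Proof.
have hE j : SP (@Qge D) (aD M N false (uE K j)).
  by rewrite aD_E; apply: spanD (SP01 _) (SP_ge (SP_KE _ _)).
have -> : aD M N false (chx K b a s') = ChM (fun j => aD M N false (uE K j)) b a s' (aD M N false (uE K a)).
  exact: (act_chx D0).
apply: (@ChM_ind K D L n n (fun j => aD M N false (uE K j)) (fun j => aD M N false (uE K j)) (fun x _ => SP (@Qge D) x) b a s' _ (aD M N false (uE K a))) => //.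
- exact: span0.
- by move=> x _ y _; apply: spanD.
- by move=> q x _; apply: spanZ.
- by move=> j x _ _; apply: spanM_ge.
by move=> j x _ _ hx; apply: spanM_ge hx (hE j).
Qed.

Lemma SP_B i : i \notin X -> exists A A', [/\ SP (@Qge D) A, SP (@Qge D) A',
  aD M N false (B i) = tm 1 (Fo N i) + A & aD M N false (ubar (B i)) = tm 1 (Fo N i) + A'].
Proof.
move=> iX.
have e1 : aD M N false (B i) = aD M N false (uF K i) +
    pc i *: (aD M N false (chx K false (t i) (lword X)) * aD M N false (uK K (- Kc i))) + sg i *: aD M N false (uK K (- Kc i)) by exact: (act_B iX (Dmod M N false)).
have e2 : aD M N false (ubar (B i)) = aD M N false (uF K i) +
    pb i *: (aD M N false (chx K true (t i) (lword X)) * aD M N false (uK K (Kc i))) + sg i *: aD M N false (uK K (Kc i)) by exact: (act_bB iX (Dmod M N false)).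
rewrite e1 e2 aD_F [tm (Fo M i) _ + _]addrC -!addrA; do 2 eexists; split=> //.
  by rewrite aD_K; apply: spanD (SP0 _ _) (spanD (spanZ _ (spanM_ge (SP_chx _ _ _) (SP0 _ _))) (spanZ _ (SP0 _ _))).
by rewrite aD_K; apply: spanD (SP0 _ _) (spanD (spanZ _ (spanM_ge (SP_chx _ _ _) (SP0 _ _))) (spanZ _ (SP0 _ _))).
Qed.

Lemma Delta_quasiK_factors : DeltaX = factX.
Proof.
apply/eqP; rewrite -subr_eq0; apply/eqP/(graded_uniq (H2 M N)).
  have -> : DeltaX - factX = (DeltaX - A1) - A1 * (Zr * Zb * XK - 1).
    by rewrite mulrBr mulr1 !mulrA opprB addrA subrK /factX mulrA.
  apply: spanB DeltaX_A1 (spanM_gtr (SP01 _) _); apply: SP_unip XK_1.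
  apply: SP_unip; [exact: (R_span hR M' N)|exact: (Rb_span hRX M' N)].
move=> i; case: (boolP (i \in X)) => iX; last first.
  have [A [A' [hA hA' e e']]] := SP_B iX; exists A, A'; split=> //.
  by rewrite -e -e' mulrBr mulrBl DeltaX_B // factX_B.
set A := tm (Fo M i) (Ko N (- Kc i)); exists A, A; split; [exact: SP0..|].
have <- : aD M N false (uF K i) = tm 1 (Fo N i) + A by rewrite aD_F addrC.
by rewrite mulrBr mulrBl DeltaX_F // factX_F.
Qed.

End OneIndex.
Lemma act2_twist (M N : gmod D L) z :
  act2m M N (tens_lift (uucst K D) (fun u => tens (twist X t t0 gam u) 1) (fun u => tens 1 u) z) = act2m (twistM M) N z.
Proof.
rewrite /tens_lift (plift_morph (act2m M N)); apply: eq_plift => [a|[u|u]].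
- exact: act2C.
- by rewrite /= act2_tens rmorph1.
by rewrite /= act2_tens rmorph1.
Qed.

Lemma RtauX_E (M N : gmod D L) : RtauX X t t0 gam R RX M N = Zr M N * Zb M N.
Proof.
transitivity (\sum_(mu \in setT) act2m (twistM M) N (mul_series R (fun nu => uubar (RX nu)) mu)).
  by apply: eq_fsbigr => mu _; exact: act2_twist.
exact: (mul_series_act (twistM M) N (R_TS hR) (Rb_TS hRX)).
Qed.

Lemma quasiK_coproduct : eq2 (Delta (sum1 L XX))
  (mul2 (mul2 (tensr1 (sum1 L XX)) (RtauX X t t0 gam R RX)) (XK2 XX)).
Proof.
move=> M0 N0 oM oN; pose M := GMod oM; pose N := GMod oN.
have e1 : Delta (sum1 L XX) M0 N0 = DeltaX M N.
  by apply: eq_fsbigr => mu _; exact: (tensmod_act M N).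
rewrite e1 Delta_quasiK_factors /mul2 (RtauX_E M N) (XK2_act M N (XXu)).
by [].
Qed.
End Main.

Theorem theorem9p4 (K : fieldType) (D : cartanDatum) (L : fieldExtType (kfield K))
    (X : {set 'I_(rk D)}) (tau tau0 : {perm 'I_(rk D)}) (s : 'I_(rk D) -> K)
    (c sp : 'I_(rk D) -> kfield K) (gamma : 'cV[rat]_(rk D) -> L)
    (barB : Uq K D -> Uq K D) (XX : 'cV[nat]_(rk D) -> Uq K D)
    (R RX : 'cV[nat]_(rk D) -> UU K D) :
  [pchar K] =i pred0 ->
  admissible X tau ->
  sign_fun X tau s ->
  parameters X tau c sp ->
  compatible_tau0 X tau tau0 s c sp ->
  is_gamma X tau s c gamma ->
  is_barB L X tau s c sp barB ->
  quasiK L X tau s c sp barB XX ->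
  quasiR L [set: 'I_(rk D)] setT R ->
  quasiR L X (leviX X) RX ->
  eq2 (Delta (sum1 L XX))
      (mul2 (mul2 (tensr1 (sum1 L XX)) (RtauX X tau tau0 gamma R RX))
            (XK2 XX)).
Proof.
by move=> _ adm sgn par com gmh hB hXX hR hRX; exact: (quasiK_coproduct adm sgn par com gmh hB hXX hR hRX).
Qed.
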